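(* Let $d\ge 1$, $\omega>0$, $p>1$ and $a$ satisfy $$0\le a<1,\qquad \frac12-\frac1{p+1}<\frac{1-a}{d}.$$ Then the equation $$-\nabla\cdot(|x|^{2a}\nabla\phi)+\omega\phi-|\phi|^{p-1}\phi=0\qquad (x\in\mathbb R^d)$$ has a distributional positive solution $\phi$ with $\phi\in C^\infty(\mathbb R^d\setminus\{0\})$. Moreover $\phi\in H^{1,a}(\mathbb R^d)$, and there are $\delta>0$, $C>0$ such that $$0<\phi(x)\le C e^{-\delta|x|^{1-a}}.$$ In case the solution $\phi$ is radial (write $\phi=\phi(\rho)$, $\rho=|x|$), it is also continuous at zero, one has $\phi^p(0)-\omega\phi(0)>0$, and for $0<\rho\ll 1$, $$\phi'(\rho)=-\frac{\phi^p(0)-\omega\phi(0)}{d}\,\rho^{1-2a}+o(\rho^{1-2a}),\qquad \phi''(\rho)=\frac{2a-1}{d}\big(\phi^p(0)-\omega\phi(0)\big)\rho^{-2a}+o(\rho^{-2a}).$$ In particular (in the radial case), if $a\in(0,1/2]$ then $\phi\in C^1(0,\infty)$, while for $a\in(1/2,1)$, $\phi'(\rho)$ blows up as $\rho\to0+$; at the same time, $\phi''$ always blows up at zero for $a\in(0,1)$.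
   Context: $H^{1,a}(\mathbb R^d)$, $0\le a<1$, is the Hilbert space of functions (completion of the Schwartz functions) with norm $\|u\|_{H^{1,a}}=\left(\int_{\mathbb R^d}(|x|^{2a}|\nabla u|^2+|u|^2)\,dx\right)^{1/2}$. A function $\phi\in H^{1,a}$ is a distributional solution of the equation if $\int |x|^{2a}\nabla\phi\cdot\nabla h+\omega\phi h-|\phi|^{p-1}\phi h\,dx=0$ for all test functions $h\in C_0^\infty(\mathbb R^d)$.
   Formalization: The claim that φ'' always blows up at zero fails at a=1/2, where φ'' has a finite limit; it is stated for a in (0,1), a≠1/2, and for every a in (0,1) the second difference quotient 2(φ(ρ)−φ(0))/ρ² is shown to blow up instead. *)

(* Defs.v *)
From HB Require Import structures.
From mathcomp Require Import all_boot all_order all_algebra.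
From mathcomp Require Import all_classical all_reals all_analysis.
Set Implicit Arguments.
Unset Strict Implicit.
Unset Printing Implicit Defensive.
Import Order.TTheory GRing.Theory Num.Theory.
Import numFieldNormedType.Exports.
Local Open Scope classical_set_scope.
Local Open Scope ring_scope.

Definition rV_display : measure_display. Proof. exact. Qed.

Section rV_measurable.
Context {R : realType} {n : nat}.

(* the product (= Borel) sigma-algebra of R^n *)
Let coord (i : 'I_n) (x : 'rV[R]_n) : measurableTypeR R := x ord0 i.

Let rV0 : g_sigma_preimage coord set0.
Proof. exact: sigma_algebra0. Qed.

Let rVC A : g_sigma_preimage coord A -> g_sigma_preimage coord (~` A).
Proof. exact: sigma_algebraC. Qed.

Let rVU (F : (set 'rV[R]_n)^nat) : (forall i, g_sigma_preimage coord (F i)) ->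
  g_sigma_preimage coord (\bigcup_i F i).
Proof. exact: sigma_algebra_bigcup. Qed.

HB.instance Definition _ := @isMeasurable.Build rV_display
  'rV[R]_n (g_sigma_preimage coord) rV0 rVC rVU.

Lemma measurable_rV_coord (i : 'I_n) :
  measurable_fun [set: 'rV[R]_n] (fun x => x ord0 i : measurableTypeR R).
Proof.
move=> _ Y mY; rewrite setTI; apply: sub_sigma_algebra => /=.
rewrite -bigcup_seq/=; exists i => /=; first by rewrite mem_index_enum.
by exists Y => //; rewrite setTI.
Qed.

Lemma measurable_fun_rVP d (T : measurableType d) (f : T -> 'rV[R]_n) :
  (forall i, measurable_fun [set: T] (fun t => f t ord0 i : measurableTypeR R)) ->
  measurable_fun [set: T] f.
Proof.
move=> mf.
suff : g_sigma_preimage (fun i => coord i \o f) `<=` measurable.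
  by rewrite g_sigma_preimage_comp => h _ A mA; apply: h; exists A.
apply: smallest_sub; first exact: sigma_algebra_measurable.
move=> A; rewrite -bigcup_seq => -[i _ [B mB <-]].
by apply: mf.
Qed.

End rV_measurable.

Section lebesgue_rV.
Context {R : realType}.

Definition rV_cons n (z : measurableTypeR R * 'rV[R]_n) : 'rV[R]_n.+1 :=
  \row_i oapp (z.2 ord0) z.1 (unlift ord0 i).

Definition rV_uncons n (v : 'rV[R]_n.+1) : measurableTypeR R * 'rV[R]_n :=
  (v ord0 ord0, \row_j v ord0 (lift ord0 j)).

Lemma rV_consK n : cancel (@rV_cons n) (@rV_uncons n).
Proof.
case=> x v; rewrite /rV_uncons /rV_cons !mxE unlift_none/=; congr pair.
by apply/rowP => j; rewrite !mxE liftK.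
Qed.

Lemma measurable_rV_cons n : measurable_fun setT (@rV_cons n).
Proof.
apply: measurable_fun_rVP => i; case: (unliftP ord0 i) => [j ->|->].
- rewrite (_ : (fun _ => _) = (fun v : 'rV[R]_n => v ord0 j) \o snd).
    by apply: measurableT_comp => //; exact: measurable_rV_coord.
  by apply/funext => z; rewrite mxE liftK.
- rewrite (_ : (fun _ => _) = fst)//.
  by apply/funext => z; rewrite mxE unlift_none.
Qed.

Lemma measurable_rV_uncons n : measurable_fun setT (@rV_uncons n).
Proof.
apply: measurable_fun_pair; first exact: measurable_rV_coord.
apply: measurable_fun_rVP => i.
rewrite (_ : (fun _ => _) = (fun v : 'rV[R]_n.+1 => v ord0 (lift ord0 i))).
  exact: measurable_rV_coord.
by apply/funext => z; rewrite mxE.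
Qed.

Section step.
Context {n : nat} (mu : {sigma_finite_measure set 'rV[R]_n -> \bar R}).

Definition rV_cons_measure : set 'rV[R]_n.+1 -> \bar R :=
  pushforward (@lebesgue_measure R \x mu)%E (@rV_cons n).

HB.instance Definition _ := Measure.copy rV_cons_measure
  (measure_function_pushforward__canonical__measure_function_Measure
    (@lebesgue_measure R \x mu)%E (@measurable_rV_cons n)).

Let rV_cons_sigma_finite : sigma_finite setT rV_cons_measure.
Proof.
have /sigma_finiteP[F [FT ndF mF]] := sigma_finiteT (@lebesgue_measure R).
have /sigma_finiteP[G [GT ndG mG]] := sigma_finiteT mu.
exists (fun k => @rV_uncons n @^-1` (F k `*` G k)).
  apply/seteqP; split => // v _.
  have [k _ Fk] : (\bigcup_k F k) (rV_uncons v).1 by rewrite -FT.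
  have [l _ Gl] : (\bigcup_k G k) (rV_uncons v).2 by rewrite -GT.
  exists (maxn k l) => //; split.
  - by apply: (subsetPset _ _ (ndF _ _ (leq_maxl k l))).
  - by apply: (subsetPset _ _ (ndG _ _ (leq_maxr k l))).
move=> k; have [mFk Fkoo] := mF k; have [mGk Gkoo] := mG k; split.
  rewrite -[X in measurable X]setTI; apply: measurable_rV_uncons => //.
  exact: measurableX.
rewrite /rV_cons_measure /pushforward -comp_preimage.
rewrite (_ : _ \o _ = id); last by apply/funext => z; exact: rV_consK.
by rewrite preimage_id product_measure1E// lte_mul_pinfty// ge0_fin_numE.
Qed.

HB.instance Definition _ := Measure_isSigmaFinite.Build _ _ _
  rV_cons_measure rV_cons_sigma_finite.

End step.

Fixpoint lebesgue_rV n : {sigma_finite_measure set 'rV[R]_n -> \bar R} :=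
  match n with
  | 0 => \d_(0 : 'rV[R]_0)
  | n'.+1 => rV_cons_measure (lebesgue_rV n')
  end.

End lebesgue_rV.

Section euclidean.
Context {R : realType} {d : nat}.
Implicit Types (x y : 'rV[R]_d) (u : 'rV[R]_d -> R).

Definition dotv x y : R := \sum_i x ord0 i * y ord0 i.

(* The library norm on matrices is the sup norm, hence this definition. *)
Definition enorm x : R := Num.sqrt (dotv x x).

Definition partial (i : 'I_d) u : 'rV[R]_d -> R := 'D_(delta_mx ord0 i) u.

Definition grad u x : 'rV[R]_d := \row_i partial i u x.

Definition partials (s : seq 'I_d) u : 'rV[R]_d -> R := foldr partial u s.

Definition smooth_on (U : set 'rV[R]_d) u : Prop :=
  forall (s : seq 'I_d) x, U x ->
    {for x, continuous (partials s u)} /\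
    forall i : 'I_d, derivable (partials s u) x (delta_mx ord0 i).

Definition schwartz u : Prop :=
  smooth_on setT u /\
  forall (k : nat) (s : seq 'I_d), exists M : R,
    forall x, enorm x ^+ k * `|partials s u x| <= M.

Definition test_function u : Prop :=
  smooth_on setT u /\ compact (closure [set x | u x != 0]).

Definition radial_profile u (f : R -> R) : Prop :=
  forall x, u x = f (enorm x).

End euclidean.

Section weighted_sobolev.
Context {R : realType} {d : nat} (a : R).
Implicit Types (phi : 'rV[R]_d -> R) (G : 'rV[R]_d -> 'rV[R]_d).

Definition weight (x : 'rV[R]_d) : R := enorm x `^ (2 * a).

(* the norm of H^{1,a}, with G in the place of the gradient of u *)
Definition H1a_norm (u : 'rV[R]_d -> R) G : \bar R :=
  ((\int[lebesgue_rV d]_x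
     (weight x * enorm (G x) ^+ 2 + `|u x| ^+ 2)%:E) `^ 2^-1)%E.

(* The completion of the Schwartz functions, realized inside
   L^2 x L^2(|x|^{2a} dx) through u |-> (u, grad u).  The first component of an
   element of the closure determines the second one almost everywhere: away from
   the origin the weight is bounded below, so G is the weak gradient of phi. *)
Definition H1a_gradient phi G : Prop :=
  [/\ measurable_fun setT (phi : 'rV[R]_d -> measurableTypeR R),
      measurable_fun setT G &
      exists u : ('rV[R]_d -> R)^nat,
        (forall n, schwartz (u n)) /\
        H1a_norm (fun x => u n x - phi x) (fun x => grad (u n) x - G x)
          @[n --> \oo] --> 0%E].

Definition in_H1a phi : Prop := exists G, H1a_gradient phi G.

Definition weak_integrand (omega p : R) phi G h (x : 'rV[R]_d) : R :=
  weight x * dotv (G x) (grad h x) + omega * phi x * h x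
    - `|phi x| `^ (p - 1) * phi x * h x.

Definition distributional_solution (omega p : R) phi : Prop :=
  exists G, H1a_gradient phi G /\
    forall h, test_function h ->
      (lebesgue_rV d).-integrable setT (EFin \o weak_integrand omega p phi G h) /\
      (\int[lebesgue_rV d]_x (weak_integrand omega p phi G h x)%:E = 0)%E.

Definition exp_decay phi : Prop :=
  exists delta C : R, [/\ 0 < delta, 0 < C &
    forall x, 0 < phi x <= C * expR (- delta * enorm x `^ (1 - a))].

End weighted_sobolev.

(* f is C^1 on [0, +oo[ once it is given the value f0 at 0 *)
Definition C1_upto0 {R : realType} (f : R -> R) (f0 : R) : Prop :=
  (forall r, 0 < r -> derivable f r 1 /\ {for r, continuous (derive1 f)}) /\
  exists l : R, (f r - f0) / r @[r --> 0^'+] --> l /\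
                derive1 f r @[r --> 0^'+] --> l.

(* Behaviour at the origin of a radial solution phi = f(|x|); being defined up to
   a null set, phi is continuous at 0 for a suitable value phi0 there. *)
Definition radial_asymptotics {R : realType} {d : nat} (omega p a : R)
    (phi : 'rV[R]_d -> R) (f : R -> R) : Prop :=
  exists phi0 : R,
    let c := phi0 `^ p - omega * phi0 in
    {for 0, continuous [eta phi with 0 |-> phi0]} /\
    0 < c /\
    (fun r => derive1 f r - (- (c / d%:R) * r `^ (1 - 2 * a)))
       =o_ (0^'+) (fun r => r `^ (1 - 2 * a)) /\
    (fun r => derive1n 2 f r - (2 * a - 1) / d%:R * c * r `^ (- (2 * a)))
       =o_ (0^'+) (fun r => r `^ (- (2 * a))) /\
    (0 < a <= 1 / 2 -> C1_upto0 f phi0) /\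
    (1 / 2 < a < 1 -> `|derive1 f r| @[r --> 0^'+] --> +oo) /\
    (0 < a < 1 -> a != 1 / 2 -> `|derive1n 2 f r| @[r --> 0^'+] --> +oo) /\
    (* at a = 1/2 the pointwise f'' stays bounded; the second derivative of phi
       at the origin is infinite for every a *)
    (0 < a < 1 -> `|2 * (f r - phi0) / r ^+ 2| @[r --> 0^'+] --> +oo).

(* Main.v *)
(* For radial functions of s = |x|^(1-a) the equation becomes that of the unweighted problem in
   the real dimension N = d/(1-a), and the hypothesis says N(p-1) < 2(p+1).  A ground state is
   found by shooting in the coefficient: let v solve v'' + (N-1)/s v' = mu v - v^p, v(0) = 1,
   v'(0) = 0.  For mu = 0 the solution crosses zero by Pohozaev's identity; at the infimum of the
   mu for which v stays nonnegative, the energy v'^2/2 + v^(p+1)/(p+1) - mu v^2/2 is nonnegative,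
   which makes v decrease to 0 exponentially.  Scaling and composition with |x|^(1-a) give phi.
   Since |x|^(2a) grad phi = M(|x|) x is a C^1 field, even at the origin, the weak equation is the
   divergence theorem, and u((|x|^2 + e)^((1-a)/2)) times a cutoff approximates phi in H^{1,a}.

   Conversely let phi = f(|x|) be a solution.  Only radial test functions h = k(|x|^2) are needed:
   |x|^(2a) grad h = H(|x|) x, and int (|x|^(2a) G.grad h + phi div (H(|x|) x)) = 0 passes to the
   limit from the Schwartz functions approximating phi.  Adding the divergence of the field
   (f H - k |x|^(2a-1) f') x turns the weak equation into the integral of k times the radial
   equation.  Hence r^(d-1+2a) f' has a limit m at 0, and m = 0: otherwise f is unbounded, or
   d = 1, 2a < 1, and a test function with h(0) > 0 gives m int |x| k'(|x|^2) = 0.  Integrating the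
   equation from the origin yields the expansions, with c = phi0^p - omega phi0.  Finally c > 0
   because r^(2a) f'^2/2 + f^(p+1)/(p+1) - omega f^2/2 decreases to a nonnegative limit. *)
Require Import Defs.
From HB Require Import structures.
From mathcomp Require Import all_boot all_order all_algebra.
From mathcomp Require Import all_classical all_reals all_analysis.
From mathcomp Require Import measurable_realfun ring lra.
Set Implicit Arguments.
Unset Strict Implicit.
Unset Printing Implicit Defensive.
Import Order.TTheory GRing.Theory Num.Theory.
Import numFieldNormedType.Exports.
Local Open Scope classical_set_scope.
Local Open Scope ring_scope.

(** * Calculus *)

(** The nonlinearity is truncated outside [[0, 1]], which makes it bounded and globally Lipschitz:
    Picard iterates then converge on the whole half-line in an exponentially weighted norm, with
    explicit dependence on [mu], and no continuation argument enters. The energy later keeps the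
    relevant solution in []0, 1]], where the truncation is invisible. Fixing [v 0 = 1] and moving
    [mu] amounts by scaling to moving the initial height, but confines the parameter to [[0, 1]],
    with the constant solution at [mu = 1] as one end. In [R^d] polar coordinates never appear.
    Radial computations are carried by fields [M(|x|) x], integrated coordinate by coordinate with
    Fubini; such a field is C^1 through the origin as soon as [M] is C^1 off 0, continuous at 0, and
    [r M'(r)] tends to 0 there. In the converse, [G] is only a limit in a weighted L^2 space. It is
    never identified with the classical gradient of [phi]: an identity that eliminates [G] replaces
    this. The delicate point is the origin, where a function smooth elsewhere could hide a
    source. *)

(* [is_derive] is a type class; this wrapper keeps instance resolution out of the proofs *)
Definition isder {R : realType} {V : normedModType R} (x v : V) (f : V -> R) (d : R)
  : Prop := is_derive x v f d.

Section calculus_rules.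
Context {R : realType} {V : normedModType R}.
Implicit Types (f g : V -> R) (x v : V).

Lemma isder_of (f : V -> R) x v d : derivable f x v -> 'D_v f x = d ->
  isder x v f d.
Proof. by move=> fx <-; rewrite /isder; exact/derivableP. Qed.

Lemma isder_eq f x v (a b : R) : isder x v f a -> a = b -> isder x v f b.
Proof. by move=> h <-. Qed.

Lemma der_cst (c : R) x v : isder x v (fun=> c) (0 : R).
Proof. exact: is_derive_cst. Qed.

Lemma derD f g x v a b : isder x v f a -> isder x v g b ->
  isder x v (fun t => f t + g t) (a + b).
Proof. by move=> fa gb; exact: is_deriveD fa gb. Qed.

Lemma derB f g x v a b : isder x v f a -> isder x v g b ->
  isder x v (fun t => f t - g t) (a - b).
Proof. by move=> fa gb; have := is_deriveB fa gb. Qed.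

Lemma derN f x v a : isder x v f a -> isder x v (fun t => - f t) (- a).
Proof. by move=> fa; have := is_deriveN fa. Qed.

Lemma derM f g x v a b : isder x v f a -> isder x v g b ->
  isder x v (fun t => f t * g t) (f x * b + g x * a).
Proof. by move=> fa gb; have := is_deriveM fa gb. Qed.

Lemma derX f n x v a : isder x v f a ->
  isder x v (fun t => f t ^+ n) (n%:R * f x ^+ n.-1 * a).
Proof.
move=> fa; have := is_deriveX n fa.
by rewrite (_ : f ^+ n = (fun t => f t ^+ n))//; apply/funext => t; rewrite fctE.
Qed.

Lemma der_sum n (h : 'I_n -> V -> R) x v (a : 'I_n -> R) :
  (forall i, isder x v (h i) (a i)) ->
  isder x v (fun t => \sum_i h i t) (\sum_i a i).
Proof.
move=> ha; have := is_derive_sum ha.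
by rewrite (_ : \sum_i h i = (fun t => \sum_i h i t))//; apply/funext => t; rewrite fct_sumE.
Qed.

End calculus_rules.

Section calculus_rules1.
Context {R : realType}.
Implicit Types (f g : R -> R) (x : R).

Lemma der_id x : isder x (1 : R) (fun t : R => t) (1 : R).
Proof. exact: is_derive_id. Qed.

Lemma der_comp (f g : R -> R) x a b : isder (g x) (1 : R) f a ->
  isder x (1 : R) g b -> isder x (1 : R) (fun t => f (g t)) (a * b).
Proof. by move=> fa gb; have := is_derive1_comp fa gb. Qed.

Lemma derV f x a : f x != 0 -> isder x (1 : R) f a ->
  isder x (1 : R) (fun t => (f t)^-1) (- f x ^- 2 * a).
Proof. by move=> f0 fa; have := is_deriveV f0 fa. Qed.

Lemma der_powR f x a r : 0 < f x -> isder x (1 : R) f a ->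
  isder x (1 : R) (fun t => f t `^ r) (r * f x `^ (r - 1) * a).
Proof. by move=> f0 fa; apply: der_comp (is_derive1_powR _ f0) fa. Qed.

Lemma der_expR f x a : isder x (1 : R) f a ->
  isder x (1 : R) (fun t => expR (f t)) (expR (f x) * a).
Proof. by move=> fa; apply: der_comp (is_derive_expR _) fa. Qed.

Lemma der_cont f x a : isder x (1 : R) f a -> {for x, continuous f}.
Proof.
by move=> [fx _]; apply/differentiable_continuous; apply/derivable1_diffP.
Qed.

Lemma der_local f g x d (e : R) : 0 < e -> (forall t, `|t - x| < e -> f t = g t) ->
  isder x (1 : R) f d -> isder x (1 : R) g d.
Proof.
move=> e0 fg; apply: near_eq_is_derive.
near=> t; apply: fg; rewrite distrC.
near: t; apply/nbhs_ballP; exists e => //= t; rewrite -ball_normE.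
Unshelve. all: by end_near. Qed.

Lemma der_pos f g x d : (forall t, 0 < t -> f t = g t) -> 0 < x ->
  isder x (1 : R) f d -> isder x (1 : R) g d.
Proof.
move=> fg x0; apply: (@der_local _ _ _ _ x) => // t; rewrite ltr_norml => /andP[h _].
apply: fg; lra.
Qed.

Lemma MVT' (f df : R -> R) (a b : R) : a < b ->
  (forall x, a < x < b -> isder x (1 : R) f (df x)) ->
  (forall x, a <= x <= b -> {for x, continuous f}) ->
  exists2 c, a < c < b & f b - f a = df c * (b - a).
Proof.
move=> ab fd fc.
have fd' x : x \in `]a, b[ -> is_derive x (1 : R) f (df x).
  by rewrite in_itv/=; exact: fd.
have fc' : {within `[a, b], continuous f}.
  by apply: continuous_in_subspaceT => x; rewrite inE/= in_itv/=; exact: fc.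
have [c cab fE] := MVT ab fd' fc'.
by exists c => //; move: cab; rewrite in_itv.
Qed.

Lemma deriv_ge0_le (f df : R -> R) (a b : R) : a <= b ->
  (forall x, a < x < b -> isder x (1 : R) f (df x)) ->
  (forall x, a < x < b -> 0 <= df x) ->
  (forall x, a <= x <= b -> {for x, continuous f}) -> f a <= f b.
Proof.
rewrite le_eqVlt => /predU1P[->//|ab] fd df0 fc.
have [c cab fE] := MVT' ab fd fc.
by rewrite -subr_ge0 fE mulr_ge0 ?df0// subr_ge0 ltW.
Qed.

Lemma deriv_gt0_lt (f df : R -> R) (a b : R) : a < b ->
  (forall x, a < x < b -> isder x (1 : R) f (df x)) ->
  (forall x, a < x < b -> 0 < df x) ->
  (forall x, a <= x <= b -> {for x, continuous f}) -> f a < f b.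
Proof.
move=> ab fd df0 fc.
have [c cab fE] := MVT' ab fd fc.
by rewrite -subr_gt0 fE mulr_gt0 ?df0// subr_gt0.
Qed.

Lemma deriv_cmp (f df g dg : R -> R) (a b : R) : a <= b ->
  (forall x, a < x < b -> isder x (1 : R) f (df x)) ->
  (forall x, a < x < b -> isder x (1 : R) g (dg x)) ->
  (forall x, a < x < b -> df x <= dg x) ->
  (forall x, a <= x <= b -> {for x, continuous f}) ->
  (forall x, a <= x <= b -> {for x, continuous g}) ->
  f b - f a <= g b - g a.
Proof.
move=> ab fd gd dfg fc gc.
suff : g a - f a <= g b - f b by lra.
apply: (@deriv_ge0_le (fun x => g x - f x) (fun x => dg x - df x)) => // x xab.
- by apply: derB; [exact: gd|exact: fd].
- by rewrite subr_ge0 dfg.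
- by apply: cvgB; [exact: gc|exact: fc].
Qed.

Lemma deriv_norm_cmp (f df g dg : R -> R) (a b : R) : a <= b ->
  (forall x, a < x < b -> isder x (1 : R) f (df x)) ->
  (forall x, a < x < b -> isder x (1 : R) g (dg x)) ->
  (forall x, a < x < b -> `|df x| <= dg x) ->
  (forall x, a <= x <= b -> {for x, continuous f}) ->
  (forall x, a <= x <= b -> {for x, continuous g}) ->
  `|f b - f a| <= g b - g a.
Proof.
move=> ab fd gd dfg fc gc; rewrite ler_norml; apply/andP; split.
- suff : - f b - - f a <= g b - g a by lra.
  apply: (@deriv_cmp (fun x => - f x) (fun x => - df x) g dg) => // x xab.
  + by apply: derN; exact: fd.
  + by have := dfg _ xab; rewrite ler_norml => /andP[]; lra.
  + by apply: cvgN; exact: fc.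
- apply: (@deriv_cmp f df g dg) => // x xab.
  by have := dfg _ xab; rewrite ler_norml => /andP[]; lra.
Qed.

End calculus_rules1.

Ltac der_step :=
  lazymatch goal with
  | |- isder _ _ (fun _ => ?c) _ => apply: der_cst
  | |- isder _ _ (fun t => t) _ => apply: der_id
  | |- isder _ _ (fun t => @?f t + @?g t) _ => apply: (@derD _ _ f g)
  | |- isder _ _ (fun t => @?f t * @?g t) _ => apply: (@derM _ _ f g)
  | |- isder _ _ (fun t => - @?f t) _ => apply: (@derN _ _ f)
  | |- isder _ _ (fun t => (@?f t) ^+ _) _ => apply: (@derX _ _ f)
  | |- isder _ _ (fun t => (@?f t) `^ _) _ => apply: (@der_powR _ f)
  | |- isder _ _ (fun t => expR (@?f t)) _ => apply: (@der_expR _ f)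
  | |- isder _ _ (fun t => (@?f t)^-1) _ => apply: (@derV _ f)
  end.
Ltac der := repeat der_step.
Ltac ringb := cbv beta; ring.

Ltac nn :=
  repeat first
    [ assumption | exact: ltr01 | exact: ler01 | exact: expR_gt0 | exact: expR_ge0
    | exact: powR_ge0 | exact: normr_ge0 | exact: sqr_ge0 | exact: ltr0Sn | exact: ler0n
    | apply: powR_gt0 | apply: mulr_gt0 | apply: exprn_gt0 | apply: addr_gt0
    | apply: mulr_ge0 | apply: exprn_ge0 | apply: addr_ge0
    | rewrite invr_gt0 | rewrite invr_ge0 | (apply: ltW; assumption) ].

Section continuity_rules.
Context {R : realType} {T : topologicalType}.
Implicit Types (f g : T -> R) (x : T).

Lemma ctAll (f : T -> R) : (forall x, {for x, continuous f}) -> continuous f.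
Proof. by []. Qed.

Lemma ct_cst (c : R) x : {for x, continuous (fun=> c)}.
Proof. exact: cvg_cst. Qed.

Lemma ctD f g x : {for x, continuous f} -> {for x, continuous g} ->
  {for x, continuous (fun t => f t + g t)}.
Proof. by move=> fx gx; apply: cvgD. Qed.

Lemma ctN f x : {for x, continuous f} -> {for x, continuous (fun t => - f t)}.
Proof. by move=> fx; apply: cvgN. Qed.

Lemma ctM f g x : {for x, continuous f} -> {for x, continuous g} ->
  {for x, continuous (fun t => f t * g t)}.
Proof. by move=> fx gx; apply: cvgM. Qed.

Lemma ctV f x : f x != 0 -> {for x, continuous f} ->
  {for x, continuous (fun t => (f t)^-1)}.
Proof. by move=> f0 fx; apply: cvgV. Qed.

Lemma ctX f n x : {for x, continuous f} -> {for x, continuous (fun t => f t ^+ n)}.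
Proof.
move=> fx; elim: n => [|n ih]; first exact: ct_cst.
have := ctM fx ih.
by rewrite (_ : (fun t => f t * f t ^+ n) = (fun t => f t ^+ n.+1))//; apply/funext => t; rewrite exprS.
Qed.

Lemma ct_norm f x : {for x, continuous f} -> {for x, continuous (fun t => `|f t|)}.
Proof. by move=> fx; apply: cvg_norm. Qed.

Lemma ct_comp (h : R -> R) f x : {for f x, continuous h} -> {for x, continuous f} ->
  {for x, continuous (fun t => h (f t))}.
Proof. by move=> hf fx; apply: (@continuous_comp _ _ _ f h). Qed.

Lemma ct_expR f x : {for x, continuous f} -> {for x, continuous (fun t => expR (f t))}.
Proof. by move=> fx; apply: ct_comp => //; exact: continuous_expR. Qed.

Lemma ct_powR f r x : 0 < f x -> {for x, continuous f} ->
  {for x, continuous (fun t => f t `^ r)}.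
Proof.
move=> f0 fx; apply: (@ct_comp (fun t => t `^ r)) => //.
exact: der_cont (is_derive1_powR _ f0).
Qed.

Lemma ct_max f g x : {for x, continuous f} -> {for x, continuous g} ->
  {for x, continuous (fun t => Num.max (f t) (g t))}.
Proof. by move=> fx gx; apply: continuous_max. Qed.

Lemma ct_min f g x : {for x, continuous f} -> {for x, continuous g} ->
  {for x, continuous (fun t => Num.min (f t) (g t))}.
Proof. by move=> fx gx; apply: continuous_min. Qed.

End continuity_rules.

Ltac ct_step :=
  lazymatch goal with
  | |- {for _, continuous (fun _ => ?c)} => apply: ct_cst
  | |- {for _, continuous (fun t => t)} => exact: cvg_id
  | |- {for _, continuous (fun t => @?f t + @?g t)} => apply: (@ctD _ _ f g)
  | |- {for _, continuous (fun t => @?f t * @?g t)} => apply: (@ctM _ _ f g)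
  | |- {for _, continuous (fun t => - @?f t)} => apply: (@ctN _ _ f)
  | |- {for _, continuous (fun t => (@?f t) ^+ _)} => apply: (@ctX _ _ f)
  | |- {for _, continuous (fun t => (@?f t) `^ _)} => apply: (@ct_powR _ _ f)
  | |- {for _, continuous (fun t => expR (@?f t))} => apply: (@ct_expR _ _ f)
  | |- {for _, continuous (fun t => (@?f t)^-1)} => apply: (@ctV _ _ f)
  | |- {for _, continuous (fun t => `|@?f t|)} => apply: (@ct_norm _ _ f)
  | |- {for _, continuous (fun t => Num.max (@?f t) (@?g t))} => apply: (@ct_max _ _ f g)
  | |- {for _, continuous (fun t => Num.min (@?f t) (@?g t))} => apply: (@ct_min _ _ f g)
  end.
Ltac ct := repeat ct_step.

Section real_misc.
Context {R : realType}.
Implicit Types (f g : R -> R) (x : R).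

Lemma ct_local f g x (e : R) : 0 < e -> (forall t, `|t - x| < e -> f t = g t) ->
  {for x, continuous f} -> {for x, continuous g}.
Proof.
move=> e0 fg fx.
have fgx : f x = g x by apply: fg; rewrite subrr normr0.
suff : f t @[t --> x] --> f x -> g t @[t --> x] --> g x by apply.
rewrite -fgx; apply: cvg_trans; apply: near_eq_cvg.
by exists e => //= t /= tx; apply: fg; rewrite distrC.
Qed.

Lemma ct_pos f g x : (forall t, 0 < t -> f t = g t) -> 0 < x ->
  {for x, continuous f} -> {for x, continuous g}.
Proof.
move=> fg x0; apply: (@ct_local _ _ _ x) => // t; rewrite ltr_norml => /andP[h _].
apply: fg; lra.
Qed.

Lemma ct_neg f g x : (forall t, t < 0 -> f t = g t) -> x < 0 ->
  {for x, continuous f} -> {for x, continuous g}.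
Proof.
move=> fg x0; apply: (@ct_local _ _ _ (- x)); first by lra.
by move=> t; rewrite ltr_norml => /andP[_ h]; apply: fg; lra.
Qed.

Lemma ct_epsP f x : {for x, continuous f} <->
  (forall e : R, 0 < e -> exists2 d : R, 0 < d & forall t, `|t - x| < d -> `|f t - f x| < e).
Proof.
split => [fx e e0|h].
- have /cvgrPdistC_lt/(_ _ e0) := fx.
  move=> /nbhs_ballP[d /= d0 H]; exists d => // t tx.
  by apply: H; rewrite -ball_normE/= distrC.
- apply/cvgrPdistC_lt => e e0; have [d d0 H] := h _ e0.
  apply/nbhs_ballP; exists d => //= t /= tx.
  by apply: H; rewrite distrC.
Qed.

Lemma ct0_lin f (C : R) : f 0 = 0 -> (forall t, `|t| < 1 -> `|f t| <= C * `|t|) ->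
  {for 0, continuous f}.
Proof.
move=> f0 H; apply/ct_epsP => e e0.
have C0 : 0 < `|C| + 1 by rewrite ltr_wpDl.
exists (Num.min 1 (e / (`|C| + 1))).
  by rewrite lt_min ltr01 divr_gt0.
move=> t; rewrite f0 !subr0 lt_min => /andP[t1 te].
apply: le_lt_trans (H _ t1) _.
rewrite ltr_pdivlMr// in te.
apply: le_lt_trans te; rewrite mulrC ler_wpM2l//.
by apply: le_trans (ler_norm _) _; rewrite lerDl.
Qed.

(** The integral starts at [-1] so that every point [s >= 0], 0 included, is interior and the
    fundamental theorem applies there; composing with [Num.max s 0] and subtracting [F 0] freezes
    the primitive at 0 on the left. The initial value problem below follows the same convention, so
    that continuity at 0 is an ordinary two-sided statement. *)
Lemma primitive_exists (h : R -> R) : continuous h ->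
  exists H : R -> R, [/\ continuous H, forall s : R, s <= 0 -> H s = 0 &
    forall s : R, 0 < s -> isder s (1 : R) H (h s)].
Proof.
move=> hc.
pose F := fun s : R => (\int[lebesgue_measure]_(t in [set` Interval (BLeft (-1)) (BRight s)]) h t)%R.
have Fd (s : R) : -1 < s -> isder s (1 : R) F (h s).
  move=> s1.
  have := @continuous_FTC1 R h (BLeft (-1)) s (s + 1) _ _ _ (hc s).
  rewrite ltrDl ltr01 => /(_ isT) H.
  have hi : lebesgue_measure.-integrable `[-1, s + 1] (EFin \o h).
    apply: continuous_compact_integrable; first exact: segment_compact.
    by apply: continuous_subspaceT.
  have /(_ _)[|dF FE] := H hi; first by rewrite /= lte_fin.
  by apply: isder_of; [exact: dF|rewrite -derive1E; exact: FE].
exists (fun s : R => F (Num.max s 0) - F 0); split.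
- apply: ctAll => s; apply: ctD; last exact: ct_cst.
  apply: ct_comp; last by ct.
  apply: der_cont; apply: Fd; rewrite lt_max; lra.
- by move=> s s0; rewrite max_r// subrr.
- move=> s s0; apply: (@der_pos _ (fun s => F s - F 0)) => //.
    by move=> t t0; rewrite max_l// ltW.
  eapply isder_eq; first by der; apply: Fd; lra.
  by rewrite addr0.
Qed.

End real_misc.
(* [lra] slows down in large contexts *)
Ltac qlra :=
  repeat match goal with H : forall x, _ |- _ => clear H end;
  repeat match goal with H := _ |- _ => clearbody H end; lra.

(** * The radial initial value problem and its ground state *)

Section powers.
Context {R : realType}.

Lemma powRB_gt0 (s a b : R) : 0 < s -> s `^ (a + b) = s `^ a * s `^ b.
Proof. by move=> s0; rewrite powRD// (gt_eqF s0) implybT. Qed.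

Lemma powRVN (s a : R) : 0 < s -> s `^ a * s `^ (- a) = 1.
Proof. by move=> s0; rewrite -powRB_gt0// subrr powRr0. Qed.

Lemma powR_sub1M (s a : R) : 0 < s -> s `^ (a - 1) * s = s `^ a.
Proof.
by move=> s0; rewrite -[X in _ * X = _]powRr1 ?ltW// -powRB_gt0// subrK.
Qed.

Lemma powR_max_cont (r : R) : 0 <= r -> continuous (fun s : R => Num.max s 0 `^ r).
Proof.
rewrite le_eqVlt => /predU1P[<-|r0].
  apply: ctAll => s; rewrite (_ : (fun s => _) = cst 1); first exact: ct_cst.
  by apply/funext => t; rewrite powRr0.
apply: ctAll => s; have [s0|s0|->] := ltgtP s 0.
- apply: (@ct_neg _ (fun=> 0)) s0 _; last exact: ct_cst.
  by move=> t t0; rewrite max_r ?ltW// powR0// gt_eqF.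
- by ct => //; rewrite lt_max s0.
- apply/ct_epsP => e e0; exists (e `^ r^-1); first exact: powR_gt0.
  move=> t; rewrite subr0 maxxx powR0 ?gt_eqF// subr0 => te.
  rewrite ger0_norm ?powR_ge0//.
  rewrite -[ltRHS](@powRr1 _ e) ?ltW// -(@mulVf _ r) ?gt_eqF// powRrM.
  apply: gt0_ltr_powR => //; rewrite ?nnegrE ?powR_ge0 ?le_max ?lexx ?orbT//.
  apply: le_lt_trans te; rewrite ge_max normr_ge0 andbT; exact: ler_norm.
Qed.

Lemma geo_le (x a b : R) : (forall n : nat, x <= a + b * (1 / 2) ^+ n) -> x <= a.
Proof.
move=> H; rewrite leNgt; apply/negP => ax.
have : (fun n => geometric b (1 / 2) n : R) @ \oo --> (0 : R).
  by apply: cvg_geometric; rewrite ger0_norm; lra.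
move=> /cvgrPdist_lt/(_ (x - a)); rewrite subr_gt0 => /(_ ax)[n _ /(_ n (leqnn _))] /=.
rewrite sub0r normrN /geometric/= => h.
have := H n; have := ler_norm (b * (1 / 2) ^+ n); lra.
Qed.

(** The intervals with ends [a n - 2 C 2^-n] and [a n + 2 C 2^-n] are nested; the limit is the
    supremum of the lower ends, and lying in every interval gives the rate at once. *)
Lemma geo_limit (a : nat -> R) (C : R) :
  (forall n, `|a n.+1 - a n| <= C * (1 / 2) ^+ n) ->
  exists l : R, forall n, `|a n - l| <= 2 * C * (1 / 2) ^+ n.
Proof.
move=> H.
pose lo n := a n - 2 * C * (1 / 2) ^+ n.
pose up n := a n + 2 * C * (1 / 2) ^+ n.
have los n : lo n <= lo n.+1.
  have := H n; rewrite ler_norml => /andP[h _]; rewrite /lo exprS; lra.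
have ups n : up n.+1 <= up n.
  have := H n; rewrite ler_norml => /andP[_ h]; rewrite /up exprS; lra.
have lom m n : (m <= n)%N -> lo m <= lo n.
  by move=> /subnKC <-; elim: (n - m)%N => [|k ih]; rewrite ?addn0// addnS (le_trans ih).
have upm m n : (m <= n)%N -> up n <= up m.
  by move=> /subnKC <-; elim: (n - m)%N => [|k ih]; rewrite ?addn0// addnS (le_trans _ ih).
have C0 : 0 <= C.
  by have := H 0%N; rewrite expr0 mulr1; apply: le_trans; exact: normr_ge0.
have loup n : lo n <= up n.
  have : 0 <= C * (1 / 2) ^+ n by rewrite mulr_ge0// exprn_ge0//; lra.
  by rewrite /lo /up; lra.
have lup m n : lo m <= up n.
  have [mn|/ltnW nm] := leqP m n.
  - by apply: le_trans (lom _ _ mn) (loup n).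
  - by apply: le_trans (loup m) (upm _ _ nm).
have hs : has_sup (range lo).
  split; first by exists (lo 0%N); exists 0%N.
  by exists (up 0%N) => _ [n _ <-].
exists (sup (range lo)) => n; rewrite ler_norml; apply/andP; split.
- have : sup (range lo) <= up n by apply: ge_sup => [|_ [m _ <-]//]; exists (lo 0%N); exists 0%N.
  rewrite /up; lra.
- have : lo n <= sup (range lo) by apply: sup_upper_bound => //; exists n.
  rewrite /lo; lra.
Qed.

End powers.

Section radial_ivp.
Context {R : realType} (N : R) (hN : 1 <= N).

(** Comparison with [t^(N-1) (D / lam) expR (lam t)]: its derivative contains
    [D t^(N-1) expR (lam t)], and the remaining term is nonnegative because [N >= 1]. One
    integration thus gains a factor [1 / lam]. *)
Lemma flux_bound (J h : R -> R) (D lam s : R) : 0 < lam -> 0 <= D -> 0 < s ->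
  continuous J -> J 0 = 0 ->
  (forall t : R, 0 < t -> isder t (1 : R) J (t `^ (N - 1) * h t)) ->
  (forall t : R, 0 < t -> `|h t| <= D * expR (lam * t)) ->
  `|J s| <= s `^ (N - 1) * (D / lam) * expR (lam * s).
Proof.
move=> l0 D0 s0 Jc J0 Jd hb.
pose g t := (Num.max t 0) `^ (N - 1) * (D / lam * expR (lam * t)).
pose dg t := (t `^ (N - 1) * (D / lam * (expR (lam * t) * lam))) +
   (N - 1) * t `^ (N - 1 - 1) * (D / lam * expR (lam * t)).
have g0 : 0 <= g 0.
  by rewrite /g mulr_ge0 ?powR_ge0// mulr_ge0 ?expR_ge0// divr_ge0// ltW.
have : `|J s - J 0| <= g s - g 0.
  apply: (@deriv_norm_cmp _ J (fun t => t `^ (N - 1) * h t) g dg); rewrite ?ltW//.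
  - by move=> t /andP[t0 _]; exact: Jd.
  - move=> t /andP[t0 _].
    apply: (@der_pos _ (fun t => t `^ (N - 1) * (D / lam * expR (lam * t)))) => //.
      by move=> u u0; rewrite /g max_l ?ltW.
    by eapply isder_eq; [der|rewrite /dg; ringb].
  - move=> t /andP[t0 _]; rewrite /dg normrM ger0_norm ?powR_ge0//.
    apply: (@le_trans _ _ (t `^ (N - 1) * (D / lam * (expR (lam * t) * lam)))).
      rewrite ler_wpM2l ?powR_ge0//; apply: le_trans (hb _ t0) _.
      by rewrite le_eqVlt; apply/orP; left; apply/eqP; field; rewrite gt_eqF.
    have N1 : 0 <= N - 1 by rewrite subr_ge0.
    by rewrite lerDl; nn.
  - by move=> t _; exact: Jc.
  - move=> t _; apply: ctM; last by ct.
    by apply: powR_max_cont; rewrite subr_ge0.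
rewrite J0 subr0 => /le_trans; apply.
have -> : s `^ (N - 1) * (D / lam) * expR (lam * s) = g s.
  by rewrite /g (max_l (ltW s0)); ring.
lra.
Qed.

(** The factor [t^(1-N)] cancels the growth of the flux, and the second integration gains another
    [1 / lam]. The resulting [1 / lam^2] is what makes the Picard map contract for large [lam]. *)
Lemma primitive_bound (V J : R -> R) (D lam s : R) : 0 < lam -> 0 <= D -> 0 < s ->
  continuous V -> V 0 = 0 ->
  (forall t : R, 0 < t -> isder t (1 : R) V (t `^ (1 - N) * J t)) ->
  (forall t : R, 0 < t -> `|J t| <= t `^ (N - 1) * (D / lam) * expR (lam * t)) ->
  `|V s| <= D / lam ^+ 2 * expR (lam * s).
Proof.
move=> l0 D0 s0 Vc V0 Vd hb.
pose g t := D / lam ^+ 2 * expR (lam * t).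
have g0 : 0 <= g 0 by rewrite /g mulr_ge0 ?expR_ge0// divr_ge0// exprn_ge0// ltW.
have : `|V s - V 0| <= g s - g 0.
  apply: (@deriv_norm_cmp _ V (fun t => t `^ (1 - N) * J t) g
     (fun t => D / lam ^+ 2 * (expR (lam * t) * lam))); rewrite ?ltW//.
  - by move=> t /andP[t0 _]; exact: Vd.
  - by move=> t _; rewrite /g; eapply isder_eq; [der|ringb].
  - move=> t /andP[t0 _]; rewrite normrM ger0_norm ?powR_ge0//.
    apply: le_trans (ler_wpM2l (powR_ge0 _ _) (hb _ t0)) _.
    have := powRVN (1 - N) t0; rewrite opprB => h.
    rewrite -!mulrA [leLHS]mulrA h mul1r le_eqVlt; apply/orP; left; apply/eqP.
    by field; rewrite gt_eqF.
  - by move=> t _; exact: Vc.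
  - by move=> t _; rewrite /g; ct.
rewrite V0 subr0 => /le_trans; apply.
by move: g0; rewrite /g; lra.
Qed.

Lemma radial_solve (h : R -> R) (M : R) : continuous h -> (forall t, `|h t| <= M) ->
  exists J V : R -> R, [/\ continuous J, continuous V,
    forall s : R, s <= 0 -> J s = 0 /\ V s = 0,
    forall s : R, 0 < s -> isder s (1 : R) J (s `^ (N - 1) * h s) &
    forall s : R, 0 < s -> isder s (1 : R) V (s `^ (1 - N) * J s)].
Proof.
move=> hc hM.
have M0 : 0 <= M by apply: le_trans (hM 0); exact: normr_ge0.
have wc : continuous (fun s : R => Num.max s 0 `^ (N - 1) * h s).
  apply: ctAll => s; apply: ctM; last exact: hc.
  by apply: powR_max_cont; rewrite subr_ge0.
have [J [Jc J0 Jd']] := primitive_exists wc.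
have Jd (s : R) : 0 < s -> isder s (1 : R) J (s `^ (N - 1) * h s).
  by move=> s0; have := Jd' s s0; rewrite max_l// ltW.
have Jb (s : R) : 0 < s -> `|J s| <= M * s `^ N.
  move=> s0.
  have N0 : 0 <= N by exact: le_trans hN.
  have : `|J s - J 0| <= M * Num.max s 0 `^ N - M * Num.max 0 0 `^ N.
    apply: (@deriv_norm_cmp _ J (fun t => t `^ (N - 1) * h t)
      (fun t => M * Num.max t 0 `^ N) (fun t => M * (N * t `^ (N - 1)))); rewrite ?ltW//.
    - by move=> t /andP[t0 _]; exact: Jd.
    - move=> t /andP[t0 _].
      apply: (@der_pos _ (fun t => M * t `^ N)) => //.
        by move=> u u0; rewrite max_l ?ltW.
      by eapply isder_eq; [der|ringb].
    - move=> t /andP[t0 _]; rewrite normrM ger0_norm ?powR_ge0//.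
      apply: le_trans (ler_wpM2l (powR_ge0 _ _) (hM _)) _.
      rewrite mulrC ler_wpM2l// ler_peMl ?powR_ge0//.
    - by move=> t _; exact: Jc.
    - by move=> t _; apply: ctM; [exact: ct_cst|exact: powR_max_cont].
  rewrite (J0 _ (lexx 0)) subr0 (max_l (ltW s0)) maxxx powR0; last by rewrite gt_eqF// (lt_le_trans _ hN).
  by rewrite mulr0 subr0.
(* The bound [|J s| <= M s^N] makes [s^(1-N) J s] of order [s], so its extension by 0 is continuous
   and has a primitive, although [s^(1-N)] is singular for [N > 1]. *)
pose k s := if 0 < s then s `^ (1 - N) * J s else 0.
have kc : continuous k.
  apply: ctAll => s; have [s0|s0|->] := ltgtP s 0.
  - apply: (@ct_neg _ (fun=> 0)) s0 _; last exact: ct_cst.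
    by move=> t t0; rewrite /k ltNge ltW.
  - apply: (@ct_pos _ (fun s => s `^ (1 - N) * J s)) => //.
      by move=> t t0; rewrite /k t0.
    by ct => //; exact: Jc.
  - apply: (@ct0_lin _ k M); first by rewrite /k ltxx.
    move=> t _; rewrite /k; case: ifPn => t0; last by rewrite normr0 mulr_ge0.
    rewrite normrM ger0_norm ?powR_ge0//.
    apply: le_trans (ler_wpM2l (powR_ge0 _ _) (Jb _ t0)) _.
    rewrite mulrCA -powRB_gt0// (_ : 1 - N + N = 1); last by ring.
    by rewrite (powRr1 (ltW t0)) gtr0_norm.
have [V [Vc V0 Vd]] := primitive_exists kc.
exists J, V; split => //; first by move=> s s0; rewrite J0// V0.
by move=> s s0; have := Vd s s0; rewrite /k s0.
Qed.

End radial_ivp.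

(** * Picard iteration for the radial initial value problem *)

Section ivp.
Context {R : realType}.

(* [v'' + (N - 1) / s v' + g v = 0], [v 0 = 1], [v' 0 = 0], with flux [J = - s^(N-1) v'] *)
Definition ivp (N : R) (g v J : R -> R) : Prop :=
  [/\ continuous v, continuous J,
    forall s : R, s <= 0 -> v s = 1 /\ J s = 0,
    forall s : R, 0 < s -> isder s (1 : R) J (s `^ (N - 1) * g (v s)) &
    forall s : R, 0 < s -> isder s (1 : R) v (- (s `^ (1 - N) * J s))].

(** The right-hand sides [h1], [h2] are arbitrary functions of [s], so the estimate serves both
    Picard iterates, whose nonlinear term comes from the previous iterate, and genuine solutions. *)
Lemma ivp_step_bound (N : R) (hN : 1 <= N) (h1 h2 v1 v2 J1 J2 : R -> R) (D lam : R) :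
  0 < lam -> 0 <= D ->
  continuous v1 -> continuous v2 -> continuous J1 -> continuous J2 ->
  v1 0 = v2 0 -> J1 0 = J2 0 ->
  (forall s : R, 0 < s -> isder s (1 : R) J1 (s `^ (N - 1) * h1 s)) ->
  (forall s : R, 0 < s -> isder s (1 : R) J2 (s `^ (N - 1) * h2 s)) ->
  (forall s : R, 0 < s -> isder s (1 : R) v1 (- (s `^ (1 - N) * J1 s))) ->
  (forall s : R, 0 < s -> isder s (1 : R) v2 (- (s `^ (1 - N) * J2 s))) ->
  (forall s : R, 0 < s -> `|h1 s - h2 s| <= D * expR (lam * s)) ->
  forall s : R, 0 < s ->
    `|J1 s - J2 s| <= s `^ (N - 1) * (D / lam) * expR (lam * s) /\
    `|v1 s - v2 s| <= D / lam ^+ 2 * expR (lam * s).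
Proof.
move=> l0 D0 v1c v2c J1c J2c v0 J0 J1d J2d v1d v2d hD.
have Jb (s : R) : 0 < s -> `|J1 s - J2 s| <= s `^ (N - 1) * (D / lam) * expR (lam * s).
  move=> s0.
  apply: (@flux_bound _ N hN (fun t => J1 t - J2 t) (fun t => h1 t - h2 t)) => //.
  - by apply: ctAll => t; apply: ctD; [exact: J1c|apply: ctN; exact: J2c].
  - by rewrite J0 subrr.
  - move=> t t0; eapply isder_eq; first by apply: derB; [exact: J1d|exact: J2d].
    by ringb.
move=> s s0; split; first exact: Jb.
have -> : `|v1 s - v2 s| = `|v2 s - v1 s| by rewrite distrC.
apply: (@primitive_bound _ N (fun t => v2 t - v1 t) (fun t => J1 t - J2 t)) => //.
- by apply: ctAll => t; apply: ctD; [exact: v2c|apply: ctN; exact: v1c].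
- by rewrite v0 subrr.
- move=> t t0; eapply isder_eq; first by apply: derB; [exact: v2d|exact: v1d].
  by ringb.
Qed.

(** A bootstrap: the crude bound [2 M] on the nonlinear terms starts it, and each pass through the
    linear estimate halves the part [q] of the error not due to [e]. The rate [lam = 1 + 2 L] makes
    [(L (e + q) + e) / lam^2 <= e + q / 2]; [M] disappears in the limit. *)
Lemma ivp_dep (N : R) (hN : 1 <= N) (g1 g2 v1 v2 J1 J2 : R -> R) (L M e : R) :
  0 <= L -> 0 <= e ->
  (forall x, `|g1 x| <= M) -> (forall x, `|g2 x| <= M) ->
  (forall x y, `|g1 x - g1 y| <= L * `|x - y|) ->
  (forall x, `|g1 x - g2 x| <= e) ->
  ivp N g1 v1 J1 -> ivp N g2 v2 J2 ->
  forall s : R, 0 < s ->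
    `|v1 s - v2 s| <= e * expR ((1 + 2 * L) * s) /\
    `|J1 s - J2 s| <= s `^ (N - 1) * e * expR ((1 + 2 * L) * s).
Proof.
move=> L0 e0 g1M g2M g1L g12 [v1c J1c vJ1 J1d v1d] [v2c J2c vJ2 J2d v2d].
have M0 : 0 <= M by apply: le_trans (g1M 0); exact: normr_ge0.
set lam := 1 + 2 * L.
have l0 : 0 < lam by rewrite /lam; qlra.
have l1 : 1 <= lam by rewrite /lam; qlra.
have ll : 1 <= lam ^+ 2 by have := sqr_ge0 L; rewrite /lam; qlra.
have [v10 J10] := vJ1 0 (lexx 0).
have [v20 J20] := vJ2 0 (lexx 0).
have step (D : R) : 0 <= D ->
    (forall s : R, 0 < s -> `|g1 (v1 s) - g2 (v2 s)| <= D * expR (lam * s)) ->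
    forall s : R, 0 < s ->
    `|J1 s - J2 s| <= s `^ (N - 1) * (D / lam) * expR (lam * s) /\
    `|v1 s - v2 s| <= D / lam ^+ 2 * expR (lam * s).
  move=> D0 hD; apply: (ivp_step_bound hN l0 D0 v1c v2c J1c J2c _ _ J1d J2d v1d v2d hD).
  - by rewrite v10 v20.
  - by rewrite J10 J20.
have E1 (s : R) : 0 < s -> 1 <= expR (lam * s).
  by move=> s0; rewrite -expR0 ler_expR mulr_ge0// ltW.
have gstep (D : R) : 0 <= D ->
    (forall s : R, 0 < s -> `|v1 s - v2 s| <= D * expR (lam * s)) ->
    forall s : R, 0 < s -> `|g1 (v1 s) - g2 (v2 s)| <= (L * D + e) * expR (lam * s).
  move=> D0 hD s s0.
  have -> : g1 (v1 s) - g2 (v2 s) = (g1 (v1 s) - g1 (v2 s)) + (g1 (v2 s) - g2 (v2 s)).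
    by ring.
  apply: le_trans (ler_normD _ _) _; rewrite mulrDl lerD//.
    by apply: le_trans (g1L _ _) _; rewrite -mulrA ler_wpM2l// hD.
  by apply: le_trans (g12 _) _; rewrite ler_peMr// E1.
have vb (n : nat) : forall s : R, 0 < s ->
    `|v1 s - v2 s| <= (e + 2 * M * (1 / 2) ^+ n) * expR (lam * s).
  elim: n => [|n ih] s s0.
    have M2 : 0 <= 2 * M by qlra.
    have hM (t : R) : 0 < t -> `|g1 (v1 t) - g2 (v2 t)| <= 2 * M * expR (lam * t).
      move=> t0; apply: le_trans (ler_normB _ _) _.
      have := g1M (v1 t); have := g2M (v2 t) => h1 h2.
      apply: (@le_trans _ _ (2 * M)); first by qlra.
      by rewrite ler_peMr// E1.
    have [_ /le_trans] := step _ M2 hM s s0; apply.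
    rewrite ler_wpM2r ?expR_ge0// expr0 mulr1.
    apply: (@le_trans _ _ (2 * M)); last by qlra.
    by rewrite ler_pdivrMr ?ler_peMr// (lt_le_trans _ ll).
  have D0 : 0 <= e + 2 * M * (1 / 2) ^+ n by nn; qlra.
  have LD0 : 0 <= L * (e + 2 * M * (1 / 2) ^+ n) + e by nn.
  have [_ /le_trans] := step _ LD0 (gstep _ D0 ih) s s0; apply.
  rewrite ler_wpM2r ?expR_ge0// ler_pdivrMr; last exact: lt_le_trans ll.
  set q := 2 * M * (1 / 2) ^+ n.
  have -> : 2 * M * (1 / 2) ^+ n.+1 = q / 2 by rewrite /q exprS; field.
  have q0 : 0 <= q by rewrite /q; nn; qlra.
  have Lq : 0 <= L * q by nn.
  have LLq : 0 <= L ^+ 2 * q by nn.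
  have Le : 0 <= L * e by nn.
  have LLe : 0 <= L ^+ 2 * e by nn.
  have -> : (e + q / 2) * lam ^+ 2 =
    e + q / 2 + 4 * (L * e) + 2 * (L * q) + 4 * (L ^+ 2 * e) + 2 * (L ^+ 2 * q).
    by rewrite /lam; field.
  rewrite mulrDr; qlra.
have vE (s : R) : 0 < s -> `|v1 s - v2 s| <= e * expR (lam * s).
  move=> s0; apply: (@geo_le _ _ _ (2 * M * expR (lam * s))) => n.
  by apply: le_trans (vb n _ s0) _; rewrite mulrDl mulrAC.
move=> s s0; split; first exact: vE.
have LD0 : 0 <= L * e + e by nn.
have [/le_trans h _] := step _ LD0 (gstep _ e0 vE) s s0; apply: h.
rewrite ler_wpM2r ?expR_ge0// ler_wpM2l ?powR_ge0// ler_pdivrMr//.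
have Le : 0 <= L * e by nn.
rewrite /lam; qlra.
Qed.

(** Picard iteration in the norm [sup |u s| expR (- lam s)]: with [lam = 1 + 2 L] one has
    [L / lam^2 <= 1/2], so the iterates converge on the whole half-line. *)
Lemma ivp_exists (N : R) (hN : 1 <= N) (g : R -> R) (L M : R) :
  0 <= L -> (forall x, `|g x| <= M) ->
  (forall x y, `|g x - g y| <= L * `|x - y|) ->
  exists v J, ivp N g v J.
Proof.
move=> L0 gM gL.
have M0 : 0 <= M by apply: le_trans (gM 0); exact: normr_ge0.
have gc : continuous g.
  apply: ctAll => x; apply/ct_epsP => e e0; exists (e / (L + 1)).
    by rewrite divr_gt0//; qlra.
  move=> t; rewrite ltr_pdivlMr; last by qlra.
  by move=> h; apply: le_lt_trans (gL _ _) _; have := normr_ge0 (t - x); qlra.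
pose step (v : R -> R) (w : (R -> R) * (R -> R)) : Prop :=
  [/\ continuous w.1, continuous w.2,
    forall s : R, s <= 0 -> w.1 s = 1 /\ w.2 s = 0,
    forall s : R, 0 < s -> isder s (1 : R) w.2 (s `^ (N - 1) * g (v s)) &
    forall s : R, 0 < s -> isder s (1 : R) w.1 (- (s `^ (1 - N) * w.2 s))].
(* Iterates are bundled with their continuity, which the linear problem requires of its right-hand
   side at every step. *)
have stepE (v : {v : R -> R | continuous v}) : exists w : {v : R -> R | continuous v} * (R -> R),
    step (sval v) (sval w.1, w.2).
  have hc : continuous (fun s : R => g (sval v s)).
    by apply: ctAll => s; apply: ct_comp; [exact: gc|exact: (svalP v)].
  have [J [V [Jc Vc JV Jd Vd]]] := radial_solve hN hc (fun t => gM _).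
  have wc : continuous (fun s : R => 1 - V s).
    by apply: ctAll => s; apply: ctD; [exact: ct_cst|apply: ctN; exact: Vc].
  exists (exist _ _ wc, J); split => //=.
  - by move=> s s0; have [-> ->] := JV s s0; rewrite subr0.
  - move=> s s0; eapply isder_eq; first by der; exact: Vd.
    by ringb.
have [T HT] := choice stepE.
have c1 : continuous (fun _ : R => 1 : R) by move=> x; exact: ct_cst.
pose u n := iter n (fun v => (T v).1) (exist _ _ c1).
pose U n := sval (u n).
have Uc n : continuous (U n) by exact: svalP (u n).
have US n : step (U n) (U n.+1, (T (u n)).2) by exact: HT.
have U0 n (s : R) : s <= 0 -> U n s = 1.
  by case: n => [//|n] s0; have [_ _ h _ _] := US n; have [] := h s s0.
pose lam := 1 + 2 * L.
have l0 : 0 < lam by rewrite /lam; qlra.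
have l1 : 1 <= lam by rewrite /lam; qlra.
have ll : 1 <= lam ^+ 2 by have := sqr_ge0 L; rewrite /lam; qlra.
have lL : 2 * L <= lam ^+ 2 by rewrite /lam; have := sqr_ge0 L; qlra.
have E1 (s : R) : 0 < s -> 1 <= expR (lam * s).
  by move=> s0; rewrite -expR0 ler_expR mulr_ge0// ltW.
have cmp (v1 v2 : R -> R) w1 w2 (D : R) : 0 <= D -> step v1 w1 -> step v2 w2 ->
    (forall s : R, 0 < s -> `|v1 s - v2 s| <= D * expR (lam * s)) ->
    forall s : R, 0 < s -> `|w1.1 s - w2.1 s| <= D / 2 * expR (lam * s).
  move=> D0 [v1c J1c vJ1 J1d v1d] [v2c J2c vJ2 J2d v2d] hD s s0.
  have LD : 0 <= L * D by nn.
  have hL (t : R) : 0 < t -> `|g (v1 t) - g (v2 t)| <= L * D * expR (lam * t).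
    by move=> t0; apply: le_trans (gL _ _) _; rewrite -mulrA ler_wpM2l// hD.
  have [w10 J10] := vJ1 0 (lexx 0); have [w20 J20] := vJ2 0 (lexx 0).
  have e1 : w1.1 0 = w2.1 0 by rewrite w10 w20.
  have e2 : w1.2 0 = w2.2 0 by rewrite J10 J20.
  have [_ /le_trans] := ivp_step_bound hN l0 LD v1c v2c J1c J2c e1 e2 J1d J2d v1d v2d hL s0.
  apply; rewrite ler_wpM2r ?expR_ge0// ler_pdivrMr; last exact: lt_le_trans ll.
  have : 0 <= D * (lam ^+ 2 - 2 * L) by rewrite mulr_ge0// subr_ge0.
  by rewrite mulrBr; qlra.
have Ud n : forall s : R, 0 < s -> `|U n.+1 s - U n s| <= M * (1 / 2) ^+ n * expR (lam * s).
  elim: n => [|n ih] s s0.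
    have [w1c w2c w0 J1d v1d] := US 0%N.
    have z0 : 0 <= M by [].
    have zc : continuous (fun _ : R => 0 : R) by move=> x; exact: ct_cst.
    have hM (t : R) : 0 < t -> `|g (U 0%N t) - 0| <= M * expR (lam * t).
      move=> t0; rewrite subr0; apply: le_trans (gM _) _.
      by rewrite ler_peMr// E1.
    have [w10 J10] := w0 0 (lexx 0).
    have d1 (t : R) : 0 < t -> isder t (1 : R) (fun _ : R => 0 : R) (t `^ (N - 1) * 0).
      by move=> t0; rewrite mulr0; der.
    have d2 (t : R) : 0 < t -> isder t (1 : R) (fun _ : R => 1 : R) (- (t `^ (1 - N) * 0)).
      by move=> t0; rewrite mulr0 oppr0; der.
    have [_ /le_trans] := ivp_step_bound hN l0 z0 w1c c1 w2c zc w10 J10 J1d d1 v1d d2 hM s0.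
    apply; rewrite ler_wpM2r ?expR_ge0// expr0 mulr1.
    by rewrite ler_pdivrMr ?ler_peMr// (lt_le_trans _ ll).
  have D0 : 0 <= M * (1 / 2) ^+ n by nn; qlra.
  have := cmp _ _ _ _ _ D0 (US n.+1) (US n) ih s s0 => /=.
  by rewrite exprS; have -> : M * (1 / 2 * (1 / 2) ^+ n) = M * (1 / 2) ^+ n / 2 by field.
have lim (s : R) : exists l : R, forall n,
    `|U n s - l| <= 2 * (M * expR (lam * `|s|)) * (1 / 2) ^+ n.
  apply: geo_limit => n; have [s0|s0] := leP s 0.
    by rewrite !U0// subrr normr0; nn; qlra.
  by apply: le_trans (Ud n s s0) _; rewrite (gtr0_norm s0) mulrAC.
have [v Hv] := choice lim.
have vU n (s : R) : 0 < s -> `|U n s - v s| <= 2 * M * (1 / 2) ^+ n * expR (lam * s).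
  move=> s0; apply: le_trans (Hv s n) _; rewrite (gtr0_norm s0).
  by rewrite le_eqVlt; apply/orP; left; apply/eqP; ring.
have v0 (s : R) : s <= 0 -> v s = 1.
  move=> s0; apply/eqP; rewrite eq_sym -subr_eq0 -normr_le0; apply: geo_le => n.
  by rewrite add0r; have := Hv s n; rewrite U0//; apply.
have vc : continuous v.
  apply: ctAll => s; apply/ct_epsP => e e0.
  pose B := 2 * (M * expR (lam * (`|s| + 1))).
  have B0 : 0 <= B by rewrite /B; nn; qlra.
  have vB n (t : R) : `|t - s| < 1 -> `|U n t - v t| <= B * (1 / 2) ^+ n.
    move=> ts; apply: le_trans (Hv t n) _; rewrite /B.
    rewrite ler_wpM2r// ler_wpM2l// ler_wpM2l// ler_expR ler_wpM2l ?(ltW l0)//.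
    have -> : t = (t - s) + s by ring.
    by apply: le_trans (ler_normD _ _) _; qlra.
  have [n Bn] : exists n : nat, B * (1 / 2) ^+ n < e / 3.
    apply: contrapT => /forallNP H.
    have : e / 3 <= 0.
      apply: (@geo_le _ _ _ B) => n; rewrite add0r leNgt; apply/negP; exact: H.
    by qlra.
  have /ct_epsP/(_ (e / 3))[|d d0 Hd] := Uc n s; first by qlra.
  exists (Num.min d 1); first by rewrite lt_min d0 ltr01.
  move=> t; rewrite lt_min => /andP[td t1].
  have := vB n t t1; have := vB n s; rewrite subrr normr0 => /(_ ltr01).
  have := Hd t td; rewrite !ltr_norml !ler_norml => /andP[? ?] /andP[? ?] /andP[? ?].
  by apply/andP; split; qlra.
(* The limit [v] comes without a flux. One more application of the map provides [J], and its output
   agrees with [v] because both are limits of [U n.+1]. *)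
have [[v' J] HJ] := stepE (exist _ _ vc); rewrite /= in HJ.
have vE : sval v' = v.
  apply/funext => s; have [s0|s0] := leP s 0.
    by rewrite v0//; have [_ _ h _ _] := HJ; have [] := h s s0.
  apply/eqP; rewrite -subr_eq0 -normr_le0.
  apply: (@geo_le _ _ _ (2 * M * expR (lam * s) * 2)) => n; rewrite add0r.
  have D0 : 0 <= 2 * M * (1 / 2) ^+ n by nn; qlra.
  have h1 := cmp _ _ _ _ _ D0 (US n) HJ (vU n) s s0; rewrite /= in h1.
  have h2 := vU n.+1 s s0; rewrite exprS in h2.
  move: h1 h2; rewrite !ler_norml => /andP[? ?] /andP[? ?].
  by apply/andP; split; qlra.
exists v, J; move: HJ; rewrite /step /= vE => -[? ? h ? ?]; split => //.
Qed.

End ivp.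

(** * The truncated nonlinearity and its potential *)

Section nonlinearity.
Context {R : realType}.

(** [[0, 1]] is the range in which the ground state takes its values. Outside it the nonlinearity is
    replaced by constants only to become bounded and globally Lipschitz, with constants uniform for
    [mu] in [[0, 1]]. *)
Definition clamp (x : R) : R := Num.min (Num.max x 0) 1.

Definition gfun (p mu x : R) : R := clamp x `^ p - mu * clamp x.

Lemma clamp_ge0 x : 0 <= clamp x.
Proof. by rewrite /clamp le_min ler01 andbT le_max lexx orbT. Qed.

Lemma clamp_le1 x : clamp x <= 1.
Proof. by rewrite /clamp ge_min lexx orbT. Qed.

Lemma clamp_id x : 0 <= x <= 1 -> clamp x = x.
Proof. by move=> /andP[x0 x1]; rewrite /clamp (max_l x0) (min_l x1). Qed.

Lemma clamp_le0 x : x <= 0 -> clamp x = 0.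
Proof. by move=> x0; rewrite /clamp (max_r x0) min_l. Qed.

Lemma clamp_ge1 x : 1 <= x -> clamp x = 1.
Proof. by move=> x1; rewrite /clamp (max_l (le_trans ler01 x1)) min_r. Qed.

Lemma clamp_le x y : x <= y -> clamp x <= clamp y.
Proof.
move=> xy; have [x0|/ltW x0] := leP x 0; first by rewrite (clamp_le0 x0) clamp_ge0.
have [y1|/ltW y1] := leP 1 y; first by rewrite (clamp_ge1 y1) clamp_le1.
by rewrite !clamp_id// ?x0 ?(le_trans xy y1)// y1 (le_trans x0 xy).
Qed.

Lemma clamp_lip x y : `|clamp x - clamp y| <= `|x - y|.
Proof.
wlog xy : x y / x <= y.
  by move=> H; have [/H//|/ltW/H] := leP x y; rewrite distrC [leRHS]distrC.
rewrite distrC [leRHS]distrC !ger0_norm ?subr_ge0 ?clamp_le//.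
have [y0|/ltW y0] := leP y 0.
  by rewrite (clamp_le0 y0) (clamp_le0 (le_trans xy y0)); qlra.
have [x1|/ltW x1] := leP 1 x.
  by rewrite (clamp_ge1 x1) (clamp_ge1 (le_trans x1 xy)); qlra.
have [x0|/ltW x0] := leP x 0; rewrite ?(clamp_le0 x0); last rewrite (@clamp_id x) ?x0//.
  have [y1|/ltW y1] := leP 1 y; rewrite ?(clamp_ge1 y1); first by qlra.
  by rewrite clamp_id ?y0//; qlra.
have [y1|/ltW y1] := leP 1 y; rewrite ?(clamp_ge1 y1); first by qlra.
by rewrite clamp_id ?y0//; qlra.
Qed.

Lemma clamp_cont : continuous clamp.
Proof. by apply: ctAll => x; rewrite /clamp; ct. Qed.

Lemma one_powR (r : R) : 1 `^ r = 1.
Proof. by rewrite powR1. Qed.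

Lemma clampp_lip p x y : 1 < p -> `|clamp x `^ p - clamp y `^ p| <= p * `|x - y|.
Proof.
move=> p1.
have H (a b : R) : 0 <= a -> a <= b -> b <= 1 -> b `^ p - a `^ p <= p * (b - a).
  move=> a0 ab b1.
  have -> : p * (b - a) = p * b - p * a by ring.
  have -> : a `^ p = Num.max a 0 `^ p by rewrite (max_l a0).
  have -> : b `^ p = Num.max b 0 `^ p by rewrite (max_l (le_trans a0 ab)).
  apply: (@deriv_cmp _ (fun t => Num.max t 0 `^ p) (fun t => p * t `^ (p - 1))
    (fun t => p * t) (fun=> p)) => //.
  - move=> t /andP[t0 _]; have {}t0 : 0 < t by exact: le_lt_trans t0.
    apply: (@der_pos _ (fun t => t `^ p)) => //.
      by move=> u u0; rewrite max_l// ltW.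
    by eapply isder_eq; [der|ringb].
  - by move=> t _; eapply isder_eq; [der|ringb].
  - move=> t /andP[t0 t1]; rewrite ler_piMr//; first by qlra.
    have {}t0 : 0 < t by exact: le_lt_trans t0.
    rewrite -[leRHS](one_powR (p - 1)); apply: ge0_ler_powR; rewrite ?nnegrE; qlra.
  - by move=> t _; apply: powR_max_cont; qlra.
  - by move=> t _; ct.
wlog xy : x y / x <= y.
  by move=> H'; have [/H'//|/ltW/H'] := leP x y; rewrite distrC [in leRHS]distrC.
have cxy := clamp_le xy.
rewrite distrC ger0_norm; last first.
  by rewrite subr_ge0; apply: ge0_ler_powR; rewrite ?nnegrE ?clamp_ge0//; qlra.
apply: le_trans (H _ _ (clamp_ge0 _) cxy (clamp_le1 _)) _.
rewrite ler_wpM2l//; first by qlra.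
apply: le_trans (clamp_lip x y); rewrite distrC; exact: ler_norm.
Qed.

Lemma clampp01 p x : 1 < p -> 0 <= clamp x `^ p <= 1.
Proof.
move=> p1; rewrite powR_ge0/= -[leRHS](one_powR p); apply: ge0_ler_powR.
- by qlra.
- by rewrite nnegrE clamp_ge0.
- by rewrite nnegrE ler01.
- exact: clamp_le1.
Qed.

Lemma gfun_le1 p mu x : 1 < p -> 0 <= mu <= 1 -> `|gfun p mu x| <= 1.
Proof.
move=> p1 /andP[m0 m1]; have /andP[? ?] := clampp01 x p1.
have c0 := clamp_ge0 x; have c1 := clamp_le1 x.
have : 0 <= mu * clamp x by nn.
have : mu * clamp x <= 1 by apply: mulr_ile1.
by rewrite /gfun ler_norml => ? ?; apply/andP; split; qlra.
Qed.

Lemma gfun_lip p mu x y : 1 < p -> 0 <= mu <= 1 ->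
  `|gfun p mu x - gfun p mu y| <= (p + 1) * `|x - y|.
Proof.
move=> p1 /andP[m0 m1].
have -> : gfun p mu x - gfun p mu y =
  (clamp x `^ p - clamp y `^ p) - mu * (clamp x - clamp y) by rewrite /gfun; ring.
apply: le_trans (ler_normB _ _) _; rewrite mulrDl lerD ?clampp_lip// normrM mul1r.
rewrite (ger0_norm m0); apply: le_trans (clamp_lip x y).
by rewrite ler_piMl.
Qed.

Lemma gfun_dep p mu nu x : `|gfun p mu x - gfun p nu x| <= `|mu - nu|.
Proof.
have -> : gfun p mu x - gfun p nu x = (nu - mu) * clamp x by rewrite /gfun; ring.
by rewrite normrM distrC (ger0_norm (clamp_ge0 x)) ler_piMr// clamp_le1.
Qed.

Lemma gfun_cont p mu : 1 < p -> continuous (gfun p mu).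
Proof.
move=> p1; apply: ctAll => x; rewrite /gfun; apply: ctD.
  rewrite (_ : (fun t => _) = fun t => Num.max (clamp t) 0 `^ p).
    apply: (@ct_comp _ _ (fun t => Num.max t 0 `^ p)); last exact: clamp_cont.
    by apply: powR_max_cont; qlra.
  by apply/funext => t; rewrite (max_l (clamp_ge0 t)).
by apply: ctN; apply: ctM; [exact: ct_cst|exact: clamp_cont].
Qed.

Lemma gfunE p mu x : 0 <= x <= 1 -> gfun p mu x = x `^ p - mu * x.
Proof. by move=> x01; rewrite /gfun clamp_id. Qed.

Lemma gfun0 p mu : 1 < p -> gfun p mu 0 = 0.
Proof.
by move=> p1; rewrite gfunE ?lexx ?ler01// powR0 ?mulr0 ?subr0// gt_eqF//; qlra.
Qed.

Lemma powRS (x p : R) : 0 < x -> x `^ p = x * x `^ (p - 1).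
Proof. by move=> x0; rewrite mulrC powR_sub1M. Qed.

(* The two terms are kept apart so that the dependence on [mu] is explicit. *)
Lemma potential_exists (p : R) : 1 < p ->
  exists Q S : R -> R, [/\ continuous Q, continuous S,
    forall x : R, 0 <= x <= 1 -> Q x = x `^ (p + 1) / (p + 1) /\ S x = x ^+ 2 / 2 &
    forall mu x : R, 0 < x -> isder x (1 : R) (fun x => Q x - mu * S x) (gfun p mu x)].
Proof.
move=> p1.
have c1 : continuous (fun x : R => clamp x `^ p).
  have := @gfun_cont p 0 p1; rewrite (_ : gfun p 0 = (fun x => clamp x `^ p))//.
  by apply/funext => x; rewrite /gfun mul0r subr0.
have [Q [Qc Q0 Qd]] := primitive_exists c1.
have [S [Sc S0 Sd]] := primitive_exists clamp_cont.
exists Q, S; split => //.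
- move=> x /andP[x0 x1].
  have e (f h : R -> R) : continuous f -> continuous h -> f 0 = h 0 ->
      (forall t : R, 0 < t < x -> exists2 d, isder t (1 : R) f d & isder t (1 : R) h d) ->
      f x = h x.
    move=> fc hc f0 fh; move: x0; rewrite le_eqVlt => /predU1P[<-//|x0].
    have [c cx E] : exists2 c, 0 < c < x & (f x - h x) - (f 0 - h 0) = 0 * (x - 0).
      apply: (@MVT' _ (fun t => f t - h t) (fun=> 0)) => //.
      + move=> t /fh[d fd hd]; eapply isder_eq; first by apply: derB; eassumption.
        by rewrite subrr.
      + by move=> t _; apply: ctD; [exact: fc|apply: ctN; exact: hc].
    by move: E; rewrite f0; qlra.
  split.
  + have -> : x `^ (p + 1) / (p + 1) = Num.max x 0 `^ (p + 1) / (p + 1) by rewrite (max_l x0).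
    apply: (e Q (fun x => Num.max x 0 `^ (p + 1) / (p + 1))) => //.
    * apply: ctAll => t; apply: ctM; last exact: ct_cst.
      by apply: powR_max_cont; qlra.
    * by rewrite Q0// maxxx powR0 ?mul0r// gt_eqF//; qlra.
    * move=> t /andP[t0 tx]; exists (t `^ p).
        by have := Qd t t0; rewrite clamp_id//; apply/andP; split; qlra.
      apply: (@der_pos _ (fun t => t `^ (p + 1) / (p + 1))) => //.
        by move=> u u0; rewrite (max_l (ltW u0)).
      eapply isder_eq; first by der.
      rewrite (_ : p + 1 - 1 = p); last by ring.
      by field; qlra.
  + apply: (e S (fun x => x ^+ 2 / 2)) => //.
    * by apply: ctAll => t; ct.
    * by rewrite S0// expr0n/= mul0r.
    * move=> t /andP[t0 tx]; exists t.
        by have := Sd t t0; rewrite clamp_id//; apply/andP; split; qlra.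
      by eapply isder_eq; [der|cbv beta; rewrite expr1; field].
- move=> mu x x0; eapply isder_eq; first by der; [exact: Qd|exact: Sd].
  by rewrite /gfun; ringb.
Qed.

End nonlinearity.

(** * Flux comparison and energy decay *)

Section ivp_facts.
Context {R : realType}.
Implicit Types (N p mu : R) (v J : R -> R).

Definition slope (N : R) (J : R -> R) (s : R) : R := - (s `^ (1 - N) * J s).

Lemma slope_der N g v J (s : R) : ivp N g v J -> 0 < s ->
  isder s (1 : R) (slope N J) ((1 - N) / s * slope N J s - g (v s)).
Proof.
move=> [_ _ _ Jd _] s0; rewrite /slope; eapply isder_eq; first by der => //; exact: Jd.
cbv beta; have := powRVN (1 - N) s0; rewrite opprB => h.
set G := g (v s).
have GE : G = s `^ (1 - N) * s `^ (N - 1) * G by rewrite h mul1r.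
rewrite [in RHS]GE (@powRS _ s (1 - N))//; by field; rewrite gt_eqF.
Qed.

(** With a constant nonlinearity [c] the flux is exactly [c / N * s^N]; the two bounds are these
    explicit fluxes. *)
Lemma flux_between N g v J (lo hi d : R) : 1 <= N -> ivp N g v J ->
  (forall t : R, 0 < t < d -> lo <= g (v t) <= hi) ->
  forall s : R, 0 < s <= d -> lo / N * s `^ N <= J s <= hi / N * s `^ N.
Proof.
move=> hN [vc Jc vJ Jd vd] H s /andP[s0 sd].
have N0 : 0 < N by qlra.
have [_ J0] := vJ 0 (lexx 0).
have cd (c t : R) : 0 < t ->
    isder t (1 : R) (fun t => c / N * Num.max t 0 `^ N) (t `^ (N - 1) * c).
  move=> t0; apply: (@der_pos _ (fun t => c / N * t `^ N)) => //.
    by move=> u u0; rewrite (max_l (ltW u0)).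
  by eapply isder_eq; [der|cbv beta; field; rewrite gt_eqF].
have cc (c : R) : continuous (fun t : R => c / N * Num.max t 0 `^ N).
  by apply: ctAll => t; apply: ctM; [exact: ct_cst|apply: powR_max_cont; qlra].
have c0 (c : R) : c / N * Num.max 0 0 `^ N = 0.
  by rewrite maxxx powR0 ?mulr0// gt_eqF.
have cs (c : R) : c / N * Num.max s 0 `^ N = c / N * s `^ N by rewrite (max_l (ltW s0)).
apply/andP; split.
- suff : lo / N * Num.max s 0 `^ N - lo / N * Num.max 0 0 `^ N <= J s - J 0.
    by rewrite c0 cs J0 !subr0.
  apply: (@deriv_cmp _ (fun t => lo / N * Num.max t 0 `^ N) (fun t => t `^ (N - 1) * lo)
    J (fun t => t `^ (N - 1) * g (v t))); rewrite ?(ltW s0)//.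
  + by move=> t /andP[t0 _]; exact: cd.
  + by move=> t /andP[t0 _]; exact: Jd.
  + move=> t /andP[t0 ts]; rewrite ler_wpM2l ?powR_ge0//.
    have tsd : 0 < t < d by rewrite t0 (lt_le_trans ts).
    by have /andP[] := H t tsd.
  + by move=> t _; exact: cc.
  + by move=> t _; exact: Jc.
- suff : J s - J 0 <= hi / N * Num.max s 0 `^ N - hi / N * Num.max 0 0 `^ N.
    by rewrite c0 cs J0 !subr0.
  apply: (@deriv_cmp _ J (fun t => t `^ (N - 1) * g (v t))
    (fun t => hi / N * Num.max t 0 `^ N) (fun t => t `^ (N - 1) * hi)); rewrite ?(ltW s0)//.
  + by move=> t /andP[t0 _]; exact: Jd.
  + by move=> t /andP[t0 _]; exact: cd.
  + move=> t /andP[t0 ts]; rewrite ler_wpM2l ?powR_ge0//.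
    have tsd : 0 < t < d by rewrite t0 (lt_le_trans ts).
    by have /andP[] := H t tsd.
  + by move=> t _; exact: Jc.
  + by move=> t _; exact: cc.
Qed.

Lemma slope_between N g v J (lo hi d : R) : 1 <= N -> ivp N g v J ->
  (forall t : R, 0 < t < d -> lo <= g (v t) <= hi) ->
  forall s : R, 0 < s <= d -> - (hi / N * s) <= slope N J s <= - (lo / N * s).
Proof.
move=> hN iv H s sd; have /andP[s0 _] := sd.
have /andP[h1 h2] := flux_between hN iv H sd.
have e : s `^ (1 - N) * s `^ N = s.
  by rewrite -powRB_gt0// (_ : 1 - N + N = 1); [rewrite powRr1// ltW|ring].
rewrite /slope !lerN2; apply/andP; split.
- have := ler_wpM2l (powR_ge0 s (1 - N)) h2.
  by rewrite [leRHS]mulrCA e.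
- have := ler_wpM2l (powR_ge0 s (1 - N)) h1.
  by rewrite [leLHS]mulrCA e.
Qed.

Lemma slope_le N g v J : 1 <= N -> ivp N g v J -> (forall x, `|g x| <= 1) ->
  forall s : R, 0 < s -> `|slope N J s| <= s.
Proof.
move=> hN iv gM s s0.
have H (t : R) : 0 < t < s -> -1 <= g (v t) <= 1.
  by move=> _; have := gM (v t); rewrite ler_norml.
have ss : 0 < s <= s by rewrite s0 lexx.
have /andP[h1 h2] := slope_between hN iv H ss.
have h3 : 1 / N * s <= s.
  by rewrite ler_piMl ?(ltW s0)// ler_pdivrMr; qlra.
rewrite ler_norml; apply/andP; split; first by qlra.
have e : -1 / N * s = - (1 / N * s) by ring.
rewrite e in h2; qlra.
Qed.

(** Along a solution the energy has derivative [- (N - 1) / t * slope^2]. Positivity of [v] before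
    [b] enters because the potential is differentiated only at positive arguments. *)
Lemma energy_nincr N p mu v J (Q S : R -> R) (b : R) : 1 <= N ->
  ivp N (gfun p mu) v J -> continuous Q -> continuous S ->
  (forall x : R, 0 < x -> isder x (1 : R) (fun x => Q x - mu * S x) (gfun p mu x)) ->
  (forall t : R, 0 < t < b -> 0 < v t) ->
  forall s : R, 0 < s <= b ->
  slope N J b ^+ 2 / 2 + (Q (v b) - mu * S (v b)) <=
  slope N J s ^+ 2 / 2 + (Q (v s) - mu * S (v s)).
Proof.
move=> hN iv Qc Sc Gd vpos s /andP[s0 sb].
have [vc Jc vJ Jd vd] := iv.
pose E t := slope N J t ^+ 2 / 2 + (Q (v t) - mu * S (v t)).
suff : - E s <= - E b by rewrite lerN2.
apply: (@deriv_ge0_le _ (fun t => - E t) (fun t => - ((1 - N) / t * slope N J t ^+ 2))) => //.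
- move=> t /andP[st tb]; have t0 : 0 < t by exact: lt_trans st.
  rewrite /E; eapply isder_eq.
    apply: derN; apply: derD; first by der; exact: slope_der iv t0.
    apply: (@der_comp _ (fun x => Q x - mu * S x)); last exact: vd.
    by apply: Gd; apply: vpos; rewrite t0 tb.
  cbv beta; rewrite -/(slope N J t) expr1.
  set w := slope N J t; by field; rewrite gt_eqF.
- move=> t /andP[st tb]; have t0 : 0 < t by exact: lt_trans st.
  have : 0 <= (N - 1) / t * slope N J t ^+ 2.
    by apply: mulr_ge0; [apply: divr_ge0; [qlra|exact: ltW]|exact: sqr_ge0].
  by qlra.
- move=> t /andP[st _]; have t0 : 0 < t by exact: lt_le_trans st.
  rewrite /E; ct.
  + exact: der_cont (slope_der iv t0).
  + by apply: ct_comp; [exact: Qc|exact: vc].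
  + by apply: ct_comp; [exact: Sc|exact: vc].
Qed.

(** Monotonicity is extended to the origin by comparison with a small radius [s]: there
    [|slope| <= s] and the potential is close to its value at [v 0 = 1], so an excess [2 e] of the
    energy at [b] is impossible. *)
Lemma energy_le0 N p mu v J (Q S : R -> R) (b : R) : 1 <= N -> 1 < p -> 0 <= mu <= 1 ->
  ivp N (gfun p mu) v J -> continuous Q -> continuous S ->
  (forall x : R, 0 < x -> isder x (1 : R) (fun x => Q x - mu * S x) (gfun p mu x)) ->
  (forall t : R, 0 < t < b -> 0 < v t) -> 0 < b ->
  slope N J b ^+ 2 / 2 + (Q (v b) - mu * S (v b)) <= Q 1 - mu * S 1.
Proof.
move=> hN p1 mu01 iv Qc Sc Gd vpos b0.
have [vc Jc vJ Jd vd] := iv.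
have [v00 _] := vJ 0 (lexx 0).
rewrite leNgt; apply/negP => h.
set E := (X in _ < X) in h.
pose e := (E - (Q 1 - mu * S 1)) / 2.
have e0 : 0 < e by rewrite /e; qlra.
have gc : {for 0, continuous (fun t : R => Q (v t) - mu * S (v t))}.
  by ct; apply: ct_comp; [exact: Qc|exact: vc|exact: Sc|exact: vc].
have /ct_epsP/(_ e e0)[d d0 Hd] := gc.
pose s := Num.min (Num.min (d / 2) b) (Num.min 1 e).
have s0 : 0 < s by rewrite /s !lt_min b0 ltr01 e0 divr_gt0.
have sd : s <= d / 2 by rewrite /s !ge_min lexx.
have sb : s <= b by rewrite /s !ge_min lexx orbT.
have s1 : s <= 1 by rewrite /s !ge_min lexx !orbT.
have se : s <= e by rewrite /s !ge_min lexx !orbT.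
have sb' : 0 < s <= b by rewrite s0 sb.
have := energy_nincr hN iv Qc Sc Gd vpos sb'; rewrite -/E.
have := slope_le hN iv (fun x => gfun_le1 x p1 mu01) s0.
move=> h2 h3.
have h1 : `|Q (v s) - mu * S (v s) - (Q 1 - mu * S 1)| < e.
  by rewrite -v00; apply: Hd; rewrite subr0 gtr0_norm//; qlra.
have : slope N J s ^+ 2 <= s * 1.
  rewrite -(ger0_norm (sqr_ge0 (slope N J s))) normrX expr2; apply: ler_pM => //; exact: le_trans h2 s1.
move: h1; rewrite ltr_norml => /andP[_]; rewrite /e in se *; qlra.
Qed.

(** Above 1 the truncated nonlinearity is the constant [1 - mu > 0], so the potential increases
    strictly there, and a value [v b > 1] would exceed the initial energy. *)
Lemma ivp_le1 N p mu v J (b : R) : 1 <= N -> 1 < p -> 0 <= mu < 1 ->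
  ivp N (gfun p mu) v J -> (forall t : R, 0 < t < b -> 0 < v t) -> 0 < b -> v b <= 1.
Proof.
move=> hN p1 /andP[mu0 mu1] iv vpos b0.
have mu01 : 0 <= mu <= 1 by rewrite mu0 ltW.
have [Q [S [Qc Sc _ Gd]]] := potential_exists p1.
have h := energy_le0 hN p1 mu01 iv Qc Sc (Gd mu) vpos b0.
rewrite leNgt; apply/negP => vb.
have : Q 1 - mu * S 1 < Q (v b) - mu * S (v b).
  apply: (@deriv_gt0_lt _ (fun x => Q x - mu * S x) (gfun p mu)) => //.
  - by move=> x /andP[x1 _]; apply: Gd; qlra.
  - by move=> x /andP[x1 _]; rewrite /gfun clamp_ge1 ?(ltW x1)// powR1; qlra.
  - by move=> x _; ct; [exact: Qc|exact: Sc].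
have := sqr_ge0 (slope N J b); qlra.
Qed.

Lemma first_zero (f : R -> R) (a s : R) : continuous f -> a < s ->
  (forall t : R, t <= a -> 0 < f t) -> f s <= 0 ->
  exists2 z, a < z <= s & f z = 0 /\ forall t : R, t < z -> 0 < f t.
Proof.
move=> fc as_ fa fs.
pose A := [set t : R | f t <= 0].
have As : A s by [].
have Ab : lbound A a.
  by move=> t At; rewrite leNgt; apply/negP => /ltW/fa; rewrite ltNge At.
have Ai : has_inf A by split; [exists s|exists a].
pose z := inf A.
have za : a <= z by apply: lb_le_inf => //; exists s.
have zs : z <= s by apply: inf_lbound => //; exists a.
have ltz (t : R) : t < z -> 0 < f t.
  move=> tz; rewrite ltNge; apply/negP => At.
  have : z <= t by apply: inf_lbound => //; exists a.
  by rewrite leNgt tz.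
have fz : f z = 0.
  apply/eqP; rewrite eq_le; apply/andP; split; rewrite leNgt; apply/negP => h.
  - have /ct_epsP/(_ (f z) h)[d d0 Hd] := fc z.
    have [t At tz] := inf_adherent d0 Ai; rewrite -/z in tz.
    have zt : z <= t by apply: inf_lbound => //; exists a.
    have : `|f t - f z| < f z by apply: Hd; rewrite ger0_norm ?subr_ge0//; qlra.
    by rewrite ltr_norml => /andP[h1 _]; rewrite /A/= in At; qlra.
  - have /ct_epsP/(_ (- f z))[|d d0 Hd] := fc z; first by qlra.
    have : `|f (z - d / 2) - f z| < - f z.
      apply: Hd; rewrite (_ : z - d / 2 - z = - (d / 2)); last by ring.
      by rewrite normrN gtr0_norm; qlra.
    by rewrite ltr_norml => /andP[_ h1]; have := ltz (z - d / 2); qlra.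
exists z => //; rewrite zs andbT lt_neqAle za andbT.
by apply/eqP => az; have := fa z; rewrite fz -az lexx => /(_ isT); rewrite ltxx.
Qed.

End ivp_facts.

(** * The case [mu = 0]: crossing zero by Pohozaev's identity *)

Section lane_emden.
Context {R : realType}.
Implicit Types (N p : R) (v J : R -> R).

Lemma small_le (x C : R) (d : R) : 0 < d -> (forall a : R, 0 < a < d -> x <= C * a) -> x <= 0.
Proof.
move=> d0 H; rewrite leNgt; apply/negP => x0.
have C1 : 0 < `|C| + 1 by have := normr_ge0 C; qlra.
pose a := Num.min (d / 2) (x / (2 * (`|C| + 1))).
have a0 : 0 < a by rewrite lt_min divr_gt0//= divr_gt0// mulr_gt0.
have ad : a < d by apply: le_lt_trans (_ : d / 2 < d); [rewrite /a ge_min lexx|qlra].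
have ax : a * (2 * (`|C| + 1)) <= x.
  by rewrite -ler_pdivlMr ?mulr_gt0// /a ge_min lexx orbT.
have := H a; rewrite a0 ad => /(_ isT).
have : C * a <= `|C| * a by rewrite ler_wpM2r ?(ltW a0)// ler_norm.
have : 0 <= `|C| * a by rewrite mulr_ge0// ltW.
qlra.
Qed.

Lemma powR_unbounded (C c eta : R) : 0 < eta -> 0 < c ->
  (forall s : R, 1 <= s -> c * s `^ eta <= C) -> False.
Proof.
move=> eta0 c0 H.
have C0 : 0 <= C by have := H 1 (lexx 1); rewrite one_powR; qlra.
have B0 : 0 < C / c + 1 by have := divr_ge0 C0 (ltW c0); qlra.
have B1 : 1 <= C / c + 1 by have := divr_ge0 C0 (ltW c0); qlra.
have := H ((C / c + 1) `^ eta^-1).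
rewrite -powRrM mulVf ?gt_eqF// powRr1 ?(ltW B0)// => /(_ _)/wrap[].
  rewrite -[leLHS](one_powR (eta^-1)); apply: ge0_ler_powR => //.
  - by rewrite invr_ge0 ltW.
  - by rewrite nnegrE ler01.
  - by rewrite nnegrE ltW.
rewrite mulrDr mulr1 mulrCA divff ?gt_eqF// mulr1; qlra.
Qed.

(** If [v] stays nonnegative, it is positive and decreasing, and the equation alone gives
    [v^2 = O(s^(-4/(p-1)))]. Pohozaev's function [P] is positive and increasing, yet at most of
    order [s^(N-2) v^2]. Subcriticality enters twice, for the growth of [P] and for the sign of the
    exponent [N - 2 - 4/(p-1)]; both amount to the same inequality [N (p - 1) < 2 (p + 1)]. *)
Lemma lane_emden_crosses N p v J : 1 <= N -> 1 < p -> N * (p - 1) < 2 * (p + 1) ->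
  ivp N (gfun p 0) v J -> exists2 s : R, 0 < s & v s < 0.
Proof.
move=> hN p1 sub iv; apply: contrapT => H.
have [vc Jc vJ Jd vd] := iv.
have N0 : 0 < N by qlra.
have v0 (s : R) : 0 <= v s.
  have [s0|s0] := leP s 0; first by have [-> _] := vJ s s0.
  by rewrite leNgt; apply/negP => vs; apply: H; exists s.
have g0 (x : R) : 0 <= gfun p 0 x by rewrite /gfun mul0r subr0 powR_ge0.
have [v00 J00] := vJ 0 (lexx 0).
have Jge0 (s : R) : 0 <= J s.
  have [s0|s0] := leP s 0; first by have [_ ->] := vJ s s0.
  rewrite -J00; apply: (@deriv_ge0_le _ J (fun t => t `^ (N - 1) * gfun p 0 (v t))); first exact: ltW.
  - by move=> t /andP[t0 _]; exact: Jd.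
  - by move=> t _; rewrite mulr_ge0 ?powR_ge0.
  - by move=> t _; exact: Jc.
have Jmono (a b : R) : 0 <= a -> a <= b -> J a <= J b.
  move=> a0 ab; apply: (@deriv_ge0_le _ J (fun t => t `^ (N - 1) * gfun p 0 (v t))) => //.
  - by move=> t /andP[t0 _]; apply: Jd; exact: le_lt_trans t0.
  - by move=> t _; rewrite mulr_ge0 ?powR_ge0.
  - by move=> t _; exact: Jc.
have vdec (a b : R) : 0 <= a -> a <= b -> v b <= v a.
  move=> a0 ab; rewrite -lerN2.
  apply: (@deriv_ge0_le _ (fun t => - v t) (fun t => t `^ (1 - N) * J t)) => //.
  - move=> t /andP[t0 _]; eapply isder_eq; first by apply: derN; apply: vd; exact: le_lt_trans t0.
    by rewrite opprK.
  - by move=> t _; rewrite mulr_ge0 ?powR_ge0.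
  - by move=> t _; apply: ctN; exact: vc.
have v1 (s : R) : 0 <= s -> v s <= 1 by move=> s0; rewrite -v00; apply: vdec.
have gE (s : R) : 0 <= s -> gfun p 0 (v s) = v s `^ p.
  by move=> s0; rewrite gfunE ?mul0r ?subr0// v0 v1.
(* the flux dominates its value for the frozen nonlinearity, v being decreasing *)
have slopeb (s : R) : 0 < s -> slope N J s <= - (v s `^ p / N * s).
  move=> s0; have ss : 0 < s <= s by rewrite s0 lexx.
  have hb (t : R) : 0 < t < s -> v s `^ p <= gfun p 0 (v t) <= 1.
    move=> /andP[t0 ts]; rewrite gE ?(ltW t0)//; apply/andP; split.
      apply: ge0_ler_powR; rewrite ?nnegrE//; first by qlra.
      by apply: vdec; exact: ltW.
    rewrite -[leRHS](one_powR p); apply: ge0_ler_powR; rewrite ?nnegrE//; first by qlra.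
    by apply: v1; exact: ltW.
  by have /andP[] := slope_between hN iv hb ss.
(* If [v] first vanished at [z], the flux would already be positive at [z / 2] and, being
   nondecreasing, would push [v] below 0 after [z]. *)
have vpos (s : R) : 0 <= s -> 0 < v s.
  move=> s0; rewrite lt_neqAle v0 andbT; apply/eqP => vs.
  have [z zs [vz zl]] : exists2 z, 0 < z <= s & v z = 0 /\ forall t : R, t < z -> 0 < v t.
    have s0' : 0 < s.
      rewrite lt_neqAle s0 andbT; apply/eqP => s00; move: vs v00; rewrite -s00 => <- /eqP.
      by rewrite eq_sym oner_eq0.
    apply: first_zero => //; last by rewrite -vs.
    by move=> t t0; have [-> _] := vJ t t0.
  have /andP[z0 _] := zs.
  have z2 : 0 < z / 2 by qlra.
  have Jz : 0 < J (z / 2).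
    have := slopeb (z / 2) z2; rewrite /slope lerN2 => h.
    have h1 : 0 < v (z / 2) `^ p / N * (z / 2).
      by rewrite mulr_gt0// divr_gt0// powR_gt0// zl; qlra.
    have := lt_le_trans h1 h; rewrite pmulr_rgt0//; exact: powR_gt0.
  have : v (2 * z) < v z.
    rewrite -ltrN2; apply: (@deriv_gt0_lt _ (fun t => - v t) (fun t => t `^ (1 - N) * J t)).
    - by qlra.
    - move=> t /andP[t0 _]; eapply isder_eq; first by apply: derN; apply: vd; qlra.
      by rewrite opprK.
    - move=> t /andP[t0 _]; rewrite mulr_gt0 ?powR_gt0//; first by qlra.
      by apply: lt_le_trans Jz _; apply: Jmono; qlra.
    - by move=> t _; apply: ctN; exact: vc.
  by rewrite vz; have := v0 (2 * z); qlra.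
have vpd (s : R) : 0 < s -> isder s (1 : R) v (slope N J s) by exact: vd.
pose K := 2 * N / (p - 1).
have K0 : 0 < K by rewrite /K divr_gt0//; qlra.
(* Dividing [v' <= - v^p s / N] by [v^p] and integrating gives [v^(1-p) >= (p - 1) s^2 / (2 N)],
   whence the constant [K]. *)
have vK (s : R) : 0 < s -> v s `^ (p - 1) <= K / s ^+ 2.
  move=> s0.
  have : (p - 1) / (2 * N) * s ^+ 2 - (p - 1) / (2 * N) * 0 ^+ 2 <= v s `^ (1 - p) - v 0 `^ (1 - p).
    apply: (@deriv_cmp _ (fun t => (p - 1) / (2 * N) * t ^+ 2) (fun t => (p - 1) / N * t)
      (fun t => v t `^ (1 - p)) (fun t => (1 - p) * v t `^ (1 - p - 1) * slope N J t)).
    - exact: ltW.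
    - by move=> t _; eapply isder_eq; [der|cbv beta; rewrite expr1; field; rewrite gt_eqF].
    - move=> t /andP[t0 _]; eapply isder_eq; first by der; [apply: vpos; exact: ltW|exact: vpd].
      by [].
    - move=> t /andP[t0 _].
      have h := slopeb t t0.
      have vt := vpos t (ltW t0).
      have h2 : 0 <= (p - 1) * v t `^ (1 - p - 1) by rewrite mulr_ge0 ?powR_ge0//; qlra.
      have := ler_wpM2l h2 h.
      have e : v t `^ (1 - p - 1) * v t `^ p = 1.
        by rewrite -powRB_gt0// (_ : 1 - p - 1 + p = 0); [rewrite powRr0|ring].
      have -> : (p - 1) * v t `^ (1 - p - 1) * - (v t `^ p / N * t) =
        - ((v t `^ (1 - p - 1) * v t `^ p) * ((p - 1) / N * t)) by ring.
      by rewrite e; qlra.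
    - by move=> t _; ct.
    - by move=> t /andP[t0 _]; ct; [exact: vpos|exact: vc].
  rewrite expr0n/= mulr0 subr0 v00 one_powR => h.
  have h1 : (p - 1) / (2 * N) * s ^+ 2 <= v s `^ (1 - p) by qlra.
  have e : v s `^ (p - 1) * v s `^ (1 - p) = 1.
    by have := powRVN (p - 1) (vpos s (ltW s0)); rewrite opprB.
  rewrite ler_pdivlMr ?exprn_gt0//.
  have := ler_wpM2l (powR_ge0 (v s) (p - 1)) h1; rewrite e => h2.
  rewrite /K ler_pdivlMr; last by qlra.
  have N2 : 0 <= 2 * N by qlra.
  have := ler_wpM2l N2 h2.
  by rewrite (_ : 2 * N * _ = v s `^ (p - 1) * s ^+ 2 * (p - 1)); [qlra|field; rewrite gt_eqF].
(* Mean value theorem on [[s, 2 s]]: the flux being nondecreasing, the size of the slope drops at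
   most by the factor [2^(N-1)] there, while the total decrease of [v] is at most [v s]. *)
have wv (s : R) : 0 < s -> s * `|slope N J s| <= 2 `^ (N - 1) * v s.
  move=> s0.
  have [c /andP[sc cs] E] : exists2 c, s < c < 2 * s & v (2 * s) - v s = slope N J c * (2 * s - s).
    apply: (@MVT' _ v (slope N J)); first by qlra.
      by move=> t /andP[t0 _]; apply: vpd; qlra.
    by move=> t _; exact: vc.
  have c0 : 0 < c by qlra.
  have h1 : (2 * s) `^ (1 - N) * J s <= c `^ (1 - N) * J c.
    apply: ler_pM; rewrite ?powR_ge0//; last by apply: Jmono; qlra.
    have hh (x : R) : 0 < x -> x `^ (1 - N) = (x `^ (N - 1))^-1.
      by move=> x0; rewrite -powRN opprB.
    rewrite !hh//; last by qlra.
    rewrite lef_pV2 ?posrE ?powR_gt0//; last by qlra.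
    by apply: ge0_ler_powR; rewrite ?nnegrE; qlra.
  have h2 : c `^ (1 - N) * J c * s <= v s.
    by have := v0 (2 * s); move: E; rewrite /slope; qlra.
  rewrite /slope normrN ger0_norm ?mulr_ge0 ?powR_ge0//.
  have e : 2 `^ (N - 1) * (2 * s) `^ (1 - N) = s `^ (1 - N).
    rewrite powRM ?(ltW s0)// mulrA -powRB_gt0// (_ : N - 1 + (1 - N) = 0); last by ring.
    by rewrite powRr0 mul1r.
  have := ler_wpM2l (powR_ge0 2 (N - 1)) (le_trans (ler_wpM2r (ltW s0) h1) h2).
  by rewrite [leLHS](_ : _ = s * (2 `^ (N - 1) * (2 * s) `^ (1 - N) * J s)); [rewrite e|ring].
(* Pohozaev's function, increasing by subcriticality *)
pose gam := N / (p + 1) - (N - 2) / 2.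
have gam0 : 0 < gam.
  rewrite /gam subr_gt0 ltr_pdivlMr; last by qlra.
  rewrite mulrAC ltr_pdivrMr//; qlra.
pose P s := s `^ N * (slope N J s ^+ 2 / 2 + v s `^ (p + 1) / (p + 1)) +
  (N - 2) / 2 * (s `^ (N - 1) * (v s * slope N J s)).
have Pd (s : R) : 0 < s -> isder s (1 : R) P (gam * (s `^ (N - 1) * v s `^ (p + 1))).
  move=> s0; rewrite /P; have vs := vpos s (ltW s0).
  have wd := slope_der iv s0; rewrite gE ?(ltW s0)// in wd.
  eapply isder_eq; first by der => //; first [exact: wd|exact: vpd].
  cbv beta; rewrite (_ : p + 1 - 1 = p); last by ring.
  rewrite (_ : v s `^ (p + 1) = v s * v s `^ p); last first.
    by rewrite (@powRS _ (v s) (p + 1))// (_ : p + 1 - 1 = p)//; ring.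
  rewrite (@powRS _ s N)// (@powRS _ s (N - 1))// /gam expr1.
  by field; qlra.
have Pmono (a b : R) : 0 < a -> a <= b -> P a <= P b.
  move=> a0 ab; apply: (@deriv_ge0_le _ P (fun s => gam * (s `^ (N - 1) * v s `^ (p + 1)))) => //.
  - by move=> t /andP[t0 _]; apply: Pd; exact: lt_trans t0.
  - by move=> t _; rewrite !mulr_ge0 ?powR_ge0// ltW.
  - by move=> t /andP[t0 _]; exact: der_cont (Pd t (lt_le_trans a0 t0)).
have wle (s : R) : 0 < s -> `|slope N J s| <= s.
  by apply: (slope_le hN iv) => x; apply: gfun_le1 => //; rewrite lexx ler01.
(* Near 0 the negative part of [P a] is at most [|N - 2| / 2 * a], and monotonicity carries the
   limit of this bound to every [s]. *)
have P0 (s : R) : 0 < s -> 0 <= P s.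
  move=> s0; rewrite -oppr_le0; apply: (@small_le _ (`|N - 2| / 2) (Num.min s 1)).
    by rewrite lt_min s0 ltr01.
  move=> a /andP[a0]; rewrite lt_min => /andP[as_ a1].
  apply: (@le_trans _ _ (- P a)); first by rewrite lerN2 Pmono// ltW.
  rewrite /P opprD.
  have h1 : 0 <= a `^ N * (slope N J a ^+ 2 / 2 + v a `^ (p + 1) / (p + 1)).
    rewrite mulr_ge0 ?powR_ge0// addr_ge0//; first by rewrite divr_ge0 ?sqr_ge0.
    by rewrite divr_ge0 ?powR_ge0//; qlra.
  have h2 : - ((N - 2) / 2 * (a `^ (N - 1) * (v a * slope N J a))) <= `|N - 2| / 2 * a.
    apply: le_trans (ler_norm _) _; rewrite normrN normrM normrM normfV (ger0_norm (ler0n _ 2)).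
    rewrite ler_wpM2l ?divr_ge0// normrM ger0_norm ?powR_ge0//.
    apply: (@le_trans _ _ (1 * (1 * a))); last by rewrite !mul1r.
    apply: ler_pM; rewrite ?powR_ge0//.
      rewrite -[leRHS](one_powR (N - 1)); apply: ge0_ler_powR; rewrite ?nnegrE; qlra.
    rewrite normrM; apply: ler_pM => //; last exact: wle.
    by rewrite ger0_norm ?v0// v1// ltW.
  by move: h1 h2; qlra.
have P1 : 0 < P 1.
  have := P0 (1 / 2); have -> : 0 < 1 / 2 :> R by qlra.
  move=> /(_ isT) h; apply: le_lt_trans h _.
  apply: (@deriv_gt0_lt _ P (fun s => gam * (s `^ (N - 1) * v s `^ (p + 1)))); first by qlra.
  - by move=> t /andP[t0 _]; apply: Pd; qlra.
  - by move=> t /andP[t0 _]; rewrite !mulr_gt0 ?powR_gt0 ?vpos//; qlra.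
  - by move=> t /andP[t0 _]; apply: der_cont; apply: Pd; qlra.
(* the decay rates of [v] and of its slope force [P] to tend to 0 *)
pose B := 2 `^ (N - 1).
have B0 : 0 <= B by exact: powR_ge0.
pose C1 := B ^+ 2 / 2 + K / (p + 1) + `|N - 2| / 2 * B.
have C10 : 0 <= C1.
  have k1 : 0 <= B ^+ 2 / 2 by rewrite divr_ge0 ?sqr_ge0.
  have k2 : 0 <= K / (p + 1) by rewrite divr_ge0; qlra.
  have k3 : 0 <= `|N - 2| / 2 * B by rewrite mulr_ge0 ?divr_ge0.
  by rewrite /C1; qlra.
have Pub (s : R) : 0 < s -> P s <= C1 * (s `^ (N - 2) * v s ^+ 2).
  move=> s0; have vs := vpos s (ltW s0).
  have w1 : `|slope N J s| <= B * v s / s.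
    by rewrite ler_pdivlMr// mulrC; exact: wv.
  have e1 : s `^ N = s `^ (N - 2) * s ^+ 2.
    rewrite -(@powR_mulrn _ s 2) ?(ltW s0)// -powRB_gt0//.
    by congr (_ `^ _); ring.
  have e2 : s `^ (N - 1) = s `^ (N - 2) * s.
    by rewrite -[X in _ = _ * X]powRr1 ?(ltW s0)// -powRB_gt0//; congr (_ `^ _); ring.
  have t1 : s `^ N * (slope N J s ^+ 2 / 2) <= B ^+ 2 / 2 * (s `^ (N - 2) * v s ^+ 2).
    have : slope N J s ^+ 2 <= (B * v s / s) ^+ 2.
      rewrite -(ger0_norm (sqr_ge0 (slope N J s))) normrX.
      by rewrite lerXn2r ?nnegrE// divr_ge0 ?mulr_ge0// ltW.
    move=> h; have := ler_wpM2l (powR_ge0 s N) h.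
    have -> : s `^ N * (B * v s / s) ^+ 2 = B ^+ 2 * (s `^ (N - 2) * v s ^+ 2).
      by rewrite e1; field; rewrite gt_eqF.
    qlra.
  have t2 : s `^ N * (v s `^ (p + 1) / (p + 1)) <= K / (p + 1) * (s `^ (N - 2) * v s ^+ 2).
    have e3 : v s `^ (p + 1) = v s `^ (p - 1) * v s ^+ 2.
      rewrite -(@powR_mulrn _ (v s) 2) ?(ltW vs)// -powRB_gt0//.
      by congr (_ `^ _); ring.
    have h0 : 0 <= s `^ N * (v s ^+ 2 / (p + 1)).
      by rewrite mulr_ge0 ?powR_ge0// divr_ge0 ?sqr_ge0//; qlra.
    have := ler_wpM2r h0 (vK s s0).
    have -> : K / s ^+ 2 * (s `^ N * (v s ^+ 2 / (p + 1))) = K / (p + 1) * (s `^ (N - 2) * v s ^+ 2).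
      by rewrite e1; field; qlra.
    by rewrite e3; qlra.
  have t3 : (N - 2) / 2 * (s `^ (N - 1) * (v s * slope N J s)) <=
      `|N - 2| / 2 * B * (s `^ (N - 2) * v s ^+ 2).
    apply: le_trans (ler_norm _) _; rewrite normrM normrM normfV (ger0_norm (ler0n _ 2)).
    rewrite -[leRHS]mulrA ler_wpM2l ?divr_ge0// normrM ger0_norm ?powR_ge0//.
    rewrite normrM (gtr0_norm vs) e2.
    have := ler_wpM2l (mulr_ge0 (mulr_ge0 (powR_ge0 s (N - 2)) (ltW s0)) (ltW vs)) w1.
    have -> : s `^ (N - 2) * s * v s * (B * v s / s) = B * (s `^ (N - 2) * v s ^+ 2).
      by field; rewrite gt_eqF.
    by rewrite -!mulrA.
  by rewrite /P /C1; qlra.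
pose q := 2 / (p - 1).
pose C2 := K `^ q.
have vq (s : R) : 0 < s -> v s ^+ 2 <= C2 * s `^ (- (2 * q)).
  move=> s0; have vs := vpos s (ltW s0).
  have q0 : 0 <= q by rewrite /q divr_ge0//; qlra.
  have -> : v s ^+ 2 = (v s `^ (p - 1)) `^ q.
    rewrite -powRrM -(@powR_mulrn _ (v s) 2) ?(ltW vs)//.
    by congr (_ `^ _); rewrite /q; field; qlra.
  have -> : C2 * s `^ (- (2 * q)) = (K / s ^+ 2) `^ q.
    rewrite powRM ?(ltW K0) ?invr_ge0 ?sqr_ge0// /C2; congr (_ * _).
    rewrite powRN powRrM -(@powR_mulrn _ s 2) ?(ltW s0)//.
    have pi (x : R) : 0 < x -> (x `^ q)^-1 = x^-1 `^ q.
      by move=> x0; rewrite -powRN -mulN1r powRrM powR_inv1 ?(ltW x0).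
    by rewrite pi// powR_gt0.
  apply: ge0_ler_powR; rewrite ?nnegrE ?powR_ge0//; last exact: vK.
  by rewrite divr_ge0 ?sqr_ge0// ltW.
apply: (@powR_unbounded (C1 * C2) (P 1) (2 * q - (N - 2))) => //.
- rewrite /q subr_gt0 mulrA ltr_pdivlMr; qlra.
- move=> s s1; have s0 : 0 < s by qlra.
  have h1 := Pmono 1 s ltr01 s1.
  have h2 := Pub s s0.
  have h3 : C1 * (s `^ (N - 2) * v s ^+ 2) <= C1 * (s `^ (N - 2) * (C2 * s `^ (- (2 * q)))).
    by rewrite ler_wpM2l// ler_wpM2l ?powR_ge0// vq.
  have h4 := le_trans h1 (le_trans h2 h3).
  have e : s `^ (N - 2) * s `^ (- (2 * q)) * s `^ (2 * q - (N - 2)) = 1.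
    rewrite -!powRB_gt0// (_ : N - 2 + - (2 * q) + (2 * q - (N - 2)) = 0); last by ring.
    by rewrite powRr0.
  have := ler_wpM2r (powR_ge0 s (2 * q - (N - 2))) h4.
  have -> : C1 * (s `^ (N - 2) * (C2 * s `^ (- (2 * q)))) * s `^ (2 * q - (N - 2)) =
    C1 * C2 * (s `^ (N - 2) * s `^ (- (2 * q)) * s `^ (2 * q - (N - 2))) by ring.
  by rewrite e mulr1.
Qed.

End lane_emden.

(** * The critical parameter and the exponentially decaying ground state *)

Section ground_state.
Context {R : realType}.
Implicit Types (N p mu : R) (v J : R -> R).

Lemma isder_unique (f : R -> R) (x a b : R) :
  isder x (1 : R) f a -> isder x (1 : R) f b -> a = b.
Proof. by move=> [_ <-] [_ <-]. Qed.

(** A zero of [v] is an interior minimum, so the slope vanishes there too, and backward uniqueness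
    would make [v] vanish at a radius [a] where it still exceeds [1/2]. The constant [C] absorbs the
    damping coefficient, at most [(N - 1) / a] on [[a, s]], and the Lipschitz constant [p + 1]. *)
Lemma nonneg_ivp_pos N p mu v J : 1 <= N -> 1 < p -> 0 <= mu <= 1 ->
  ivp N (gfun p mu) v J -> (forall s, 0 <= v s) -> forall s, 0 < v s.
Proof.
move=> hN p1 mu01 iv v0 s; have [vc Jc vJ Jd vd] := iv.
rewrite lt_neqAle v0 andbT; apply/eqP => /esym vs.
have s0 : 0 < s.
  by rewrite ltNge; apply/negP => /vJ[]; rewrite vs => /esym/eqP; rewrite oner_eq0.
have ws : slope N J s = 0.
  apply: (@isder_unique v s); first exact: vd.
  apply: (@derive1_at_min R v 0 (2 * s)); first by qlra.
  - by move=> t; rewrite in_itv/= => /andP[t0 _]; have [] := vd t t0.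
  - by rewrite in_itv/=; apply/andP; split; qlra.
  - by move=> t _; rewrite vs.
have [v00 _] := vJ 0 (lexx 0).
have /ct_epsP/(_ (1 / 2))[|d d0 Hd] := vc 0; first by qlra.
pose a := Num.min (d / 2) (s / 2).
have a0 : 0 < a by rewrite lt_min !divr_gt0.
have ad : a <= d / 2 by rewrite /a ge_min lexx.
have as_ : a <= s / 2 by rewrite /a ge_min lexx orbT.
have va : 0 < v a.
  have : `|v a - v 0| < 1 / 2 by apply: Hd; rewrite subr0 gtr0_norm//; qlra.
  by rewrite v00 ltr_norml => /andP[? _]; qlra.
(* Gronwall, backwards from s *)
pose C := 1 + 2 * (N - 1) / a + (p + 1).
pose Y t := expR (C * t) * (v t ^+ 2 + slope N J t ^+ 2).
have : Y a <= Y s.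
  apply: (@deriv_ge0_le _ Y (fun t => expR (C * t) * (2 * v t * slope N J t +
     2 * slope N J t * ((1 - N) / t * slope N J t - gfun p mu (v t)) +
     C * (v t ^+ 2 + slope N J t ^+ 2)))); first by qlra.
  - move=> t /andP[ta _]; have t0 : 0 < t by qlra.
    rewrite /Y; eapply isder_eq.
      by der; [exact: vd|exact: slope_der iv t0].
    by cbv beta; rewrite -/(slope N J t) !expr1; ring.
  - move=> t /andP[ta _]; have t0 : 0 < t by qlra.
    rewrite mulr_ge0 ?expR_ge0//; set w := slope N J t; set u := v t.
    have gu : `|gfun p mu u| <= (p + 1) * `|u|.
      by have := gfun_lip u 0 p1 mu01; rewrite gfun0// !subr0.
    have q1 : 2 * `|u| * `|w| <= u ^+ 2 + w ^+ 2.
      have := sqr_ge0 (`|u| - `|w|).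
      rewrite sqrrB -!normrX !(ger0_norm (sqr_ge0 _)) -mulr_natl; qlra.
    have uw : - (`|u| * `|w|) <= u * w by rewrite -normrM lerNl -normrN ler_norm.
    have gw : w * gfun p mu u <= (p + 1) * (`|u| * `|w|).
      apply: le_trans (ler_norm _) _; rewrite normrM mulrC mulrA.
      by rewrite ler_wpM2r.
    have nw : (N - 1) / t * w ^+ 2 <= (N - 1) / a * w ^+ 2.
      rewrite ler_wpM2r ?sqr_ge0// ler_wpM2l; [by []|by qlra|].
      by rewrite lef_pV2 ?posrE// ltW.
    have na : 0 <= (N - 1) / a * u ^+ 2.
      by rewrite mulr_ge0 ?sqr_ge0// divr_ge0 ?(ltW a0)//; qlra.
    set X := `|u| * `|w| in uw gw.
    have {}q1 : 2 * X <= u ^+ 2 + w ^+ 2 by rewrite /X mulrA.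
    have pq : (p + 1) * X <= (p + 1) * (u ^+ 2 + w ^+ 2) / 2.
      by rewrite -mulrA ler_wpM2l//; qlra.
    have -> : 2 * u * w + 2 * w * ((1 - N) / t * w - gfun p mu u) + C * (u ^+ 2 + w ^+ 2) =
      2 * (u * w) - 2 * ((N - 1) / t * w ^+ 2) - 2 * (w * gfun p mu u) + (u ^+ 2 + w ^+ 2) +
      2 * ((N - 1) / a * u ^+ 2) + 2 * ((N - 1) / a * w ^+ 2) +
      (p + 1) * (u ^+ 2 + w ^+ 2) by rewrite /C; ring.
    move: q1 uw gw nw na pq; move: (u * w) ((N - 1) / t * w ^+ 2) (w * gfun p mu u)
      ((N - 1) / a * u ^+ 2) ((N - 1) / a * w ^+ 2) ((p + 1) * X)
      ((p + 1) * (u ^+ 2 + w ^+ 2)) (u ^+ 2 + w ^+ 2) => *.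
    qlra.
  - move=> t /andP[ta _]; have t0 : 0 < t by qlra.
    by rewrite /Y; ct; [exact: vc|exact: der_cont (slope_der iv t0)].
rewrite /Y vs ws expr0n/= addr0 mulr0; apply/negP; rewrite -ltNge.
by rewrite mulr_gt0 ?expR_gt0// ltr_pwDl ?sqr_ge0// exprn_gt0.
Qed.

(* The parameter is the infimum of those for which the solution stays nonnegative; the energy is
   nonnegative for smaller parameters, where the solution crosses zero, hence in the limit. *)
Lemma critical_parameter N p : 1 <= N -> 1 < p -> N * (p - 1) < 2 * (p + 1) ->
  exists mu v J, [/\ 0 < mu <= 1, ivp N (gfun p mu) v J, (forall s, 0 < v s) &
   forall Q S : R -> R, continuous Q -> continuous S ->
    (forall x : R, 0 <= x <= 1 -> Q x = x `^ (p + 1) / (p + 1) /\ S x = x ^+ 2 / 2) ->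
    (forall mu x : R, 0 < x -> isder x (1 : R) (fun x => Q x - mu * S x) (gfun p mu x)) ->
    forall s : R, 0 < s -> 0 <= slope N J s ^+ 2 / 2 + (Q (v s) - mu * S (v s))].
Proof.
move=> hN p1 sub.
have L0 : 0 <= p + 1 by qlra.
have sols (mu : R) : exists vJ : (R -> R) * (R -> R),
    0 <= mu <= 1 -> ivp N (gfun p mu) vJ.1 vJ.2.
  have [m|m] := boolP (0 <= mu <= 1); last by exists (id, id).
  have [v [J iv]] := ivp_exists hN L0 (fun x => gfun_le1 x p1 m) (fun x y => gfun_lip x y p1 m).
  by exists (v, J).
have [F HF] := choice sols.
pose E (s : R) := expR ((1 + 2 * (p + 1)) * s).
have E0 s : 0 < E s by exact: expR_gt0.
have dep (mu nu : R) v J w K : 0 <= mu <= 1 -> 0 <= nu <= 1 ->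
    ivp N (gfun p mu) v J -> ivp N (gfun p nu) w K ->
    forall s : R, 0 < s -> `|v s - w s| <= `|mu - nu| * E s /\
    `|J s - K s| <= s `^ (N - 1) * `|mu - nu| * E s.
  move=> m n iv iw; apply: (ivp_dep hN L0 _ _ _ _ _ iv iw) => //.
  - by move=> x; exact: gfun_le1.
  - by move=> x; exact: gfun_le1.
  - by move=> x y; exact: gfun_lip.
  - by move=> x; exact: gfun_dep.
pose A := [set mu : R | 0 <= mu <= 1 /\ forall s, 0 <= (F mu).1 s].
have i1 : 0 <= (1 : R) <= 1 by rewrite ler01 lexx.
have A1 : A 1.
  split => // s.
  (* For [mu = 1] the constant 1 is an equilibrium; the dependence estimate with equal parameters
     identifies it with the chosen solution. *)
  have iv : ivp N (gfun p 1) (fun=> 1) (fun=> 0).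
    split => //; try by move=> x; exact: ct_cst.
    - by move=> t t0; rewrite gfunE ?ler01 ?lexx// one_powR mulr1 subrr mulr0; der.
    - by move=> t t0; rewrite mulr0 oppr0; der.
  have [s0|s0] := leP s 0; first by have [_ _ /(_ s s0)[-> _] _ _] := HF 1 i1.
  have [] := dep _ _ _ _ _ _ i1 i1 (HF 1 i1) iv s s0.
  by rewrite subrr normr0 mul0r normr_le0 subr_eq0 => /eqP ->.
have Ai : has_inf A by split; [exists 1|exists 0 => x [/andP[]]].
pose mu := inf A.
have mu0 : 0 <= mu by apply: lb_le_inf; [exists 1|move=> x [/andP[]]].
have mu1 : mu <= 1 by apply: inf_lbound => //; exists 0 => x [/andP[]].
have m01 : 0 <= mu <= 1 by rewrite mu0 mu1.
have iv := HF mu m01.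
(* Nonnegativity passes to the infimum: a negative value at [s] would persist for all parameters
   within [- (F mu).1 s / E s] of [mu]. *)
have v0 s : 0 <= (F mu).1 s.
  have [s0|s0] := leP s 0; first by have [_ _ /(_ s s0)[-> _] _ _] := iv.
  rewrite leNgt; apply/negP => vs.
  have e0 : 0 < - (F mu).1 s / E s by rewrite divr_gt0// oppr_gt0.
  have [nu [n01 nus] nue] := inf_adherent e0 Ai; rewrite -/mu in nue.
  have mnu : mu <= nu by apply: inf_lbound => //; exists 0 => x [/andP[]].
  have [] := dep _ _ _ _ _ _ n01 m01 (HF nu n01) iv s s0.
  rewrite (@ger0_norm _ (nu - mu)) ?subr_ge0// => h _.
  have : (nu - mu) * E s < - (F mu).1 s by rewrite -ltr_pdivlMr//; qlra.
  by have := nus s; have := ler_norm ((F nu).1 s - (F mu).1 s); qlra.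
have mup : 0 < mu.
  rewrite lt_neqAle mu0 andbT; apply/eqP => m0.
  rewrite -m0 in iv v0.
  have [s _] := lane_emden_crosses hN p1 sub iv.
  by rewrite ltNge v0.
have vpos := nonneg_ivp_pos hN p1 m01 iv v0.
exists mu, (F mu).1, (F mu).2; split => //; first by rewrite mup.
move=> Q S Qc Sc QS Gd t t0; rewrite leNgt; apply/negP => neg.
(* Parameters are clamped to [[0, 1]], where the solutions are defined, so that continuity at [mu]
   can be stated on the whole line. *)
pose c (nu : R) := clamp nu.
have c01 nu : 0 <= c nu <= 1 by rewrite clamp_ge0 clamp_le1.
have cmu : c mu = mu by exact: clamp_id.
have vlip (nu : R) : `|(F (c nu)).1 t - (F (c mu)).1 t| <= E t * `|nu - mu|.
  have [/le_trans + _] := dep _ _ _ _ _ _ (c01 nu) (c01 mu) (HF _ (c01 nu)) (HF _ (c01 mu)) t t0.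
  by apply; rewrite mulrC ler_wpM2l ?(ltW (E0 t))// clamp_lip.
have Jlip (nu : R) : `|(F (c nu)).2 t - (F (c mu)).2 t| <= t `^ (N - 1) * E t * `|nu - mu|.
  have [_ /le_trans +] := dep _ _ _ _ _ _ (c01 nu) (c01 mu) (HF _ (c01 nu)) (HF _ (c01 mu)) t t0.
  apply; rewrite -!mulrA ler_wpM2l ?powR_ge0// mulrC ler_wpM2l ?(ltW (E0 t))//.
  exact: clamp_lip.
have lipc (f : R -> R) (C : R) : 0 <= C -> (forall nu, `|f nu - f mu| <= C * `|nu - mu|) ->
    {for mu, continuous f}.
  move=> C0 fl; apply/ct_epsP => e e0; exists (e / (C + 1)).
    by rewrite divr_gt0//; qlra.
  move=> nu; rewrite ltr_pdivlMr; last by qlra.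
  by move=> h; apply: le_lt_trans (fl nu) _; have := normr_ge0 (nu - mu); qlra.
have vct : {for mu, continuous (fun nu => (F (c nu)).1 t)}.
  by apply: lipc vlip; exact: ltW.
have Jct : {for mu, continuous (fun nu => (F (c nu)).2 t)}.
  by apply: lipc Jlip; rewrite mulr_ge0 ?powR_ge0// ltW.
pose En nu := (t `^ (1 - N) * (F (c nu)).2 t) ^+ 2 / 2 +
   (Q ((F (c nu)).1 t) - c nu * S ((F (c nu)).1 t)).
have Ect : {for mu, continuous En}.
  rewrite /En; ct => //.
  - by apply: (@ct_comp _ _ Q) => //; exact: Qc.
  - by exact: clamp_cont.
  - by apply: (@ct_comp _ _ S) => //; exact: Sc.
have Emu : En mu < 0 by rewrite /En cmu; move: neg; rewrite /slope sqrrN.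
have /ct_epsP/(_ (- En mu))[|d d0 Hd] := Ect; first by qlra.
have [vc _ vJ _ _] := iv.
have [x x01 xmin] : exists2 x, x \in `[0, t] & forall y, y \in `[0, t] -> (F mu).1 x <= (F mu).1 y.
  apply: EVT_min; first exact: ltW.
  exact: continuous_subspaceT.
pose m := (F mu).1 x.
have mp : 0 < m by exact: vpos.
(* Three requirements on [nu = mu - del]: the energy at [t] stays negative, [nu] stays in [[0, 1]],
   and the solution stays positive on [[0, t]], where the one for [mu] is at least [m]. *)
pose del := Num.min (d / 2) (Num.min (mu / 2) (m / (2 * E t))).
have del0 : 0 < del by rewrite /del !lt_min !divr_gt0// mulr_gt0.
have deld : del <= d / 2 by rewrite /del !ge_min lexx.
have delm : del <= mu / 2 by rewrite /del !ge_min lexx orbT.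
have delE : del * (2 * E t) <= m.
  by rewrite -ler_pdivlMr ?mulr_gt0// /del !ge_min lexx !orbT.
pose nu := mu - del.
have n01 : 0 <= nu <= 1 by rewrite /nu; apply/andP; split; qlra.
have cnu : c nu = nu by exact: clamp_id.
have Enu : En nu < 0.
  have : `|En nu - En mu| < - En mu.
    apply: Hd; rewrite /nu (_ : mu - del - mu = - del); last by ring.
    by rewrite normrN gtr0_norm//; qlra.
  by rewrite ltr_norml => /andP[_]; qlra.
have nA : ~ A nu.
  move=> /(@inf_lbound _ A)-/(_ _)/wrap[|]; first by exists 0 => y [/andP[]].
  by rewrite -/mu /nu; qlra.
have [s vs] : exists s, (F nu).1 s < 0.
  apply: contrapT => H; apply: nA; split => // s.
  by rewrite leNgt; apply/negP => h; apply: H; exists s.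
have inu := HF nu n01; have [nc _ nJ _ _] := inu.
have npos (s' : R) : s' <= t -> 0 < (F nu).1 s'.
  move=> st; have [s0|s0] := leP s' 0; first by have [-> _] := nJ s' s0.
  have [] := dep _ _ _ _ _ _ n01 m01 inu iv s' s0.
  rewrite /nu (_ : mu - del - mu = - del); last by ring.
  rewrite normrN (gtr0_norm del0) ler_norml => /andP[h _] _.
  have : m <= (F mu).1 s' by apply: xmin; rewrite in_itv/= (ltW s0).
  have : del * E s' <= del * E t.
    rewrite ler_wpM2l ?(ltW del0)// /E ler_expR ler_wpM2l//; qlra.
  qlra.
have ts : t < s.
  by rewrite ltNge; apply/negP => /npos; rewrite ltNge (ltW vs).
have [z /andP[tz _] [vz zl]] := first_zero nc ts npos (ltW vs).
have zl' (y : R) : 0 < y < z -> 0 < (F nu).1 y by move=> /andP[_ /zl].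
have tz' : 0 < t <= z by rewrite t0 ltW.
(* At the first zero [z > t] the energy is [slope^2 / 2 >= 0], yet it cannot exceed its negative
   value at [t]. *)
have := energy_nincr hN inu Qc Sc (Gd nu) zl' tz'; rewrite vz.
have [-> ->] : Q 0 = 0 /\ S 0 = 0.
  have i00 : 0 <= (0 : R) <= 1 by rewrite ler01 lexx.
  have [-> ->] := QS 0 i00.
  by rewrite expr0n/= mul0r powR0 ?mul0r// gt_eqF//; qlra.
move: Enu; rewrite /En cnu /slope !sqrrN mulr0 subr0 addr0.
by have := sqr_ge0 (z `^ (1 - N) * (F nu).2 z); qlra.
Qed.

Lemma ground_state N p : 1 <= N -> 1 < p -> N * (p - 1) < 2 * (p + 1) ->
  exists mu v w (C k : R), [/\ 0 < mu, 0 < C, 0 < k &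
   [/\ continuous v, forall s : R, s <= 0 -> v s = 1, forall s : R, 0 < v s,
     forall s : R, 0 < s -> isder s (1 : R) v (w s) &
   [/\ forall s : R, 0 < s ->
      isder s (1 : R) w ((1 - N) / s * w s - (v s `^ p - mu * v s)),
    forall s : R, 0 <= s -> v s <= C * expR (- k * s),
    forall s : R, 0 < s -> `|w s| <= C * expR (- k * s),
    forall s : R, 0 < s -> `|w s| <= s &
    forall e : R, 0 < e -> exists2 d : R, 0 < d &
      forall s : R, 0 < s < d -> `|w s / s + (1 - mu) / N| <= e]]].
Proof.
move=> hN p1 sub.
have [mu [v [J [/andP[mu0 mu1'] iv vpos Epos]]]] := critical_parameter hN p1 sub.
have [Q [S [Qc Sc QS Gd]]] := potential_exists p1.
have {}Epos := Epos Q S Qc Sc QS Gd.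
have N0 : 0 < N by qlra.
have [vc Jc vJ Jd vd] := iv.
have [v00 J00] := vJ 0 (lexx 0).
have mu01 : 0 <= mu <= 1 by rewrite (ltW mu0).
have gM x : `|gfun p mu x| <= 1 by exact: gfun_le1.
(* The energy at radius 1 is nonnegative and at most the initial energy [1 / (p + 1) - mu / 2], so
   [mu <= 2 / (p + 1) < 1]. *)
have mu1 : mu < 1.
  have vp1 (t : R) : 0 < t < 1 -> 0 < v t by move=> _; exact: vpos.
  have h := energy_le0 hN p1 mu01 iv Qc Sc (Gd mu) vp1 ltr01.
  have := Epos 1 ltr01; move=> h1.
  have {h h1} : 0 <= Q 1 - mu * S 1 by qlra.
  have i11 : 0 <= (1 : R) <= 1 by rewrite ler01 lexx.
  have [-> ->] := QS 1 i11.
  rewrite one_powR expr1n => h.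
  have : mu / 2 <= 1 / (p + 1) by qlra.
  rewrite ler_pdivlMr; last by qlra.
  move=> h2; rewrite ltNge; apply/negP => h3.
  have : 0 <= (mu - 1) * (p + 1) by rewrite mulr_ge0//; qlra.
  qlra.
have v1 (s : R) : v s <= 1.
  have [s0|s0] := leP s 0; first by have [-> _] := vJ s s0.
  by apply: (ivp_le1 hN p1 _ iv _ s0) => //; rewrite (ltW mu0).
have v01 (s : R) : 0 <= v s <= 1 by rewrite (ltW (vpos s)) v1.
have gE (s : R) : gfun p mu (v s) = v s `^ p - mu * v s by rewrite gfunE.
have gE2 (s : R) : gfun p mu (v s) = v s * (v s `^ (p - 1) - mu).
  by rewrite gE powRS//; ring.
have EE (s : R) : Q (v s) - mu * S (v s) = v s ^+ 2 * (v s `^ (p - 1) / (p + 1) - mu / 2).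
  have [-> ->] := QS _ (v01 s).
  have -> : v s `^ (p + 1) = v s ^+ 2 * v s `^ (p - 1).
    rewrite -(@powR_mulrn _ (v s) 2) ?(ltW (vpos s))// -powRB_gt0//.
    by congr (_ `^ _); ring.
  by field; qlra.
have gc : continuous (fun s : R => gfun p mu (v s)).
  by apply: ctAll => s; apply: ct_comp; [exact: gfun_cont|exact: vc].
have g1 : gfun p mu 1 = 1 - mu by rewrite gfunE ?ler01 ?lexx// one_powR mulr1.
have wlim (e : R) : 0 < e -> exists2 d : R, 0 < d &
      forall s : R, 0 < s < d -> `|slope N J s / s + (1 - mu) / N| <= e.
  move=> e0; have /ct_epsP/(_ (e * N))[|d d0 Hd] := gc 0; first by rewrite mulr_gt0.
  exists d => // s /andP[s0 sd].
  have ss : 0 < s <= s by rewrite s0 lexx.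
  have H (t : R) : 0 < t < s -> 1 - mu - e * N <= gfun p mu (v t) <= 1 - mu + e * N.
    move=> /andP[t0 ts].
    have : `|gfun p mu (v t) - gfun p mu (v 0)| < e * N.
      by apply: Hd; rewrite subr0 gtr0_norm//; qlra.
    by rewrite v00 g1 ltr_norml => /andP[? ?]; apply/andP; split; qlra.
  have /andP[h1 h2] := slope_between hN iv H ss.
  have : - ((1 - mu + e * N) / N) <= slope N J s / s <= - ((1 - mu - e * N) / N).
    rewrite ler_pdivlMr// ler_pdivrMr// !mulNr h1 h2//.
  rewrite (_ : (1 - mu + e * N) / N = (1 - mu) / N + e); last by field; rewrite gt_eqF.
  rewrite (_ : (1 - mu - e * N) / N = (1 - mu) / N - e); last by field; rewrite gt_eqF.
  by move=> /andP[? ?]; rewrite ler_norml; apply/andP; split; qlra.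
have ws (s : R) : 0 < s -> `|slope N J s| <= s by apply: (slope_le hN iv).
have Jslope (s : R) : 0 < s -> (J s <= 0) = (0 <= slope N J s).
  by move=> s0; rewrite /slope oppr_ge0 pmulr_rle0// powR_gt0.
(* At a first zero of the flux the energy is purely potential, and its nonnegativity gives
   [v^(p-1) >= mu (p + 1) / 2 > mu]. The nonlinear term is then positive, so the flux increases up
   to its zero and would be negative just before it. *)
have Jp (s : R) : 0 < s -> 0 < J s.
  move=> s0; rewrite ltNge; apply/negP => Js.
  have [|d d0 Hd] := wlim ((1 - mu) / N / 2); first by rewrite !divr_gt0// subr_gt0.
  pose a := Num.min (d / 2) (s / 2).
  have a0 : 0 < a by rewrite lt_min !divr_gt0.
  have ad : a <= d / 2 by rewrite /a ge_min lexx.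
  have as_ : a <= s / 2 by rewrite /a ge_min lexx orbT.
  have near0 (t : R) : 0 < t <= a -> 0 < J t.
    move=> /andP[t0 ta]; rewrite ltNge; apply/negP; rewrite Jslope// => h.
    have := Hd t; rewrite t0 (_ : t < d)//; last by qlra.
    move=> /(_ isT); rewrite ler_norml => /andP[_].
    have : 0 <= slope N J t / t by rewrite divr_ge0// ltW.
    have : 0 < (1 - mu) / N by rewrite divr_gt0// subr_gt0.
    qlra.
  (* The flux vanishes for nonpositive arguments; freezing it below [a] provides the positivity on
     the left that [first_zero] asks for. *)
  pose f (t : R) := J (Num.max t a).
  have fc : continuous f.
    by apply: ctAll => t; apply: ct_comp; [exact: Jc|ct].
  have fa (t : R) : t <= a -> 0 < f t.
    by move=> ta; rewrite /f max_r//; apply: near0; rewrite a0 lexx.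
  have as2 : a < s by qlra.
  have fs : f s <= 0 by rewrite /f max_l// ltW.
  have [z /andP[az zs] [fz zl]] := first_zero fc as2 fa fs.
  have z0 : 0 < z by qlra.
  have Jz : J z = 0 by move: fz; rewrite /f max_l// ltW.
  have gz : 0 < gfun p mu (v z).
    have := Epos z z0; rewrite /slope Jz mulr0 oppr0 expr0n/= mul0r add0r EE.
    rewrite pmulr_rge0 ?exprn_gt0// => h.
    rewrite gE2 mulr_gt0// subr_gt0.
    have : mu / 2 <= v z `^ (p - 1) / (p + 1) by qlra.
    rewrite ler_pdivlMr; last by qlra.
    by apply: lt_le_trans; rewrite -subr_gt0 (_ : _ - mu = mu * (p - 1) / 2);
      [rewrite divr_gt0// mulr_gt0//; qlra|field].
  have /ct_epsP/(_ _ gz)[e e0 He] := gc z.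
  pose b := Num.max a (z - e / 2).
  have bz : b < z by rewrite gt_max az; qlra.
  have ba : a <= b by rewrite le_max lexx.
  have bb : z - e / 2 <= b by rewrite le_max lexx orbT.
  have : J b < J z.
    apply: (@deriv_gt0_lt _ J (fun t => t `^ (N - 1) * gfun p mu (v t))) => //.
    - by move=> t /andP[bt _]; apply: Jd; qlra.
    - move=> t /andP[bt tz]; rewrite mulr_gt0 ?powR_gt0//; first by qlra.
      have : `|gfun p mu (v t) - gfun p mu (v z)| < gfun p mu (v z).
        by apply: He; rewrite ltr_norml; apply/andP; split; qlra.
      by rewrite ltr_norml => /andP[? _]; qlra.
    - by move=> t _; exact: Jc.
  rewrite Jz; apply/negP; rewrite -leNgt.
  by have := zl b bz; rewrite /f max_l// => /ltW.
have wneg (s : R) : 0 < s -> slope N J s < 0.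
  by move=> s0; rewrite ltNge -Jslope// -ltNge Jp.
have vpd (s : R) : 0 < s -> isder s (1 : R) v (slope N J s) by exact: vd.
have vdec (a b : R) : 0 <= a -> a <= b -> v b <= v a.
  move=> a0 ab; rewrite -lerN2.
  apply: (@deriv_ge0_le _ (fun t => - v t) (fun t => - slope N J t)) => //.
  - by move=> t /andP[t0 _]; apply: derN; apply: vpd; exact: le_lt_trans t0.
  - by move=> t /andP[t0 _]; rewrite oppr_ge0 ltW// wneg// (le_lt_trans a0).
  - by move=> t _; apply: ctN; exact: vc.
have Ew (s : R) : 0 < s ->
    0 <= slope N J s ^+ 2 / 2 + v s ^+ 2 * (v s `^ (p - 1) / (p + 1) - mu / 2).
  by move=> s0; rewrite -EE; exact: Epos.
clear EE Epos Gd QS Qc Sc Q S Jslope gc g1 mu1' sub.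
(* The midpoint of [mu] and [mu (p + 1) / 2]. Above [mu], it is a level that [v^(p-1)] must reach,
   since otherwise the nonlinear term stays bounded below and [v] becomes negative. Below
   [mu (p + 1) / 2], the zero of the potential, it makes the potential negative from then on. *)
pose th := mu * (p + 3) / 4.
have thmu : mu < th.
  by rewrite /th -subr_gt0 (_ : _ - mu = mu * (p - 1) / 4);
     [rewrite divr_gt0// mulr_gt0//; qlra|field].
have [T T0 HT] : exists2 T : R, 0 < T & v T `^ (p - 1) <= th.
  apply: contrapT => H.
  have big (s : R) : 0 < s -> th < v s `^ (p - 1).
    by move=> s0; rewrite ltNge; apply/negP => h; apply: H; exists s.
  pose l := th `^ (p - 1)^-1.
  have th0 : 0 < th by qlra.
  have l0 : 0 < l by exact: powR_gt0.
  have vl (s : R) : 0 < s -> l <= v s.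
    move=> s0; have := ltW (big s s0) => h.
    have -> : v s = (v s `^ (p - 1)) `^ (p - 1)^-1.
      by rewrite -powRrM divff ?powRr1 ?(ltW (vpos s))// gt_eqF//; qlra.
    apply: ge0_ler_powR => //; rewrite ?nnegrE ?powR_ge0 ?(ltW th0)//.
    by rewrite invr_ge0; qlra.
  pose c := l * (th - mu).
  have c0 : 0 < c by rewrite /c mulr_gt0// subr_gt0.
  have wc (s : R) : 0 < s -> slope N J s <= - (c / N * s).
    move=> s0; have ss : 0 < s <= s by rewrite s0 lexx.
    have Hc (t : R) : 0 < t < s -> c <= gfun p mu (v t) <= 1.
      move=> /andP[t0 _]; apply/andP; split; last first.
        by apply: le_trans (ler_norm _) (gM _).
      rewrite gE2 /c; apply: ler_pM; rewrite ?(ltW l0) ?vl//; first by qlra.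
      by have := big t t0; qlra.
    by have /andP[] := slope_between hN iv Hc ss.
  have vq (s : R) : 0 < s -> v s <= 1 - c / (2 * N) * s ^+ 2.
    move=> s0.
    have : v s - v 0 <= - (c / (2 * N) * s ^+ 2) - - (c / (2 * N) * 0 ^+ 2).
      apply: (@deriv_cmp _ v (slope N J) (fun s => - (c / (2 * N) * s ^+ 2)) (fun s => - (c / N * s))).
      - exact: ltW.
      - by move=> t /andP[t0 _]; exact: vpd.
      - by move=> t _; eapply isder_eq; [der|cbv beta; rewrite expr1; field; rewrite gt_eqF].
      - by move=> t /andP[t0 _]; exact: wc.
      - by move=> t _; exact: vc.
      - by move=> t _; ct.
    by rewrite v00 expr0n/=; qlra.
  have sq0 : 0 < 2 * N / c by rewrite divr_gt0// mulr_gt0.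
  have := vq (Num.sqrt (2 * N / c)); rewrite sqrtr_gt0 sq0 => /(_ isT).
  rewrite sqr_sqrtr ?(ltW sq0)// (_ : c / (2 * N) * (2 * N / c) = 1); last first.
    by field; rewrite !gt_eqF.
  by have := vpos (Num.sqrt (2 * N / c)); qlra.
have small (s : R) : T <= s -> v s `^ (p - 1) <= th.
  move=> Ts; apply: le_trans HT; apply: ge0_ler_powR; rewrite ?nnegrE ?(ltW (vpos _))//; first by qlra.
  by apply: vdec => //; exact: ltW.
(* Chosen so that [k2 / 2 = mu / 2 - th / (p + 1)]. *)
pose k2 := mu * (p - 1) / (2 * (p + 1)).
have k20 : 0 < k2 by rewrite /k2 divr_gt0 ?mulr_gt0//; qlra.
pose k := Num.sqrt k2.
have k0 : 0 < k by rewrite sqrtr_gt0.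
(* the energy being nonnegative, [v'^2 >= k^2 v^2] far from the origin *)
have wk (s : R) : T <= s -> slope N J s <= - (k * v s).
  move=> Ts; have s0 : 0 < s by qlra.
  have h := Ew s s0.
  have h1 : v s ^+ 2 * (v s `^ (p - 1) / (p + 1) - mu / 2) <= v s ^+ 2 * (- (k2 / 2)).
    rewrite ler_wpM2l ?sqr_ge0//.
    have : v s `^ (p - 1) / (p + 1) <= th / (p + 1).
      by rewrite ler_wpM2r ?small// invr_ge0; qlra.
    have -> : th / (p + 1) = mu / 2 - k2 / 2 by rewrite /th /k2; field; qlra.
    qlra.
  have h2 : (k * v s) ^+ 2 <= (- slope N J s) ^+ 2.
    by rewrite sqrrN exprMn sqr_sqrtr ?(ltW k20)//; qlra.
  have : k * v s <= - slope N J s.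
    rewrite -ler_sqr ?nnegrE//; first by rewrite mulr_ge0 ?(ltW k0)// ltW.
    by rewrite oppr_ge0 ltW// wneg.
  by qlra.
have vexp (s : R) : 0 <= s -> v s <= expR (k * T) * expR (- k * s).
  move=> s0; rewrite -expRD.
  have [sT|Ts] := leP s T.
    by apply: le_trans (v1 s) _; rewrite -expR0 ler_expR; have := ler_wpM2l (ltW k0) sT; qlra.
  have : v s * expR (k * s) <= v T * expR (k * T).
    rewrite -lerN2; apply: (@deriv_ge0_le _ (fun t => - (v t * expR (k * t)))
      (fun t => - ((slope N J t + k * v t) * expR (k * t)))); first exact: ltW.
    - move=> t /andP[Tt _]; eapply isder_eq; first by der; apply: vpd; qlra.
      by ringb.
    - move=> t /andP[/ltW Tt _]; rewrite oppr_ge0 mulr_le0_ge0 ?expR_ge0//.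
      by have := wk t Tt; qlra.
    - by move=> t _; ct; exact: vc.
  move=> h.
  have h2 : v s * expR (k * s) <= expR (k * T).
    by apply: le_trans h _; rewrite ler_piMl ?expR_ge0.
  have := ler_wpM2r (expR_ge0 (- k * s)) h2.
  by rewrite -mulrA -!expRD (_ : k * s + - k * s = 0) ?expR0 ?mulr1//; ring.
clear Ew wk small thmu HT th k20; clearbody k; clear k2.
(* Beyond [U] the nonlinear term is nonpositive, so the flux decreases and with it the size of the
   slope. *)
have [U U0 HU] : exists2 U : R, 0 < U & forall s, U <= s -> v s `^ (p - 1) <= mu.
  pose l := mu `^ (p - 1)^-1.
  have l0 : 0 < l by exact: powR_gt0.
  pose U := Num.max 1 (T + - ln l / k).
  exists U; first by rewrite lt_max ltr01.
  move=> s Us; have s1 : 1 <= s by apply: le_trans Us; rewrite le_max lexx.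
  have s2 : T + - ln l / k <= s by apply: le_trans Us; rewrite le_max lexx orbT.
  have vsl : v s <= l.
    apply: le_trans (vexp s _) _; first by qlra.
    rewrite -expRD -[leRHS](lnK l0) ler_expR.
    have : - ln l / k <= s - T by qlra.
    by rewrite ler_pdivrMr//; qlra.
  have -> : mu = l `^ (p - 1).
    by rewrite /l -powRrM mulVf ?powRr1 ?(ltW mu0)// gt_eqF//; qlra.
  by apply: ge0_ler_powR; rewrite ?nnegrE ?(ltW (vpos _)) ?(ltW l0)//; qlra.
have Jdec (a b : R) : U <= a -> a <= b -> J b <= J a.
  move=> Ua ab; rewrite -lerN2.
  apply: (@deriv_ge0_le _ (fun t => - J t) (fun t => - (t `^ (N - 1) * gfun p mu (v t)))) => //.
  - by move=> t /andP[t0 _]; apply: derN; apply: Jd; qlra.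
  - move=> t /andP[ta _]; rewrite oppr_ge0 mulr_ge0_le0 ?powR_ge0// gE2.
    rewrite mulr_ge0_le0 ?(ltW (vpos t))// subr_le0 HU//; qlra.
  - by move=> t _; apply: ctN; exact: Jc.
(* The size of the slope at [s] is at most its mean over [[s - 1, s]], hence at most [v (s - 1)];
   the unit shift costs the factor [expR k]. *)
have wexp (s : R) : U + 1 <= s -> `|slope N J s| <= expR (k * T) * expR k * expR (- k * s).
  move=> Us; have s0 : 0 < s by qlra.
  have [c /andP[c1 c2] cE] : exists2 c, s - 1 < c < s & v s - v (s - 1) = slope N J c * (s - (s - 1)).
    apply: (@MVT' _ v (slope N J)); first by qlra.
      by move=> t /andP[t0 _]; apply: vpd; qlra.
    by move=> t _; exact: vc.
  have c0 : 0 < c by qlra.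
  have h1 : - slope N J s <= - slope N J c.
    rewrite /slope !opprK; apply: ler_pM; rewrite ?powR_ge0 ?(ltW (Jp _ s0))//.
      have hh (x : R) : 0 < x -> x `^ (1 - N) = (x `^ (N - 1))^-1.
        by move=> x0; rewrite -powRN opprB.
      rewrite !hh// lef_pV2 ?posrE ?powR_gt0//.
      by apply: ge0_ler_powR; rewrite ?nnegrE; qlra.
    by apply: Jdec; qlra.
  have h2 : - slope N J c <= v (s - 1) by have := vpos s; qlra.
  rewrite ltr0_norm ?wneg//.
  apply: le_trans h1 (le_trans h2 _); apply: le_trans (vexp (s - 1) _) _; first by qlra.
  by rewrite -!mulrA ler_wpM2l ?expR_ge0// -expRD ler_expR; qlra.
(* The second term covers [s < U + 1], where the bound [|slope| <= s] is used. *)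
pose C := expR (k * T) * expR k + (U + 1) * expR (k * (U + 1)).
have C1 : expR (k * T) <= C.
  have : expR (k * T) <= expR (k * T) * expR k.
    by rewrite ler_peMr ?expR_ge0// -expR0 ler_expR ltW.
  have : 0 <= (U + 1) * expR (k * (U + 1)) by rewrite mulr_ge0 ?expR_ge0//; qlra.
  by rewrite /C; qlra.
exists mu, v, (slope N J), C, k; split => //.
  by apply: lt_le_trans C1; exact: expR_gt0.
split => //; first by move=> s /vJ[].
split => //.
- by move=> s s0; rewrite -gE; exact: slope_der iv s0.
- move=> s s0; apply: le_trans (vexp s s0) _.
  by rewrite ler_wpM2r ?expR_ge0.
- move=> s s0; have [Us|sU] := leP (U + 1) s.
    apply: le_trans (wexp s Us) _; rewrite ler_wpM2r ?expR_ge0// /C lerDl.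
    by rewrite mulr_ge0 ?expR_ge0//; qlra.
  apply: le_trans (ws s s0) _.
  apply: (@le_trans _ _ ((U + 1) * expR (k * (U + 1)) * expR (- k * s))).
    rewrite -mulrA -expRD; apply: (@le_trans _ _ (U + 1)); first exact: ltW.
    rewrite ler_peMr//; first by qlra.
    rewrite -[leLHS]expR0 ler_expR; have := ler_wpM2l (ltW k0) (ltW sU); qlra.
  by rewrite ler_wpM2r ?expR_ge0// /C lerDr mulr_ge0 ?expR_ge0.
Qed.

End ground_state.

(** * Geometry, integration and divergence in R^d *)

Section lines.
Context {R : realType} {V : normedModType R}.

Lemma isder_lineP (f : V -> R) (x v : V) (d : R) :
  isder x v f d <-> isder (0 : R) (1 : R) (fun h : R => f (h *: v + x)) d.
Proof.
have E : 'D_v f x = 'D_1 (fun h : R => f (h *: v + x)) (0 : R).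
  have E2 : (fun h : R => h^-1 *: ((f \o shift x) (h *: v) - f x)) =
      (fun h : R => h^-1 *: (((fun h : R => f (h *: v + x)) \o shift 0) (h *: (1 : R)) -
        (fun h : R => f (h *: v + x)) 0)).
    apply/funext => h /=.
    by rewrite scale0r add0r addr0 [h *: (1 : R)]mulr1.
  by rewrite /derive E2.
split=> -[fd fE].
- by apply: isder_of; [exact: (derivable1P f x v).1|rewrite -E].
- by apply: isder_of; [exact: (derivable1P f x v).2|rewrite E].
Qed.

Lemma der_comp_dir (f : R -> R) (g : V -> R) (x v : V) a b :
  isder (g x) (1 : R) f a -> isder x v g b -> isder x v (fun y => f (g y)) (a * b).
Proof.
move=> fa /isder_lineP gb; apply/isder_lineP.
apply: (@der_comp _ f (fun h : R => g (h *: v + x))) => //.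
by rewrite scale0r add0r.
Qed.

End lines.

Section sum_cont.
Context {R : realType}.

Lemma sum_cont (I : finType) (T : topologicalType) (f : I -> T -> R) (x : T) :
  (forall i, {for x, continuous (f i)}) -> {for x, continuous (fun y => \sum_i f i y)}.
Proof.
move=> fc; elim: (index_enum I) => [|i s ih].
  rewrite (_ : (fun y => _) = (fun=> 0)); first exact: ct_cst.
  by apply/funext => y; rewrite big_nil.
rewrite (_ : (fun y => _) = (fun y => f i y + \sum_(j <- s) f j y)); first exact: ctD.
by apply/funext => y; rewrite big_cons.
Qed.

End sum_cont.

Section rV_geometry.
Context {R : realType} {d : nat}.
Implicit Types (x y : 'rV[R]_d) (i j : 'I_d).

Definition sqn x : R := dotv x x.

Local Notation e_ i := (delta_mx ord0 i : 'rV[R]_d).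

Lemma sqn_ge0 x : 0 <= sqn x.
Proof. by apply: sumr_ge0 => i _; rewrite -expr2 sqr_ge0. Qed.

Lemma enorm_ge0 x : 0 <= enorm x.
Proof. exact: sqrtr_ge0. Qed.

Lemma enorm_sqr x : enorm x ^+ 2 = sqn x.
Proof. by rewrite sqr_sqrtr// sqn_ge0. Qed.

Lemma coord_le_enorm x i : `|x ord0 i| <= enorm x.
Proof.
rewrite -sqrtr_sqr; apply: ler_wsqrtr.
rewrite /dotv (bigD1 i)//= expr2 lerDl.
by apply: sumr_ge0 => j _; rewrite -expr2 sqr_ge0.
Qed.

Lemma enorm0P x : reflect (x = 0) (enorm x == 0).
Proof.
apply: (iffP eqP) => [x0|->].
  apply/rowP => i; apply/eqP; rewrite mxE -normr_le0.
  by apply: le_trans (coord_le_enorm x i) _; rewrite x0.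
by rewrite /enorm /dotv big1 ?sqrtr0// => i _; rewrite mxE mulr0.
Qed.

Lemma enorm0 : enorm (0 : 'rV[R]_d) = 0.
Proof. by apply/eqP/enorm0P. Qed.

Lemma enorm_gt0 x : (0 < enorm x) = (x != 0).
Proof.
rewrite lt_neqAle enorm_ge0 andbT eq_sym; congr negb.
by apply/enorm0P/eqP.
Qed.

Lemma sqn_gt0 x : (0 < sqn x) = (x != 0).
Proof. by rewrite -enorm_gt0 -enorm_sqr lt0r sqrf_eq0 sqr_ge0 andbT lt0r enorm_ge0 andbT. Qed.

Lemma coord_cont i x : {for x, continuous (fun y : 'rV[R]_d => y ord0 i)}.
Proof. by have := @coord_continuous _ 1 d ord0 i x. Qed.

Lemma coord_der i j x : isder x (e_ i) (fun y : 'rV[R]_d => y ord0 j) (i == j)%:R.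
Proof.
apply/isder_lineP.
have -> : (fun h : R => (h *: e_ i + x) ord0 j) = (fun h => h * (i == j)%:R + x ord0 j).
  by apply/funext => h; rewrite !mxE eqxx/= eq_sym.
by eapply isder_eq; [der|ringb].
Qed.

Lemma sqn_cont x : {for x, continuous sqn}.
Proof.
by apply: (@sum_cont _ 'I_d _ (fun i y => y ord0 i * y ord0 i)) => i; ct; exact: coord_cont.
Qed.

Lemma sqn_der i x : isder x (e_ i) sqn (2 * x ord0 i).
Proof.
have -> : 2 * x ord0 i = \sum_j (x ord0 j * (i == j)%:R + x ord0 j * (i == j)%:R).
  rewrite (bigD1 i)//= eqxx !mulr1 big1 ?addr0; first by rewrite mulr2n mulrDl mul1r.
  by move=> j; rewrite eq_sym => /negbTE ->; rewrite !mulr0 addr0.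
apply: (@der_sum _ _ d (fun j y => y ord0 j * y ord0 j)) => j.
by apply: derM; exact: coord_der.
Qed.

Lemma enorm_cont x : {for x, continuous (@enorm R d)}.
Proof. by apply: ct_comp; [exact: sqrt_continuous|exact: sqn_cont]. Qed.

Lemma enorm_der i x : x != 0 -> isder x (e_ i) (@enorm R d) (x ord0 i / enorm x).
Proof.
move=> x0; have s0 : 0 < sqn x by rewrite sqn_gt0.
have -> : x ord0 i / enorm x = (2 * Num.sqrt (sqn x))^-1 * (2 * x ord0 i).
  by rewrite invfM -[Num.sqrt _]/(enorm x); field; rewrite gt_eqF// enorm_gt0.
apply: (@der_comp_dir _ _ Num.sqrt sqn); last exact: sqn_der.
exact: is_derive1_sqrt.
Qed.

Lemma norm_le_enorm x : `|x| <= enorm x.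
Proof.
have -> : `|x| = mx_norm x by [].
rewrite mx_normrE; apply: bigmax_le; first exact: enorm_ge0.
by move=> [a i] _ /=; rewrite (ord1 a) coord_le_enorm.
Qed.

Lemma coord_le_norm x i : `|x ord0 i| <= `|x|.
Proof.
have -> : `|x| = mx_norm x by [].
by rewrite mx_normrE (le_trans _ (le_bigmax _ _ (ord0, i))).
Qed.

Lemma norm_leP x (C : R) : 0 <= C -> (forall i, `|x ord0 i| <= C) -> `|x| <= C.
Proof.
move=> C0 H; have -> : `|x| = mx_norm x by [].
by rewrite mx_normrE; apply: bigmax_le => // -[a i] _ /=; rewrite (ord1 a).
Qed.

Lemma norm_ltP x (C : R) : 0 < C -> (forall i, `|x ord0 i| < C) -> `|x| < C.
Proof.
move=> C0 H; have -> : `|x| = mx_norm x by [].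
by rewrite mx_normrE; apply: bigmax_lt => // -[a i] _ /=; rewrite (ord1 a).
Qed.

Lemma ct_epsV (f : 'rV[R]_d -> R) x : {for x, continuous f} <->
  (forall e : R, 0 < e -> exists2 r : R, 0 < r &
    forall y, `|y - x| < r -> `|f y - f x| < e).
Proof.
split => [fx e e0|h].
- have /cvgrPdistC_lt/(_ _ e0) := fx.
  move=> /nbhs_ballP[r /= r0 H]; exists r => // t tx.
  by apply: H; rewrite -ball_normE/= distrC.
- suff : f y @[y --> x] --> f x by [].
  apply: (@cvgrPdistC_lt R R 'rV[R]_d (nbhs x) (nbhs_filter x) f (f x)).2 => e e0.
  have [r r0 H] := h _ e0.
  apply/nbhs_ballP; exists r => //= t /=; rewrite -ball_normE/= => tx.
  by apply: H; rewrite distrC.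
Qed.

Lemma enorm_ball_compact (A : R) : compact [set x : 'rV[R]_d | enorm x <= A].
Proof.
apply: bounded_closed_compact.
- exists A; split; first exact: num_real.
  by move=> M AM x /= xA; apply: le_trans (norm_le_enorm x) (le_trans xA (ltW AM)).
- apply: (@preimage_closed _ _ (@enorm R d) [set t | t <= A]); last exact: closed_le.
  by move=> x _; exact: enorm_cont.
Qed.

Lemma cc_bounded (f : 'rV[R]_d -> R) (A : R) : continuous f ->
  (forall x, A < enorm x -> f x = 0) -> exists2 M, 0 <= M & forall x, `|f x| <= M.
Proof.
move=> fc fA.
have [M [_ HM]] : bounded_set (f @` [set x | enorm x <= A]).
  apply: compact_bounded; apply: continuous_compact; last exact: enorm_ball_compact.
  exact: continuous_subspaceT.
exists (`|M| + 1); first by rewrite addr_ge0.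
move=> x; have [xA|xA] := leP (enorm x) A; last by rewrite fA// normr0 addr_ge0.
apply: HM; last by exists x.
by apply: le_lt_trans (ler_norm M) _; rewrite ltrDl.
Qed.

End rV_geometry.

Notation e_ i := (delta_mx ord0 i).

(** * Borel sets of [R^d] and the product sigma-algebra *)

Section rV_measurability.
Context {R : realType} {d : nat}.

(** The sigma-algebra is generated by the coordinates and the balls of the sup norm are cubes: an
    open set is the union of the rational cubes it contains. [F] runs over all rational cubes and
    replaces the others by the empty set. *)
Lemma open_measurable_rV (U : set 'rV[R]_d) : open U -> measurable U.
Proof.
move=> oU.
pose B (qn : 'rV[rat]_d * nat) : set 'rV[R]_d :=
  [set x | forall i, `|x ord0 i - ratr (qn.1 ord0 i)| < qn.2.+1%:R^-1].
pose F (qn : 'rV[rat]_d * nat) := if `[< B qn `<=` U >] then B qn else set0.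
have -> : U = \bigcup_qn F qn.
  apply/seteqP; split => [x Ux|x [qn _]]; last first.
    by rewrite /F; case: asboolP => // BU; exact: BU.
  have /nbhs_ballP[e /= e0 eU] : nbhs x U by exact: open_nbhs_nbhs.
  have [n ne] : exists n : nat, n.+1%:R^-1 < e / 2.
    have /cvgrPdistC_lt/(_ (e / 2)) := @cvg_harmonic R.
    rewrite divr_gt0// => /(_ isT)[n _ /(_ n (leqnn n))] /=.
    by rewrite subr0 ger0_norm// => h; exists n.
  have n0 : 0 < n.+1%:R^-1 :> R by rewrite invr_gt0.
  have qE (i : 'I_d) : exists q : rat, `|x ord0 i - ratr q| < n.+1%:R^-1.
    move: (n.+1%:R^-1) n0 => c c0.
    have xx : x ord0 i - c < x ord0 i + c by lra.
    have [q] := rat_in_itvoo xx.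
    rewrite in_itv/= => /andP[? ?]; exists q.
    by rewrite ltr_norml; apply/andP; split; lra.
  have [q Hq] := choice qE.
  exists (\row_i q i, n) => //.
  have Bx : B (\row_i q i, n) x by move=> i; rewrite /= mxE.
  rewrite /F; case: asboolP => // -[] y By; apply: eU.
  rewrite -ball_normE/=; apply: norm_ltP => // i.
  have h1 := Hq i; have h2 := By i; rewrite /= mxE in h2.
  move: (n.+1%:R^-1) ne h1 h2 => c ce h1 h2.
  rewrite !mxE; move: h1 h2; rewrite !ltr_norml => /andP[? ?] /andP[? ?].
  by apply/andP; split; lra.
apply: countable_bigcupT_measurable; first exact: countableP.
move=> qn; rewrite /F; case: asboolP => // _.
have -> : B qn = \bigcap_(i in [set: 'I_d])
    ((fun x : 'rV[R]_d => x ord0 i) @^-1` ball (ratr (qn.1 ord0 i) : R) (qn.2.+1%:R^-1 : R)).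
  apply/seteqP; split => x.
    by move=> Bx i _; rewrite /= -ball_normE/= distrC; exact: Bx.
  by move=> Bx i; have := Bx i I; rewrite /= -ball_normE/= distrC.
apply: fin_bigcap_measurable; first exact: finite_finset.
move=> i _; rewrite -[X in measurable X]setTI; apply: measurable_rV_coord => //.
by apply: open_measurable; exact: ball_open.
Qed.

Lemma cont_measurable_rV (f : 'rV[R]_d -> R) : continuous f ->
  measurable_fun setT (f : 'rV[R]_d -> measurableTypeR R).
Proof.
move=> fc; apply: (measurability _ (measurable_realfun.RGenOpens.measurableE R)).
move=> _ [_ [a [b ->]] <-]; rewrite setTI; apply: open_measurable_rV.
by apply: open_comp => // x _; exact: fc.
Qed.

Lemma sqn_measurable : measurable_fun setT (@sqn R d : 'rV[R]_d -> measurableTypeR R).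
Proof. by apply: cont_measurable_rV; apply: ctAll => x; exact: sqn_cont. Qed.

End rV_measurability.

(** * Integration in [R^n] by induction on the dimension *)

Section rV_integration.
Context {R : realType}.
Local Notation lam := (@lebesgue_measure R).
Local Notation mu d := (@lebesgue_rV R d).

Lemma integral_rVS n (f : 'rV[R]_n.+1 -> \bar R) : measurable_fun setT f ->
  (lam \x mu n)%E.-integrable setT (f \o @rV_cons R n) ->
  (\int[mu n.+1]_x f x = \int[lam \x mu n]_z f (rV_cons z))%E.
Proof.
move=> mf fi.
exact: (integral_pushforward (@measurable_rV_cons R n) mf fi measurableT).
Qed.

Lemma integrable_rVS n (f : 'rV[R]_n.+1 -> \bar R) : measurable_fun setT f ->
  (lam \x mu n)%E.-integrable setT (f \o @rV_cons R n) ->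
  (mu n.+1).-integrable setT f.
Proof.
move=> mf fi.
exact: (integrable_pushforward (@measurable_rV_cons R n) mf fi measurableT).
Qed.

(** An integrable majorant that factorises over the coordinates, so that its integrability goes by
    induction on the dimension. Bounded functions of compact support and, later, stretched
    exponentials are compared with it. *)
Definition rdecay n (x : 'rV[R]_n) : R := \prod_i (1 + x ord0 i ^+ 2)^-1.

Lemma rdecay_gt0 n (x : 'rV[R]_n) : 0 < rdecay x.
Proof.
by apply: prodr_gt0 => i _; rewrite invr_gt0 ltr_pwDl// sqr_ge0.
Qed.

Lemma rdecay_cons n (z : R) (v : 'rV[R]_n) :
  rdecay (rV_cons (z, v)) = (1 + z ^+ 2)^-1 * rdecay v.
Proof.
rewrite /rdecay big_ord_recl; congr (_ * _).
  by rewrite mxE unlift_none.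
by apply: eq_bigr => i _; rewrite mxE liftK.
Qed.

Lemma rdecay_measurable n : measurable_fun setT (@rdecay n : 'rV[R]_n -> measurableTypeR R).
Proof.
apply: (@measurable_prod _ _ R setT _ (index_enum 'I_n)) => i _.
apply: (measurableT_comp (f := fun t : R => (1 + t ^+ 2)^-1)); last exact: measurable_rV_coord.
apply: continuous_measurable_fun; apply: ctAll => t; ct.
by rewrite gt_eqF// ltr_pwDl// sqr_ge0.
Qed.

Lemma oneDsqrV_integrable : lam.-integrable setT (fun t : R => ((1 + t ^+ 2)^-1)%:E).
Proof.
have p0 (t : R) : 0 <= (1 + t ^+ 2)^-1 by rewrite invr_ge0 addr_ge0// sqr_ge0.
have c0 : continuous (fun t : R => (1 + t ^+ 2)^-1).
  by apply: ctAll => t; ct; rewrite gt_eqF// ltr_pwDl// sqr_ge0.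
apply/integrableP; split.
  by apply/measurable_EFinP; apply: continuous_measurable_fun.
under eq_integral do rewrite /= ger0_norm//.
rewrite ge0_symfun_integralT//; last by move=> t /=; rewrite sqrrN.
have -> : [set x : R | 0 <= x] = `[0, +oo[%classic.
  by apply/seteqP; split => x /=; rewrite in_itv/= andbT.
have -> : (\int[lam]_(x in `[0%R, +oo[) ((1 + x ^+ 2)^-1)%:E)%E = (pi / 2)%:E.
  exact: integral0y_oneDsqr.
by rewrite -EFinM ltry.
Qed.

Lemma rdecay_cons_integrable n : (mu n).-integrable setT (EFin \o @rdecay n) ->
  (lam \x mu n)%E.-integrable setT ((EFin \o @rdecay n.+1) \o @rV_cons R n).
Proof.
move=> /integrableP[_ fin].
have m1 : measurable_fun setT ((EFin \o @rdecay n.+1) \o @rV_cons R n).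
  apply: measurableT_comp; last exact: measurable_rV_cons.
  by apply/measurable_EFinP; exact: rdecay_measurable.
apply/(integrable12ltyP _ _ m1).
have e (z : R) (v : 'rV[R]_n) : (`|((EFin \o @rdecay n.+1) \o @rV_cons R n) (z, v)| =
    ((1 + z ^+ 2)^-1)%:E * `|(EFin \o @rdecay n) v|)%E.
  rewrite /comp rdecay_cons /= -EFinM !ger0_norm//.
  - by rewrite ltW// rdecay_gt0.
  - by rewrite mulr_ge0 ?(ltW (rdecay_gt0 _))// invr_ge0 addr_ge0// sqr_ge0.
have -> : (\int[lam]_x \int[mu n]_y `|((EFin \o @rdecay n.+1) \o @rV_cons R n) (x, y)| =
    \int[lam]_x (((1 + x ^+ 2)^-1)%:E * \int[mu n]_y `|(EFin \o @rdecay n) y|))%E.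
  apply: eq_integral => z _; under eq_integral do rewrite e.
  rewrite ge0_integralZl//.
  - apply: measurableT_comp => //; apply/measurable_EFinP; exact: rdecay_measurable.
  - by rewrite lee_fin invr_ge0 addr_ge0// sqr_ge0.
move: fin; set c := (\int[mu n]_y `|(EFin \o @rdecay n) y|)%E => fin.
have c0 : (0 <= c)%E by apply: integral_ge0.
have cE : c = (fine c)%:E by rewrite fineK// ge0_fin_numE.
rewrite cE.
have /integrableP[m2 f2] := oneDsqrV_integrable.
have p0 (t : R) : 0 <= (1 + t ^+ 2)^-1 by rewrite invr_ge0 addr_ge0// sqr_ge0.
under eq_integral do rewrite muleC.
rewrite ge0_integralZl//; last 2 first.
- by move=> x _; rewrite lee_fin.
- by rewrite -cE.
rewrite lte_mul_pinfty// -?cE// ?fin_numE ?cE//.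
apply: le_lt_trans f2; apply: ge0_le_integral => //.
- by move=> x _; rewrite lee_fin.
- by apply: measurableT_comp.
- by move=> x _; rewrite /= ger0_norm.
Qed.

Lemma rdecay_integrable n : (mu n).-integrable setT (EFin \o @rdecay n).
Proof.
elim: n => [|n ih].
  apply/integrableP; split.
    by apply/measurable_EFinP; exact: rdecay_measurable.
  rewrite integral_dirac//; last first.
    by apply: measurableT_comp => //; apply/measurable_EFinP; exact: rdecay_measurable.
  by rewrite diracT mul1e /= ltry.
apply: integrable_rVS; last exact: rdecay_cons_integrable.
by apply/measurable_EFinP; exact: rdecay_measurable.
Qed.

Lemma le_rdecay_integrable n (f : 'rV[R]_n -> R) (C : R) :
  measurable_fun setT (f : 'rV[R]_n -> measurableTypeR R) ->
  (forall x, `|f x| <= C * rdecay x) -> (mu n).-integrable setT (EFin \o f).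
Proof.
move=> mf fC.
apply: (@le_integrable _ _ _ _ _ _ _ (EFin \o (fun x => C * rdecay x))) => //.
- by apply/measurable_EFinP.
- by move=> x _ /=; rewrite lee_fin; apply: le_trans (fC x) (ler_norm _).
- by have := integrableZl measurableT C (rdecay_integrable n).
Qed.

Lemma le_rdecay_integrable_cons n (f : 'rV[R]_n.+1 -> R) (C : R) :
  measurable_fun setT (f : 'rV[R]_n.+1 -> measurableTypeR R) ->
  (forall x, `|f x| <= C * rdecay x) ->
  (lam \x mu n)%E.-integrable setT ((EFin \o f) \o @rV_cons R n).
Proof.
move=> mf fC.
apply: (@le_integrable _ _ _ _ _ _ _ ((EFin \o (fun x => C * rdecay x)) \o @rV_cons R n)) => //.
- by apply: measurableT_comp; [apply/measurable_EFinP|exact: measurable_rV_cons].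
- by move=> x _ /=; rewrite lee_fin; apply: le_trans (fC _) (ler_norm _).
- by have := integrableZl measurableT C (rdecay_cons_integrable (rdecay_integrable n)).
Qed.

(** On the ball of radius [A] every factor of [(1 + A^2)^n * rdecay x] is at least 1. *)
Lemma cc_le_rdecay n (f : 'rV[R]_n -> R) (A M : R) : 0 <= M ->
  (forall x, `|f x| <= M) -> (forall x, A < enorm x -> f x = 0) ->
  forall x, `|f x| <= M * (1 + A ^+ 2) ^+ n * rdecay x.
Proof.
move=> M0 fM fA x.
have r0 := rdecay_gt0 x.
have q0 : 0 <= 1 + A ^+ 2 by rewrite addr_ge0// sqr_ge0.
have [xA|xA] := leP (enorm x) A; last first.
  by rewrite fA// normr0 !mulr_ge0 ?exprn_ge0// ltW.
apply: le_trans (fM x) _; rewrite -mulrA ler_peMr//.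
have -> : (1 + A ^+ 2) ^+ n = \prod_(i < n) (1 + A ^+ 2) by rewrite prodr_const card_ord.
rewrite /rdecay -big_split/=.
apply: (big_ind (fun t : R => 1 <= t)) => //.
  by move=> a b a1 b1; rewrite mulr_ege1.
move=> i _; rewrite -[leLHS](@mulfV _ (1 + x ord0 i ^+ 2)); last first.
  by rewrite gt_eqF// ltr_pwDl// sqr_ge0.
rewrite ler_wpM2r ?invr_ge0 ?addr_ge0 ?sqr_ge0// lerD2l.
rewrite -(ger0_norm (sqr_ge0 (x ord0 i))) normrX lerXn2r ?nnegrE//.
  by apply: le_trans xA; exact: enorm_ge0.
by apply: le_trans (coord_le_enorm x i) xA.
Qed.

Lemma cc_integrable n (f : 'rV[R]_n -> R) (A : R) : continuous f ->
  (forall x, A < enorm x -> f x = 0) -> (mu n).-integrable setT (EFin \o f).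
Proof.
move=> fc fA; have [M M0 fM] := cc_bounded fc fA.
apply: (@le_rdecay_integrable _ _ (M * (1 + A ^+ 2) ^+ n)).
  exact: cont_measurable_rV.
exact: cc_le_rdecay.
Qed.

Lemma integral_deriv_cc (f f' : R -> R) (A : R) : 0 < A ->
  (forall t : R, isder t (1 : R) f (f' t)) -> continuous f' ->
  (forall t : R, A < `|t| -> f t = 0) -> (forall t : R, A < `|t| -> f' t = 0) ->
  (\int[lam]_t (f' t)%:E = 0)%E.
Proof.
move=> A0 fd fc fA fA'.
pose B := A + 1.
have -> : (\int[lam]_t (f' t)%:E = \int[lam]_(t in `[(- B)%R, B]) (f' t)%:E)%E.
  rewrite [RHS]integral_mkcond; apply: eq_integral => t _.
  rewrite patchE; case: ifPn => // tB; rewrite fA'//.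
  rewrite ltNge; apply/negP => tA; move/negP: tB; apply.
  rewrite inE/= in_itv/= /B; move: tA; rewrite ler_norml => /andP[? ?].
  by apply/andP; split; lra.
have BB : - B < B by rewrite /B; lra.
have fc' : continuous f by apply: ctAll => t; exact: der_cont (fd t).
rewrite (@continuous_FTC2 _ f' f).
- have fB : f B = 0 by apply: fA; rewrite /B gtr0_norm; lra.
  have fNB : f (- B) = 0 by apply: fA; rewrite /B normrN gtr0_norm; lra.
  by rewrite fB fNB subee.
- exact: BB.
- exact: continuous_subspaceT.
- split.
  + by move=> t _; have [] := fd t.
  + by apply: cvg_at_right_filter; exact: fc'.
  + by apply: cvg_at_left_filter; exact: fc'.
- by move=> t _; rewrite derive1E; have [] := fd t.
Qed.

Lemma rV_cons_line n (z h : R) (v : 'rV[R]_n) :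
  h *: (e_ ord0 : 'rV[R]_n.+1) + rV_cons (z, v) = rV_cons (h + z, v).
Proof.
apply/rowP => i; rewrite !mxE eqxx /=; case: (unliftP ord0 i) => [j ->|->].
  by rewrite -[lift ord0 j == ord0]/(false) mulr0 add0r.
by rewrite eqxx mulr1.
Qed.

Lemma rV_cons_line_lift n (z h : R) (v : 'rV[R]_n) (j : 'I_n) :
  h *: (e_ (lift ord0 j) : 'rV[R]_n.+1) + rV_cons (z, v) = rV_cons (z, h *: e_ j + v).
Proof.
apply/rowP => i; rewrite !mxE eqxx /=; case: (unliftP ord0 i) => [k ->|->].
  by rewrite /= !mxE eqxx/= (inj_eq lift_inj).
by rewrite -[ord0 == lift ord0 j]/(false) mulr0 add0r.
Qed.

Lemma rV_cons_cont1 n (v : 'rV[R]_n) : continuous (fun z : R => rV_cons (z, v)).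
Proof.
move=> z; apply/cvgrPdistC_lt => e e0.
apply/nbhs_ballP; exists e => //= t /= zt.
apply: norm_ltP => // i; rewrite !mxE; case: (unliftP ord0 i) => [j _|_] /=.
  by rewrite subrr normr0.
by rewrite distrC.
Qed.

Lemma rV_cons_cont2 n (z : R) : continuous (fun v : 'rV[R]_n => rV_cons (z, v)).
Proof.
move=> v.
apply: (@cvgrPdistC_lt R 'rV[R]_n.+1 'rV[R]_n (nbhs v) (nbhs_filter v) _ _).2 => e e0.
apply/nbhs_ballP; exists e => //= w /=; rewrite -ball_normE/= => vw.
apply: norm_ltP => // i; rewrite !mxE; case: (unliftP ord0 i) => [j _|_] /=.
  apply: le_lt_trans vw; rewrite -normrN opprB.
  by have := coord_le_norm (w - v) j; rewrite !mxE.
by rewrite subrr normr0.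
Qed.

Lemma cons_enorm_ge n (z : R) (v : 'rV[R]_n) :
  `|z| <= enorm (rV_cons (z, v)) /\ enorm v <= enorm (rV_cons (z, v)).
Proof.
split.
  by have := coord_le_enorm (rV_cons (z, v)) ord0; rewrite mxE unlift_none.
apply: ler_wsqrtr; rewrite /dotv big_ord_recl.
rewrite [X in _ <= _ + X](_ : _ = \sum_i v ord0 i * v ord0 i).
  by rewrite lerDr -expr2 sqr_ge0.
by apply: eq_bigr => i _; rewrite mxE liftK.
Qed.

(** Fubini in the splitting [rV_cons]: for the first coordinate the inner integral runs over that
    coordinate and vanishes by the fundamental theorem; for any other one it runs over the tail,
    where the induction hypothesis applies. *)
Lemma integral_partial_cc n (i : 'I_n) (F F' : 'rV[R]_n -> R) (A : R) : 0 < A ->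
  (forall x, isder x (e_ i) F (F' x)) -> continuous F' ->
  (forall x, A < enorm x -> F x = 0) ->
  (forall x, A < enorm x -> F' x = 0) ->
  (\int[mu n]_x (F' x)%:E = 0)%E.
Proof.
elim: n i F F' => [[]//|n ih] i F F' A0 Fd Fc FA FA'.
have [M M0 FM] := cc_bounded Fc FA'.
have mF : measurable_fun setT (EFin \o F').
  by apply/measurable_EFinP; exact: cont_measurable_rV.
have Fi : (lam \x mu n)%E.-integrable setT ((EFin \o F') \o @rV_cons R n).
  apply: (@le_rdecay_integrable_cons _ _ (M * (1 + A ^+ 2) ^+ n.+1)).
    exact: cont_measurable_rV.
  exact: cc_le_rdecay.
rewrite -[LHS]/(\int[mu n.+1]_x (EFin \o F') x)%E (integral_rVS mF Fi).
case: (unliftP ord0 i) Fd => [j ->|->] Fd.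
- rewrite -(integral12_prod_meas1 Fi) /fubini_F integral0_eq// => z _ /=.
  apply: (ih j (fun v => F (rV_cons (z, v))) (fun v => F' (rV_cons (z, v)))) => //.
  + move=> v; apply/isder_lineP; have /isder_lineP := Fd (rV_cons (z, v)).
    rewrite (_ : (fun h : R => F (h *: _ + _)) =
       (fun h : R => F (rV_cons (z, h *: e_ j + v))))//.
    by apply/funext => h; rewrite rV_cons_line_lift.
  + move=> v; apply: (@continuous_comp _ _ _ (fun v => rV_cons (z, v)) F').
      exact: rV_cons_cont2.
    exact: Fc.
  + by move=> v vA; apply: FA; apply: lt_le_trans vA (cons_enorm_ge z v).2.
  + by move=> v vA; apply: FA'; apply: lt_le_trans vA (cons_enorm_ge z v).2.
- rewrite -(integral21_prod_meas1 Fi) /fubini_G integral0_eq// => v _ /=.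
  apply: (@integral_deriv_cc (fun z => F (rV_cons (z, v))) (fun z => F' (rV_cons (z, v))) A) => //.
  + move=> z; apply/isder_lineP; have /isder_lineP := Fd (rV_cons (z, v)).
    rewrite (_ : (fun h : R => F (h *: _ + _)) =
       (fun h : R => F (rV_cons (h *: (1 : R) + z, v))))//.
    by apply/funext => h; rewrite rV_cons_line [h *: (1 : R)]mulr1.
  + move=> z; apply: (@continuous_comp _ _ _ (fun z => rV_cons (z, v)) F').
      exact: rV_cons_cont1.
    exact: Fc.
  + by move=> z zA; apply: FA; apply: lt_le_trans zA (cons_enorm_ge z v).1.
  + by move=> z zA; apply: FA'; apply: lt_le_trans zA (cons_enorm_ge z v).1.
Qed.

Lemma box_measure_gt0 n (c : 'rV[R]_n) (r : R) : 0 < r ->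
  (0 < mu n [set x | forall i, (`|x ord0 i - c ord0 i| < r)%R])%E.
Proof.
move=> r0; elim: n c => [|n ih] c.
  have h : [set x : 'rV[R]_0 | forall i, `|x ord0 i - c ord0 i| < r] 0 by case.
  by rewrite /= diracE (mem_set h) lte_fin.
have mbox m (c' : 'rV[R]_m) : measurable [set x : 'rV[R]_m | forall i, `|x ord0 i - c' ord0 i| < r].
  have -> : [set x : 'rV[R]_m | forall i, `|x ord0 i - c' ord0 i| < r] = ball c' r.
    apply/seteqP; split => x /=; rewrite -ball_normE/=.
      by move=> h; apply: norm_ltP => // i; rewrite !mxE distrC.
    move=> h i; apply: le_lt_trans h; rewrite -normrN opprB.
    by have := coord_le_norm (x - c') i; rewrite !mxE.
  by apply: open_measurable_rV; exact: ball_open.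
pose c' : 'rV[R]_n := \row_j c ord0 (lift ord0 j).
pose B' := [set x : 'rV[R]_n | forall i, `|x ord0 i - c' ord0 i| < r].
have -> : mu n.+1 [set x | forall i, (`|x ord0 i - c ord0 i| < r)%R] =
  (lam \x mu n)%E ((ball (c ord0 ord0 : R) r : set (measurableTypeR R)) `*` B').
  rewrite /= /rV_cons_measure /pushforward; congr ((lam \x mu n)%E _).
  apply/seteqP; split => -[z v] /=.
    move=> h; split; first by have := h ord0; rewrite /= mxE unlift_none/= distrC.
    by move=> j; have := h (lift ord0 j); rewrite !mxE liftK.
  move=> [h1 h2] i; case: (unliftP ord0 i) => [j ->|->].
    by have := h2 j; rewrite !mxE liftK.
  by rewrite mxE unlift_none/= distrC.
have m1 : measurable (ball (c ord0 ord0 : R) r : set (measurableTypeR R)).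
  by apply: open_measurable; exact: ball_open.
rewrite (product_measure1E _ _ m1 (mbox n c')).
rewrite mule_gt0//; last exact: ih.
rewrite [X in (_ < X)%E](_ : _ = (r *+ 2)%:E); last first.
  exact: lebesgue_measure_ball (ltW r0).
by rewrite lte_fin mulrn_wgt0.
Qed.

Lemma integral0_cont_eq0 n (g : 'rV[R]_n -> R) : continuous g -> (forall x, 0 <= g x) ->
  (\int[mu n]_x (g x)%:E = 0)%E -> forall c, g c = 0.
Proof.
move=> gc g0 gi c; apply/eqP; rewrite eq_le g0 andbT leNgt; apply/negP => gc0.
have /ct_epsV/(_ (g c / 2))[|r r0 Hr] := gc c; first by rewrite divr_gt0.
pose B := [set x : 'rV[R]_n | forall i, `|x ord0 i - c ord0 i| < r].
have mB : measurable B.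
  have -> : B = ball c r.
    apply/seteqP; split => x /=; rewrite -ball_normE/=.
      by move=> h; apply: norm_ltP => // i; rewrite !mxE distrC.
    move=> h i; apply: le_lt_trans h; rewrite -normrN opprB.
    by have := coord_le_norm (x - c) i; rewrite !mxE.
  by apply: open_measurable_rV; exact: ball_open.
have mg : measurable_fun setT (EFin \o g).
  by apply/measurable_EFinP; exact: cont_measurable_rV.
have : (\int[mu n]_(x in B) (g c / 2)%:E <= \int[mu n]_x (g x)%:E)%E.
  apply: (@le_trans _ _ (\int[mu n]_(x in B) (g x)%:E)%E).
    apply: ge0_le_integral => //.
    - by move=> x _; rewrite lee_fin divr_ge0.
    - exact: measurable_funS mg.
    - move=> x Bx; rewrite lee_fin.
      have : `|g x - g c| < g c / 2.
        by apply: Hr; apply: norm_ltP => // i; rewrite !mxE; exact: Bx.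
      by rewrite ltr_norml => /andP[? _]; lra.
  by apply: ge0_subset_integral => // x _; rewrite lee_fin.
rewrite gi integral_cst// leNgt => /negP; apply.
by rewrite mule_gt0 ?lte_fin ?divr_gt0// box_measure_gt0.
Qed.

End rV_integration.

(** * Radial C^1 fields and their divergence *)

Section radial_fields.
Context {R : realType} {d : nat}.
Local Notation mu := (@lebesgue_rV R d).
Implicit Types (M : R -> R) (x : 'rV[R]_d).

(* [M(|x|) x] is a C^1 vector field, with divergence [d M + r M'] *)
Definition regular_profile (M M' : R -> R) : Prop :=
  [/\ forall r : R, 0 < r -> isder r (1 : R) M (M' r),
    forall r : R, 0 < r -> {for r, continuous M'},
    forall e : R, 0 < e -> exists2 t : R, 0 < t & forall r, 0 <= r < t -> `|M r - M 0| < e &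
    forall e : R, 0 < e -> exists2 t : R, 0 < t & forall r, 0 <= r < t -> `|r * M' r| < e].

Definition field_div (M M' : R -> R) (r : R) : R := d%:R * M r + r * M' r.

Lemma radial_cont (f : R -> R) x :
  (x != 0 -> {for enorm x, continuous f}) ->
  (x = 0 -> forall e : R, 0 < e -> exists2 t : R, 0 < t & forall r, 0 <= r < t -> `|f r - f 0| < e) ->
  {for x, continuous (fun y : 'rV[R]_d => f (enorm y))}.
Proof.
have [->|x0] := eqVneq x 0; last first.
  by move=> /(_ isT) fc _; apply: ct_comp => //; exact: enorm_cont.
move=> _ /(_ erefl) H.
apply/ct_epsV => e e0; have [t t0 Ht] := H e e0.
have /ct_epsV/(_ t t0)[r r0 Hr] := @enorm_cont R d 0.
exists r => // y yr; rewrite enorm0; apply: Ht.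
rewrite enorm_ge0/=; have := Hr y yr; rewrite enorm0 subr0.
by apply: le_lt_trans; exact: ler_norm.
Qed.

Lemma profile_cont M M' : regular_profile M M' ->
  continuous (fun x : 'rV[R]_d => M (enorm x)).
Proof.
move=> [Md _ M0 _]; apply: ctAll => x; apply: radial_cont; last by move=> _; exact: M0.
by rewrite -enorm_gt0 => x0; exact: der_cont (Md _ x0).
Qed.

Lemma profile'_cont M M' : regular_profile M M' ->
  continuous (fun x : 'rV[R]_d => enorm x * M' (enorm x)).
Proof.
move=> [_ M'c _ M'0]; apply: ctAll => x; apply: (@radial_cont (fun r => r * M' r)).
  by rewrite -enorm_gt0 => x0; apply: ctM; [exact: cvg_id|exact: M'c].
by move=> _ e e0; have [t t0 Ht] := M'0 e e0; exists t => // r /Ht; rewrite mul0r subr0.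
Qed.

Lemma field_div_cont M M' : regular_profile M M' ->
  continuous (fun x : 'rV[R]_d => field_div M M' (enorm x)).
Proof.
move=> h; apply: ctAll => x; rewrite /field_div; apply: ctD.
  by apply: ctM; [exact: ct_cst|exact: (profile_cont h)].
exact: (profile'_cont h).
Qed.

(** At the origin the difference quotient in direction [e_ i] is [M |h|], so it converges by
    continuity of [M]; the second term of the formula vanishes there because it carries the factor
    [enorm x]. *)
Lemma profile_der M M' x (i : 'I_d) : regular_profile M M' ->
  isder x (e_ i) (fun y : 'rV[R]_d => M (enorm y) * y ord0 i)
    (M (enorm x) + enorm x * M' (enorm x) * (x ord0 i / enorm x) ^+ 2).
Proof.
move=> h; have [Md _ M0 _] := h.
have [->|x0] := eqVneq x 0; last first.
  have r0 : 0 < enorm x by rewrite enorm_gt0.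
  eapply isder_eq.
    apply: derM; last exact: coord_der.
    by apply: der_comp_dir; [exact: Md|exact: enorm_der].
  by cbv beta; rewrite eqxx mulr1; have /lt0r_neq0 := r0; cbv delta [isder] => rn; field.
rewrite enorm0 mul0r mul0r addr0; apply/isder_lineP.
have -> : (fun h0 : R => M (enorm (h0 *: e_ i + 0)) * (h0 *: (e_ i : 'rV[R]_d) + 0) ord0 i) =
  (fun h0 : R => M `|h0| * h0).
  apply/funext => t; rewrite addr0 !mxE !eqxx mulr1; congr (M _ * _).
  rewrite /enorm /dotv (bigD1 i)//= big1 ?addr0; last first.
    by move=> j ji; rewrite !mxE (negbTE ji) andbF mulr0 mul0r.
  by rewrite !mxE !eqxx mulr1 -expr2 sqrtr_sqr.
have cvg : h0^-1 *: (((fun h0 : R => M `|h0| * h0) \o shift 0) (h0 *: (1 : R)) -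
    (fun h0 : R => M `|h0| * h0) 0) @[h0 --> 0^'] --> M 0.
  apply/cvgrPdistC_lt => e e0; have [t t0 Ht] := M0 e e0.
  apply/nbhs_ballP; exists t => //= y yt yn.
  rewrite addr0 mulr0 subr0 [y *: (1 : R)]mulr1.
  have -> : y^-1 *: (M `|y| * y) = M `|y| by rewrite /GRing.scale/=; field.
  apply: Ht; rewrite normr_ge0/=; move: yt.
  by rewrite /ball/= sub0r normrN.
apply: isder_of; first by apply/cvg_ex; exists (M 0).
exact/cvg_lim.
Qed.

Lemma sum_sqr_enorm x : x != 0 -> \sum_(i < d) (x ord0 i / enorm x) ^+ 2 = 1.
Proof.
move=> x0; have r0 : 0 < enorm x by rewrite enorm_gt0.
under eq_bigr do rewrite exprMn expr2.
by rewrite -mulr_suml -/(dotv x x) -/(sqn x) -enorm_sqr -exprMn divff ?expr1n// gt_eqF.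
Qed.

(** Compact support is asked of the products only, since it comes from different factors: from the
    test function [h] when the profile is the flux of the solution, from the profile when [h] is a
    Schwartz function or the constant 1. The components of [h M(|x|) x] have continuous partial
    derivatives, each of which integrates to zero. *)
Lemma divergence_theorem (h : 'rV[R]_d -> R) (h' : 'I_d -> 'rV[R]_d -> R) M M' (A : R) :
  (forall i x, isder x (e_ i) h (h' i x)) -> continuous h -> (forall i, continuous (h' i)) ->
  regular_profile M M' ->
  (forall x, A < enorm x -> h x * M (enorm x) = 0) ->
  (forall x i, A < enorm x -> h' i x * M (enorm x) = 0) ->
  (forall x, A < enorm x -> h x * M' (enorm x) = 0) ->
  let q x := \sum_i h' i x * (M (enorm x) * x ord0 i) + h x * field_div M M' (enorm x) in
  [/\ continuous q, mu.-integrable setT (EFin \o q) & (\int[mu]_x (q x)%:E = 0)%E].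
Proof.
move=> hd hc h'c HM zM zM1 zM' q; have [Md M'c M0 M'0] := HM.
wlog A0 : A zM zM1 zM' / 0 < A.
  move=> H; apply: (H (`|A| + 1)); last by rewrite ltr_wpDl.
  - by move=> x xA; apply: zM; apply: le_lt_trans xA; rewrite (le_trans (ler_norm _))// lerDl.
  - by move=> x i xA; apply: zM1; apply: le_lt_trans xA; rewrite (le_trans (ler_norm _))// lerDl.
  - by move=> x xA; apply: zM'; apply: le_lt_trans xA; rewrite (le_trans (ler_norm _))// lerDl.
pose F i x := h x * (M (enorm x) * x ord0 i).
pose F' i x := h' i x * (M (enorm x) * x ord0 i) +
  h x * (M (enorm x) + enorm x * M' (enorm x) * (x ord0 i / enorm x) ^+ 2).
have Fd i x : isder x (e_ i) (F i) (F' i x).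
  eapply isder_eq; first by apply: derM; [exact: hd|exact: profile_der HM].
  by rewrite /F'; ring.
have F'c i : continuous (F' i).
  apply: ctAll => x; rewrite /F'; apply: ctD; apply: ctM.
  - exact: h'c.
  - by apply: ctM; [exact: (profile_cont HM)|exact: coord_cont].
  - exact: hc.
  - apply: ctD; first exact: (profile_cont HM).
    have [->|x0] := eqVneq x 0; last first.
      ct; [exact: enorm_cont| |exact: coord_cont|by rewrite gt_eqF// enorm_gt0|exact: enorm_cont].
      by apply: ct_comp; [apply: M'c; rewrite enorm_gt0|exact: enorm_cont].
    (* The direction [x / |x|] has no limit at 0, but it is bounded and multiplies [r M'(r)], which
       tends to 0. *)
    apply/ct_epsV => e e0.
    have /ct_epsV/(_ e e0)[r r0 Hr] := profile'_cont HM (x := 0).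
    exists r => // y yr; rewrite enorm0 !mul0r subr0.
    have := Hr y yr; rewrite enorm0 mul0r subr0; apply: le_lt_trans.
    rewrite normrM ler_piMr//.
    have [->|y0] := eqVneq y 0; first by rewrite enorm0 invr0 mulr0 expr0n/= normr0.
    rewrite normrX -[leRHS](expr1n _ 2) lerXn2r ?nnegrE//.
    rewrite normrM normfV (ger0_norm (enorm_ge0 y)) ler_pdivrMr ?enorm_gt0// mul1r.
    exact: coord_le_enorm.
have FA i x : A < enorm x -> F i x = 0.
  by move=> xA; rewrite /F mulrA zM// mul0r.
have F'A i x : A < enorm x -> F' i x = 0.
  move=> xA; rewrite /F' mulrA zM1// mul0r add0r mulrDr zM// add0r.
  have -> : h x * (enorm x * M' (enorm x) * (x ord0 i / enorm x) ^+ 2) =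
    (h x * M' (enorm x)) * (enorm x * (x ord0 i / enorm x) ^+ 2) by ring.
  by rewrite zM'// mul0r.
have qE x : q x = \sum_i F' i x.
  rewrite /q /F' big_split/=; congr (_ + _).
  rewrite -mulr_sumr big_split/= -mulr_sumr sumr_const card_ord /field_div -[in RHS]mulr_natl.
  congr (_ * (_ + _)).
  have [->|x0] := eqVneq x 0; first by rewrite enorm0 !mul0r.
  by rewrite sum_sqr_enorm// mulr1.
have qEf : q = (fun x => \sum_i F' i x) by apply/funext.
have Fi i : mu.-integrable setT (EFin \o F' i) by apply: (cc_integrable (F'c i)) (F'A i).
have qc : continuous q.
  by rewrite qEf; apply: ctAll => x; apply: (@sum_cont _ _ _ F') => i; exact: F'c.
split => //.
- apply: (@cc_integrable _ _ _ A qc) => x xA.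
  by rewrite qE big1// => i _; rewrite F'A.
- have -> : (\int[mu]_x (q x)%:E = \int[mu]_x (\sum_(i < d) (EFin \o F' i) x)%R)%E.
    by apply: eq_integral => x _; rewrite qE sumEFin.
  rewrite integral_sum// big1// => i _.
  exact: (@integral_partial_cc R d i (F i) (F' i) A A0 (Fd i) (F'c i) (FA i) (F'A i)).
Qed.

End radial_fields.

(** * Smooth radial functions *)

Section function_algebras.
Context {R : realType} {V : normedModType R}.
Implicit Types (G P : (V -> R) -> Prop) (U : set V) (f g : V -> R).

(** Smoothness is proved by closure: if the derivative of each generator lies in the algebra they
    generate, the whole algebra is stable under differentiation, and no formula for higher
    derivatives is written. *)
Inductive salg G : (V -> R) -> Prop :=
| salg_gen g : G g -> salg G g
| salg_cst c : salg G (fun=> c)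
| salgD f g : salg G f -> salg G g -> salg G (fun x => f x + g x)
| salgM f g : salg G f -> salg G g -> salg G (fun x => f x * g x).

Lemma salg_der G U (v : V) :
  (forall g, G g -> exists2 g', salg G g' & forall x, U x -> isder x v g (g' x)) ->
  forall f, salg G f -> exists2 f', salg G f' & forall x, U x -> isder x v f (f' x).
Proof.
move=> Gd f; elim => {f} [g /Gd//|c|f g fG [f' f'G fd] gG [g' g'G gd]|f g fG [f' f'G fd] gG [g' g'G gd]].
- by exists (fun=> 0); [exact: salg_cst|move=> x _; exact: der_cst].
- exists (fun x => f' x + g' x); first exact: salgD.
  by move=> x Ux; apply: derD; [exact: fd|exact: gd].
- exists (fun x => f x * g' x + g x * f' x); first by apply: salgD; exact: salgM.
  by move=> x Ux; apply: derM; [exact: fd|exact: gd].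
Qed.

Lemma salg_cont G U :
  (forall g, G g -> forall x, U x -> {for x, continuous g}) ->
  forall f, salg G f -> forall x, U x -> {for x, continuous f}.
Proof.
move=> Gc f; elim => {f} [g Gg|c|f g fG fc gG gc|f g fG fc gG gc] x Ux.
- exact: Gc.
- exact: ct_cst.
- by apply: ctD; [exact: fc|exact: gc].
- by apply: ctM; [exact: fc|exact: gc].
Qed.

End function_algebras.

Section smooth_line.
Context {R : realType}.
Implicit Types (P : (R -> R) -> Prop) (U : set R) (f g : R -> R).

Definition dclosed U P := forall f, P f -> exists2 g, P g & forall t, U t -> isder t (1 : R) f (g t).

(** A coinductive form of smoothness: all derivatives exist because differentiation never leaves the
    class [P]. *)
Definition smooth1 U f := exists2 P, dclosed U P & P f.

Lemma smooth1_salg U (G : (R -> R) -> Prop) f :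
  (forall g, G g -> exists2 g', salg G g' & forall t, U t -> isder t (1 : R) g (g' t)) ->
  salg G f -> smooth1 U f.
Proof. by move=> Gd fG; exists (salg G) => // g; exact: salg_der. Qed.

Lemma smooth1M U f g : smooth1 U f -> smooth1 U g -> smooth1 U (fun t => f t * g t).
Proof.
move=> [P Pd Pf] [Q Qd Qg].
apply: (@smooth1_salg _ (fun h => P h \/ Q h)); last first.
  by apply: salgM; apply: salg_gen; [left|right].
move=> h [/Pd|/Qd] [h' Ph hd]; exists h' => //; apply: salg_gen; [by left|by right].
Qed.

Lemma der_sqr_small f (C : R) : f 0 = 0 -> (forall t : R, `|t| < 1 -> `|f t| <= C * t ^+ 2) ->
  isder (0 : R) (1 : R) f 0.
Proof.
move=> f0 H.
have cvg : h^-1 *: ((f \o shift 0) (h *: (1 : R)) - f 0) @[h --> 0^'] --> (0 : R).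
  apply/cvgrPdistC_lt => e e0; apply/nbhs_ballP.
  have C0 : 0 < `|C| + 1 by rewrite ltr_wpDl.
  exists (Num.min 1 (e / (`|C| + 1))); first by rewrite /= lt_min ltr01 divr_gt0.
  move=> t; rewrite /ball/= sub0r normrN lt_min => /andP[t1 te] t0.
  rewrite addr0 f0 !subr0 [t *: (1 : R)]mulr1 normrM normfV.
  have n0 : 0 < `|t| by rewrite normr_gt0.
  rewrite mulrC ltr_pdivrMr//; apply: le_lt_trans (H _ t1) _.
  rewrite -[t ^+ 2]ger0_norm ?sqr_ge0// normrX expr2 mulrA ltr_pM2r//.
  rewrite ltr_pdivlMr// in te; apply: le_lt_trans te.
  by rewrite mulrC ler_wpM2l// (le_trans (ler_norm _))// lerDl.
apply: isder_of; first by apply/cvg_ex; exists 0.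
exact/cvg_lim.
Qed.

(** From [expR x = expR (x / n)^n] and [expR y >= 1 + y]. *)
Lemma expR_ge_pow (n : nat) (x : R) : 0 <= x -> x ^+ n <= n%:R ^+ n * expR x.
Proof.
case: n => [|n] x0; first by rewrite !expr0 mul1r -[leLHS]expR0 ler_expR.
have n0 : (0 : R) < n.+1%:R by rewrite ltr0n.
have -> : expR x = expR (x / n.+1%:R) ^+ n.+1.
  by rewrite -expRM_natl -mulr_natl mulrC divfK// gt_eqF.
rewrite -exprMn lerXn2r ?nnegrE ?mulr_ge0 ?expR_ge0//; last first.
rewrite mulrC -ler_pdivrMr//; apply: le_trans (expR_ge1Dx _).
by rewrite lerDr.
Qed.

(* the derivatives of [exp (-1/t)], extended by 0 to the half-line [t <= 0] *)
Definition flat (k : nat) (t : R) : R := if t <= 0 then 0 else t^-1 ^+ k * expR (- t^-1).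

Lemma flat_ge0 k t : 0 <= flat k t.
Proof.
rewrite /flat; case: ifPn => //; rewrite -ltNge => t0.
by rewrite mulr_ge0 ?expR_ge0// exprn_ge0// invr_ge0 ltW.
Qed.

(** Differentiation sends [flat k] to the orders [k + 1] and [k + 2], so the family is closed. At 0
    the bound [y^(k+2) <= (k+2)^(k+2) expR y] with [y = 1 / s] gives [flat k s = O(s^2)], hence the
    derivative 0. *)
Lemma flat_der k t : isder t (1 : R) (flat k) (- k%:R * flat k.+1 t + flat k.+2 t).
Proof.
have [t0|t0|t0] := ltgtP t 0.
- rewrite /flat ltW// mulr0 addr0.
  apply: (@der_local _ (fun=> 0) _ _ _ (- t)); [by rewrite oppr_gt0| |exact: der_cst].
  by move=> s; rewrite ltr_norml => /andP[_ h]; rewrite ifT//; lra.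
- apply: (@der_local _ (fun s => s^-1 ^+ k * expR (- s^-1)) _ _ _ t) => //.
    by move=> s; rewrite ltr_norml /flat => /andP[h _]; rewrite ifF//; apply/negP; lra.
  rewrite /flat !ifF; try by apply/negP; lra.
  eapply isder_eq; first by der; rewrite ?gt_eqF.
  cbv beta; rewrite mulr1 -exprVn !exprS; case: k => [|k]; first by rewrite /= expr0; ring.
  by rewrite /= exprS; ring.
- rewrite t0 {2 3}/flat lexx mulr0 addr0.
  apply: (@der_sqr_small _ (k.+2%:R ^+ k.+2)); first by rewrite /flat lexx.
  move=> s _; rewrite ger0_norm ?flat_ge0// /flat; case: ifPn => [s0|].
    by rewrite mulr_ge0 ?sqr_ge0// exprn_ge0.
  rewrite -ltNge => s0.
  have v0 : 0 <= s^-1 by rewrite invr_ge0 ltW.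
  have := expR_ge_pow k.+2 v0.
  rewrite expRN => h.
  have -> : s^-1 ^+ k * (expR s^-1)^-1 = s^-1 ^+ k.+2 / expR s^-1 * s ^+ 2.
    by rewrite !exprS; field; rewrite !gt_eqF ?expR_gt0.
  by rewrite ler_wpM2r ?sqr_ge0// ler_pdivrMr// expR_gt0.
Qed.

(* a smooth function of [t] supported in [t0 - rho, t0 + rho] *)
Definition bump (t0 rho t : R) : R := flat 0 (1 - ((t - t0) / rho) ^+ 2).

Definition bump' (t0 rho t : R) : R :=
  flat 2 (1 - ((t - t0) / rho) ^+ 2) * (- (2 * ((t - t0) / rho) / rho)).

Lemma bump_der t0 rho t : isder t (1 : R) (bump t0 rho) (bump' t0 rho t).
Proof.
eapply isder_eq.
  by apply: der_comp; [exact: flat_der|der].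
by rewrite /bump'/=; ringb.
Qed.

Lemma smooth1_bump U t0 rho : smooth1 U (bump t0 rho).
Proof.
pose G (f : R -> R) := exists k, f = fun t => flat k (1 - ((t - t0) / rho) ^+ 2).
pose H (f : R -> R) := G f \/ f = id.
apply: (@smooth1_salg _ H); last by apply: salg_gen; left; exists 0.
move=> g [[k ->]|->]; last by exists (fun=> 1); [exact: salg_cst|move=> t _; exact: der_id].
have flH j : salg H (fun t => flat j (1 - ((t - t0) / rho) ^+ 2)).
  by apply: salg_gen; left; exists j.
exists (fun t => (- k%:R * flat k.+1 (1 - ((t - t0) / rho) ^+ 2) + flat k.+2 (1 - ((t - t0) / rho) ^+ 2)) *
    ((- 2 / rho ^+ 2) * (t + - t0))).
  apply: salgM.
    by apply: salgD; [apply: salgM; [exact: salg_cst|exact: flH]|exact: flH].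
  apply: salgM; first exact: salg_cst.
  by apply: salgD; [apply: salg_gen; right|exact: salg_cst].
move=> t _; eapply isder_eq.
  by apply: der_comp; [exact: flat_der|der].
cbv beta; congr (_ * _) => //=; rewrite -exprVn; ring.
Qed.

End smooth_line.

Section smooth_radial.
Context {R : realType} {d : nat}.
Implicit Types (u f : 'rV[R]_d -> R) (U : set 'rV[R]_d) (s : seq 'I_d).

(** By induction on the list of directions, every iterated partial derivative coincides on [U] with
    a member of [P]; openness of [U] allows this coincidence to be differentiated. *)
Lemma smooth_on_dclosed U (P : ('rV[R]_d -> R) -> Prop) u : open U ->
  (forall f, P f -> forall i, exists2 g, P g & forall x, U x -> isder x (e_ i) f (g x)) ->
  (forall f, P f -> forall x, U x -> {for x, continuous f}) ->
  P u -> smooth_on U u.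
Proof.
move=> oU Pd Pc Pu.
have H s : exists2 g, P g & forall x, U x -> partials s u x = g x.
  elim: s => [|i s [g Pg ug]]; first by exists u.
  have [h Ph hd] := Pd g Pg i.
  exists h => // x Ux /=; rewrite /partial.
  have [_ <-] := hd x Ux; apply: near_eq_derive.
  by near=> y; apply: ug; near: y; exact: open_nbhs_nbhs.
move=> s x Ux; have [g Pg ug] := H s.
have ugn : {near x, partials s u =1 g}.
  by near=> y; apply: ug; near: y; exact: open_nbhs_nbhs.
have gun : {near x, g =1 partials s u}.
  by near=> y; apply/esym/ug; near: y; exact: open_nbhs_nbhs.
split.
  have gx := Pc g Pg x Ux.
  suff : partials s u y @[y --> x] --> partials s u x by [].
  by rewrite ug//; exact: cvg_trans (near_eq_cvg gun) gx.
move=> i; have [h Ph hd] := Pd g Pg i.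
by have [] := near_eq_is_derive gun (hd x Ux).
Unshelve. all: by end_near. Qed.

(** The variable [|x|^2] is chosen because it is a polynomial in the coordinates: functions of it
    generate, together with the coordinates, an algebra stable under partial derivatives. *)
Lemma smooth_on_radial (U : set R) (F : R -> R) : open U -> smooth1 U F ->
  smooth_on [set x : 'rV[R]_d | U (sqn x)] (fun x => F (sqn x)).
Proof.
move=> oU [P Pd PF].
pose G (f : 'rV[R]_d -> R) := (exists i, f = fun x => x ord0 i) \/
  exists2 g, P g & f = fun x => g (sqn x).
apply: (@smooth_on_dclosed _ (salg G)).
- by apply: open_comp => // x _; exact: sqn_cont.
- move=> f fG i; apply: salg_der f fG => _ [[j ->]|[g Pg ->]].
    by exists (fun=> (i == j)%:R); [exact: salg_cst|move=> x _; exact: coord_der].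
  have [g' Pg' gd] := Pd g Pg.
  exists (fun x => g' (sqn x) * (2 * x ord0 i)).
    apply: salgM; first by apply: salg_gen; right; exists g'.
    by apply: salgM; [exact: salg_cst|apply: salg_gen; left; exists i].
  by move=> x Ux; apply: der_comp_dir; [exact: gd|exact: sqn_der].
- apply: salg_cont => _ [[j ->]|[g Pg ->]] x Ux; first exact: coord_cont.
  have [g' Pg' gd] := Pd g Pg.
  by apply: ct_comp; [exact: der_cont (gd _ Ux)|exact: sqn_cont].
- by apply: salg_gen; right; exists F.
Qed.

Lemma partials_out s u (A : R) : (forall x, A < enorm x -> u x = 0) ->
  forall x, A < enorm x -> partials s u x = 0.
Proof.
move=> uA; elim: s => //= i s ih x Ax; rewrite /partial.
have oU : open [set x : 'rV[R]_d | A < enorm x].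
  by apply: (@open_comp _ _ (@enorm R d) [set t | A < t]) => [y _|]; [exact: enorm_cont|exact: open_gt].
rewrite (@near_eq_derive _ _ _ (partials s u) (fun=> 0)).
  by have [_ ->] := der_cst (0 : R) x (e_ i).
by near=> y; apply: ih; near: y; exact: open_nbhs_nbhs.
Unshelve. all: by end_near. Qed.

Lemma cc_test_function u (A : R) : smooth_on setT u -> (forall x, A < enorm x -> u x = 0) ->
  test_function u.
Proof.
move=> us uA; split => //; apply: (subclosed_compact _ (@enorm_ball_compact R d A)); first exact: closed_closure.
rewrite (_ : [set x | enorm x <= A] = closure [set x | enorm x <= A]).
  apply: closure_subset => x /= ux; rewrite leNgt; apply/negP => /uA; exact/eqP.
apply/closure_id; apply: (@preimage_closed _ _ (@enorm R d) [set t | t <= A]); last exact: closed_le.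
by move=> x _; exact: enorm_cont.
Qed.

Lemma cc_schwartz u (A : R) : smooth_on setT u -> (forall x, A < enorm x -> u x = 0) ->
  schwartz u.
Proof.
move=> us uA; split => // k s.
have fc : continuous (fun x => enorm x ^+ k * partials s u x).
  by apply: ctAll => x; apply: ctM; [ct; exact: enorm_cont|exact: (us s x I).1].
have [|M M0 HM] := @cc_bounded _ _ _ A fc.
  by move=> x Ax; rewrite (@partials_out s u A)// mulr0.
exists M => x; have := HM x; rewrite normrM ger0_norm// exprn_ge0//; exact: enorm_ge0.
Qed.

End smooth_radial.

(** * Existence *)

Section scaled_ground_state.
Context {R : realType}.

(* [u(|x|^(1-a))] solves the equation in dimension [N (1-a)] *)
Record ground_profile (N a omega p : R) (u w : R -> R) (C k : R) : Prop := GroundProfile {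
  gp_C : 0 < C;
  gp_k : 0 < k;
  gp_cont : continuous u;
  gp_contw : continuous w;
  gp_gt0 : forall s : R, 0 < u s;
  gp_der : forall s : R, 0 < s -> isder s (1 : R) u (w s);
  gp_derw : forall s : R, 0 < s ->
    isder s (1 : R) w ((1 - N) / s * w s + (omega * u s - u s `^ p) / (1 - a) ^+ 2);
  gp_le : forall s : R, 0 <= s -> u s <= C * expR (- (k * s));
  gp_lew : forall s : R, 0 <= s -> `|w s| <= C * expR (- (k * s));
  gp_lim : forall e : R, 0 < e -> exists2 t : R, 0 < t & forall s : R, 0 < s < t ->
    `|w s / s - (omega * u 0 - u 0 `^ p) / ((1 - a) ^+ 2 * N)| <= e }.

(** Scaling [u s = A * v (b s)], with [b^2 = omega / ((1 - a)^2 mu)] to match the linear term and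
    [A^(p-1) = omega / mu] to match the power. *)
Lemma ground_profile_exists (N a omega p : R) : a < 1 -> 0 < omega ->
  1 <= N -> 1 < p -> N * (p - 1) < 2 * (p + 1) ->
  exists u w C k, ground_profile N a omega p u w C k.
Proof.
move=> a1 om0 N1 p1 Np.
have [mu [v [w [C [k [mu0 C0 k0 [vc v1 v0 vd [wd vle wle ws wlim]]]]]]]] := ground_state N1 p1 Np.
have ka0 : 0 < (1 - a) ^+ 2 by rewrite exprn_gt0// subr_gt0.
have [A [A0 AE]] : exists A : R, 0 < A /\ A `^ p = A * (omega / mu).
  exists ((omega / mu) `^ (p - 1)^-1); split; first by rewrite powR_gt0// divr_gt0.
  have om : 0 < omega / mu by rewrite divr_gt0.
  rewrite -powRrM -[X in _ = _ * X](@powRr1 _ (omega / mu)) ?ltW// -powRB_gt0//.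
  by congr (_ `^ _); field; rewrite gt_eqF// subr_gt0.
have [b [b0 bE]] : exists b : R, 0 < b /\ b ^+ 2 = omega / ((1 - a) ^+ 2 * mu).
  have h : 0 < omega / ((1 - a) ^+ 2 * mu) by rewrite divr_gt0// mulr_gt0.
  by exists (Num.sqrt (omega / ((1 - a) ^+ 2 * mu))); rewrite sqrtr_gt0 sqr_sqrtr// ltW.
pose u (s : R) := A * v (b * s).
(* The derivative is set to 0 on the left of the origin, where [w] is not controlled; the bound
   [|w s| <= s] makes this extension continuous. *)
pose z (s : R) := if s <= 0 then 0 else A * b * w (b * s).
have zE (s : R) : 0 < s -> z s = A * b * w (b * s) by move=> s0; rewrite /z ifF//; apply/negP; lra.
have bs (s : R) : 0 < s -> 0 < b * s by move=> ?; exact: mulr_gt0.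
have dsc (f : R -> R) (s c : R) : isder (b * s) (1 : R) f c -> isder s (1 : R) (fun t => f (b * t)) (c * b).
  move=> fd; apply: der_comp fd _; rewrite (_ : *%R b = fun t => b * t)//.
  by eapply isder_eq; [der|ringb].
have ud (s : R) : 0 < s -> isder s (1 : R) u (z s).
  move=> s0; rewrite zE// /u; eapply isder_eq.
    by der; apply: dsc; apply: vd; exact: bs.
  by ringb.
have uE (s : R) : u s `^ p = A * (omega / mu) * v (b * s) `^ p.
  by rewrite /u powRM ?ltW// AE.
have zd (s : R) : 0 < s ->
    isder s (1 : R) z ((1 - N) / s * z s + (omega * u s - u s `^ p) / (1 - a) ^+ 2).
  move=> s0; apply: (@der_pos _ (fun s => A * b * w (b * s))) => //.
    by move=> t t0; rewrite zE.
  eapply isder_eq.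
    by der; apply: dsc; apply: wd; exact: bs.
  cbv beta; rewrite zE// uE /u mulr0 addr0.
  have -> : omega * (A * v (b * s)) = (1 - a) ^+ 2 * mu * b ^+ 2 * (A * v (b * s)).
    by rewrite bE; congr (_ * _); field; rewrite !gt_eqF// subr_gt0.
  have -> : omega / mu = (1 - a) ^+ 2 * b ^+ 2.
    by rewrite bE; field; rewrite !gt_eqF// subr_gt0.
  by field; rewrite !gt_eqF// subr_gt0.
have zle (s : R) : 0 < s -> `|z s| <= A * b * (b * s).
  move=> s0; have := ws _ (bs _ s0); rewrite zE// normrM (gtr0_norm (mulr_gt0 A0 b0)) => h.
  by apply: ler_wpM2l h; nn.
exists u, z, (A * C * (1 + b)), (k * b); split.
- by nn.
- by nn.
- apply: ctAll => s; rewrite /u; ct; apply: ct_comp; [exact: vc|exact: mulrl_continuous].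
- apply: ctAll => s; have [s0|s0|->] := ltgtP s 0.
  + by apply: (@ct_neg _ (fun=> 0)) s0 _; [move=> t t0; rewrite /z ltW|exact: ct_cst].
  + exact: der_cont (zd _ s0).
  + apply: (@ct0_lin _ _ (A * b * b)); first by rewrite /z lexx.
    move=> t _; have [t0|t0] := leP t 0; first by rewrite /z t0 normr0; nn.
    by rewrite -mulrA (gtr0_norm t0); exact: zle.
- by move=> s; rewrite /u mulr_gt0.
- exact: ud.
- exact: zd.
- move=> s s0; rewrite /u.
  have -> : A * C * (1 + b) * expR (- (k * b * s)) = A * (C * expR (- k * (b * s))) * (1 + b).
    by rewrite -!mulrA mulNr; ring.
  apply: (@le_trans _ _ (A * (C * expR (- k * (b * s))))).
    by apply: ler_wpM2l; [nn|apply: vle; nn].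
  by apply: ler_peMr; [nn|rewrite lerDl ltW].
- move=> s; rewrite le_eqVlt => /predU1P[<-|s0].
    by rewrite /z lexx normr0; nn.
  have -> : A * C * (1 + b) * expR (- (k * b * s)) = A * (C * expR (- k * (b * s))) * (1 + b).
    by rewrite -!mulrA mulNr; ring.
  rewrite zE// normrM (gtr0_norm (mulr_gt0 A0 b0)).
  apply: (@le_trans _ _ (A * b * (C * expR (- k * (b * s))))).
    by apply: ler_wpM2l; [nn|apply: wle; exact: bs].
  have -> : A * b * (C * expR (- k * (b * s))) = A * (C * expR (- k * (b * s))) * b by ring.
  by apply: ler_wpM2l; [nn|rewrite lerDr ler01].
- move=> e e0.
  have Ab0 : 0 < A * b ^+ 2 by rewrite mulr_gt0// exprn_gt0.
  have [t t0 Ht] := wlim (e / (A * b ^+ 2)) (divr_gt0 e0 Ab0).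
  exists (t / b); first exact: divr_gt0.
  move=> s /andP[s0 st].
  have bst : b * s < t by rewrite mulrC -ltr_pdivlMr.
  have := Ht (b * s); rewrite bs// bst => /(_ isT) h.
  suff -> : z s / s - (omega * u 0 - u 0 `^ p) / ((1 - a) ^+ 2 * N) =
      A * b ^+ 2 * (w (b * s) / (b * s) + (1 - mu) / N).
    by rewrite normrM (gtr0_norm Ab0) mulrC -ler_pdivlMr.
  rewrite zE// uE /u mulr0 v1 // powR1 mulr1.
  have -> : omega * A = (1 - a) ^+ 2 * mu * b ^+ 2 * A.
    by rewrite bE; congr (_ * _); field; rewrite !gt_eqF// subr_gt0.
  have -> : omega / mu = (1 - a) ^+ 2 * b ^+ 2.
    by rewrite bE; field; rewrite !gt_eqF// subr_gt0.
  have N0 : 0 < N by apply: lt_le_trans N1.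
  by field; rewrite !gt_eqF// subr_gt0.
Qed.

End scaled_ground_state.

(** * Smooth cutoffs with a scale parameter *)

Section cutoffs.
Context {R : realType}.
Implicit Types (t rho e : R).

Lemma flat_le (k : nat) t : flat k t <= k%:R ^+ k.
Proof.
rewrite /flat; case: ifPn => [_|]; first by rewrite exprn_ge0.
rewrite -ltNge => t0; rewrite expRN ler_pdivrMr ?expR_gt0//.
by apply: expR_ge_pow; rewrite invr_ge0 ltW.
Qed.

Lemma flat_gt0 (k : nat) t : 0 < t -> 0 < flat k t.
Proof.
by move=> t0; rewrite /flat leNgt t0/= mulr_gt0 ?expR_gt0// exprn_gt0// invr_gt0.
Qed.

Lemma bump_ge0 t0 rho t : 0 <= bump t0 rho t.
Proof. exact: flat_ge0. Qed.

Lemma bump_eq0 t0 rho t : 0 < rho -> rho <= `|t - t0| -> bump t0 rho t = 0.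
Proof.
move=> r0 h; rewrite /bump /flat ifT// subr_le0 -real_normK ?num_real//.
by rewrite exprn_ege1// normrM normfV (gtr0_norm r0) ler_pdivlMr// mul1r.
Qed.

Lemma bump'_eq0 t0 rho t : 0 < rho -> rho <= `|t - t0| -> bump' t0 rho t = 0.
Proof.
move=> r0 h; rewrite /bump' /flat ifT ?mul0r// subr_le0 -real_normK ?num_real//.
by rewrite exprn_ege1// normrM normfV (gtr0_norm r0) ler_pdivlMr// mul1r.
Qed.

Lemma bump_gt0 t0 rho t : `|t - t0| < rho -> 0 < bump t0 rho t.
Proof.
move=> h; have r0 : 0 < rho by apply: le_lt_trans h.
apply: flat_gt0; rewrite subr_gt0 -real_normK ?num_real//.
by rewrite exprn_ilt1// normrM normfV (gtr0_norm r0) ltr_pdivrMr// mul1r.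
Qed.

Lemma bump_cont t0 rho : continuous (bump t0 rho).
Proof. by apply: ctAll => t; exact: der_cont (bump_der _ _ _). Qed.

Lemma flat_cont k : continuous (@flat R k).
Proof. by apply: ctAll => t; exact: der_cont (flat_der _ _). Qed.

Lemma bump'_cont t0 rho : continuous (bump' t0 rho).
Proof.
apply: ctAll => t; rewrite /bump'; ct.
by apply: ct_comp; [exact: flat_cont|ct].
Qed.

(** The factor [expR 1] compensates the central value [expR (-1)] of the bump. There is no plateau:
    the cutoff only tends to 1 pointwise as its parameter tends to 0, which is enough for dominated
    convergence, and at parameter 0 it is the constant 1. *)
Definition cutoff e t : R := expR 1 * bump 0 1 (e * t).
Definition cutoff' e t : R := expR 1 * (bump' 0 1 (e * t) * e).

Lemma der_mull (f : R -> R) (e t c : R) : isder (e * t) (1 : R) f c ->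
  isder t (1 : R) (fun s => f (e * s)) (c * e).
Proof.
move=> fc; apply: (@der_comp _ f (fun s => e * s)) => //.
by eapply isder_eq; [der|ringb].
Qed.

Lemma cutoff_der e t : isder t (1 : R) (cutoff e) (cutoff' e t).
Proof.
by rewrite /cutoff; eapply isder_eq; [der; apply: (@der_mull (bump 0 1)); exact: bump_der|rewrite /cutoff'; ringb].
Qed.

Lemma smooth1_cutoff U e : smooth1 U (cutoff e).
Proof.
have -> : cutoff e = fun t => expR 1 * bump 0 (e^-1) t.
  by apply/funext => t; rewrite /cutoff /bump !subr0 invrK invr1 mulr1 mulrC mulrC [t * e]mulrC.
apply: smooth1M (smooth1_bump _ _ _).
apply: (@smooth1_salg _ _ (fun=> False)) => //; exact: salg_cst.
Qed.

Lemma cutoff_ge0 e t : 0 <= cutoff e t.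
Proof. by rewrite mulr_ge0 ?expR_ge0// bump_ge0. Qed.

Lemma cutoff_le e t : cutoff e t <= expR 1.
Proof. by rewrite ler_piMr ?expR_ge0// (le_trans (flat_le _ _))// expr0. Qed.

Lemma cutoff'_le e t : 0 <= e <= 1 -> `|cutoff' e t| <= 8 * expR 1.
Proof.
move=> /andP[e0 e1]; rewrite /cutoff' normrM ger0_norm ?expR_ge0// mulrC ler_wpM2r ?expR_ge0//.
rewrite normrM (ger0_norm e0).
apply: (@le_trans _ _ (8 * e)); last by rewrite ler_piMr.
rewrite ler_wpM2r//; have [h|h] := leP 1 (`|e * t - 0|).
  by rewrite bump'_eq0// normr0.
rewrite /bump' normrM ger0_norm ?flat_ge0// invr1 !mulr1 normrN normrM (ger0_norm (_ : 0 <= 2))//.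
have := flat_le 2 (1 - (e * t - 0) ^+ 2).
have := @flat_ge0 R 2 (1 - (e * t - 0) ^+ 2).
move: (flat _ _) => F F0 F4.
apply: (@le_trans _ _ (4 * (2 * 1))); last by rewrite mulr1 -natrM.
by apply: ler_pM; [exact: F0|rewrite mulr_ge0|rewrite (le_trans F4)// -natrX|rewrite ler_wpM2l// ltW].
Qed.

Lemma cutoff0 t : cutoff 0 t = 1.
Proof.
rewrite /cutoff mul0r /bump subrr mul0r expr0n/= subr0 /flat ifF; last by apply/negP; lra.
by rewrite expr0 mul1r invr1 expRN divff// gt_eqF// expR_gt0.
Qed.

Lemma cutoff'0 t : cutoff' 0 t = 0.
Proof. by rewrite /cutoff' !mulr0. Qed.

Lemma cutoff_out e t : 0 < e -> e^-1 <= t -> cutoff e t = 0.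
Proof.
move=> e0 et; rewrite /cutoff bump_eq0 ?mulr0// subr0.
have et1 : 1 <= e * t by rewrite mulrC -ler_pdivrMr// div1r.
by rewrite (le_trans et1) ?ler_norm.
Qed.

End cutoffs.

(** * The regularised profile as a function of [t = |x|^2] *)

Section profile_line.
Context {R : realType}.
Variables (N a omega p : R) (u w : R -> R) (C k : R).
Hypothesis gp : ground_profile N a omega p u w C k.
Hypothesis a01 : 0 <= a < 1.
Let b := (1 - a) / 2.
Implicit Types (t e : R).

Let b0 : 0 < b. Proof. by move: a01 => /andP[_ ?]; rewrite /b divr_gt0// subr_gt0. Qed.

Definition prof e t : R := u ((t + e) `^ ((1 - a) / 2)).
Definition prof' e t : R :=
  w ((t + e) `^ ((1 - a) / 2)) * ((1 - a) / 2 * (t + e) `^ ((1 - a) / 2 - 1)).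

Lemma prof_der e t : 0 < t + e -> isder t (1 : R) (prof e) (prof' e t).
Proof.
move=> te; eapply isder_eq.
  by apply: der_comp; [apply: (gp_der gp); exact: powR_gt0|der].
by rewrite /prof' -/b; ringb.
Qed.

(** By the equation, the derivative of [w] is expressed through [w], [u] and [u^p] with real [p].
    The generators are therefore all real powers of [t + e], all real powers of the positive
    function [u], and [w]. *)
Lemma smooth1_prof e : smooth1 [set t | - e < t] (prof e).
Proof.
pose G (f : R -> R) := (exists c, f = fun t => (t + e) `^ c) \/
  (exists c, f = fun t => u ((t + e) `^ b) `^ c) \/ f = fun t => w ((t + e) `^ b).
have Gt c : salg G (fun t => (t + e) `^ c) by apply: salg_gen; left; exists c.
have Gu c : salg G (fun t => u ((t + e) `^ b) `^ c) by apply: salg_gen; right; left; exists c.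
have Gw : salg G (fun t => w ((t + e) `^ b)) by apply: salg_gen; right; right.
have uE t : u ((t + e) `^ b) `^ 1 = u ((t + e) `^ b) by rewrite powRr1// ltW// (gp_gt0 gp).
have -> : prof e = fun t => u ((t + e) `^ b) `^ 1 by apply/funext => t; rewrite uE.
apply: (@smooth1_salg _ _ G _ _ (Gu 1)) => g [[c ->]|[[c ->]|->]].
- exists (fun t => c * (t + e) `^ (c - 1)); first by apply: salgM => //; exact: salg_cst.
  by move=> t /= te; eapply isder_eq; [der; lra|ringb].
- exists (fun t => c * u ((t + e) `^ b) `^ (c - 1) * (w ((t + e) `^ b) * (b * (t + e) `^ (b - 1)))).
    by do ![apply: salgM => //; try exact: salg_cst].
  move=> t /= te; apply: (@der_powR _ (fun t => u ((t + e) `^ b))); first exact: (gp_gt0 gp).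
  by apply: prof_der; lra.
- exists (fun t => ((1 - N) * (t + e) `^ (- b) * w ((t + e) `^ b) +
     (omega * u ((t + e) `^ b) `^ 1 + (- 1) * u ((t + e) `^ b) `^ p) * ((1 - a) ^+ 2)^-1) *
     (b * (t + e) `^ (b - 1))).
    by do ![apply: salgM => //; try exact: salg_cst | apply: salgD].
  move=> t /= te; have te0 : 0 < t + e by lra.
  eapply isder_eq.
    by apply: der_comp; [apply: (gp_derw gp); exact: powR_gt0|der].
  cbv beta; rewrite uE powRN; ring.
Qed.

Definition approx e t : R := prof e t * cutoff e t.
Definition approx' e t : R := prof e t * cutoff' e t + cutoff e t * prof' e t.

Lemma approx_der e t : 0 < t + e -> isder t (1 : R) (approx e) (approx' e t).
Proof. by move=> te; apply: derM; [exact: prof_der|exact: cutoff_der]. Qed.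

Lemma smooth1_approx e : smooth1 [set t | - e < t] (approx e).
Proof. by apply: smooth1M; [exact: smooth1_prof|exact: smooth1_cutoff]. Qed.

(* the integrand of the squared [H^{1,a}] distance, as a function of [t = |x|^2] *)
Definition gap e t : R :=
  t `^ a * (2 * (approx' e t - prof' 0 t)) ^+ 2 * t + (approx e t - prof 0 t) ^+ 2.

Lemma gap_ge0 e t : 0 <= t -> 0 <= gap e t.
Proof. by move=> t0; rewrite /gap; nn. Qed.

Let E t := expR (- (k * t `^ b)).

Lemma prof_le e t : 0 <= e -> 0 <= t -> prof e t <= C * E t.
Proof.
move=> e0 t0; apply: le_trans (gp_le gp (powR_ge0 _ _)) _.
have kp := gp_k gp; have Cp := gp_C gp.
rewrite /E; apply: ler_wpM2l; first exact: ltW.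
rewrite ler_expR lerN2; apply: ler_wpM2l; first exact: ltW.
by rewrite ge0_ler_powR ?nnegrE ?addr_ge0 ?lerDl// ltW.
Qed.

(** The exponent is that of the square root of [t^a * t], the factor accompanying the squared
    derivative in [gap]. As [(1 - a) / 2 - 1 = - (1 + a) / 2], it compensates the singular power of
    [t + e] uniformly in [e]. *)
Lemma prof'_le e t : 0 <= e -> 0 < t -> t `^ ((1 + a) / 2) * `|prof' e t| <= C * E t.
Proof.
move=> e0 t0; have te : 0 < t + e by lra.
have kp := gp_k gp; have Cp := gp_C gp.
have h1 : `|w ((t + e) `^ b)| <= C * E t.
  apply: le_trans (gp_lew gp (powR_ge0 _ _)) _.
  rewrite /E; apply: ler_wpM2l; first exact: ltW.
rewrite ler_expR lerN2; apply: ler_wpM2l; first exact: ltW.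
  by rewrite ge0_ler_powR ?nnegrE ?addr_ge0 ?lerDl// ltW.
have h2 : t `^ ((1 + a) / 2) * (t + e) `^ (b - 1) <= 1.
  have -> : b - 1 = - ((1 + a) / 2) by rewrite /b; field.
  rewrite -[leRHS](powRVN ((1 + a) / 2) te) ler_wpM2r ?powR_ge0//.
  move: a01 => /andP[a0 _].
  by rewrite ge0_ler_powR ?nnegrE ?divr_ge0 ?addr_ge0 ?lerDl// ltW.
have q0 : 0 <= b * (t + e) `^ (b - 1) := mulr_ge0 (ltW b0) (powR_ge0 _ _).
rewrite /prof' -/b normrM (ger0_norm q0).
have -> : t `^ ((1 + a) / 2) * (`|w ((t + e) `^ b)| * (b * (t + e) `^ (b - 1))) =
  `|w ((t + e) `^ b)| * (t `^ ((1 + a) / 2) * (t + e) `^ (b - 1)) * b by ring.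
have b1 : b <= 1 by move: a01 => /andP[a0 _]; rewrite /b; lra.
apply: le_trans h1.
rewrite -[leRHS]mulr1; apply: ler_pM => //; try by nn.
  exact: ltW.
by rewrite -[leRHS]mulr1 ler_wpM2l.
Qed.

(** The majorant for dominated convergence, uniform in [e]. The factor [1 + t] dominates the square
    root of the weight where it multiplies the derivative of the cutoff, which is only bounded. *)
Lemma gap_le : exists2 K, 0 < K & forall e t, 0 <= e <= 1 -> 0 <= t ->
  gap e t <= K * (E t * (1 + t)) ^+ 2.
Proof.
have Cp := gp_C gp; pose c : R := 8 * expR 1.
have c1 : expR 1 <= c by rewrite ler_peMl ?expR_ge0// ler1n.
have c0 : 0 < c by rewrite mulr_gt0// expR_gt0.
exists (C ^+ 2 * (4 * (2 * c + 1) ^+ 2 + (c + 1) ^+ 2)).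
  by rewrite mulr_gt0 ?exprn_gt0// addr_gt0// ?mulr_gt0 ?exprn_gt0// addr_gt0 ?mulr_gt0.
move=> e t e01 t0; have e0 : 0 <= e by case/andP: e01.
(* [P] is the square root of [t^a * t], taken as 0 at [t = 0], where [prof'_le] does not apply. *)
have [P [P0 P2 P1 PE]] : exists P, [/\ 0 <= P, t `^ a * t = P ^+ 2, P <= 1 + t &
    forall e, 0 <= e -> P * `|prof' e t| <= C * E t].
  move: t0; rewrite le_eqVlt => /predU1P[<-|t0].
    exists 0; rewrite mulr0 expr0n/= addr0 ler01; split => // e' _.
    by rewrite mul0r; rewrite mulr_ge0 ?expR_ge0 ?ltW.
  exists (t `^ ((1 + a) / 2)); split; [exact: powR_ge0| | |by move=> e' e'0; exact: prof'_le].
    rewrite expr2 -powRB_gt0// -[X in _ * X = _]powRr1 ?ltW// -powRB_gt0//.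
    by congr (_ `^ _); field.
  move: a01 => /andP[a0 a1].
  have [t1|t1] := leP t 1.
    apply: (@le_trans _ _ 1); last by rewrite lerDl ltW.
    have one (q : R) : 1 `^ q = 1 :> R by rewrite powR1.
    rewrite -[leRHS](one ((1 + a) / 2)).
    by apply: ge0_ler_powR; rewrite ?nnegrE ?ler01 ?(ltW t0)// divr_ge0// addr_ge0.
  apply: (@le_trans _ _ (t `^ 1)); last by rewrite powRr1 ?lerDr ?ltW.
  by apply: ler_powR; [exact: ltW|lra].
have E0 : 0 <= E t by exact: expR_ge0.
have h1 := prof_le e0 t0.
have h2 := prof_le (lexx 0) t0.
have u0 e' : 0 <= prof e' t by rewrite ltW// (gp_gt0 gp).
have h3 := PE e e0; have h4 := PE 0 (lexx 0).
have h5 := cutoff_le e t; have h6 := cutoff_ge0 e t; have h7 := cutoff'_le t e01.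
have A1 : P * `|approx' e t - prof' 0 t| <= C * E t * ((2 * c + 1) * (1 + t)).
  have CE : 0 <= C * E t by rewrite mulr_ge0// ltW.
  apply: (@le_trans _ _ (C * E t * (1 + t) * c + c * (C * E t) + C * E t)).
    apply: (@le_trans _ _ (P * (`|prof e t * cutoff' e t| + `|cutoff e t * prof' e t| + `|prof' 0 t|))).
      rewrite ler_wpM2l// (le_trans (ler_normB _ _))// lerD2r; exact: ler_normD.
    rewrite (normrM (prof e t)) (normrM (cutoff e t)) (ger0_norm (u0 e)) (ger0_norm h6) !mulrDr; apply: lerD => //; apply: lerD.
      rewrite mulrA [P * _]mulrC; apply: ler_pM => //; first by rewrite mulr_ge0.
      by rewrite -mulrDr; apply: ler_pM.
    by rewrite mulrCA; apply: ler_pM => //; [rewrite mulr_ge0|exact: le_trans c1].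
  move: (C * E t) CE => D D0.
  have : 0 <= D * t by rewrite mulr_ge0.
  have : 0 <= D * t * c by rewrite !mulr_ge0// ltW.
  by move=> ? ?; nra.
have A2 : `|approx e t - prof 0 t| <= C * E t * ((c + 1) * (1 + t)).
  have CE : 0 <= C * E t by rewrite mulr_ge0// ltW.
  apply: (@le_trans _ _ (C * E t * c + C * E t)).
    rewrite (le_trans (ler_normB _ _))// (ger0_norm (u0 0)); apply: lerD => //.
    rewrite (normrM (prof e t)) (ger0_norm (u0 e)) (ger0_norm h6); apply: ler_pM => //; exact: le_trans c1.
  move: (C * E t) CE => D D0.
  have : 0 <= D * t by rewrite mulr_ge0.
  have : 0 <= D * t * c by rewrite !mulr_ge0// ltW.
  by move=> ? ?; nra.
have -> : gap e t = 4 * (P * `|approx' e t - prof' 0 t|) ^+ 2 + `|approx e t - prof 0 t| ^+ 2.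
  by rewrite /gap !exprMn !real_normK ?num_real// -P2; ring.
have -> : C ^+ 2 * (4 * (2 * c + 1) ^+ 2 + (c + 1) ^+ 2) * (E t * (1 + t)) ^+ 2 =
  4 * (C * E t * ((2 * c + 1) * (1 + t))) ^+ 2 + (C * E t * ((c + 1) * (1 + t))) ^+ 2 by ring.
apply: lerD; first rewrite ler_wpM2l//.
  have A0 : 0 <= P * `|approx' e t - prof' 0 t| by rewrite mulr_ge0.
  by rewrite lerXn2r ?nnegrE ?(le_trans A0 A1).
by rewrite lerXn2r ?nnegrE ?(le_trans (normr_ge0 _) A2).
Qed.

Lemma gap_cvg t : 0 <= t -> gap (@harmonic R n) t @[n --> \oo] --> (0 : R).
Proof.
move=> t0.
have h0 : harmonic n @[n --> \oo] --> (0 : R) := @cvg_harmonic R.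
have cmp (f : R -> R) : {for 0, continuous f} -> f (harmonic n) @[n --> \oo] --> f 0.
  by move=> fc; apply: (@cvg_comp _ _ _ (@harmonic R) f _ _ _ h0 fc).
have ctc : (fun e => cutoff e t) (harmonic n) @[n --> \oo] --> (1 : R).
  rewrite -(cutoff0 t); apply: (cmp (fun e => cutoff e t)); rewrite /cutoff; ct.
  by apply: ct_comp; [exact: bump_cont|ct].
have ctc' : (fun e => cutoff' e t) (harmonic n) @[n --> \oo] --> (0 : R).
  rewrite -(cutoff'0 t); apply: (cmp (fun e => cutoff' e t)); rewrite /cutoff'; ct.
  by apply: ct_comp; [exact: bump'_cont|ct].
have pc : prof (harmonic n) t @[n --> \oo] --> prof 0 t.
  have -> : (fun n => prof (harmonic n) t) = (fun n => u (Num.max (t + harmonic n) 0 `^ b)).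
    by apply/funext => n; rewrite /prof max_l// addr_ge0// /harmonic/= invr_ge0.
  have -> : prof 0 t = u (Num.max (t + 0) 0 `^ b) by rewrite /prof max_l ?addr0.
  apply: (cmp (fun e => u (Num.max (t + e) 0 `^ b))).
  apply: ct_comp; first exact: (gp_cont gp).
  apply: (@ct_comp _ _ (fun s => Num.max s 0 `^ b)); first exact: powR_max_cont (ltW b0) _.
  by apply: (@ctD _ _ (fun=> t) id); [exact: ct_cst|exact: cvg_id].
have ac : approx (harmonic n) t @[n --> \oo] --> prof 0 t.
  by rewrite -[prof 0 t]mulr1; apply: cvgM.
have z2 : (approx (harmonic n) t - prof 0 t) ^+ 2 @[n --> \oo] --> (0 : R).
  have z : approx (harmonic n) t - prof 0 t @[n --> \oo] --> (0 : R).
    by have := cvgB ac (cvg_cst (prof 0 t)); rewrite subrr; apply.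
  by have := cvgM z z; rewrite mulr0; apply.
have z1 : t `^ a * (2 * (approx' (harmonic n) t - prof' 0 t)) ^+ 2 * t @[n --> \oo] --> (0 : R).
  move: t0; rewrite le_eqVlt => /predU1P[<-|t0].
    by under eq_fun do rewrite mulr0; exact: cvg_cst.
  have p'c : prof' (harmonic n) t @[n --> \oo] --> prof' 0 t.
    apply: (cmp (fun e => prof' e t)); rewrite /prof'; ct; rewrite ?addr0//.
    by apply: ct_comp; [exact: (gp_contw gp)|ct; rewrite addr0].
  have a'c : approx' (harmonic n) t @[n --> \oo] --> prof' 0 t.
    by have := cvgD (cvgM pc ctc') (cvgM ctc p'c); rewrite mulr0 add0r mul1r; apply.
  have z : 2 * (approx' (harmonic n) t - prof' 0 t) @[n --> \oo] --> (0 : R).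
    by have := cvgM (cvg_cst (2 : R)) (cvgB a'c (cvg_cst (prof' 0 t))); rewrite subrr mulr0; apply.
  have := cvgM (cvgM (cvg_cst (t `^ a)) (cvgM z z)) (cvg_cst t).
  by rewrite mulr0 mulr0 mul0r; apply.
have := cvgD z1 z2; rewrite addr0; exact.
Qed.

End profile_line.

Section integral_estimates.
Context {R : realType}.

(** With [j >= m / b] one has [t^m <= (t^b)^j] for [t >= 1], and the exponential beats the power
    [j]. *)
Lemma exp_powR_le (k b : R) (m : nat) : 0 < k -> 0 < b ->
  exists2 C : R, 0 < C & forall t, 0 <= t -> (1 + t) ^+ m * expR (- (k * t `^ b)) <= C.
Proof.
move=> k0 b0.
have [j jb] : exists j : nat, m%:R / b <= j%:R.
  by exists (Num.truncn (m%:R / b)).+1; apply/ltW/truncnS_gt.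
pose C := 2 ^+ m * (1 + j%:R ^+ j / k ^+ j).
have q0 : 0 <= j%:R ^+ j / k ^+ j by rewrite divr_ge0 ?exprn_ge0// ltW.
exists C; first by rewrite mulr_gt0 ?exprn_gt0// ltr_wpDr.
move=> t t0; rewrite expRN ler_pdivrMr ?expR_gt0//.
have kt0 : 0 <= k * t `^ b by rewrite mulr_ge0 ?powR_ge0// ltW.
have e1 : 1 <= expR (k * t `^ b) by rewrite -[leLHS]expR0 ler_expR.
rewrite /C -mulrA.
have [t1|t1] := leP t 1.
  have h : (1 + t) ^+ m <= 2 ^+ m by rewrite lerXn2r ?nnegrE ?addr_ge0//; lra.
  rewrite -[leLHS]mulr1; apply: ler_pM => //; first by rewrite exprn_ge0// addr_ge0.
  by rewrite -[leLHS]mulr1; apply: ler_pM => //; rewrite lerDl.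
have tm : 0 < t by lra.
apply: (@le_trans _ _ (2 ^+ m * t ^+ m)).
  by rewrite -exprMn lerXn2r ?nnegrE ?mulr_ge0 ?addr_ge0//; lra.
rewrite ler_pM2l ?exprn_gt0//.
apply: (@le_trans _ _ ((t `^ b) ^+ j)).
  rewrite -!powR_mulrn// ?powR_ge0// -powRrM; apply: ler_powR; first exact: ltW.
  by rewrite mulrC -ler_pdivrMr.
have := expR_ge_pow j kt0.
rewrite exprMn mulrC -ler_pdivlMr ?exprn_gt0// => /le_trans; apply.
rewrite mulrAC ler_pM2r ?expR_gt0//.
by rewrite lerDr.
Qed.

Lemma rdecay_ge d (x : 'rV[R]_d) : 1 <= (1 + sqn x) ^+ d * rdecay x.
Proof.
have -> : (1 + sqn x) ^+ d = \prod_(i < d) (1 + sqn x) by rewrite prodr_const card_ord.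
rewrite /rdecay -big_split/=.
rewrite -[leLHS](_ : \prod_(i < d) (1 : R) = 1); last by rewrite big1.
apply: ler_prod => i _; rewrite ler01/= ler_pdivlMr ?mul1r; last first.
  by rewrite ltr_pwDl// sqr_ge0.
rewrite lerD2l -real_normK ?num_real// -enorm_sqr.
by rewrite lerXn2r ?nnegrE ?enorm_ge0// coord_le_enorm.
Qed.

Lemma cvg_sqrt_integral d (Q : nat -> 'rV[R]_d -> R) (C : R) :
  (forall n, measurable_fun setT (Q n : 'rV[R]_d -> measurableTypeR R)) ->
  (forall n x, 0 <= Q n x <= C * rdecay x) ->
  (forall x, Q n x @[n --> \oo] --> (0 : R)) ->
  ((\int[lebesgue_rV d]_x (Q n x)%:E) `^ 2^-1)%E @[n --> \oo] --> 0%E.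
Proof.
move=> mQ QC Q0.
have Qi n : (lebesgue_rV d).-integrable setT (EFin \o Q n).
  apply: (@le_rdecay_integrable R d (Q n) C) => // x.
  by have /andP[h1 h2] := QC n x; rewrite ger0_norm.
have mQ' n : measurable_fun setT (EFin \o Q n) by apply/measurable_EFinP; exact: mQ.
have Q0' : {ae lebesgue_rV d, forall x, setT x -> (fun n => (EFin \o Q n) x) @ \oo --> cst 0%E x}.
  by apply: aeW => x _; apply/cvg_EFin; [exact: nearW|exact: Q0].
have QC' : {ae lebesgue_rV d, forall x (n : nat), setT x ->
    (`|(EFin \o Q n) x| <= (EFin \o (fun x => (C * rdecay x)%R)) x)%E}.
  by apply: aeW => x n _ /=; rewrite lee_fin; have /andP[h1 h2] := QC n x; rewrite ger0_norm.
have iC : (lebesgue_rV d).-integrable setT (EFin \o (fun x => C * rdecay x)).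
  by have := integrableZl measurableT C (rdecay_integrable d).
have [_ _] := dominated_convergence measurableT mQ' (measurable_cst _) Q0' iC QC'.
rewrite integral0 => H.
have Qf n : (\int[lebesgue_rV d]_x (Q n x)%:E)%E = (fine (\int[lebesgue_rV d]_x (Q n x)%:E))%:E.
  by rewrite fineK//; exact: (integrable_fin_num measurableT (Qi n)).
have Qf0 n : 0 <= fine (\int[lebesgue_rV d]_x (Q n x)%:E)%E.
  by apply: fine_ge0; apply: integral_ge0 => x _; rewrite lee_fin; case/andP: (QC n x).
have Hf : fine (\int[lebesgue_rV d]_x (Q n x)%:E)%E @[n --> \oo] --> (0 : R).
  exact: fine_cvg H.
have -> : (fun n => (\int[lebesgue_rV d]_x (Q n x)%:E) `^ 2^-1)%E =
    (fun n => (Num.max (fine (\int[lebesgue_rV d]_x (Q n x)%:E)%E) 0 `^ 2^-1)%:E).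
  by apply/funext => n; rewrite max_l// Qf poweR_EFin.
apply/cvg_EFin; first exact: nearW.
have h2 : 0 <= 2^-1 :> R by rewrite invr_ge0.
have := @cvg_comp _ _ _ _ (fun s : R => Num.max s 0 `^ 2^-1) _ _ _ Hf (powR_max_cont h2 (x := 0)).
by rewrite maxxx powR0 ?invr_eq0 ?pnatr_eq0.
Qed.

End integral_estimates.

(** * The solution in [R^d] *)

Section existence.
Context {R : realType} {d : nat}.
Variables (a omega p : R) (u w : R -> R) (C k : R).
Hypothesis gp : ground_profile (d%:R / (1 - a)) a omega p u w C k.
Hypothesis a01 : 0 <= a < 1.
Hypothesis d0 : (0 < d)%N.
Local Notation mu := (@lebesgue_rV R d).
Implicit Types (x : 'rV[R]_d) (e t r : R).

Let a1 : 0 < 1 - a. Proof. by case/andP: a01 => _; rewrite subr_gt0. Qed.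

Definition sol x : R := u (enorm x `^ (1 - a)).
Definition sol_grad x : 'rV[R]_d := (2 * prof' a w 0 (sqn x)) *: x.

Lemma sqn_powR x r : sqn x `^ r = enorm x `^ (2 * r).
Proof. by rewrite -enorm_sqr -powR_mulrn ?enorm_ge0// -powRrM. Qed.

Lemma solE x : sol x = prof a u 0 (sqn x).
Proof. by rewrite /sol /prof addr0 sqn_powR; congr (u (_ `^ _)); field. Qed.

Lemma prof_measurable e : measurable_fun setT (prof a u e : measurableTypeR R -> measurableTypeR R).
Proof.
apply: (measurableT_comp (f := u)); first exact: continuous_measurable_fun (gp_cont gp).
apply: (measurableT_comp (f := fun t => t `^ _)); first exact: measurable_powR.
exact: measurable_funD.
Qed.

Lemma prof'_measurable e : measurable_fun setT (prof' a w e : measurableTypeR R -> measurableTypeR R).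
Proof.
have mp c : measurable_fun setT (fun t : measurableTypeR R => (t + e) `^ c : measurableTypeR R).
  apply: (measurableT_comp (f := fun t => t `^ _)); first exact: measurable_powR.
  exact: measurable_funD.
have mw : measurable_fun setT (w : measurableTypeR R -> measurableTypeR R).
  exact: continuous_measurable_fun (gp_contw gp).
apply: measurable_funM; first by apply: measurableT_comp mw _; exact: mp.
by apply: measurable_funM => //; exact: mp.
Qed.

Lemma gap_measurable e : measurable_fun setT (gap a u w e : measurableTypeR R -> measurableTypeR R).
Proof.
have mc : measurable_fun setT (cutoff e : measurableTypeR R -> measurableTypeR R).
  by apply: continuous_measurable_fun; apply: ctAll => t; exact: der_cont (cutoff_der _ _).
have mc' : measurable_fun setT (cutoff' e : measurableTypeR R -> measurableTypeR R).
  apply: continuous_measurable_fun; apply: ctAll => t; rewrite /cutoff'; ct.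
  by apply: ct_comp; [exact: bump'_cont|exact: mulrl_continuous].
have mp := prof_measurable e; have mp' := prof'_measurable e.
have mp0 := prof_measurable 0; have mp'0 := prof'_measurable 0.
apply: measurable_funD.
  apply: measurable_funM => //; apply: measurable_funM; first exact: measurable_powR.
  apply: measurable_funX; apply: measurable_funM => //; apply: measurable_funB => //.
  by rewrite /approx'; apply: measurable_funD; apply: measurable_funM.
by apply: measurable_funX; apply: measurable_funB => //; rewrite /approx; apply: measurable_funM.
Qed.

Lemma sol_measurable : measurable_fun setT (sol : 'rV[R]_d -> measurableTypeR R).
Proof.
rewrite (_ : sol = prof a u 0 \o @sqn R d); last by apply/funext => x; exact: solE.
by apply: measurableT_comp; [exact: prof_measurable|exact: sqn_measurable].
Qed.

Lemma sol_grad_measurable : measurable_fun setT sol_grad.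
Proof.
apply: measurable_fun_rVP => i.
rewrite (_ : (fun x => _) = (fun x => 2 * prof' a w 0 (sqn x) * x ord0 i)); last first.
  by apply/funext => x; rewrite mxE.
apply: measurable_funM; last exact: measurable_rV_coord.
apply: measurable_funM => //; apply: (measurableT_comp (f := prof' a w 0)).
  exact: prof'_measurable.
exact: sqn_measurable.
Qed.

Definition sol_approx (n : nat) x : R := approx a u (@harmonic R n) (sqn x).

Lemma harmonic01 n : 0 < @harmonic R n <= 1.
Proof. by rewrite /harmonic/= invr_gt0 ltr0n/= invf_le1 ?ler1n ?ltr0n. Qed.

Lemma sol_approx_schwartz n : schwartz (sol_approx n).
Proof.
have /andP[h0 _] := harmonic01 n.
have hi : 0 < (harmonic n)^-1 :> R by rewrite invr_gt0.
apply: (@cc_schwartz R d _ (1 + (harmonic n)^-1)).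
  have := @smooth_on_radial R d _ _ (@open_gt R (- harmonic n)) (smooth1_approx gp (harmonic n)).
  rewrite (_ : [set x | _] = setT)//.
  by apply/seteqP; split => // x _ /=; rewrite (lt_le_trans _ (sqn_ge0 x))// oppr_lt0.
move=> x Ax; rewrite /sol_approx /approx cutoff_out ?mulr0// -enorm_sqr.
have : enorm x <= enorm x ^+ 2 by rewrite expr2 ler_peMl ?enorm_ge0//; lra.
lra.
Qed.

Lemma sol_approx_grad n x : grad (sol_approx n) x = (2 * approx' a u w (harmonic n) (sqn x)) *: x.
Proof.
have /andP[h0 _] := harmonic01 n.
apply/rowP => i; rewrite !mxE /partial.
have t0 : 0 < sqn x + (harmonic n : R) by have := sqn_ge0 x; lra.
have [_ ->] := der_comp_dir (approx_der gp t0) (sqn_der i x).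
by ring.
Qed.

Lemma sol_H1a : H1a_gradient a sol sol_grad.
Proof.
split; [exact: sol_measurable|exact: sol_grad_measurable|].
exists sol_approx; split; first exact: sol_approx_schwartz.
have [K K0 HK] := gap_le gp a01.
have b0 : 0 < (1 - a) / 2 by rewrite divr_gt0.
(* The exponent is 2 for the square in [gap_le] plus [d] for the reciprocal of [rdecay]. *)
have [D D0 HD] := exp_powR_le (2 + d) (gp_k gp) b0.
rewrite /H1a_norm.
have -> : (fun n => (\int[mu]_x (weight a x * enorm (grad (sol_approx n) x - sol_grad x) ^+ 2 +
      `|sol_approx n x - sol x| ^+ 2)%:E) `^ 2^-1)%E =
    (fun n => (\int[mu]_x (gap a u w (harmonic n) (sqn x))%:E) `^ 2^-1)%E.
  apply/funext => n; congr (_ `^ _)%E; apply: eq_integral => x _; congr EFin.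
  rewrite sol_approx_grad /sol_grad -scalerBl -mulrBr /gap /weight -sqn_powR real_normK ?num_real//.
  congr (_ + _); last by rewrite solE.
  rewrite -mulrA; congr (_ * _); rewrite enorm_sqr /sqn /dotv mulr_sumr.
  by apply: eq_bigr => i _; rewrite !mxE; ring.
apply: (@cvg_sqrt_integral R d (fun n x => gap a u w (harmonic n) (sqn x)) (K * D)).
- move=> n; apply: (measurableT_comp (f := gap a u w (harmonic n))).
    exact: gap_measurable.
  exact: sqn_measurable.
- move=> n x; have /andP[h0 h1] := harmonic01 n; have t0 := sqn_ge0 x.
  rewrite gap_ge0//=; apply: le_trans (HK _ _ _ t0) _; first by rewrite ltW.
  rewrite -mulrA ler_pM2l//; move: (sqn x) t0 (HD _ t0) (rdecay_ge x) => t t0.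
  set E := expR _ => HE Hr.
  have E0 : 0 <= E by exact: expR_ge0.
  have E1 : E <= 1.
    by rewrite -expR0 ler_expR oppr_le0 mulr_ge0 ?powR_ge0// ltW// (gp_k gp).
  have r0 := rdecay_gt0 x.
  apply: (@le_trans _ _ (E * (1 + t) ^+ 2 * ((1 + t) ^+ d * rdecay x))).
    rewrite exprMn -[leLHS]mulr1; apply: ler_pM => //; first by nn.
    by rewrite ler_wpM2r ?sqr_ge0// expr2 ler_piMl.
  rewrite mulrA ler_pM2r//; apply: le_trans HE.
  by rewrite exprD -mulrA mulrC.
- by move=> x; exact: (gap_cvg gp a01 (sqn_ge0 x)).
Qed.

Lemma sol_smooth : smooth_on [set x : 'rV[R]_d | x != 0] sol.
Proof.
have := @smooth_on_radial R d _ _ (@open_gt R (- 0)) (smooth1_prof gp 0).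
rewrite (_ : [set x | _] = [set x | x != 0]).
  by rewrite (_ : sol = fun x => prof a u 0 (sqn x))//; apply/funext => x; exact: solE.
by apply/seteqP; split => x /=; rewrite oppr0 sqn_gt0.
Qed.

Lemma sol_exp_decay : exp_decay a sol.
Proof.
exists k, C; split; [exact: gp_k gp|exact: gp_C gp|].
by move=> x; rewrite /sol (gp_gt0 gp)/= mulNr (gp_le gp)// powR_ge0.
Qed.

Let K := (1 - a) ^+ 2.
Let N := d%:R / (1 - a).
Let L := (omega * u 0 - u 0 `^ p) / (K * N).
Let w1 (s : R) := (1 - N) / s * w s + (omega * u s - u s `^ p) / K.

(* [|x|^(2a) grad sol = flux(|x|) x] *)
Definition flux r : R :=
  if r <= 0 then (1 - a) * L else (1 - a) * (w (r `^ (1 - a)) / r `^ (1 - a)).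
Definition flux' r : R :=
  K * (w1 (r `^ (1 - a)) - w (r `^ (1 - a)) / r `^ (1 - a)) / r.

Let N0 : 0 < N. Proof. by rewrite divr_gt0// ltr0n. Qed.
Let K0 : 0 < K. Proof. by rewrite exprn_gt0. Qed.

Let fluxE r : 0 < r -> flux r = (1 - a) * (w (r `^ (1 - a)) / r `^ (1 - a)).
Proof. by move=> r0; rewrite /flux leNgt r0. Qed.

Let nonlin s : 0 < s -> K * (w1 s - w s / s) = - (K * N) * (w s / s) + (omega * u s - u s `^ p).
Proof. by move=> s0; rewrite /w1; field; rewrite !gt_eqF. Qed.

Let small_pow (t : R) : 0 < t -> exists2 r1, 0 < r1 & forall r, 0 < r < r1 -> 0 < r `^ (1 - a) < t.
Proof.
move=> t0; exists (t `^ (1 - a)^-1); first exact: powR_gt0.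
move=> r /andP[r0 rt]; rewrite powR_gt0//=.
have tE : t = (t `^ (1 - a)^-1) `^ (1 - a).
  by rewrite -powRrM mulVf ?gt_eqF// powRr1// ltW.
by rewrite [ltRHS]tE; apply: gt0_ltr_powR => //; rewrite nnegrE ?powR_ge0 ?ltW.
Qed.

(** [L] is the limit of [w s / s], so [flux] is continuous at 0. With [s = r^(1-a)], the product
    [r * flux' r] equals [- K N (w s / s) + omega u s - (u s)^p], and it tends to 0 because
    [K N L = omega u 0 - (u 0)^p]. *)
Lemma flux_regular : regular_profile flux flux'.
Proof.
split.
- move=> r r0; apply: (@der_pos _ (fun r => (1 - a) * (w (r `^ (1 - a)) * (r `^ (1 - a))^-1))) => //.
    by move=> t t0; rewrite fluxE.
  have s0 : 0 < r `^ (1 - a) by exact: powR_gt0.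
  eapply isder_eq.
    der; rewrite ?gt_eqF//.
    by apply: der_comp; [exact: (gp_derw gp)|der].
  cbv beta; rewrite -/N -/K /flux' /w1.
  have -> : r `^ (1 - a - 1) = r `^ (1 - a) / r by rewrite -[in RHS](powR_sub1M (1 - a) r0) mulfK// gt_eqF.
  move: (r `^ _) s0 => s s0; rewrite /K; field.
  by rewrite !gt_eqF.
- move=> r r0; have s0 : 0 < r `^ (1 - a) by exact: powR_gt0.
  rewrite /flux' /w1; ct => //; rewrite ?gt_eqF//;
    try by [apply: ct_comp; [exact: (gp_contw gp)|ct]|apply: ct_comp; [exact: (gp_cont gp)|ct]].
  exact: (gp_gt0 gp).
- move=> e e0; have e0' : 0 < e / (2 * (1 - a)) by rewrite divr_gt0// mulr_gt0.
  have [t t0 Ht] := gp_lim gp e0'.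
  have [r1 r10 Hr] := small_pow t0.
  exists r1 => // r /andP[]; rewrite le_eqVlt => /predU1P[<-|r0] rr; first by rewrite subrr normr0.
  rewrite fluxE// /flux lexx -mulrBr normrM gtr0_norm// mulrC -ltr_pdivlMr//.
  apply: le_lt_trans (Ht _ (Hr _ _)) _; first by rewrite r0.
  by rewrite ltr_pM2l// ltf_pV2 ?posrE ?mulr_gt0//; have := a1; lra.
- move=> e e0; pose g s := omega * u s - u s `^ p.
  have gc : {for 0, continuous g}.
    rewrite /g; ct; [exact: (gp_cont gp)|exact: (gp_gt0 gp)|exact: (gp_cont gp)].
  have e2 : 0 < e / 2 by rewrite divr_gt0.
  have [t1 t10 H1] := (ct_epsP _ _).1 gc _ e2.
  have e0' : 0 < e / (2 * (K * N)) := divr_gt0 e0 (mulr_gt0 (ltr0Sn _ 1) (mulr_gt0 K0 N0)).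
  have [t t0 Ht] := gp_lim gp e0'.
  have tt : 0 < Num.min t t1 by rewrite lt_min t0.
  have [r1 r10 Hr] := small_pow tt.
  exists r1 => // r /andP[]; rewrite le_eqVlt => /predU1P[<-|r0] rr; first by rewrite mul0r normr0.
  have := Hr r; rewrite r0 rr => /(_ isT); rewrite lt_min => /and3P[s0 st st1].
  rewrite /flux' mulrCA divff ?gt_eqF// mulr1 nonlin//.
  have := Ht (r `^ (1 - a)); rewrite s0 st => /(_ isT).
  have := H1 (r `^ (1 - a)); rewrite subr0 gtr0_norm// => /(_ st1).
  rewrite -/K -/N -/L -/(g (r `^ (1 - a))).
  have -> : g 0 = K * N * L by rewrite /L /g; field; rewrite !gt_eqF// mulr_gt0.
  have KN0 : 0 < K * N := mulr_gt0 K0 N0.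
  rewrite (_ : e / (2 * (K * N)) = e / 2 / (K * N)); last by rewrite invfM mulrA.
  rewrite ler_pdivlMr//.
  move: (g _) (w _ / _) => G W h1 h2.
  have -> : - (K * N) * W + G = (G - K * N * L) - (W - L) * (K * N) by ring.
  apply: le_lt_trans (ler_normB _ _) _; rewrite normrM (gtr0_norm (mulr_gt0 K0 N0)); lra.
Qed.

(** With [d = N (1 - a)] the two terms in [w s / s] cancel and only the nonlinear terms remain; at
    the origin the definition of [L] gives the same value. *)
Lemma field_div_flux x : @field_div R d flux flux' (enorm x) = omega * sol x - sol x `^ p.
Proof.
have dE : d%:R = N * (1 - a) by rewrite /N divfK// gt_eqF.
have [->|x0] := eqVneq x 0.
  rewrite /field_div /sol enorm0 mul0r addr0 powR0 ?gt_eqF// /flux lexx dE /L.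
  by rewrite /K; field; rewrite !gt_eqF.
have r0 : 0 < enorm x by rewrite enorm_gt0.
have -> : @field_div R d flux flux' (enorm x) = d%:R * flux (enorm x) +
    K * (w1 (enorm x `^ (1 - a)) - w (enorm x `^ (1 - a)) / enorm x `^ (1 - a)).
  by rewrite /field_div /flux'; congr (_ + _); rewrite mulrCA divff ?gt_eqF// mulr1.
rewrite fluxE// nonlin ?powR_gt0// dE /sol.
by rewrite /K; ring.
Qed.

Lemma flux_grad x i : weight a x * sol_grad x ord0 i = flux (enorm x) * x ord0 i.
Proof.
have [->|x0] := eqVneq x 0; first by rewrite !mxE !mulr0.
have r0 : 0 < enorm x by rewrite enorm_gt0.
rewrite mxE fluxE// /prof' addr0 !sqn_powR /weight.
have -> : 2 * ((1 - a) / 2) = 1 - a by field.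
have -> : 2 * ((1 - a) / 2 - 1) = - a - 1 by field.
have -> : enorm x `^ (2 * a) = enorm x * enorm x `^ a * enorm x `^ (a - 1).
  have e1 : enorm x = enorm x `^ 1 by rewrite powRr1 ?ltW.
  by rewrite {2}e1 -!powRB_gt0//; congr (_ `^ _); ring.
have -> : enorm x `^ (- a - 1) = (enorm x `^ a)^-1 / enorm x.
  by rewrite -powRN -(powR_sub1M (- a)) ?mulfK ?gt_eqF.
have -> : enorm x `^ (a - 1) = (enorm x `^ (1 - a))^-1 by rewrite -powRN opprB.
by field; rewrite !gt_eqF ?powR_gt0.
Qed.

Lemma cc_bound (h : 'rV[R]_d -> R) : compact (closure [set x | h x != 0]) ->
  exists A : R, forall x, A < enorm x -> h x = 0.
Proof.
move=> ch; have [M [_ HM]] : bounded_set (@enorm R d @` closure [set x | h x != 0]).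
  apply: compact_bounded; apply: continuous_compact => //.
  by apply: continuous_subspaceT => x; exact: enorm_cont.
exists (`|M| + 1) => x Ax; apply/eqP/negPn/negP => hx.
have : `|enorm x| <= `|M| + 1.
  apply: HM; first by apply: le_lt_trans (ler_norm M) _; rewrite ltrDl.
  by exists x => //; exact: subset_closure.
by rewrite ger0_norm ?enorm_ge0// leNgt Ax.
Qed.

Lemma sol_solution : distributional_solution a omega p sol.
Proof.
exists sol_grad; split; first exact: sol_H1a.
move=> h [hs hc]; have [A hA] := cc_bound hc.
have h'A i x : A < enorm x -> partial i h x = 0 := @partials_out _ _ [:: i] h A hA x.
have hd i x : isder x (e_ i) h (partial i h x).
  by apply: isder_of => //; exact: (hs [::] x I).2.
have [] := @divergence_theorem R d h (fun i => partial i h) flux flux' A hd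
  (fun x => (hs [::] x I).1) (fun i x => (hs [:: i] x I).1) flux_regular.
- by move=> x Ax; rewrite hA// mul0r.
- by move=> x i Ax; rewrite h'A// mul0r.
- by move=> x Ax; rewrite hA// mul0r.
have E x : \sum_i partial i h x * (flux (enorm x) * x ord0 i) +
    h x * @field_div R d flux flux' (enorm x) = weak_integrand a omega p sol sol_grad h x.
  rewrite field_div_flux /weak_integrand.
  have s0 : 0 < sol x by exact: (gp_gt0 gp).
  rewrite (gtr0_norm s0) (powR_sub1M _ s0) /dotv mulr_sumr.
  rewrite -addrA; congr (_ + _); last by ring.
  by apply: eq_bigr => i _; rewrite [in RHS]mulrA flux_grad mxE mulrC.
move=> _ qi q0; split.
  by rewrite (_ : EFin \o _ = EFin \o (fun x => \sum_i partial i h x * (flux (enorm x) * x ord0 i) +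
    h x * @field_div R d flux flux' (enorm x)))//; apply/funext => x /=; rewrite E.
by rewrite -[RHS]q0; apply: eq_integral => x _; rewrite E.
Qed.

End existence.

(** * Radial solutions near the origin *)

Section singular_point.
Context {R : realType}.
Implicit Types (f : R -> R) (r s t : R).

Lemma power_der (g : R) (r : R) : 0 < r -> isder r (1 : R) (fun t => t `^ g) (g * r `^ (g - 1)).
Proof. by move=> r0; eapply isder_eq; [der|ringb]. Qed.

Lemma power_growth f f1 (K g s r : R) : 0 < g -> 0 < s <= r ->
  (forall t, 0 < t -> isder t (1 : R) f (f1 t)) ->
  (forall t, s < t < r -> `|f1 t| <= K * t `^ (g - 1)) ->
  `|f r - f s| <= K / g * (r `^ g - s `^ g).
Proof.
move=> g0 /andP[s0 sr] fd fK.
have := @deriv_norm_cmp R f f1 (fun t => K / g * t `^ g) (fun t => K * t `^ (g - 1)) s r sr.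
rewrite mulrBr; apply.
- by move=> t /andP[st _]; apply: fd; lra.
- move=> t /andP[st _]; have t0 : 0 < t by lra.
  eapply isder_eq; first by der.
  by cbv beta; field; rewrite gt_eqF.
- exact: fK.
- by move=> t /andP[st _]; apply: der_cont (fd _ _); lra.
- by move=> t /andP[st _]; ct; lra.
Qed.

Lemma half_root (g : R) (n : nat) : 0 < g ->
  exists2 s : R, 0 < s <= 1 & s `^ g = (1 / 2) ^+ n.
Proof.
move=> g0; have h0 : 0 < (1 / 2 : R) ^+ n by rewrite exprn_gt0.
have E : (((1 / 2 : R) ^+ n) `^ g^-1) `^ g = (1 / 2) ^+ n.
  by rewrite -powRrM mulVf ?gt_eqF// powRr1// ltW.
exists (((1 / 2 : R) ^+ n) `^ g^-1) => //; rewrite powR_gt0//=.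
have one (q : R) : 1 `^ q = 1 :> R by rewrite powR1.
rewrite -[leRHS](one g^-1); apply: ge0_ler_powR; rewrite ?nnegrE ?ler01 ?(ltW h0)//.
  by rewrite invr_ge0 ltW.
by rewrite exprn_ile1//; lra.
Qed.

(** The derivative is bounded by an integrable power, so [f] is Cauchy at 0 in the variable [r^g];
    radii with [r^g = 2^-n] yield the limit as that of a geometric sequence. *)
Lemma limit0 f f1 (K g : R) : 0 < g ->
  (forall t, 0 < t -> isder t (1 : R) f (f1 t)) ->
  (forall t, 0 < t <= 1 -> `|f1 t| <= K * t `^ (g - 1)) ->
  exists l, forall r, 0 < r <= 1 -> `|f r - l| <= K / g * r `^ g.
Proof.
move=> g0 fd fK.
have K0 : 0 <= K / g.
  have := fK 1; rewrite ltr01 lexx powR1 mulr1 => /(_ isT) h.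
  by rewrite divr_ge0 ?(le_trans _ h)// ltW.
have dist s r : 0 < s <= 1 -> 0 < r <= 1 -> `|f r - f s| <= K / g * `|r `^ g - s `^ g|.
  wlog sr : s r / s <= r.
    move=> H hs hr; have [|/ltW] := leP s r; first by move=> ?; exact: H.
    by move=> /H h; rewrite distrC [X in _ * X]distrC; exact: h.
  move=> /andP[s0 s1] /andP[r0 r1].
  apply: le_trans (power_growth g0 _ fd _) _; first by rewrite s0.
    by move=> t /andP[st tr]; apply: fK; apply/andP; split; lra.
  by rewrite ler_wpM2l// ler_norm.
pose a n := sval (cid2 (half_root n g0)).
have [a01 aE] : (forall n, 0 < a n <= 1) /\ forall n, a n `^ g = (1 / 2) ^+ n.
  by split => n; rewrite /a; case: cid2.
have [|l Hl] := @geo_limit R (fun n => f (a n)) (K / g).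
  move=> n; apply: le_trans (dist _ _ (a01 _) (a01 _)) _; rewrite ler_wpM2l// !aE exprS.
  have : 0 <= (1 / 2 : R) ^+ n by rewrite exprn_ge0//; lra.
  by move: (_ ^+ n) => x x0; rewrite ler_norml; apply/andP; split; lra.
exists l => r r01; apply: (@geo_le R _ _ (K / g * 3)) => n.
have h1 := dist _ _ (a01 n) r01; have h2 := Hl n.
have h3 : `|r `^ g - a n `^ g| <= r `^ g + (1 / 2) ^+ n.
  rewrite aE; apply: le_trans (ler_normB _ _) _.
  by rewrite !ger0_norm ?powR_ge0 ?exprn_ge0//; lra.
have h4 : `|f r - l| <= `|f r - f (a n)| + `|f (a n) - l|.
  by rewrite -[f r - l](subrKA (f (a n))) ler_normD.
have h5 : K / g * `|r `^ g - a n `^ g| <= K / g * (r `^ g + (1 / 2) ^+ n) by rewrite ler_wpM2l.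
move: (K / g) K0 h1 h2 h3 h4 h5 => Q Q0 h1 h2 h3 h4 h5; rewrite mulrDr in h5; lra.
Qed.

(** Integration of the expansion of [f1] from the origin. The bound with [K] lets the lower end of
    integration tend to 0 and leaves no trace in the conclusion. *)
Lemma limit0_asymp f f1 (l K c e g d : R) : 0 < g ->
  (forall t, 0 < t -> isder t (1 : R) f (f1 t)) ->
  (forall r, 0 < r <= 1 -> `|f r - l| <= K * r `^ g) ->
  (forall t, 0 < t < d -> `|f1 t - c * t `^ (g - 1)| <= e * t `^ (g - 1)) ->
  forall r, 0 < r < d -> `|f r - l - c / g * r `^ g| <= e / g * r `^ g.
Proof.
move=> g0 fd fl fe r /andP[r0 rd].
pose h t := f t - c / g * t `^ g.
have hd t : 0 < t -> isder t (1 : R) h (f1 t - c * t `^ (g - 1)).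
  move=> t0; eapply isder_eq; first by apply: derB; [exact: fd|der].
  by cbv beta; field; rewrite gt_eqF.
have e0 : 0 <= e / g.
  have := fe r; rewrite r0 rd => /(_ isT) /(le_trans (normr_ge0 _)).
  by rewrite pmulr_lge0 ?powR_gt0// => ?; rewrite divr_ge0// ltW.
have -> : f r - l - c / g * r `^ g = h r - l by rewrite /h; ring.
apply: (@geo_le R _ _ (`|K| + `|c / g|)) => n.
have [q /andP[q0 q1] qE] := half_root n.+1 g0.
pose m := Num.min r 1; have m0 : 0 < m by rewrite lt_min r0 ltr01.
have m1 : m <= 1 by rewrite ge_min lexx orbT.
have mr : m <= r by rewrite ge_min lexx.
pose s := m * q; have s0 : 0 < s by rewrite mulr_gt0.
have s1 : s <= 1 by apply: le_trans m1; rewrite ler_piMr// ltW.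
have sr : s <= r by rewrite (le_trans _ mr)// ler_piMr// ltW.
have sg : s `^ g <= (1 / 2) ^+ n.
  have one (x : R) : 1 `^ x = 1 :> R by rewrite powR1.
  rewrite /s (powRM g (ltW m0) (ltW q0)) qE -[leRHS]mul1r; apply: ler_pM; rewrite ?powR_ge0 ?exprn_ge0//.
  - rewrite -[leRHS](one g); apply: ge0_ler_powR; rewrite ?nnegrE ?ler01//; exact: ltW.
  - by rewrite exprS ler_piMl ?exprn_ge0//; lra.
have h1 : `|h r - h s| <= e / g * r `^ g.
  apply: le_trans (power_growth g0 _ hd _) _; first by rewrite s0.
    by move=> t /andP[st tr]; apply: fe; apply/andP; split; lra.
  by rewrite ler_wpM2l// gerBl powR_ge0.
have h2 : `|h s - l| <= (`|K| + `|c / g|) * s `^ g.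
  have -> : h s - l = (f s - l) - c / g * s `^ g by rewrite /h; ring.
  apply: le_trans (ler_normB _ _) _; rewrite mulrDl; apply: lerD.
    apply: le_trans (fl _ _) _; first by rewrite s0.
    by rewrite ler_wpM2r ?powR_ge0// ler_norm.
  by rewrite normrM (ger0_norm (powR_ge0 _ _)).
have h3 : `|h r - l| <= `|h r - h s| + `|h s - l|.
  by rewrite -[h r - l](subrKA (h s)) ler_normD.
have h4 : (`|K| + `|c / g|) * s `^ g <= (`|K| + `|c / g|) * (1 / 2) ^+ n.
  by rewrite ler_wpM2l// addr_ge0.
lra.
Qed.

(* a flux that does not vanish at the origin forces a logarithmic singularity *)
Lemma bounded_flux0 f f1 (m q B C : R) : 1 <= q ->
  (forall t, 0 < t -> isder t (1 : R) f (f1 t)) ->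
  (forall t, 0 < t <= 1 -> `|t `^ q * f1 t - m| <= B * t) ->
  (forall t, 0 < t -> `|f t| <= C) -> m = 0.
Proof.
move=> q1 fd fm fC; apply/eqP; apply/negPn/negP => m0.
have n0 : 0 < `|m| by rewrite normr_gt0.
have m20 : 0 < m ^+ 2 by rewrite exprn_even_gt0.
have B0 : 0 <= B.
  by have := fm 1; rewrite ltr01 lexx mulr1 => /(_ isT); apply: le_trans.
(* Below [r] the error [B t] is at most [|m| / 2], so that [m * f1 t >= m^2 / (2 t)]. *)
pose r := Num.min 1 (`|m| / (2 * (B + 1))).
have B1 : 0 < 2 * (B + 1) by rewrite mulr_gt0// ltr_wpDl.
have r0 : 0 < r by rewrite lt_min ltr01 divr_gt0.
have r1 : r <= 1 by rewrite ge_min lexx.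
have rB : r * (2 * (B + 1)) <= `|m| by rewrite -ler_pdivlMr// ge_min lexx orbT.
have low t : 0 < t <= r -> m ^+ 2 / 2 * t^-1 <= m * f1 t.
  move=> /andP[t0 tr]; have h := fm t; rewrite t0 (le_trans tr r1) in h.
  have {}h := h isT.
  have tq0 : 0 < t `^ q by exact: powR_gt0.
  have tq : t `^ q <= t.
    rewrite -(powR_sub1M q t0) ler_piMl ?(ltW t0)//.
    have one (x : R) : 1 `^ x = 1 :> R by rewrite powR1.
    by rewrite -[leRHS](one (q - 1)); apply: ge0_ler_powR; rewrite ?nnegrE ?ler01 ?subr_ge0 ?(ltW t0)// (le_trans tr).
  have Bt : B * t <= `|m| / 2.
    have : t * (B + 1) <= r * (B + 1) by rewrite ler_wpM2r// addr_ge0.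
    by move: r0 t0 rB; rewrite mulrCA; lra.
  have hm : `|m| * `|t `^ q * f1 t - m| <= m ^+ 2 / 2.
    rewrite -[m ^+ 2]real_normK ?num_real// expr2 -mulrA ler_wpM2l//.
    exact: le_trans h Bt.
  have : m ^+ 2 / 2 <= t `^ q * (m * f1 t).
    have := ler_norm (- (m * (t `^ q * f1 t - m))); rewrite normrN normrM; nra.
  move=> h2; have p0 : 0 <= m * f1 t.
    have : 0 <= t `^ q * (m * f1 t) by apply: le_trans h2; rewrite divr_ge0// ltW.
    by rewrite pmulr_rge0.
  rewrite ler_pdivrMr//; apply: le_trans h2 _.
  by rewrite mulrC ler_wpM2l.
(* At the radius [s = r * expR (- S)] the logarithmic growth [m^2 S / 2] exceeds the largest
   possible oscillation [2 C |m|]. *)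
pose S := 4 * C / `|m| + 1.
have C0 : 0 <= C by apply: le_trans (fC 1 ltr01).
have S0 : 0 < S by rewrite ltr_wpDl// divr_ge0// mulr_ge0.
pose s := r * expR (- S).
have s0 : 0 < s by rewrite mulr_gt0// expR_gt0.
have sr : s <= r by rewrite ler_piMr ?(ltW r0)// -expR0 ler_expR oppr_le0 ltW.
have : m ^+ 2 / 2 * ln r - m ^+ 2 / 2 * ln s <= m * f r - m * f s.
  have := @deriv_cmp R (fun t => m ^+ 2 / 2 * ln t) (fun t => m ^+ 2 / 2 * t^-1)
    (fun t => m * f t) (fun t => m * f1 t) s r sr; apply.
  - move=> t /andP[st tr]; have t0 : 0 < t by lra.
    by eapply isder_eq; [der; exact: is_derive1_ln|ringb].
  - move=> t /andP[st tr]; have t0 : 0 < t by lra.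
    by eapply isder_eq; [der; exact: fd|ringb].
  - by move=> t /andP[st tr]; apply: low; apply/andP; split; lra.
  - move=> t /andP[st tr]; have t0 : 0 < t by lra.
    by ct; exact: continuous_ln.
  - move=> t /andP[st tr]; have t0 : 0 < t by lra.
    by ct; exact: der_cont (fd _ _).
have -> : ln s = ln r - S by rewrite /s lnM ?posrE ?expR_gt0// expRK.
have h1 : m * f r - m * f s <= `|m| * (2 * C).
  apply: le_trans (ler_norm _) _; rewrite -mulrBr normrM ler_wpM2l//.
  apply: le_trans (ler_normB _ _) _.
  by have := fC r r0; have := fC s s0; lra.
have h2 : m ^+ 2 / 2 * S = `|m| * (2 * C) + m ^+ 2 / 2.
  by rewrite /S -[m ^+ 2]real_normK ?num_real//; field; rewrite gt_eqF.
move: h1 h2 m20; lra.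
Qed.

End singular_point.

(** * Behaviour at the origin of bounded positive solutions of the radial equation *)

Section radial_asymptotic_analysis.
Context {R : realType}.
Variables (D a omega p C : R) (f f1 f2 : R -> R).
Hypotheses (D1 : 1 <= D) (a01 : 0 <= a < 1) (om0 : 0 < omega) (p1 : 1 < p).
Hypothesis fd : forall t : R, 0 < t -> isder t (1 : R) f (f1 t).
Hypothesis f1d : forall t : R, 0 < t -> isder t (1 : R) f1 (f2 t).
Hypothesis f0 : forall t : R, 0 < t -> 0 < f t.
Hypothesis fC : forall t : R, 0 < t -> f t <= C.
Hypothesis ode : forall t : R, 0 < t ->
  f2 t = (omega * f t - f t `^ p) * t `^ (- (2 * a)) - (D - 1 + 2 * a) / t * f1 t.
Implicit Types (r s t e : R).

Let nl x := omega * x - x `^ p.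
Let P t := t `^ (D - 1 + 2 * a) * f1 t.

(** The power [t^(D-1+2a)] is the integrating factor of the first-order term. *)
Lemma radial_flux_der t : 0 < t -> isder t (1 : R) P (t `^ (D - 1) * nl (f t)).
Proof.
move=> t0; rewrite /P; eapply isder_eq; first by der => //; exact: f1d.
cbv beta; rewrite ode// -/(nl (f t)) mulr1.
have -> : t `^ (D - 1 + 2 * a) = t `^ (D - 1) * t `^ (2 * a) by rewrite powRB_gt0.
have -> : t `^ (D - 1 + 2 * a - 1) = t `^ (D - 1) * t `^ (2 * a) / t.
  by rewrite -powRB_gt0// -(powR_sub1M (D - 1 + 2 * a) t0) mulfK// gt_eqF.
rewrite powRN; field.
by rewrite !gt_eqF ?powR_gt0.
Qed.

Let C0 : 0 < C. Proof. exact: lt_le_trans (f0 ltr01) (fC ltr01). Qed.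
Let B := omega * C + C `^ p.
Let g := 2 - 2 * a.
Let g0 : 0 < g. Proof. by case/andP: a01 => _ a1; rewrite /g; lra. Qed.
Let D0 : 0 < D. Proof. exact: lt_le_trans D1. Qed.

Let nl_le t : 0 < t -> `|nl (f t)| <= B.
Proof.
move=> t0; apply: le_trans (ler_normB _ _) _; rewrite normrM (gtr0_norm om0).
rewrite (gtr0_norm (f0 t0)) (ger0_norm (powR_ge0 _ _)); apply: lerD.
  by rewrite ler_pM2l// fC.
by apply: ge0_ler_powR; rewrite ?nnegrE ?fC ?ltW ?f0//; have := p1; lra.
Qed.

Lemma radial_flux_limit :
  exists m, forall t, 0 < t <= 1 -> `|t `^ (D - 1 + 2 * a) * f1 t - m| <= B / D * t `^ D.
Proof.
apply: (limit0 D0 radial_flux_der) => t /andP[t0 _].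
rewrite normrM (ger0_norm (powR_ge0 _ _)) mulrC ler_wpM2r ?powR_ge0//.
exact: nl_le.
Qed.

Lemma radial_flux_eq0 m : 1 <= D - 1 + 2 * a ->
  (forall t, 0 < t <= 1 -> `|t `^ (D - 1 + 2 * a) * f1 t - m| <= B / D * t `^ D) -> m = 0.
Proof.
move=> q1 Hm; apply: (@bounded_flux0 R f f1 m (D - 1 + 2 * a) (B / D) C q1 fd).
  move=> t t01; apply: le_trans (Hm _ t01) _; case/andP: t01 => t0 t1.
  have BD : 0 <= B / D by rewrite divr_ge0 ?(le_trans _ (nl_le ltr01))// ltW.
  rewrite ler_wpM2l// -(powR_sub1M D t0) ler_piMl ?(ltW t0)//.
  have one (x : R) : 1 `^ x = 1 :> R by rewrite powR1.
  by rewrite -[leRHS](one (D - 1)); apply: ge0_ler_powR; rewrite ?nnegrE ?ler01 ?subr_ge0 ?(ltW t0).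
by move=> t t0; rewrite gtr0_norm ?fC ?f0.
Qed.

Lemma power_small (K q e : R) : 0 < q -> 0 < e ->
  exists2 r1, 0 < r1 <= 1 & forall r, 0 < r < r1 -> K * r `^ q < e.
Proof.
move=> q0 e0; have K1 : 0 < `|K| + 1 by rewrite ltr_wpDl.
have /ct_epsP/(_ _ (divr_gt0 e0 K1))[r1 r10 Hr] := powR_max_cont (ltW q0) (x := 0).
exists (Num.min r1 1); first by rewrite lt_min r10 ltr01 ge_min lexx orbT.
move=> r /andP[r0]; rewrite lt_min => /andP[rr _].
have := Hr r; rewrite subr0 gtr0_norm// => /(_ rr).
rewrite maxxx powR0 ?gt_eqF// subr0 max_l ?(ltW r0)// ger0_norm ?powR_ge0//.
rewrite ltr_pdivlMr// mulrC; apply: le_lt_trans.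
by rewrite ler_wpM2r ?powR_ge0// (le_trans (ler_norm _))// lerDl.
Qed.

Section regular_origin.
Variable K : R.
Hypothesis f1K : forall t, 0 < t <= 1 -> `|f1 t| <= K * t `^ (1 - 2 * a).

Lemma radial_limit : exists l, forall r, 0 < r <= 1 -> `|f r - l| <= K / g * r `^ g.
Proof.
apply: (limit0 g0 fd) => t t01.
have -> : g - 1 = 1 - 2 * a by rewrite /g; ring.
exact: f1K.
Qed.

Variable phi0 : R.
Hypothesis fphi0 : forall r, 0 < r <= 1 -> `|f r - phi0| <= K / g * r `^ g.

Let c := phi0 `^ p - omega * phi0.

Lemma radial_limit_ge0 : 0 <= phi0.
Proof.
rewrite leNgt; apply/negP => h.
have e0 : 0 < - phi0 by rewrite oppr_gt0.
have [r1 /andP[r10 r11] Hr] := power_small (K / g) g0 e0.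
have r2 : 0 < r1 / 2 by lra.
have := Hr (r1 / 2); have := fphi0 (r := r1 / 2); have := f0 r2; have := ler_norm (f (r1 / 2) - phi0).
have -> : 0 < r1 / 2 <= 1 by apply/andP; split; lra.
have -> : 0 < r1 / 2 < r1 by apply/andP; split; lra.
move=> h1 h2 /(_ isT) h3 /(_ isT) h4; lra.
Qed.

Lemma radial_near (h : R -> R) e : {for phi0, continuous h} -> 0 < e ->
  exists2 r1, 0 < r1 <= 1 & forall r, 0 < r < r1 -> `|h (f r) - h phi0| < e.
Proof.
move=> /ct_epsP hc /hc[s s0 Hs].
have [r1 /andP[r10 r11] Hr] := power_small (K / g) g0 s0.
exists r1; first by rewrite r10.
move=> r /andP[r0 rr]; apply: Hs; apply: le_lt_trans (fphi0 _) (Hr _ _); rewrite r0//=; lra.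
Qed.

Lemma radial_nl_near e : 0 < e ->
  exists2 r1, 0 < r1 <= 1 & forall r, 0 < r < r1 -> `|nl (f r) + c| < e.
Proof.
(* [phi0] may still be 0 at this point; the positive part makes the power continuous there as
   well. *)
move=> e0; pose h x := omega * x - Num.max x 0 `^ p.
have hc : {for phi0, continuous h}.
  apply: ctD; first exact: mulrl_continuous.
  apply: ctN; apply: powR_max_cont; have := p1; lra.
have [r1 r11 Hr] := radial_near hc e0.
exists r1 => // r rr; have := Hr r rr; have r0 : 0 < r by case/andP: rr.
rewrite /h /nl /c max_l ?ltW ?f0// max_l ?radial_limit_ge0//.
by rewrite opprB.
Qed.

Lemma radial_flux_asymp e : 0 < e ->
  exists2 r1, 0 < r1 <= 1 & forall r, 0 < r < r1 -> `|P r + c / D * r `^ D| <= e * r `^ D.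
Proof.
move=> e0; have eD : 0 < e * D by rewrite mulr_gt0.
have [r1 r11 Hr] := radial_nl_near eD.
exists r1 => // r rr.
have H1 t : 0 < t <= 1 -> `|P t - 0| <= K * t `^ D.
  move=> /andP[t0 t1]; rewrite subr0 /P normrM ger0_norm ?powR_ge0//.
  have -> : t `^ D = t `^ (D - 1 + 2 * a) * t `^ (1 - 2 * a) by rewrite -powRB_gt0//; congr (_ `^ _); ring.
  by rewrite mulrCA ler_wpM2l ?powR_ge0// f1K// t0.
have H2 t : 0 < t < r1 -> `|t `^ (D - 1) * nl (f t) - - c * t `^ (D - 1)| <= e * D * t `^ (D - 1).
  move=> tr; have h := Hr t tr.
  have -> : t `^ (D - 1) * nl (f t) - - c * t `^ (D - 1) = (nl (f t) + c) * t `^ (D - 1) by ring.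
  by rewrite normrM (ger0_norm (powR_ge0 _ _)) ler_wpM2r ?powR_ge0// ltW.
have := limit0_asymp D0 radial_flux_der H1 H2 rr.
by rewrite subr0 mulNr mulNr opprK mulfK// gt_eqF.
Qed.

Lemma radial_der_asymp e : 0 < e ->
  exists2 r1, 0 < r1 <= 1 & forall r, 0 < r < r1 ->
    `|f1 r + c / D * r `^ (1 - 2 * a)| <= e * r `^ (1 - 2 * a).
Proof.
move=> e0; have [r1 r11 Hr] := radial_flux_asymp e0.
exists r1 => // r rr; have := Hr r rr; have r0 : 0 < r by case/andP: rr.
have -> : r `^ D = r `^ (D - 1 + 2 * a) * r `^ (1 - 2 * a) by rewrite -powRB_gt0//; congr (_ `^ _); ring.
rewrite /P mulrCA -mulrDr normrM ger0_norm ?powR_ge0// mulrCA ler_pM2l ?powR_gt0//.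
Qed.

Lemma radial_asymp e : 0 < e ->
  exists2 r1, 0 < r1 <= 1 & forall r, 0 < r < r1 ->
    `|f r - phi0 + c / D / g * r `^ g| <= e * r `^ g.
Proof.
move=> e0; have eg : 0 < e * g by rewrite mulr_gt0.
have [r1 r11 Hr] := radial_der_asymp eg.
exists r1 => // r rr.
have gE : g - 1 = 1 - 2 * a by rewrite /g; ring.
have H2 t : 0 < t < r1 -> `|f1 t - - (c / D) * t `^ (g - 1)| <= e * g * t `^ (g - 1).
  by move=> tr; rewrite gE mulNr opprK; exact: Hr.
have := limit0_asymp g0 fd fphi0 H2 rr.
by rewrite mulNr mulNr opprK mulfK// gt_eqF.
Qed.

(** The expansions of [f] and [f1] are substituted into the equation; the coefficient comes from [-
    c + (D - 1 + 2 a) c / D = (2 a - 1) c / D]. *)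
Lemma radial_der2_asymp e : 0 < e ->
  exists2 r1, 0 < r1 <= 1 & forall r, 0 < r < r1 ->
    `|f2 r - (2 * a - 1) / D * c * r `^ (- (2 * a))| <= e * r `^ (- (2 * a)).
Proof.
move=> e0; have e2 : 0 < e / 2 by rewrite divr_gt0.
have [q0 q00] : exists q, q = D - 1 + 2 * a by exists (D - 1 + 2 * a).
have qp : 0 <= q0 by case/andP: a01 => a0 _; rewrite q00; have := D1; lra.
have e3 : 0 < e / (2 * (q0 + 1)) by rewrite divr_gt0// mulr_gt0// ltr_wpDl.
have [r1 /andP[r10 r11] Hr] := radial_nl_near e2.
have [r2 /andP[r20 r21] Hs] := radial_der_asymp e3.
exists (Num.min r1 r2); first by rewrite lt_min r10 r20 ge_min r11.
move=> r /andP[r0]; rewrite lt_min => /andP[rr1 rr2].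
have h1 := Hr r; have h2 := Hs r; rewrite r0 rr1 rr2 in h1 h2.
move: (h1 isT) (h2 isT) => {}h1 {}h2.
rewrite ode// -/(nl (f r)) -q00.
have E1 : r `^ (1 - 2 * a) = r * r `^ (- (2 * a)) by rewrite powRB_gt0// powRr1 ?ltW.
rewrite E1 in h2.
have T0 : 0 < r `^ (- (2 * a)) by exact: powR_gt0.
move: (r `^ (- (2 * a))) T0 h2 => T T0 h2.
have -> : nl (f r) * T - q0 / r * f1 r - (2 * a - 1) / D * c * T =
    (nl (f r) + c) * T - q0 / r * (f1 r + c / D * (r * T)).
  by rewrite q00; field; rewrite !gt_eqF.
have -> : e * T = e / 2 * T + e / 2 * T by field.
apply: le_trans (ler_normB _ _) _; apply: lerD.
  by rewrite normrM (gtr0_norm T0) ler_pM2r// ltW.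
have qr : 0 <= q0 / r by rewrite divr_ge0// ltW.
rewrite normrM (ger0_norm qr).
apply: (@le_trans _ _ (q0 / r * (e / (2 * (q0 + 1)) * (r * T)))); first by rewrite ler_wpM2l.
have -> : q0 / r * (e / (2 * (q0 + 1)) * (r * T)) = e / 2 * T * (q0 / (q0 + 1)).
  by field; rewrite !gt_eqF// ltr_wpDl.
apply: ler_piMr; first exact: mulr_ge0 (ltW e2) (ltW T0).
by rewrite ler_pdivrMr ?ltr_wpDl// mul1r lerDl.
Qed.

(* If [phi0 = 0] then, near 0, [f] increases and [f <= theta f] with [theta < 1]. *)
Lemma radial_limit_neq0 : phi0 != 0.
Proof.
apply/eqP => phi00.
have P0 t : 0 < t <= 1 -> `|P t - 0| <= K * t `^ D.
  move=> /andP[t0 t1]; rewrite subr0 /P normrM ger0_norm ?powR_ge0//.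
  have -> : t `^ D = t `^ (D - 1 + 2 * a) * t `^ (1 - 2 * a) by rewrite -powRB_gt0//; congr (_ `^ _); ring.
  by rewrite mulrCA ler_wpM2l ?powR_ge0// f1K// t0.
have pp : 0 < p - 1 by rewrite subr_gt0.
have oq : 0 < omega `^ (p - 1)^-1 by exact: powR_gt0.
have [r1 /andP[r10 r11] H1] := radial_near (h := id) cvg_id oq.
(* At radii with [t^g <= D g / (2 omega)], the bound [f t <= omega f s / (D g) * t^g] becomes
   [f t <= f s / 2]. *)
have e2 : 0 < (D * g) / (2 * omega) by rewrite divr_gt0 ?mulr_gt0.
have [r2 /andP[r20 r21] H2] := power_small 1 g0 e2.
pose r3 := Num.min r1 r2.
have r30 : 0 < r3 by rewrite lt_min r10.
have nl0 t : 0 < t < r3 -> 0 <= nl (f t) <= omega * f t.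
  move=> /andP[t0 tr]; have ft := f0 t0.
  have : `|f t - phi0| < omega `^ (p - 1)^-1.
    by apply: H1; rewrite t0 (lt_le_trans tr)// ge_min lexx.
  rewrite phi00 subr0 gtr0_norm// => h.
  have h2 : f t `^ (p - 1) <= omega.
    have -> : omega = (omega `^ (p - 1)^-1) `^ (p - 1).
      by rewrite -powRrM mulVf ?gt_eqF// powRr1// ltW.
    by apply: ge0_ler_powR; rewrite ?nnegrE ?ltW.
  rewrite /nl -(powR_sub1M p ft); apply/andP; split.
    by rewrite subr_ge0 ler_pM2r.
  by rewrite gerBl mulr_ge0 ?powR_ge0 ?ltW.
have Pb s M : 0 < s <= r3 -> (forall t, 0 < t < s -> f t <= M) ->
    forall t, 0 < t < s -> 0 <= P t <= omega * M / D * t `^ D.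
  move=> /andP[s0 sr] fM t ts.
  (* The interval from 0 to [omega M] is written as the ball with centre and radius [omega M / 2],
     so that the expansion lemma yields a two-sided bound. *)
  have := @limit0_asymp R P (fun t => t `^ (D - 1) * nl (f t)) 0 K (omega * M / 2) (omega * M / 2) D s
    D0 radial_flux_der P0 _ t ts.
  have H x : 0 < x < s -> `|x `^ (D - 1) * nl (f x) - omega * M / 2 * x `^ (D - 1)| <=
      omega * M / 2 * x `^ (D - 1).
    move=> xs; have /andP[x0 xs'] := xs.
    have -> : x `^ (D - 1) * nl (f x) - omega * M / 2 * x `^ (D - 1) =
      (nl (f x) - omega * M / 2) * x `^ (D - 1) by ring.
    rewrite normrM (ger0_norm (powR_ge0 _ _)) ler_wpM2r ?powR_ge0//.
    have := nl0 x; rewrite x0 (lt_le_trans xs' sr) => /(_ isT)/andP[h1 h2].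
    have h3 : omega * f x <= omega * M by rewrite ler_pM2l// fM.
    by rewrite ler_norml; apply/andP; split; lra.
  move=> /(_ H); rewrite subr0 ler_norml => /andP[h1 h2].
  have E : omega * M / 2 / D * t `^ D = omega * M / D * t `^ D / 2 by field; rewrite gt_eqF.
  rewrite E in h1 h2; apply/andP; split; lra.
have P_ge0 t : 0 < t < r3 -> 0 <= P t.
  move=> tr; have := Pb r3 C; rewrite r30 lexx => /(_ isT) H.
  by have /andP[] := H (fun t ht => fC (proj1 (andP ht))) t tr.
have f1_ge0 t : 0 < t < r3 -> 0 <= f1 t.
  by move=> tr; have := P_ge0 t tr; rewrite /P pmulr_rge0// powR_gt0//; case/andP: tr.
have fincr s t : 0 < s <= t -> t < r3 -> f s <= f t.
  move=> /andP[s0 st] tr; apply: (@deriv_ge0_le R f f1) => // x /andP[x1 x2].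
  - by apply: fd; lra.
  - by apply: f1_ge0; apply/andP; split; lra.
  - have x0 : 0 < x by lra.
    exact: der_cont (fd x0).
pose s := r3 / 2; have s0 : 0 < s by rewrite divr_gt0.
have sr : s < r3 by rewrite /s; lra.
have fs := f0 s0.
have half t : 0 < t < s -> f t <= f s / 2.
  move=> ts; have f1b x : 0 < x < s -> 0 <= f1 x <= omega * f s / D * x `^ (1 - 2 * a).
    move=> xs; have /andP[x0 xs'] := xs; apply/andP; split; first by apply: f1_ge0; apply/andP; split; lra.
    have := Pb s (f s); rewrite s0 (ltW sr) => /(_ isT) H.
    have /H/(_ x xs)/andP[_] : forall t, 0 < t < s -> f t <= f s.
      by move=> y /andP[y0 ys]; apply: fincr => //; rewrite y0 ltW.
    have -> : x `^ D = x `^ (D - 1 + 2 * a) * x `^ (1 - 2 * a) by rewrite -powRB_gt0//; congr (_ `^ _); ring.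
    by rewrite /P mulrCA ler_pM2l// powR_gt0.
  have := @limit0_asymp R f f1 phi0 (K / g) (omega * f s / D / 2) (omega * f s / D / 2) g s g0 fd fphi0 _ t ts.
  have gE : g - 1 = 1 - 2 * a by rewrite /g; ring.
  rewrite gE phi00 subr0.
  have H x : 0 < x < s -> `|f1 x - omega * f s / D / 2 * x `^ (1 - 2 * a)| <=
      omega * f s / D / 2 * x `^ (1 - 2 * a).
    move=> /f1b; have -> : omega * f s / D / 2 * x `^ (1 - 2 * a) =
      omega * f s / D * x `^ (1 - 2 * a) / 2 by ring.
    by move: (omega * f s / D * _) => y /andP[? ?]; rewrite ler_norml; apply/andP; split; lra.
  move=> /(_ H); rewrite ler_norml => /andP[_ h].
  have h2 : f t <= omega * f s / D / g * t `^ g.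
    have E : omega * f s / D / 2 / g * t `^ g = omega * f s / D / g * t `^ g / 2.
      by field; rewrite !gt_eqF.
    rewrite E in h; lra.
  apply: le_trans h2 _.
  have /andP[t0 ts'] := ts.
  have := H2 t; rewrite t0/= mul1r => /(_ _)/ltW h3.
  have {}h3 : t `^ g <= D * g / (2 * omega).
    by apply: h3; apply: lt_trans ts' (lt_le_trans sr _); rewrite ge_min lexx orbT.
  have w0 : 0 <= omega * f s / D / g by rewrite !divr_ge0 ?(ltW D0) ?(ltW g0)// mulr_ge0 ?ltW.
  apply: le_trans (ler_wpM2l w0 h3) _.
  have -> : omega * f s / D / g * (D * g / (2 * omega)) = f s / 2 by field; rewrite !gt_eqF.
  exact: lexx.
(* The halved bound holds at points [t < s] arbitrarily close to [s], against continuity at [s]. *)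
have fc : {for s, continuous f} := der_cont (fd s0).
have fs2 : 0 < f s / 2 by rewrite divr_gt0.
have [e ee He] := (ct_epsP _ _).1 fc _ fs2.
pose t := s - Num.min s e / 2.
have m0 : 0 < Num.min s e by rewrite lt_min s0.
have ms : Num.min s e <= s by rewrite ge_min lexx.
have me : Num.min s e <= e by rewrite ge_min lexx orbT.
have := He t; have := half t.
have -> : 0 < t < s by rewrite /t; apply/andP; split; lra.
have -> : `|t - s| < e by rewrite /t addrAC subrr sub0r normrN gtr0_norm; lra.
move=> /(_ isT) h1 /(_ isT); rewrite ltr_norml => /andP[h2 _]; lra.
Qed.

Hypothesis fvanish : forall r e, 0 < e -> exists2 s, r < s & f s < e.

Let F x := x `^ (p + 1) / (p + 1) - omega / 2 * x ^+ 2.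
Let En t := t `^ (2 * a) / 2 * f1 t ^+ 2 + F (f t).

(** The weight contributes [a t^(2a-1) f1^2] and the equation [- (D - 1 + 2 a) t^(2a-1) f1^2];
    everything else cancels. *)
Lemma radial_energy_der t : 0 < t ->
  isder t (1 : R) En (- ((D - 1 + a) * t `^ (2 * a - 1) * f1 t ^+ 2)).
Proof.
move=> t0; have ft := f0 t0; have pp : 0 < p + 1 by have := p1; lra.
eapply isder_eq; first by rewrite /En /F; der => //; (exact: fd || exact: f1d).
cbv beta; rewrite ode// /= !expr1 addrK.
have -> : t `^ (2 * a - 1) = t `^ (2 * a) / t by rewrite -[in RHS](powR_sub1M (2 * a) t0) mulfK// gt_eqF.
by rewrite powRN; field; rewrite !gt_eqF ?powR_gt0.
Qed.

(** Dropping its nonnegative terms, the energy is at least [- omega / 2 * f^2], which is as small as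
    desired at the large radii provided by [fvanish]; a negative energy could only decrease
    further. *)
Lemma radial_energy_ge0 t : 0 < t -> 0 <= En t.
Proof.
move=> t0; rewrite leNgt; apply/negP => En0.
have e0 : 0 < Num.min 1 (- En t / omega) by rewrite lt_min ltr01 divr_gt0// oppr_gt0.
have [s ts fs] := fvanish t e0.
have s0 : 0 < s by lra.
have : - En t <= - En s.
  apply: (@deriv_ge0_le R (fun t => - En t) (fun t => (D - 1 + a) * t `^ (2 * a - 1) * f1 t ^+ 2)); first exact: ltW.
  - move=> x /andP[x1 x2]; have x0 : 0 < x by lra.
    by eapply isder_eq; [apply: derN; exact: radial_energy_der|rewrite opprK].
  - move=> x _; have q0 : 0 <= D - 1 + a by case/andP: a01 => a0 _; have := D1; lra.
    by nn.
  - move=> x /andP[x1 x2]; have x0 : 0 < x by lra.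
    by apply: ctN; exact: der_cont (radial_energy_der x0).
have fs0 := f0 s0.
move: fs; rewrite lt_min => /andP[fs1 fs2].
have pp : 0 < p + 1 by have := p1; lra.
have h1 : - (omega / 2 * f s ^+ 2) <= En s.
  rewrite /En /F addrA lerDr addr_ge0//; first by rewrite mulr_ge0 ?sqr_ge0// divr_ge0// powR_ge0.
  by rewrite divr_ge0 ?powR_ge0 ?ltW.
have h2 : f s ^+ 2 <= f s by rewrite expr2 ler_piMr ?ltW.
rewrite ltr_pdivlMr// in fs2.
have h3 : omega * f s ^+ 2 <= omega * f s by rewrite ler_pM2l.
have h4 : 0 <= omega * f s by rewrite mulr_ge0 ?ltW.
lra.
Qed.

(** Near 0 the kinetic term is at most [K^2 / 2 * r^g], so the energy tends to [F phi0], which is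
    therefore nonnegative. This says [phi0^(p-1) >= omega (p + 1) / 2], and the right side exceeds
    [omega] because [p > 1]. *)
Lemma radial_c_gt0 : 0 < c.
Proof.
have ph0 : 0 < phi0 by rewrite lt_neqAle eq_sym radial_limit_neq0 radial_limit_ge0.
have pp : 0 < p + 1 by have := p1; lra.
have F0 : 0 <= F phi0.
  rewrite leNgt; apply/negP => Fn.
  have e0 : 0 < - F phi0 / 2 by lra.
  have Fc : {for phi0, continuous F} by rewrite /F; ct.
  have [r1 /andP[r10 r11] H1] := radial_near Fc e0.
  have [r2 /andP[r20 r21] H2] := power_small (K ^+ 2 / 2) g0 e0.
  pose r := Num.min r1 r2 / 2.
  have m0 : 0 < Num.min r1 r2 by rewrite lt_min r10.
  have m1 : Num.min r1 r2 <= r1 by rewrite ge_min lexx.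
  have m2 : Num.min r1 r2 <= r2 by rewrite ge_min lexx orbT.
  have r0 : 0 < r by rewrite divr_gt0.
  have := H1 r; have -> : 0 < r < r1 by rewrite /r; apply/andP; split; lra.
  move=> /(_ isT); rewrite ltr_norml => /andP[_ h1].
  have := H2 r; have -> : 0 < r < r2 by rewrite /r; apply/andP; split; lra.
  move=> /(_ isT) h2.
  have h3 : r `^ (2 * a) / 2 * f1 r ^+ 2 <= K ^+ 2 / 2 * r `^ g.
    have := f1K (t := r); have -> : 0 < r <= 1 by rewrite /r; apply/andP; split; lra.
    move=> /(_ isT) h.
    have h' : f1 r ^+ 2 <= (K * r `^ (1 - 2 * a)) ^+ 2.
      by rewrite -[f1 r ^+ 2]real_normK ?num_real// lerXn2r ?nnegrE// (le_trans _ h).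
    have -> : r `^ g = r `^ (2 * a) * (r `^ (1 - 2 * a) * r `^ (1 - 2 * a)).
      by rewrite -!powRB_gt0//; congr (_ `^ _); rewrite /g; ring.
    have -> : K ^+ 2 / 2 * (r `^ (2 * a) * (r `^ (1 - 2 * a) * r `^ (1 - 2 * a))) =
      r `^ (2 * a) / 2 * (K * r `^ (1 - 2 * a)) ^+ 2 by ring.
    by rewrite ler_wpM2l// divr_ge0 ?powR_ge0.
  have := radial_energy_ge0 r0; rewrite /En; lra.
have E1 : phi0 `^ (p + 1) = phi0 `^ (p - 1) * phi0 ^+ 2.
  by rewrite -powR_mulrn ?ltW// -powRB_gt0//; congr (_ `^ _); ring.
have h : omega * (p + 1) / 2 <= phi0 `^ (p - 1).
  have s0 : 0 < phi0 ^+ 2 by rewrite exprn_gt0.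
  move: F0; rewrite /F E1 subr_ge0 => F0.
  rewrite -(ler_pM2r s0).
  have -> : omega * (p + 1) / 2 * phi0 ^+ 2 = omega / 2 * phi0 ^+ 2 * (p + 1) by ring.
  by rewrite -ler_pdivlMr.
have h2 : omega < phi0 `^ (p - 1).
  apply: lt_le_trans h; rewrite ltr_pdivlMr// ltr_pM2l//; have := p1; lra.
rewrite /c -(powR_sub1M p ph0) -mulrBl mulr_gt0// subr_gt0//.
Qed.

End regular_origin.

End radial_asymptotic_analysis.

(** * Integration by parts for elements of H^{1,a} *)

Section gradient_identity.
Context {R : realType} {d : nat}.
Local Notation mu := (@lebesgue_rV R d).
Implicit Types (x : 'rV[R]_d) (r e : R).

Lemma weight_cont (a : R) : 0 <= a -> continuous (@weight R d a).
Proof.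
move=> a0; have -> : @weight R d a = fun x => Num.max (enorm x) 0 `^ (2 * a).
  by apply/funext => x; rewrite /weight max_l// enorm_ge0.
apply: ctAll => x; apply: (@ct_comp _ _ (fun s => Num.max s 0 `^ (2 * a))); last exact: enorm_cont.
by apply: powR_max_cont; rewrite mulr_ge0.
Qed.

Lemma young (e y z : R) : 0 < e -> `|y * z| <= e^-1 * y ^+ 2 + e * z ^+ 2.
Proof.
move=> e0; have h1 := sqr_ge0 (y - e * z); have h2 := sqr_ge0 (y + e * z).
have E1 : e^-1 * (y - e * z) ^+ 2 = e^-1 * y ^+ 2 + e * z ^+ 2 - 2 * (y * z) by field; rewrite gt_eqF.
have E2 : e^-1 * (y + e * z) ^+ 2 = e^-1 * y ^+ 2 + e * z ^+ 2 + 2 * (y * z) by field; rewrite gt_eqF.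
have e1 : 0 <= e^-1 by rewrite invr_ge0 ltW.
have {}h1 := mulr_ge0 e1 h1; have {}h2 := mulr_ge0 e1 h2.
have h3 : 0 <= e^-1 * y ^+ 2 + e * z ^+ 2 by rewrite addr_ge0// mulr_ge0 ?sqr_ge0// ltW.
by rewrite ler_norml; apply/andP; split; lra.
Qed.

Lemma H1a_norm_lt (Q : nat -> 'rV[R]_d -> R) (e : R) : 0 < e ->
  (forall n x, 0 <= Q n x) ->
  ((\int[mu]_x (Q n x)%:E) `^ 2^-1)%E @[n --> \oo] --> 0%E ->
  exists n, (\int[mu]_x (Q n x)%:E <= e%:E)%E.
Proof.
move=> e0 Q0 /fine_cvgP[]; move=> [n0 _ Hf] Hc.
have s0 : 0 < Num.sqrt e by rewrite sqrtr_gt0.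
have /cvgrPdistC_lt/(_ _ s0)[n1 _ H1] := Hc.
pose n := maxn n0 n1; exists n.
have Hn := Hf n (leq_maxl _ _); have := H1 n (leq_maxr _ _).
have I0 : (0 <= \int[mu]_x (Q n x)%:E)%E by apply: integral_ge0 => x _; rewrite lee_fin.
rewrite /= subr0 => h.
have -> : (\int[mu]_x (Q n x)%:E = ((\int[mu]_x (Q n x)%:E) `^ 2^-1) `^ 2)%E.
  by rewrite -poweRrM mulVf// poweRe1.
rewrite -(fineK Hn) poweR_EFin lee_fin -[leRHS](sqr_sqrtr (ltW e0)).
rewrite -[leRHS]powR_mulrn ?sqrtr_ge0//.
have f0 : 0 <= fine ((\int[mu]_x (Q n x)%:E) `^ 2^-1)%E by apply: fine_ge0; exact: poweR_ge0.
by rewrite ge0_ler_powR ?nnegrE ?sqrtr_ge0// ltW// (le_lt_trans _ h)// ler_norm.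
Qed.

(* The identity holds for Schwartz functions by the divergence theorem; Young's inequality with a
   small weight [e] controls the error in the [H^{1,a}] norm. *)
Lemma gradient_identity (a A : R) (phi : 'rV[R]_d -> R) G (H H' h : R -> R) :
  0 <= a -> H1a_gradient a phi G -> regular_profile H H' ->
  (forall r, 0 <= r -> H r = r `^ (2 * a) * h r) ->
  continuous h ->
  (forall r, A < r -> h r = 0) -> (forall r, A < r -> H r = 0) -> (forall r, A < r -> H' r = 0) ->
  let S x := \sum_i G x ord0 i * (H (enorm x) * x ord0 i) + phi x * @field_div R d H H' (enorm x) in
  mu.-integrable setT (EFin \o S) -> (\int[mu]_x (S x)%:E = 0)%E.
Proof.
move=> a0 [mphi mG [u [us uc]]] HH Hh hc hA HA H'A S iS.
pose T n x := \sum_i partial i (u n) x * (H (enorm x) * x ord0 i) + u n x * @field_div R d H H' (enorm x).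
pose Q n x := weight a x * enorm (grad (u n) x - G x) ^+ 2 + `|u n x - phi x| ^+ 2.
pose fd x := @field_div R d H H' (enorm x).
(* Since [H] carries the weight, Young's inequality leaves one weight in each square; [B] collects
   the factors independent of the approximating sequence and is continuous with compact support. *)
pose B x := weight a x * (h (enorm x) ^+ 2 * sqn x) + fd x ^+ 2.
have fdc : continuous fd := field_div_cont HH.
have hec : continuous (fun x : 'rV[R]_d => h (enorm x)).
  by apply: ctAll => x; apply: ct_comp; [exact: hc|exact: enorm_cont].
have Bc : continuous B.
  apply: ctAll => x; rewrite /B; ct;
    by [exact: weight_cont|exact: hec|exact: sqn_cont|exact: fdc].
have BA x : A < enorm x -> B x = 0.
  move=> xA; rewrite /B /fd /field_div hA// HA// H'A// expr0n/= !mulr0 mul0r.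
  by rewrite mulr0 addr0 expr0n/= addr0.
have iB : mu.-integrable setT (EFin \o B) := cc_integrable Bc BA.
have B0 x : 0 <= B x.
  apply: addr_ge0; last exact: sqr_ge0.
  by apply: mulr_ge0; [exact: powR_ge0|exact: mulr_ge0 (sqr_ge0 _) (sqn_ge0 _)].
have Q0 n x : 0 <= Q n x.
  apply: addr_ge0; last exact: sqr_ge0.
  by apply: mulr_ge0; [exact: powR_ge0|exact: sqr_ge0].
have uder n i x : isder x (e_ i) (u n) (partial i (u n) x).
  by apply: isder_of => //; exact: ((us n).1 [::] x I).2.
have ucont n : continuous (u n) by move=> x; exact: ((us n).1 [::] x I).1.
have pcont n i : continuous (partial i (u n)) by move=> x; exact: ((us n).1 [:: i] x I).1.
have Tn n : mu.-integrable setT (EFin \o T n) /\ (\int[mu]_x (T n x)%:E = 0)%E.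
  have [] := @divergence_theorem R d (u n) (fun i => partial i (u n)) H H' A (uder n) (ucont n) (pcont n) HH.
  - by move=> x xA; rewrite HA// mulr0.
  - by move=> x i xA; rewrite HA// mulr0.
  - by move=> x xA; rewrite H'A// mulr0.
  - by [].
have mQ n : measurable_fun setT (Q n : 'rV[R]_d -> measurableTypeR R).
  apply: measurable_funD.
    apply: measurable_funM; first by apply: cont_measurable_rV; exact: weight_cont.
    have -> : (fun x => enorm (grad (u n) x - G x) ^+ 2) = @sqn R d \o (fun x => grad (u n) x - G x).
      by apply/funext => x; rewrite enorm_sqr.
    apply: measurableT_comp; first exact: sqn_measurable.
    apply: measurable_fun_rVP => i.
    have -> : (fun x => (grad (u n) x - G x) ord0 i) = (fun x => partial i (u n) x - G x ord0 i).
      by apply/funext => x; rewrite !mxE.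
    apply: measurable_funB; first exact: cont_measurable_rV.
    by apply: (measurableT_comp (measurable_rV_coord i)).
  apply: measurable_funX; apply: measurableT_comp => //.
  by apply: measurable_funB => //; exact: cont_measurable_rV.
have dST n e x : 0 < e -> `|S x - T n x| <= e^-1 * Q n x + e * B x.
  move=> e0.
  have -> : S x - T n x = \sum_i (G x ord0 i - partial i (u n) x) * (H (enorm x) * x ord0 i) +
      (phi x - u n x) * fd x.
    rewrite /S /T -/(fd x) mulrBl opprD addrACA -sumrB; congr (_ + _).
    by apply: eq_bigr => i _; ring.
  apply: le_trans (ler_normD _ _) _.
  have h2 := young (phi x - u n x) (fd x) e0.
  have h1 : `|\sum_i (G x ord0 i - partial i (u n) x) * (H (enorm x) * x ord0 i)| <=
      e^-1 * (weight a x * enorm (grad (u n) x - G x) ^+ 2) + e * (weight a x * (h (enorm x) ^+ 2 * sqn x)).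
    rewrite enorm_sqr /sqn /dotv !mulr_sumr -big_split/=.
    apply: le_trans (ler_norm_sum _ _ _) _; apply: ler_sum => i _.
    rewrite Hh ?enorm_ge0// -/(weight a x) !mxE -/(partial i (u n) x).
    have w0 : 0 <= weight a x by exact: powR_ge0.
    have -> : (G x ord0 i - partial i (u n) x) * (weight a x * h (enorm x) * x ord0 i) =
      weight a x * ((G x ord0 i - partial i (u n) x) * (h (enorm x) * x ord0 i)) by ring.
    rewrite normrM (ger0_norm w0).
    apply: le_trans (ler_wpM2l w0 (young _ _ e0)) _.
    by rewrite le_eqVlt; apply/orP; left; apply/eqP; ring.
  rewrite /Q /B real_normK ?num_real//.
  have -> : (u n x - phi x) ^+ 2 = (phi x - u n x) ^+ 2 by rewrite -sqrrN opprB.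
  by rewrite (mulrDr e^-1) (mulrDr e) addrACA; exact: lerD h1 h2.
have [M0 M00 HM0] : exists2 M0 : R, 0 <= M0 & (\int[mu]_x (B x)%:E = M0%:E)%E.
  exists (fine (\int[mu]_x (B x)%:E)%E).
    by apply: fine_ge0; apply: integral_ge0 => x _; rewrite lee_fin.
  by rewrite fineK//; exact: (integrable_fin_num measurableT iB).
have [s0 Hs0] : exists s0 : R, (\int[mu]_x (S x)%:E = s0%:E)%E.
  exists (fine (\int[mu]_x (S x)%:E)%E).
  by rewrite fineK//; exact: (integrable_fin_num measurableT iS).
rewrite Hs0; congr EFin; apply/eqP; rewrite -normr_le0; apply/ler_addgt0Pl => e e0; rewrite addr0.
(* With the squared distance at most [eta^2], the total error is at most
   [eta^-1 eta^2 + eta M0 = e]. *)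
pose eta := e / (1 + M0).
have M1 : 0 < 1 + M0 by rewrite ltr_pwDl.
have eta0 : 0 < eta by rewrite divr_gt0.
have [n Hn] := @H1a_norm_lt Q (eta ^+ 2) (exprn_gt0 2 eta0) Q0 uc.
have [iT T0] := Tn n.
have mS := measurable_int _ iS; have mT := measurable_int _ iT.
have iST : mu.-integrable setT (EFin \o (fun x => S x - T n x)).
  exact: (integrableB measurableT iS iT).
have E1 : (\int[mu]_x (S x - T n x)%:E = s0%:E)%E.
  by rewrite -Hs0 -[RHS]sube0 -T0 -(integralB measurableT iS iT).
rewrite -lee_fin -abse_EFin -E1.
have mST := measurable_int _ iST.
apply: le_trans (le_abse_integral _ measurableT mST) _.
have mB : measurable_fun setT (B : 'rV[R]_d -> measurableTypeR R) := cont_measurable_rV Bc.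
have m1 : measurable_fun setT ((fun x => eta^-1 * Q n x) : 'rV[R]_d -> measurableTypeR R).
  exact: measurable_funM (measurable_cst _) (mQ n).
have m2 : measurable_fun setT ((fun x => eta * B x) : 'rV[R]_d -> measurableTypeR R).
  exact: measurable_funM (measurable_cst _) mB.
apply: (@le_trans _ _ (\int[mu]_x (eta^-1 * Q n x + eta * B x)%:E)%E).
  apply: ge0_le_integral => //.
  - exact: measurableT_comp.
  - by apply/measurable_EFinP; exact: measurable_funD.
  - by move=> x _; rewrite lee_fin; exact: dST.
under eq_integral do rewrite EFinD !EFinM.
have iv0 : (0 <= (eta^-1)%:E)%E by rewrite lee_fin invr_ge0 ltW.
have et0 : (0 <= eta%:E)%E by rewrite lee_fin ltW.
rewrite ge0_integralD//; first last.
- exact: ((measurable_EFinP _ _).2 m2).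
- by move=> x _; rewrite mule_ge0// lee_fin.
- exact: ((measurable_EFinP _ _).2 m1).
- by move=> x _; rewrite mule_ge0// lee_fin.
have Q0' x : [set: 'rV[R]_d] x -> (0 <= (Q n x)%:E)%E by rewrite lee_fin.
have B0' x : [set: 'rV[R]_d] x -> (0 <= (B x)%:E)%E by rewrite lee_fin.
have eQ : measurable_fun setT (EFin \o Q n) by apply/measurable_EFinP; exact: mQ.
have eB : measurable_fun setT (EFin \o B) by apply/measurable_EFinP.
have -> := @ge0_integralZl _ _ _ mu _ measurableT _ eQ _ Q0' iv0.
have -> := @ge0_integralZl _ _ _ mu _ measurableT _ eB _ B0' et0.
rewrite HM0.
apply: (@le_trans _ _ ((eta^-1)%:E * (eta ^+ 2)%:E + eta%:E * M0%:E)%E).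
  by rewrite leeD2r// lee_wpmul2l.
rewrite -!EFinM -EFinD lee_fin le_eqVlt; apply/orP; left; apply/eqP.
by rewrite /eta; field; rewrite !gt_eqF.
Qed.

End gradient_identity.

Section origin.
Context {R : realType} {n : nat}.

Lemma origin_measurable : measurable [set (0 : 'rV[R]_n.+1)].
Proof.
rewrite -[X in measurable X]setCK; apply: measurableC; apply: open_measurable_rV.
rewrite (_ : ~` _ = [set x : 'rV[R]_n.+1 | 0 < enorm x]).
  by apply: (@open_comp _ _ (@enorm R n.+1) [set t | 0 < t]) => [y _|]; [exact: enorm_cont|exact: open_gt].
by apply/seteqP; split => x /=; rewrite enorm_gt0 => /eqP.
Qed.

Lemma origin_null : lebesgue_rV n.+1 [set (0 : 'rV[R]_n.+1)] = 0%E.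
Proof.
rewrite /= /rV_cons_measure /pushforward.
apply/eqP; rewrite eq_le measure_ge0 andbT.
apply: (@le_trans _ _ ((@lebesgue_measure R \x lebesgue_rV n)%E ([set 0] `*` setT))).
  apply: le_measure; rewrite ?inE.
  - rewrite -[X in measurable X]setTI; apply: measurable_rV_cons => //.
    exact: origin_measurable.
  - by apply: measurableX => //; exact: measurable_set1.
  - move=> [z v] /= h; split => //=.
    have := congr1 (fun x : 'rV[R]_n.+1 => x ord0 ord0) h.
    by rewrite mxE unlift_none mxE.
by rewrite product_measure1E//= lebesgue_measure_set1 mul0e.
Qed.

Lemma integral_off_origin (q1 q2 : 'rV[R]_n.+1 -> R) :
  measurable_fun setT (q1 : _ -> measurableTypeR R) ->
  measurable_fun setT (q2 : _ -> measurableTypeR R) ->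
  (forall x, x != 0 -> q1 x = q2 x) ->
  (\int[lebesgue_rV n.+1]_x (q1 x)%:E = \int[lebesgue_rV n.+1]_x (q2 x)%:E)%E.
Proof.
move=> m1 m2 q12; apply: ae_eq_integral => //.
- by apply/measurable_EFinP.
- by apply/measurable_EFinP.
exists [set 0]; split; [exact: origin_measurable|exact: origin_null|].
by move=> x /= H; apply/eqP; apply: contra_notT H => x0 _; rewrite q12.
Qed.

End origin.

(** * Radial bumps and their weighted gradients *)

Section bump_profile.
Context {R : realType}.
Variables (a t0 rho : R).
Hypotheses (a0 : 0 <= a) (rho0 : 0 < rho) (t0rho : t0 = 0 \/ rho < t0).
Implicit Types (r t : R).

Definition bump'' (t : R) : R :=
  let s := (t - t0) / rho in
  (- 2 * flat 3 (1 - s ^+ 2) + flat 4 (1 - s ^+ 2)) * (2 * s / rho) ^+ 2 -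
    flat 2 (1 - s ^+ 2) * (2 / rho ^+ 2).

Lemma bump'_der t : isder t (1 : R) (bump' t0 rho) (bump'' t).
Proof.
rewrite /bump'; eapply isder_eq.
  by der; apply: der_comp; [exact: flat_der|der].
by rewrite /bump'' /= -exprVn; ringb.
Qed.

Lemma bump''_cont : continuous bump''.
Proof.
apply: ctAll => t; rewrite /bump''; ct; (apply: ct_comp; [exact: flat_cont|ct]).
Qed.

Lemma bump''_eq0 t : rho < `|t - t0| -> bump'' t = 0.
Proof.
move=> h; rewrite /bump'' /flat !ifT ?mulr0 ?mul0r ?addr0 ?mul0r ?oppr0 ?addr0//;
  by rewrite subr_le0 -real_normK ?num_real// exprn_ege1// normrM normfV (gtr0_norm rho0)
     ler_pdivlMr// mul1r ltW.
Qed.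

(** In either case the derivative vanishes at [t = 0]: a bump centred at 0 is even, and any other
    one is supported away from 0. Through [t = r^2] this gives [bumph r = O(r^2)], so the weighted
    gradient is a regular field at the origin for every [a >= 0]. *)
Lemma bump'_linear : exists2 c : R, 0 <= c & forall t, 0 <= t -> `|bump' t0 rho t| <= c * t.
Proof.
have F t : 0 <= flat 2 (1 - ((t - t0) / rho) ^+ 2) <= 4.
  by rewrite flat_ge0/= (le_trans (flat_le _ _))// -natrX.
case: t0rho => [t00|tr].
  exists (8 / rho ^+ 2); first by rewrite divr_ge0// exprn_ge0// ltW.
  move=> t tp; rewrite /bump' normrM; have /andP[f0 f4] := F t.
  move: f0 f4; rewrite t00 subr0 => f0 f4; rewrite (ger0_norm f0) normrN.
  have -> : 2 * (t / rho) / rho = 2 * t / rho ^+ 2 by field; rewrite gt_eqF.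
  have q0 : 0 <= 2 * t / rho ^+ 2 := divr_ge0 (mulr_ge0 (ler0n _ 2) tp) (sqr_ge0 rho).
  rewrite (ger0_norm q0).
  have -> : 8 / rho ^+ 2 * t = 4 * (2 * t / rho ^+ 2) by field; rewrite gt_eqF.
  by rewrite ler_wpM2r.
have d0 : 0 < t0 - rho by rewrite subr_gt0.
have q0 : 0 <= 8 / (rho * (t0 - rho)) := divr_ge0 (ler0n _ 8) (mulr_ge0 (ltW rho0) (ltW d0)).
exists (8 / (rho * (t0 - rho))) => //.
move=> t tp; have [h|h] := leP rho `|t - t0|.
  by rewrite bump'_eq0// normr0; exact: mulr_ge0 q0 tp.
have tt : t0 - rho < t by move: h; rewrite ltr_norml => /andP[? _]; lra.
rewrite /bump' normrM; have /andP[f0 f4] := F t; rewrite (ger0_norm f0) normrN.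
rewrite !normrM !normfV (gtr0_norm rho0) (ger0_norm (_ : 0 <= 2))//.
have h1 : `|t - t0| / rho <= 1 by rewrite ler_pdivrMr// mul1r ltW.
have h0 : 0 <= `|t - t0| / rho by rewrite divr_ge0// ltW.
apply: (@le_trans _ _ (4 * (2 * 1 / rho))).
  apply: ler_pM => //; first exact: divr_ge0 (mulr_ge0 (ler0n _ 2) h0) (ltW rho0).
  by rewrite ler_pM2r ?invr_gt0// ler_wpM2l.
have -> : 8 / (rho * (t0 - rho)) * t = 4 * (2 * 1 / rho) * (t / (t0 - rho)).
  by field; rewrite !gt_eqF.
rewrite ler_peMr// ?mulr_ge0 ?invr_ge0 ?(ltW rho0)//.
by rewrite ler_pdivlMr// mul1r ltW.
Qed.

(* [|x|^(2a) grad (bump (|x|^2)) = bumpH (|x|) x] *)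
Definition bumph r : R := 2 * bump' t0 rho (r ^+ 2).
Definition bumph' r : R := 4 * r * bump'' (r ^+ 2).
Definition bumpH r : R := r `^ (2 * a) * bumph r.
Definition bumpH' r : R := 2 * a * r `^ (2 * a - 1) * bumph r + r `^ (2 * a) * bumph' r.

Lemma bumph_der r : isder r (1 : R) bumph (bumph' r).
Proof.
rewrite /bumph; eapply isder_eq.
  by der; apply: (@der_comp _ (bump' t0 rho) (fun r => r ^+ 2)); [exact: bump'_der|der].
by rewrite /bumph' /= expr1; ringb.
Qed.

Lemma bumph_cont : continuous bumph.
Proof. by apply: ctAll => r; exact: der_cont (bumph_der r). Qed.

Lemma bumph'_cont : continuous bumph'.
Proof.
apply: ctAll => r; rewrite /bumph'; ct.
by apply: (@ct_comp _ _ bump'' (fun r => r ^+ 2)); [exact: bump''_cont|ct].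
Qed.

Lemma bumph_sqr : exists2 c : R, 0 <= c & forall r, `|bumph r| <= c * r ^+ 2.
Proof.
have [c c0 Hc] := bump'_linear; exists (2 * c); first by rewrite mulr_ge0.
by move=> r; rewrite /bumph normrM ger0_norm// -mulrA ler_wpM2l// Hc// sqr_ge0.
Qed.

Lemma bumph'_lin : exists2 c : R, 0 <= c & forall r, 0 <= r < 1 -> `|bumph' r| <= c * r.
Proof.
have /ct_epsP/(_ 1 ltr01) := bump''_cont (x := 0).
have [M HM] : exists M, forall s, 0 <= s <= 1 -> `|bump'' s| <= M.
  have [M [_ HM]] : bounded_set (bump'' @` `[0, 1]).
    apply: compact_bounded; apply: continuous_compact; last exact: segment_compact.
    exact: continuous_subspaceT bump''_cont.
  exists (`|M| + 1) => s s01; apply: HM.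
    by apply: le_lt_trans (ler_norm M) _; rewrite ltrDl.
  by exists s => //; rewrite /= in_itv.
move=> _; have M0 : 0 <= M.
  by apply: le_trans (normr_ge0 _) (HM 0 _); rewrite lexx ler01.
exists (4 * M); first by rewrite mulr_ge0.
move=> r /andP[r0 r1]; rewrite /bumph' !normrM (ger0_norm r0) (ger0_norm (_ : 0 <= 4))//.
have -> : 4 * M * r = 4 * r * M by ring.
rewrite ler_wpM2l ?mulr_ge0// HM// sqr_ge0/= -(expr1n _ 2) lerXn2r ?nnegrE//; exact: ltW.
Qed.

Lemma small_linear (F : R -> R) (c : R) : (forall r, 0 <= r < 1 -> `|F r - F 0| <= c * r) ->
  forall e : R, 0 < e -> exists2 t, 0 < t & forall r, 0 <= r < t -> `|F r - F 0| < e.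
Proof.
move=> H e e0; have c1 : 0 < `|c| + 1 by rewrite ltr_wpDl.
exists (Num.min 1 (e / (`|c| + 1))); first by rewrite lt_min ltr01 divr_gt0.
move=> r /andP[r0]; rewrite lt_min => /andP[r1 re].
apply: le_lt_trans (H r _) _; first by rewrite r0.
rewrite ltr_pdivlMr// mulrC in re; apply: le_lt_trans re.
by rewrite ler_wpM2r// (le_trans (ler_norm c))// lerDl.
Qed.

Lemma powR_le1 (q r : R) : 0 <= q -> 0 <= r < 1 -> r `^ q <= 1.
Proof.
move=> q0 /andP[r0 r1]; have one (x : R) : 1 `^ x = 1 :> R by rewrite powR1.
by rewrite -[leRHS](one q); apply: ge0_ler_powR; rewrite ?nnegrE ?ler01 ?(ltW r1).
Qed.

Lemma bumpH_regular : regular_profile bumpH bumpH'.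
Proof.
have [c c0 Hc] := bumph_sqr; have [c' c'0 Hc'] := bumph'_lin.
have a20 : 0 <= 2 * a by rewrite mulr_ge0.
have H0 : bumpH 0 = 0.
  have := Hc 0; rewrite expr0n/= mulr0 normr_le0 => /eqP h.
  by rewrite /bumpH h mulr0.
split.
- move=> r r0; rewrite /bumpH; eapply isder_eq; first by der => //; exact: bumph_der.
  by rewrite /bumpH'; ringb.
- move=> r r0; rewrite /bumpH'; ct => //; [exact: bumph_cont|exact: bumph'_cont].
- apply: (@small_linear _ c) => r r01; rewrite H0 subr0.
  have r1 := powR_le1 a20 r01; have /andP[r0 r1'] := r01.
  rewrite /bumpH normrM ger0_norm ?powR_ge0// -[leRHS]mul1r.
  apply: ler_pM => //; first exact: powR_ge0.
  by apply: le_trans (Hc r) _; rewrite ler_wpM2l// expr2 ler_piMr// ltW.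
- have H (r : R) : 0 <= r < 1 -> `|r * bumpH' r - 0 * bumpH' 0| <= (2 * a * c + c') * r.
    move=> r01; have r1 := powR_le1 a20 r01; have /andP[r0 r1'] := r01; rewrite mul0r subr0.
    move: r0; rewrite le_eqVlt => /predU1P[<-|r0]; first by rewrite mul0r normr0 mulr0.
    have -> : r * bumpH' r = r `^ (2 * a) * (2 * a * bumph r + r * bumph' r).
      by rewrite /bumpH' -(powR_sub1M (2 * a) r0); ring.
    rewrite normrM ger0_norm ?powR_ge0// -[leRHS]mul1r.
    apply: ler_pM => //; first exact: powR_ge0.
    apply: le_trans (ler_normD _ _) _; rewrite [leRHS]mulrDl; apply: lerD.
      rewrite normrM ger0_norm// -mulrA; apply: ler_wpM2l => //.
      by apply: le_trans (Hc r) _; rewrite ler_wpM2l// expr2 ler_piMr// ltW.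
    rewrite normrM gtr0_norm//; apply: (@le_trans _ _ (r * (c' * r))).
      by rewrite ler_wpM2l ?Hc' ?(ltW r0)//; apply/andP; split.
    by apply: ler_piMl; [exact: mulr_ge0 c'0 (ltW r0)|exact: ltW].
  move=> e e0; have [t tp Ht] := small_linear H e0.
  by exists t => // r /Ht; rewrite mul0r subr0.
Qed.

Lemma bump_support r : t0 + rho < r ^+ 2 ->
  [/\ bump t0 rho (r ^+ 2) = 0, bumph r = 0, bumpH r = 0 & bumpH' r = 0].
Proof.
move=> h; have h' : rho < `|r ^+ 2 - t0| by apply: lt_le_trans (ler_norm _); lra.
have z : bumph r = 0 by rewrite /bumph bump'_eq0 ?mulr0// ltW.
have z' : bumph' r = 0 by rewrite /bumph' bump''_eq0// mulr0.
split => //; first by rewrite bump_eq0// ltW.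
- by rewrite /bumpH z mulr0.
- by rewrite /bumpH' z z' !mulr0 addr0.
Qed.

Lemma bump_hole r : r ^+ 2 < t0 - rho ->
  [/\ bump t0 rho (r ^+ 2) = 0, bumph r = 0, bumpH r = 0 & bumpH' r = 0].
Proof.
move=> h; have h' : rho < `|r ^+ 2 - t0|.
  by rewrite distrC; apply: lt_le_trans (ler_norm _); lra.
have z : bumph r = 0 by rewrite /bumph bump'_eq0 ?mulr0// ltW.
have z' : bumph' r = 0 by rewrite /bumph' bump''_eq0// mulr0.
split => //; first by rewrite bump_eq0// ltW.
- by rewrite /bumpH z mulr0.
- by rewrite /bumpH' z z' !mulr0 addr0.
Qed.

Lemma bump_large r : 1 + t0 + rho < r -> t0 + rho < r ^+ 2.
Proof.
move=> h; have t00 : 0 <= t0 by have := rho0; case: t0rho => [->//|]; lra.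
have := rho0 => r0; rewrite expr2; apply: (@lt_trans _ _ r); first by lra.
by rewrite ltr_pMr; lra.
Qed.

End bump_profile.

Lemma norm_sub_lt_gt0 {R : realType} (x y : R) : `|x - y| < y -> 0 < x.
Proof. by rewrite ltr_norml => /andP[h _]; lra. Qed.

Lemma enorm_line {R : realType} n (r : R) : enorm (r *: delta_mx ord0 ord0 : 'rV[R]_n.+1) = `|r|.
Proof.
rewrite /enorm /dotv (bigD1 ord0)//= big1 ?addr0; last first.
  by move=> j j0; rewrite !mxE (negbTE j0) andbF mulr0 mul0r.
by rewrite !mxE !eqxx mulr1 -expr2 sqrtr_sqr.
Qed.

(** * From the weak equation to the radial differential equation *)

Section radial_solution.
Context {R : realType} {n : nat}.
Variables (a omega p C : R) (phi : 'rV[R]_n.+1 -> R) (G : 'rV[R]_n.+1 -> 'rV[R]_n.+1) (f : R -> R).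
Hypotheses (a01 : 0 <= a < 1) (om0 : 0 < omega) (p1 : 1 < p).
Hypothesis HG : H1a_gradient a phi G.
Hypothesis weak : forall h, test_function h ->
  (lebesgue_rV n.+1).-integrable setT (EFin \o weak_integrand a omega p phi G h) /\
  (\int[lebesgue_rV n.+1]_x (weak_integrand a omega p phi G h x)%:E = 0)%E.
Hypothesis smooth : smooth_on [set x | x != 0] phi.
Hypothesis pos : forall x, 0 < phi x.
Hypothesis bnd : forall x, phi x <= C.
Hypothesis rad : radial_profile phi f.
Local Notation mu := (@lebesgue_rV R n.+1).
Local Notation D := (n.+1%:R : R).
Implicit Types (x : 'rV[R]_n.+1) (r t e : R).

Let a0 : 0 <= a. Proof. by case/andP: a01. Qed.
Let pt r : 'rV[R]_n.+1 := r *: e_ ord0.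

(** Read off along the half-line spanned by the first basis vector, so that smoothness of [phi] off
    the origin passes to [f]. *)
Definition rad1 r : R := partial ord0 phi (pt r).
Definition rad2 r : R := partial ord0 (partial ord0 phi) (pt r).

Let enorm_pt r : enorm (pt r) = `|r| := enorm_line n r.

Let pt0 r : 0 < r -> [set x : 'rV[R]_n.+1 | x != 0] (pt r).
Proof. by move=> r0 /=; rewrite -enorm_gt0 enorm_pt normr_gt0 gt_eqF. Qed.

Let pt_cont : continuous pt.
Proof.
move=> r; apply: (@cvgrPdistC_lt _ _ _ (nbhs r) (nbhs_filter r) pt (pt r)).2 => e e0.
apply/nbhs_ballP; exists e => //= t /=; rewrite -ball_normE/= distrC => tr.
rewrite /pt -scalerBl; apply: le_lt_trans tr.
apply: norm_leP => // i; rewrite !mxE normrM.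
by rewrite eqxx; case: (i == ord0); rewrite /= ?normr1 ?normr0 ?mulr1 ?mulr0.
Qed.

Let f_phi r : 0 <= r -> f r = phi (pt r).
Proof. by move=> r0; rewrite rad enorm_pt ger0_norm. Qed.

Let line_der (g : 'rV[R]_n.+1 -> R) (c r : R) : isder (pt r) (e_ ord0) g c ->
  isder r (1 : R) (fun t => g (pt t)) c.
Proof.
move=> /isder_lineP gc.
have -> : (fun t => g (pt t)) = (fun t => (fun h : R => g (h *: e_ ord0 + pt r)) (t - r)).
  by apply/funext => t /=; rewrite /pt -scalerDl subrK.
eapply isder_eq.
  apply: (@der_comp _ (fun h : R => g (h *: e_ ord0 + pt r)) (fun t => t - r)).
    by rewrite subrr; exact: gc.
  by der.
by ringb.
Qed.

Lemma rad_der r : 0 < r -> isder r (1 : R) f (rad1 r).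
Proof.
move=> r0; apply: (@der_pos _ (fun t => phi (pt t))) => //.
  by move=> t t0; rewrite f_phi// ltW.
by apply: line_der; apply: isder_of => //; exact: (smooth [::] (pt0 r0)).2.
Qed.

Lemma rad1_der r : 0 < r -> isder r (1 : R) rad1 (rad2 r).
Proof.
by move=> r0; apply: line_der; apply: isder_of => //; exact: (smooth [:: ord0] (pt0 r0)).2.
Qed.

Lemma rad2_cont r : 0 < r -> {for r, continuous rad2}.
Proof.
move=> r0; apply: (@continuous_comp _ _ _ pt); first exact: pt_cont.
exact: (smooth [:: ord0; ord0] (pt0 r0)).1.
Qed.

Let f_gt0 r : 0 <= r -> 0 < f r. Proof. by move=> r0; rewrite f_phi. Qed.
Let f_le r : 0 <= r -> f r <= C. Proof. by move=> r0; rewrite f_phi. Qed.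
Let C0 : 0 < C. Proof. exact: lt_le_trans (f_gt0 (lexx 0)) (f_le (lexx 0)). Qed.

Section test.
Variables (t0 rho : R).
Hypotheses (rho0 : 0 < rho) (t0rho : t0 = 0 \/ rho < t0).
Let A := 1 + t0 + rho.
Let H := bumpH a t0 rho.
Let H' := bumpH' a t0 rho.
Let k r := bump t0 rho (r ^+ 2).

(** The weak integrand for the test function [bump t0 rho (|x|^2)] minus the integrand of the
    gradient identity: the weak gradient [G] has dropped out. *)
Definition test_rest x : R := k (enorm x) * (omega * phi x - phi x `^ p) -
  phi x * @field_div R n.+1 H H' (enorm x).

Let far x : A < enorm x -> t0 + rho < enorm x ^+ 2.
Proof. exact: bump_large rho0 t0rho _. Qed.

Let HR : regular_profile H H' := bumpH_regular a0 rho0 t0rho.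

Lemma bump_test : test_function (fun x : 'rV[R]_n.+1 => bump t0 rho (sqn x)).
Proof.
apply: (@cc_test_function R n.+1 _ A).
  have := @smooth_on_radial R n.+1 setT (bump t0 rho) openT (smooth1_bump _ _ _).
  by rewrite (_ : [set x | _] = setT)//; apply/seteqP; split.
by move=> x /far/(bump_support a rho0)[]; rewrite enorm_sqr.
Qed.

Let mphi : measurable_fun setT (phi : 'rV[R]_n.+1 -> measurableTypeR R).
Proof. by case: HG. Qed.

Let fdc : continuous (fun x : 'rV[R]_n.+1 => @field_div R n.+1 H H' (enorm x)) := field_div_cont HR.

Let kc : continuous (fun x : 'rV[R]_n.+1 => k (enorm x)).
Proof.
apply: ctAll => x; rewrite /k; apply: (@ct_comp _ _ (bump t0 rho) (fun x : 'rV[R]_n.+1 => enorm x ^+ 2)).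
  exact: bump_cont.
by ct; exact: enorm_cont.
Qed.

Lemma test_rest_measurable : measurable_fun setT (test_rest : 'rV[R]_n.+1 -> measurableTypeR R).
Proof.
apply: measurable_funB; apply: measurable_funM => //; try exact: cont_measurable_rV.
apply: measurable_funB; first exact: measurable_funM.
by apply: (measurableT_comp (f := fun t => t `^ p)) => //; exact: measurable_powR.
Qed.

Lemma test_rest_integrable : mu.-integrable setT (EFin \o test_rest).
Proof.
have fdA x : A < enorm x -> @field_div R n.+1 H H' (enorm x) = 0.
  move=> /far/(bump_support a rho0)[_ _ h h'].
  by rewrite /field_div /H /H' h h' !mulr0 addr0.
have [M1 M10 HM1] := cc_bounded fdc fdA.
have pp : 0 <= p by have := p1; lra.
pose M := (omega * C + C `^ p) + C * M1.
have M0 : 0 <= M by rewrite /M !addr_ge0 ?mulr_ge0 ?powR_ge0 ?(ltW om0) ?(ltW C0).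
have ZM x : `|test_rest x| <= M.
  have ph := pos x; have pC := bnd x.
  apply: le_trans (ler_normB _ _) _; apply: lerD; last first.
    by rewrite normrM (gtr0_norm ph); apply: ler_pM => //; exact: ltW.
  rewrite normrM ger0_norm ?bump_ge0// -[leRHS]mul1r; apply: ler_pM => //; first exact: bump_ge0.
    by rewrite (le_trans (flat_le _ _))// expr0.
  apply: le_trans (ler_normB _ _) _; rewrite ger0_norm ?mulr_ge0 ?(ltW om0) ?(ltW ph)//.
  rewrite ger0_norm ?powR_ge0//; apply: lerD; first by rewrite ler_pM2l.
  by apply: ge0_ler_powR; rewrite ?nnegrE ?(ltW ph) ?(ltW C0).
have ZA x : A < enorm x -> test_rest x = 0.
  move=> xA; rewrite /test_rest fdA// mulr0 subr0 /k.
  by have /(bump_support a rho0)[-> _ _ _] := far xA; rewrite mul0r.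
exact: le_rdecay_integrable test_rest_measurable (cc_le_rdecay M0 ZM ZA).
Qed.

Lemma integral_test_rest : (\int[mu]_x (test_rest x)%:E = 0)%E.
Proof.
pose h x : R := bump t0 rho (sqn x).
have [iw w0] := weak bump_test.
have a20 : 0 <= a := a0.
pose S x := \sum_i G x ord0 i * (H (enorm x) * x ord0 i) + phi x * @field_div R n.+1 H H' (enorm x).
have SE x : S x = weak_integrand a omega p phi G h x - test_rest x.
  rewrite /weak_integrand /test_rest /k enorm_sqr -/(h x) (gtr0_norm (pos x)) (powR_sub1M p (pos x)).
  have -> : weight a x * dotv (G x) (grad h x) = \sum_i G x ord0 i * (H (enorm x) * x ord0 i).
    rewrite /dotv mulr_sumr; apply: eq_bigr => i _; rewrite !mxE.
    have -> : partial i h x = bump' t0 rho (sqn x) * (2 * x ord0 i).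
      by have [_ E] := der_comp_dir (bump_der t0 rho (sqn x)) (sqn_der i x); exact: E.
    by rewrite /H /bumpH /bumph /weight enorm_sqr; ring.
  by rewrite /S; ring.
have iS : mu.-integrable setT (EFin \o S).
  have -> : EFin \o S = EFin \o (fun x => weak_integrand a omega p phi G h x - test_rest x).
    by apply/funext => x /=; rewrite SE.
  exact: (integrableB measurableT iw test_rest_integrable).
have S0 : (\int[mu]_x (S x)%:E = 0)%E.
  apply: (@gradient_identity R n.+1 a A phi G H H' (bumph t0 rho) a0 HG HR) => //.
  - exact: bumph_cont.
  - by move=> r /(bump_large rho0 t0rho)/(bump_support a rho0)[].
  - by move=> r /(bump_large rho0 t0rho)/(bump_support a rho0)[].
  - by move=> r /(bump_large rho0 t0rho)/(bump_support a rho0)[].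
have E : (\int[mu]_x (S x)%:E = \int[mu]_x ((weak_integrand a omega p phi G h x)%:E - (test_rest x)%:E))%E.
  by apply: eq_integral => x _; rewrite SE.
rewrite E (integralB measurableT iw test_rest_integrable) w0 sub0e in S0.
by rewrite -[LHS]oppeK S0 oppe0.
Qed.

(** A divergence with zero integral is added in order to turn [test_rest] into a prescribed
    continuous function. The two sides are compared off the origin, which is a null set. *)
Lemma integral_field (M M' : R -> R) (Y : 'rV[R]_n.+1 -> R) :
  regular_profile M M' -> (forall r, A < r -> M r = 0) -> (forall r, A < r -> M' r = 0) ->
  continuous Y ->
  (forall x, x != 0 -> @field_div R n.+1 M M' (enorm x) + test_rest x = Y x) ->
  (\int[mu]_x (Y x)%:E = 0)%E.
Proof.
move=> HM MA M'A Yc MY.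
have [] := @divergence_theorem R n.+1 (fun=> 1) (fun _ _ => 0) M M' A
  (fun i x => der_cst 1 x (e_ i)) (fun x => @ct_cst R _ 1 x) (fun i x => @ct_cst R _ 0 x) HM.
- by move=> x /MA ->; rewrite mulr0.
- by move=> x i _; rewrite mul0r.
- by move=> x /M'A ->; rewrite mulr0.
set q := (X in continuous X) => qc qi q0.
have qE x : q x = @field_div R n.+1 M M' (enorm x).
  by rewrite /q big1 ?add0r ?mul1r// => i _; rewrite mul0r.
rewrite -(@integral_off_origin R n (fun x => q x + test_rest x) Y).
- have := @integralD _ _ _ mu _ measurableT _ _ qi test_rest_integrable.
  by rewrite q0 integral_test_rest adde0; apply.
- by apply: measurable_funD; [exact: cont_measurable_rV|exact: test_rest_measurable].
- exact: cont_measurable_rV.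
- by move=> x x0; rewrite qE MY.
Qed.

End test.

Let gap r : R := omega * f r - f r `^ p - ((D - 1 + 2 * a) * r `^ (2 * a - 1) * rad1 r + r `^ (2 * a) * rad2 r).

Let gap_cont r : 0 < r -> {for r, continuous gap}.
Proof.
move=> r0; have fc := der_cont (rad_der r0); have f1c := der_cont (rad1_der r0).
by rewrite /gap; ct => //; [exact: f_gt0 (ltW r0)|exact: rad2_cont].
Qed.

(** If the defect were nonzero at [r], it would keep its sign on the support of a bump [k] around
    [r^2]. The continuous function [k g (g r)] would then be nonnegative with zero integral, hence
    zero, although it is positive at radius [r]. *)
Lemma radial_equation r : 0 < r -> gap r = 0.
Proof.
move=> r0; have [g gE] : exists g, g = gap by exists gap.
have g_cont t : 0 < t -> {for t, continuous g} by rewrite gE; exact: gap_cont.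
rewrite -gE; apply/eqP/negPn/negP => gr.
have g20 : 0 < g r * g r by rewrite -expr2 exprn_even_gt0.
have gc : {for r, continuous (fun t => g t * g r)}.
  by apply: ctM; [exact: g_cont|exact: ct_cst].
have [d1 d10 Hd1] := (ct_epsP _ _).1 gc _ g20.
pose d := Num.min d1 (r / 2); have d0 : 0 < d by rewrite lt_min d10 divr_gt0.
have dd1 : d <= d1 by rewrite ge_min lexx.
have dr : d <= r / 2 by rewrite ge_min lexx orbT.
(* [rho = r d] makes [|t^2 - r^2| < rho] imply [|t - r| < d], because [t + r >= r]. *)
pose t0 := r ^+ 2; pose rho := r * d.
have rho0 : 0 < rho by rewrite mulr_gt0.
have rt : rho < t0 by rewrite /rho /t0 expr2 ltr_pM2l//; lra.
have t0rho : t0 = 0 \/ rho < t0 by right.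
have near t : 0 <= t -> `|t ^+ 2 - t0| < rho -> `|t - r| < d.
  move=> tp; have -> : t ^+ 2 - t0 = (t - r) * (t + r) by rewrite /t0; ring.
  have tr : 0 < t + r by lra.
  rewrite normrM (gtr0_norm tr) => h; rewrite -(ltr_pM2l r0).
  by apply: le_lt_trans h; rewrite mulrC ler_wpM2l// lerDr.
have gpos t : 0 <= t -> `|t ^+ 2 - t0| < rho -> 0 < g t * g r.
  by move=> tp /(near _ tp) h; exact: norm_sub_lt_gt0 (Hd1 t (lt_le_trans h dd1)).
pose k t := bump t0 rho (t ^+ 2).
have k0 t : 0 <= t -> rho <= `|t ^+ 2 - t0| -> k t = 0.
  by move=> _; exact: bump_eq0.
pose H := bumpH a t0 rho; pose H' := bumpH' a t0 rho; pose h := bumph t0 rho.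
pose s := Num.sqrt (t0 - rho); have s0 : 0 < s by rewrite sqrtr_gt0 subr_gt0.
have hole t : 0 <= t < s -> [/\ k t = 0, h t = 0, H t = 0 & H' t = 0].
  move=> /andP[tp ts]; apply: bump_hole => //.
  by rewrite -(@sqr_sqrtr _ (t0 - rho)) ?subr_ge0 ?(ltW rt)// ltrXn2r ?nnegrE ?sqrtr_ge0.
have z0 : 0 <= (0 : R) < s by rewrite lexx.
have [k00 _ _ _] := hole 0 z0.
(* The divergence of the first term cancels the one in [test_rest] up to [r f' H], which is in turn
   cancelled by the derivative of [k] in the second term; only [k] times the equation remains. All
   of it vanishes below [s], so the field is trivially regular at the origin. *)
pose M t := if t <= 0 then 0 else f t * H t - k t * (t `^ (2 * a - 1) * rad1 t).
pose M' t := rad1 t * H t + f t * H' t - (t * h t * (t `^ (2 * a - 1) * rad1 t) +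
  k t * ((2 * a - 1) * t `^ (2 * a - 1 - 1) * rad1 t + t `^ (2 * a - 1) * rad2 t)).
have [Hd H'c _ _] := bumpH_regular a0 rho0 t0rho.
have kd t : isder t (1 : R) k (t * h t).
  eapply isder_eq; first by apply: (@der_comp _ (bump t0 rho) (fun t => t ^+ 2)); [exact: bump_der|der].
  by rewrite /h /bumph; ringb.
have M0 t : 0 <= t < s -> M t = 0.
  by move=> /hole[kz _ hz _]; rewrite /M kz hz mulr0 mul0r subr0 if_same.
have M'0 t : 0 <= t < s -> M' t = 0.
  by move=> /hole[kz hz Hz H'z]; rewrite /M' kz hz Hz H'z !(mulr0, mul0r) !addr0 subr0.
have MR : regular_profile M M'.
  split.
  - move=> t tp; apply: (@der_pos _ (fun t => f t * H t - k t * (t `^ (2 * a - 1) * rad1 t))) => //.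
      by move=> t' t'0; rewrite /M leNgt t'0.
    eapply isder_eq.
      apply: derB; apply: derM; [exact: rad_der|exact: Hd|exact: kd|].
      by apply: derM; [exact: power_der|exact: rad1_der].
    by rewrite /M' /H'; ringb.
  - move=> t tp; have fc := der_cont (rad_der tp); have f1c := der_cont (rad1_der tp).
    have Hc := der_cont (Hd t tp); have kc := der_cont (kd t); have hc : {for t, continuous h} := @bumph_cont R t0 rho t.
    by rewrite /M'; ct => //; [exact: H'c|exact: rad2_cont].
  - by move=> e e0; exists s => // t ts; rewrite !M0 ?subrr ?normr0 ?lexx.
  - by move=> e e0; exists s => // t ts; rewrite M'0// mulr0 normr0.
have far t : 1 + t0 + rho < t -> [/\ k t = 0, h t = 0, H t = 0 & H' t = 0].
  by move=> /(bump_large rho0 t0rho)/(bump_support a rho0).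
pose Y (x : 'rV[R]_n.+1) := k (enorm x) * (g (enorm x) * g r).
have Yc : continuous Y.
  apply: ctAll => x; apply: (@radial_cont R n.+1 (fun t => k t * (g t * g r))).
    rewrite -enorm_gt0 => x0; apply: ctM; first exact: der_cont (kd _).
    by apply: ctM; [exact: g_cont|exact: ct_cst].
  move=> _ e e0; exists s => // t ts.
  have [-> _ _ _] := hole t ts; rewrite k00.
  by rewrite !mul0r subrr normr0.
have Y0 x : 0 <= Y x.
  have [hk|hk] := leP rho `|enorm x ^+ 2 - t0|.
    by rewrite /Y k0 ?mul0r// enorm_ge0.
  by rewrite /Y mulr_ge0 ?bump_ge0// ltW// gpos// enorm_ge0.
have YE : (\int[mu]_x (Y x)%:E = 0)%E.
  pose Y1 (x : 'rV[R]_n.+1) := k (enorm x) * g (enorm x).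
  have Y1c : continuous Y1.
    apply: ctAll => x; apply: (@radial_cont R n.+1 (fun t => k t * g t)).
      by rewrite -enorm_gt0 => x0; apply: ctM; [exact: der_cont (kd _)|exact: g_cont].
    move=> _ e e0; exists s => // t ts.
    have [-> _ _ _] := hole t ts; rewrite k00.
    by rewrite !mul0r subrr normr0.
  have Y1A x : 1 + t0 + rho < enorm x -> Y1 x = 0 by move=> /far[kz _ _ _]; rewrite /Y1 kz mul0r.
  have Y10 : (\int[mu]_x (Y1 x)%:E = 0)%E.
    apply: (integral_field rho0 t0rho MR) => //.
    - by move=> t /far[kz _ Hz _]; rewrite /M kz Hz mulr0 mul0r subr0 if_same.
    - by move=> t /far[kz hz Hz H'z]; rewrite /M' kz hz Hz H'z !(mulr0, mul0r) !addr0 subr0.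
    - move=> x x0; have e0 : 0 < enorm x by rewrite enorm_gt0.
      rewrite /test_rest -/(k (enorm x)) -/H -/H' rad /field_div /M leNgt e0/= /M' /Y1 gE /gap.
      have E2 : enorm x `^ (2 * a - 1 - 1) = enorm x `^ (2 * a - 1) / enorm x.
        by rewrite -[in RHS](powR_sub1M (2 * a - 1) e0) mulfK// gt_eqF.
      have E1 : enorm x `^ (2 * a) = enorm x `^ (2 * a - 1) * enorm x by rewrite powR_sub1M.
      have HE : H (enorm x) = enorm x `^ (2 * a) * h (enorm x) by [].
      rewrite E2 HE E1; move: (enorm x `^ _) => T; move: (H' _) (h _) (k _) => Hp hh kk.
      by field; rewrite gt_eqF.
  have -> : (\int[mu]_x (Y x)%:E = \int[mu]_x ((g r)%:E * (Y1 x)%:E))%E.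
    by apply: eq_integral => x _; rewrite -EFinM /Y /Y1; congr EFin; ring.
  by rewrite (integralZl measurableT (cc_integrable Y1c Y1A)) Y10 mule0.
have := integral0_cont_eq0 Yc Y0 YE (pt r).
rewrite /Y enorm_pt gtr0_norm// => /eqP; rewrite mulf_eq0 (gt_eqF g20) orbF gt_eqF//.
by apply: bump_gt0; rewrite subrr normr0.
Qed.

Lemma rad2E t : 0 < t ->
  rad2 t = (omega * f t - f t `^ p) * t `^ (- (2 * a)) - (D - 1 + 2 * a) / t * rad1 t.
Proof.
move=> t0; have := radial_equation t0; rewrite /gap => /eqP.
rewrite subr_eq0 => /eqP ->.
have -> : t `^ (2 * a - 1) = t `^ (2 * a) / t by rewrite -[in RHS](powR_sub1M (2 * a) t0) mulfK// gt_eqF.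
by rewrite powRN; field; rewrite !gt_eqF ?powR_gt0.
Qed.

End radial_solution.

Section right_limits.
Context {R : realType}.
Implicit Types (f g : R -> R) (r t e : R).

Lemma near_right0P (P : R -> Prop) :
  (\forall r \near 0^'+, P r) <-> exists2 t : R, 0 < t & forall r, 0 < r < t -> P r.
Proof.
split=> [[t /= t0 H]|[t t0 H]].
  exists t => // r /andP[r0 rt]; apply: H => //=.
  by rewrite sub0r normrN gtr0_norm.
exists t => //= r /=; rewrite sub0r normrN => rt r0; apply: H.
by rewrite r0 (le_lt_trans (ler_norm r)).
Qed.

Lemma lim_right0P f (l : R) : f r @[r --> 0^'+] --> l <->
  forall e, 0 < e -> exists2 t : R, 0 < t & forall r, 0 < r < t -> `|f r - l| < e.
Proof.
split=> [/cvgrPdistC_lt H e e0|H].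
  exact/near_right0P/(H e e0).
by apply/cvgrPdistC_lt => e e0; apply/near_right0P; exact: H.
Qed.

Lemma lim_right0_eq f g (l : R) : (forall r, 0 < r -> f r = g r) ->
  f r @[r --> 0^'+] --> l -> g r @[r --> 0^'+] --> l.
Proof.
move=> fg /lim_right0P H; apply/lim_right0P => e e0; have [t t0 Ht] := H e e0.
by exists t => // r rt; rewrite -fg ?Ht//; case/andP: rt.
Qed.

Lemma cont_right0 f : {for 0, continuous f} -> f r @[r --> 0^'+] --> f 0.
Proof.
move=> /ct_epsP fc; apply/lim_right0P => e e0; have [t t0 Ht] := fc e e0.
by exists t => // r /andP[r0 rt]; apply: Ht; rewrite subr0 gtr0_norm.
Qed.

Lemma right0_profile f (l : R) : f 0 = l -> f r @[r --> 0^'+] --> l ->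
  forall e : R, 0 < e -> exists2 t : R, 0 < t & forall r, 0 <= r < t -> `|f r - l| < e.
Proof.
move=> f0 /lim_right0P H e e0; have [t t0 Ht] := H e e0; exists t => // r /andP[].
rewrite le_eqVlt => /predU1P[<- _|r0 rt]; first by rewrite f0 subrr normr0.
by apply: Ht; rewrite r0.
Qed.

Lemma power_blowup (c q : R) : 0 < c -> 0 < q ->
  forall A : R, exists2 t, 0 < t & forall r, 0 < r < t -> A <= c * r `^ (- q).
Proof.
move=> c0 q0 A; have A1 : 0 < `|A| + 1 by rewrite ltr_wpDl.
have [t /andP[t0 _] Ht] := power_small 1 q0 (divr_gt0 c0 A1).
exists t => // r rt; have := Ht r rt; rewrite mul1r; have r0 : 0 < r by case/andP: rt.
rewrite ltr_pdivlMr// powRN ler_pdivlMr ?powR_gt0// => h.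
apply: le_trans (ltW h); rewrite mulrC ler_wpM2l ?powR_ge0//.
by rewrite (le_trans (ler_norm A))// lerDl.
Qed.

End right_limits.

(** * Vanishing of the flux at the origin *)

Section thin_origin.
Context {R : realType} {n : nat}.
Variables (a omega p C : R) (phi : 'rV[R]_n.+1 -> R) (G : 'rV[R]_n.+1 -> 'rV[R]_n.+1) (f : R -> R).
Hypotheses (a01 : 0 <= a < 1) (om0 : 0 < omega) (p1 : 1 < p).
Hypothesis HG : H1a_gradient a phi G.
Hypothesis weak : forall h, test_function h ->
  (lebesgue_rV n.+1).-integrable setT (EFin \o weak_integrand a omega p phi G h) /\
  (\int[lebesgue_rV n.+1]_x (weak_integrand a omega p phi G h x)%:E = 0)%E.
Hypothesis smooth : smooth_on [set x | x != 0] phi.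
Hypothesis pos : forall x, 0 < phi x.
Hypothesis bnd : forall x, phi x <= C.
Hypothesis rad : radial_profile phi f.
Local Notation mu := (@lebesgue_rV R n.+1).
Implicit Types (x : 'rV[R]_n.+1) (r t e m : R).
Let a0 : 0 <= a. Proof. by case/andP: a01. Qed.
Let f1 := rad1 phi.
Let f2 := rad2 phi.
Let nl t := omega * f t - f t `^ p.

Let fd t : 0 < t -> isder t (1 : R) f (f1 t).
Proof. exact: rad_der smooth rad _. Qed.
Let f1d t : 0 < t -> isder t (1 : R) f1 (f2 t).
Proof. exact: rad1_der smooth _. Qed.
Let f_gt0 t : 0 < t -> 0 < f t.
Proof. by move=> t0; rewrite -(gtr0_norm t0) -(enorm_line n) -rad. Qed.
Let f_le t : 0 < t -> f t <= C.
Proof. by move=> t0; rewrite -(gtr0_norm t0) -(enorm_line n) -rad. Qed.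

(* In this range the fundamental solution of [div (|x|^(2a) grad)] is bounded, and only test
   functions that do not vanish at the origin exclude it. *)
Lemma thin_flux_eq0 m : n.+1%:R = 1 :> R -> 2 * a < 1 ->
  (forall t, 0 < t <= 1 ->
    `|t `^ (n.+1%:R - 1 + 2 * a) * f1 t - m| <= (omega * C + C `^ p) / n.+1%:R * t `^ n.+1%:R) ->
  m = 0.
Proof.
move=> D1 a1 Hm0; apply/eqP/negPn/negP => m0.
have ode t (t0 : 0 < t) := rad2E a01 om0 p1 HG weak smooth pos bnd rad t0.
pose P t := t `^ (2 * a) * f1 t.
pose B := omega * C + C `^ p.
have B0 : 0 <= B.
  have C0 : 0 <= C by apply/ltW/(lt_le_trans (f_gt0 ltr01))/f_le.
  by rewrite addr_ge0 ?powR_ge0// mulr_ge0// ltW.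
have Hm t : 0 < t <= 1 -> `|P t - m| <= B * t `^ 1.
  by move=> t01; have := Hm0 t t01; rewrite D1 divr1 subrr add0r.
have Pd t : 0 < t -> isder t (1 : R) P (nl t).
  move=> t0; have := radial_flux_der f1d ode t0.
  by rewrite D1 subrr add0r powRr0 mul1r.
pose g := 1 - 2 * a; have g0 : 0 < g by rewrite /g subr_gt0.
have [phi0 Hphi0] : exists l, forall r, 0 < r <= 1 -> `|f r - l| <= (`|m| + B) / g * r `^ g.
  apply: (limit0 g0 fd) => t t01; have /andP[t0 t1] := t01.
  have -> : f1 t = t `^ (g - 1) * P t.
    by rewrite /P mulrA -powRB_gt0// (_ : g - 1 + 2 * a = 0) ?powRr0 ?mul1r// /g; ring.
  rewrite normrM ger0_norm ?powR_ge0// mulrC ler_wpM2r ?powR_ge0//.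
  rewrite -[P t](subrK m); apply: le_trans (ler_normD _ _) _; rewrite addrC lerD2l.
  by apply: le_trans (Hm t t01) _; rewrite powRr1 ?(ltW t0)// ler_piMr.
have fl : f r @[r --> 0^'+] --> phi0.
  apply/lim_right0P => e e0.
  have [t /andP[t0 t1] Ht] := power_small ((`|m| + B) / g) g0 e0.
  exists t => // r rt; apply: le_lt_trans (Ht r rt); apply: Hphi0.
  by case/andP: rt => -> /= rt; rewrite (le_trans (ltW rt)).
pose L := omega * phi0 - Num.max phi0 0 `^ p.
have nll : nl r @[r --> 0^'+] --> L.
  pose h (s : R) := omega * s - Num.max s 0 `^ p.
  have hc : {for phi0, continuous h}.
    apply: ctD; first exact: mulrl_continuous.
    by apply: ctN; apply: powR_max_cont; have := p1; lra.
  apply: (@lim_right0_eq _ (h \o f)).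
    by move=> r r0; rewrite /h/= max_l// ltW// f_gt0.
  exact: (@cvg_comp _ _ _ f h _ _ _ fl hc).
pose W t := (P t - m) / t.
have Wl : W r @[r --> 0^'+] --> L.
  apply/lim_right0P => e e0; have e2 : 0 < e / 2 by rewrite divr_gt0.
  have [t t0 Ht] := (lim_right0P nl L).1 nll _ e2.
  exists t => // r rt; have r0 : 0 < r by case/andP: rt.
  have H2 s : 0 < s < t -> `|nl s - L * s `^ (1 - 1)| <= e / 2 * s `^ (1 - 1).
    by move=> st; rewrite subrr powRr0 !mulr1 ltW// Ht.
  have := limit0_asymp ltr01 Pd Hm H2 rt; rewrite !divr1 powRr1 ?(ltW r0)// => h.
  have -> : W r - L = (P r - m - L * r) / r by rewrite /W; field; rewrite gt_eqF.
  rewrite normrM normfV (gtr0_norm r0) ltr_pdivrMr//; apply: le_lt_trans h _.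
  by rewrite ltr_pM2r//; lra.
have rho0 : 0 < 1 :> R := ltr01.
have t0rho : 0 = 0 :> R \/ 1 < 0 :> R by left.
pose k r : R := bump 0 1 (r ^+ 2); pose h : R -> R := bumph 0 1.
pose H := bumpH a 0 1; pose H' := bumpH' a 0 1.
have HR := bumpH_regular a0 rho0 t0rho.
have [Hd H'c Hc0 H'0] := HR; rewrite -/H -/H' in Hd H'c Hc0 H'0.
have kd t : isder t (1 : R) k (t * h t).
  eapply isder_eq; first by apply: (@der_comp _ (bump 0 1) (fun t => t ^+ 2)); [exact: bump_der|der].
  by rewrite /h /bumph; ringb.
have h0 : h 0 = 0 by rewrite /h /bumph /bump' expr0n/= subrr !(mul0r, mulr0) oppr0 mulr0 mulr0.
have hc : continuous h := @bumph_cont R 0 1.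
have H0 : H 0 = 0 by rewrite /H /bumpH -/(h 0) h0 mulr0.
(* Subtracting [m] keeps the field regular at the origin, where [(P t - m) / t] tends to [L]. In
   dimension one the price is the divergence of [m k x / |x|] off the origin, that is [m] times the
   derivative of [k]. *)
pose M t := if t <= 0 then - (k 0 * L) else f t * H t - k t * W t.
pose W' t := nl t / t - (P t - m) / t ^+ 2.
pose M' t := f1 t * H t + f t * H' t - (t * h t * W t + k t * W' t).
have MR : regular_profile M M'.
  split.
  - move=> t tp; apply: (@der_pos _ (fun t => f t * H t - k t * ((P t - m) * t^-1))) => //.
      by move=> t' t'0; rewrite /M leNgt t'0.
    eapply isder_eq.
      apply: derB; apply: derM; [exact: fd|exact: Hd|exact: kd|].
      apply: derM; first by apply: derB; [exact: Pd|exact: der_cst].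
      by apply: (@derV _ (fun t => t)); [rewrite gt_eqF|exact: der_id].
    by rewrite /M' /W /W' -exprVn; ringb.
  - move=> t tp; have fc := der_cont (fd tp); have f1c := der_cont (f1d tp).
    have Hc := der_cont (Hd t tp); have kc := der_cont (kd t); have hct := hc t.
    have Pc := der_cont (Pd t tp); have H'ct := H'c t tp.
    rewrite /M' /W /W' /nl; ct => //; rewrite ?gt_eqF ?exprn_gt0//; exact: f_gt0.
  - have M0 : M 0 = - (k 0 * L) by rewrite /M lexx.
    rewrite M0; apply: right0_profile => //.
    apply: (@lim_right0_eq _ (fun t => f t * H t - k t * W t)).
      by move=> r r0; rewrite /M leNgt r0.
    have Hl : H r @[r --> 0^'+] --> (0 : R).
      apply/lim_right0P => e e0; have [t t0 Ht] := Hc0 e e0; exists t => // r /andP[r0 rt].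
      by have := Ht r; rewrite (ltW r0) rt H0 => /(_ isT).
    have kl : k r @[r --> 0^'+] --> k 0 := cont_right0 (der_cont (kd 0)).
    by have := cvgB (cvgM fl Hl) (cvgM kl Wl); rewrite mulr0 sub0r; apply.
  - have rM0 : 0 * M' 0 = 0 by rewrite mul0r.
    suff rMl : r * M' r @[r --> 0^'+] --> (0 : R).
      by move=> e e0; have [t t0 Ht] := right0_profile rM0 rMl e0;
        exists t => // r /Ht; rewrite subr0.
    have Pl : P r @[r --> 0^'+] --> m.
      apply/lim_right0P => e e0; have [t /andP[t0 t1] Ht] := power_small B ltr01 e0.
      exists t => // r rt; apply: le_lt_trans (Ht r rt); apply: Hm.
      by case/andP: rt => -> /= rt; rewrite (le_trans (ltW rt)).
    have hl : r * h r @[r --> 0^'+] --> (0 : R).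
      have := @cont_right0 R (fun r => r * h r); rewrite mul0r; apply.
      by apply: ctM; [exact: cvg_id|exact: hc].
    have H'l : r * H' r @[r --> 0^'+] --> (0 : R).
      apply/lim_right0P => e e0; have [t t0 Ht] := H'0 e e0; exists t => // r /andP[r0 rt].
      by rewrite subr0; apply: Ht; rewrite (ltW r0).
    have kl : k r @[r --> 0^'+] --> k 0 := cont_right0 (der_cont (kd 0)).
    have rl : r @[r --> 0^'+] --> (0 : R) := cont_right0 cvg_id.
    apply: (@lim_right0_eq _ (fun r => P r * (r * h r) + f r * (r * H' r) -
        (r * (r * h r) * W r + k r * (nl r - W r)))).
      move=> r r0; rewrite /M' /W' /W.
      have -> : H r = r `^ (2 * a) * h r by [].
      have -> : f1 r * (r `^ (2 * a) * h r) = P r * h r by rewrite /P; ring.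
      by move: (P r) (h r) (H' r) (k r) (nl r) (f r) => *; field; rewrite gt_eqF.
    have := cvgB (cvgD (cvgM Pl hl) (cvgM fl H'l))
      (cvgD (cvgM (cvgM rl hl) Wl) (cvgM kl (cvgB nll Wl))).
    by rewrite !(mulr0, mul0r, subrr, addr0); apply.
have far t : 1 + 0 + 1 < t -> [/\ k t = 0, h t = 0, H t = 0 & H' t = 0].
  by move=> /(bump_large rho0 t0rho)/(bump_support a rho0).
have far0 t : 1 + 0 + 1 < t -> t <= 0 = false by move=> ?; apply/negP; lra.
(* Minus the radial derivative of [k]: continuous, nonnegative and not identically zero, so its
   integral cannot vanish and [m] must. *)
pose c x : R := - (enorm x * h (enorm x)).
have cc : continuous c.
  apply: ctAll => x; apply: ctN; apply: ctM; first exact: enorm_cont.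
  by apply: ct_comp; [exact: hc|exact: enorm_cont].
have cA x : 1 + 0 + 1 < enorm x -> c x = 0 by move=> /far[_ z _ _]; rewrite /c z mulr0 oppr0.
have hE r : - h r = 4 * r ^+ 2 * flat 2 (1 - (r ^+ 2) ^+ 2).
  by rewrite /h /bumph /bump' subr0 invr1 !mulr1; ring.
have c0 x : 0 <= c x.
  by rewrite /c -mulrN hE !mulr_ge0 ?enorm_ge0 ?flat_ge0 ?sqr_ge0.
have Y0 : (\int[mu]_x (- m * c x)%:E = 0)%E.
  apply: (@integral_field R n a omega p C phi G f a01 om0 p1 HG weak pos bnd rad 0 1 rho0 t0rho M M') => //.
  - by move=> t ht; have [kz _ Hz _] := far t ht; rewrite /M far0// kz Hz mulr0 mul0r subr0.
  - by move=> t /far[kz hz Hz H'z]; rewrite /M' kz hz Hz H'z !(mulr0, mul0r) !addr0 subr0.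
  - by apply: ctAll => x; apply: ctM; [exact: ct_cst|exact: cc].
  - move=> x x0; have e0 : 0 < enorm x by rewrite enorm_gt0.
    rewrite /test_rest -/(k (enorm x)) -/H -/H' rad /field_div /M leNgt e0/= /M' /W /W' D1 -/(nl (enorm x)) /c.
    have HE : H (enorm x) = enorm x `^ (2 * a) * h (enorm x) by [].
    rewrite HE /P; field; by rewrite gt_eqF.
have ci := cc_integrable cc cA.
have cz : (\int[mu]_x (c x)%:E = 0)%E.
  have E : (\int[mu]_x (- m * c x)%:E = (- m)%:E * \int[mu]_x (c x)%:E)%E.
    by rewrite -(integralZl measurableT ci); apply: eq_integral => x _; rewrite EFinM.
  move: Y0; rewrite E => /eqP; rewrite mule_eq0 eqe oppr_eq0 (negbTE m0)/= => /eqP//.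
have := integral0_cont_eq0 cc c0 cz ((1 / 2 : R) *: e_ ord0).
rewrite /c enorm_line gtr0_norm// -mulrN hE => /eqP; rewrite gt_eqF//.
rewrite !mulr_gt0 ?exprn_gt0//; apply: flat_gt0; rewrite -exprM subr_gt0 exprn_ilt1//; lra.
Qed.

Lemma rad1_bound : exists K, forall r, 0 < r <= 1 -> `|f1 r| <= K * r `^ (1 - 2 * a).
Proof.
have ode t (t0 : 0 < t) := rad2E a01 om0 p1 HG weak smooth pos bnd rad t0.
have D1 : 1 <= n.+1%:R :> R by rewrite ler1n.
have [m Hm] := radial_flux_limit D1 om0 p1 f1d f_gt0 f_le ode.
have m0 : m = 0.
  have [q1|q1] := leP 1 (n.+1%:R - 1 + 2 * a).
    exact: (radial_flux_eq0 D1 om0 p1 fd f_gt0 f_le q1 Hm).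
  have n0 : n = 0%N.
    apply/eqP; rewrite -leqn0 -ltnS -(ltn_add2r 0) addn0 -[(_ < _)%N]/(n.+1 < 2)%N -(ltr_nat R).
    have := a0; lra.
  have E1 : n.+1%:R = 1 :> R by rewrite n0.
  by apply: (thin_flux_eq0 E1 _ Hm); move: q1; rewrite E1; lra.
exists ((omega * C + C `^ p) / n.+1%:R) => r r01; have := Hm r r01; rewrite m0 subr0.
have /andP[r0 _] := r01.
rewrite normrM ger0_norm ?powR_ge0//.
have -> : r `^ n.+1%:R = r `^ (n.+1%:R - 1 + 2 * a) * r `^ (1 - 2 * a).
  by rewrite -powRB_gt0//; congr (_ `^ _); ring.
by rewrite mulrCA ler_pM2l// powR_gt0.
Qed.

End thin_origin.

(** The differential equation has been used up in the hypotheses: only the passage from explicit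
    inequalities near 0 to limits and little-o statements remains. *)
Lemma radial_asymptotics_of_bounds {R : realType} {n : nat} (omega p a K phi0 : R)
    (phi : 'rV[R]_n.+1 -> R) (f f1 f2 : R -> R) :
  let c := phi0 `^ p - omega * phi0 in
  let D := n.+1%:R in
  0 <= a < 1 -> radial_profile phi f -> 0 < c ->
  (forall t : R, 0 < t -> isder t (1 : R) f (f1 t)) ->
  (forall t : R, 0 < t -> isder t (1 : R) f1 (f2 t)) ->
  (forall t : R, 0 < t <= 1 -> `|f1 t| <= K * t `^ (1 - 2 * a)) ->
  (forall t : R, 0 < t <= 1 -> `|f t - phi0| <= K / (2 - 2 * a) * t `^ (2 - 2 * a)) ->
  (forall e : R, 0 < e -> exists2 r1 : R, 0 < r1 <= 1 & forall r, 0 < r < r1 ->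
    `|f r - phi0 + c / D / (2 - 2 * a) * r `^ (2 - 2 * a)| <= e * r `^ (2 - 2 * a)) ->
  (forall e : R, 0 < e -> exists2 r1 : R, 0 < r1 <= 1 & forall r, 0 < r < r1 ->
    `|f1 r + c / D * r `^ (1 - 2 * a)| <= e * r `^ (1 - 2 * a)) ->
  (forall e : R, 0 < e -> exists2 r1 : R, 0 < r1 <= 1 & forall r, 0 < r < r1 ->
    `|f2 r - (2 * a - 1) / D * c * r `^ (- (2 * a))| <= e * r `^ (- (2 * a))) ->
  radial_asymptotics omega p a phi f.
Proof.
move=> c D a01 rad c0 fd f1d f1K fK fE f1E f2E; have /andP[a0 a1] := a01.
have D0 : 0 < D by rewrite ltr0n.
have g0 : 0 < 2 - 2 * a by lra.
have dE (r : R) : 0 < r -> derive1 f r = f1 r.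
  by move=> r0; rewrite derive1E; have [_] := fd r r0.
have d2E (r : R) : 0 < r -> derive1n 2 f r = f2 r.
  move=> r0; have h : isder r (1 : R) (derive1 f) (f2 r).
    by apply: der_pos r0 (f1d r r0) => t t0; rewrite dE.
  by rewrite derive1nS derive1E; have [_] := h.
have near0 (P Q : R -> Prop) : (exists2 r1 : R, 0 < r1 <= 1 & forall r, 0 < r < r1 -> P r) ->
    (forall r, 0 < r -> P r -> Q r) -> \forall r \near 0^'+, Q r.
  move=> [r1 /andP[r10 _] H] PQ; apply/near_right0P; exists r1 => // r rr.
  by apply: PQ; [case/andP: rr|exact: H].
exists phi0; rewrite -/c -/D; split; [|split; [by []|split; [|split; [|split; [|split; [|split]]]]]].
(* The value [f 0 = phi 0] is unrelated to the behaviour nearby, as [phi] is smooth only off the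
   origin; both functions are modified to take the limit [phi0] there. *)
- have -> : ([eta phi with 0 |-> phi0] : 'rV[R]_n.+1 -> R) =
      (fun x => (fun r => if r == 0 then phi0 else f r) (enorm x)).
    apply/funext => x /=; have [->|x0] := eqVneq x 0; first by rewrite enorm0 eqxx.
    by rewrite rad gt_eqF// enorm_gt0.
  apply: (@radial_cont R n.+1 (fun r => if r == 0 then phi0 else f r)); first by rewrite eqxx.
  move=> _ e e0; have [t /andP[t0 t1] Ht] := power_small (K / (2 - 2 * a)) g0 e0.
  exists t => // r /andP[r0 rt]; rewrite eqxx; case: eqVneq => [_|rn]; first by rewrite subrr normr0.
  have rp : 0 < r by rewrite lt_neqAle eq_sym rn.
  apply: le_lt_trans (fK r _) (Ht r _); rewrite rp//=; exact: le_trans (ltW rt) t1.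
- apply/eqoP => e e0; apply: near0 (f1E e e0) _ => r r0.
  by rewrite dE// (ger0_norm (powR_ge0 _ _)) mulNr opprK.
- apply/eqoP => e e0; apply: near0 (f2E e e0) _ => r r0.
  by rewrite d2E// (ger0_norm (powR_ge0 _ _)).
- move=> /andP[ap ah]; split.
    move=> r r0; split; first by have [] := fd r r0.
    by apply: ct_pos r0 (der_cont (f1d r r0)) => t t0; rewrite dE.
  (* At [a = 1/2] the exponent [1 - 2 a] is 0 and the one-sided derivative at 0 is [- c / D]; for
     smaller [a] the exponent is positive and this derivative is 0. *)
  move: ah; rewrite le_eqVlt => /predU1P[ah|ah].
    have E1 : 1 - 2 * a = 0 by rewrite ah; field.
    have E2 : 2 - 2 * a = 1 by rewrite ah; field.
    exists (- (c / D)); split.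
      apply/lim_right0P => e e0; have e2 : 0 < e / 2 by rewrite divr_gt0.
      have [t /andP[t0 _] Ht] := fE _ e2; exists t => // r rt; have := Ht r rt.
      have r0 : 0 < r by case/andP: rt.
      rewrite E2 divr1 powRr1 ?(ltW r0)// => h.
      have -> : (f r - phi0) / r - - (c / D) = (f r - phi0 + c / D * r) / r by field; rewrite !gt_eqF.
      rewrite normrM normfV (gtr0_norm r0) ltr_pdivrMr//; apply: le_lt_trans h _.
      by rewrite ltr_pM2r//; lra.
    apply/lim_right0P => e e0; have e2 : 0 < e / 2 by rewrite divr_gt0.
    have [t /andP[t0 _] Ht] := f1E _ e2; exists t => // r rt; have := Ht r rt.
    have r0 : 0 < r by case/andP: rt.
    by rewrite E1 powRr0 !mulr1 dE// opprK => h; apply: le_lt_trans h _; lra.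
  have q0 : 0 < 1 - 2 * a by lra.
  exists 0; split; apply/lim_right0P => e e0.
    have [t /andP[t0 t1] Ht] := power_small (K / (2 - 2 * a)) q0 e0.
    exists t => // r rt; have /andP[r0 rt'] := rt; rewrite subr0 normrM normfV (gtr0_norm r0).
    rewrite ltr_pdivrMr//.
    have r01 : 0 < r <= 1 by rewrite r0 (le_trans (ltW rt')).
    apply: le_lt_trans (fK r r01) _.
    have -> : r `^ (2 - 2 * a) = r `^ (1 - 2 * a) * r.
      by rewrite -(powR_sub1M (2 - 2 * a) r0); congr (_ `^ _ * _); ring.
    by rewrite mulrA ltr_pM2r// Ht.
  have [t /andP[t0 t1] Ht] := power_small K q0 e0.
  exists t => // r rt; have /andP[r0 rt'] := rt; rewrite subr0 dE//.
  by apply: le_lt_trans (f1K r _) (Ht r rt); rewrite r0 (le_trans (ltW rt')).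
- move=> /andP[ah _]; apply/cvgryPge => A.
  (* Half of the leading coefficient is spent on the remainder; the other half times a negative
     power of [r] diverges. The two remaining blow-up statements follow the same scheme. *)
  have k0 : 0 < c / D / 2 by rewrite !divr_gt0.
  have k1 : 0 < c / D by rewrite divr_gt0.
  have q0 : 0 < 2 * a - 1 by lra.
  have [t2 t20 Ht2] := power_blowup k0 q0 A.
  have [t1 /andP[t10 _] Ht1] := f1E _ k0.
  apply/near_right0P; exists (Num.min t1 t2); first by rewrite lt_min t10.
  move=> r /andP[r0]; rewrite lt_min => /andP[rt1 rt2].
  have := Ht1 r; have := Ht2 r; rewrite r0 rt1 rt2 => /(_ isT) h2 /(_ isT) h1.
  rewrite dE//; have E : - (2 * a - 1) = 1 - 2 * a by ring.
  rewrite E in h2; apply: le_trans h2 _.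
  have := ler_normB (f1 r + c / D * r `^ (1 - 2 * a)) (f1 r).
  have -> : f1 r + c / D * r `^ (1 - 2 * a) - f1 r = c / D * r `^ (1 - 2 * a) by ring.
  rewrite (ger0_norm (mulr_ge0 (ltW k1) (powR_ge0 _ _))).
  by move: h1; rewrite [c / D / 2 * _]mulrAC; move: (c / D * _) => y; lra.
- move=> /andP[ap _] ah; apply/cvgryPge => A.
  pose k := (2 * a - 1) / D * c.
  have kn : 0 < `|k| / 2.
    have k1 : 2 * a - 1 != 0.
      by apply: contra ah => /eqP h; apply/eqP; lra.
    rewrite divr_gt0// normr_gt0 /k mulf_eq0 (gt_eqF c0) orbF mulf_eq0 (negbTE k1)/=.
    by rewrite invr_eq0 gt_eqF.
  have q0 : 0 < 2 * a by rewrite mulr_gt0.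
  have [t2 t20 Ht2] := power_blowup kn q0 A.
  have [t1 /andP[t10 _] Ht1] := f2E _ kn.
  apply/near_right0P; exists (Num.min t1 t2); first by rewrite lt_min t10.
  move=> r /andP[r0]; rewrite lt_min => /andP[rt1 rt2].
  have := Ht1 r; have := Ht2 r; rewrite r0 rt1 rt2 => /(_ isT) h2 /(_ isT).
  rewrite d2E// -/k => h1; apply: le_trans h2 _.
  have := ler_normB (f2 r) (f2 r - k * r `^ (- (2 * a))).
  have -> : f2 r - (f2 r - k * r `^ (- (2 * a))) = k * r `^ (- (2 * a)) by ring.
  rewrite (normrM k) (ger0_norm (powR_ge0 _ _)).
  by move: h1; rewrite [`|k| / 2 * _]mulrAC; move: (`|k| * _) => y; lra.
- move=> /andP[ap _]; apply/cvgryPge => A.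
  pose k := c / D / (2 - 2 * a).
  have k0 : 0 < k by rewrite !divr_gt0.
  have k2 : 0 < k / 2 by rewrite divr_gt0.
  have q0 : 0 < 2 * a by rewrite mulr_gt0.
  have [t2 t20 Ht2] := power_blowup k0 q0 A.
  have [t1 /andP[t10 _] Ht1] := fE _ k2.
  apply/near_right0P; exists (Num.min t1 t2); first by rewrite lt_min t10.
  move=> r /andP[r0]; rewrite lt_min => /andP[rt1 rt2].
  have := Ht1 r; have := Ht2 r; rewrite r0 rt1 rt2 => /(_ isT) h2 /(_ isT).
  rewrite -/k => h1; apply: le_trans h2 _.
  have r2 : 0 < r ^+ 2 by rewrite exprn_gt0.
  rewrite normrM normfV (gtr0_norm r2) ler_pdivlMr// normrM (ger0_norm (_ : 0 <= 2))//.
  have E : r `^ (2 - 2 * a) = r `^ (- (2 * a)) * r ^+ 2.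
    by rewrite -powR_mulrn ?(ltW r0)// -powRB_gt0//; congr (_ `^ _); ring.
  rewrite -mulrA -E.
  have := ler_normB (f r - phi0 + k * r `^ (2 - 2 * a)) (f r - phi0).
  have -> : f r - phi0 + k * r `^ (2 - 2 * a) - (f r - phi0) = k * r `^ (2 - 2 * a) by ring.
  rewrite (ger0_norm (mulr_ge0 (ltW k0) (powR_ge0 _ _))).
  by move: h1; rewrite [k / 2 * _]mulrAC; move: (k * _) => y; lra.
Qed.

Theorem theorem1 (R : realType) (d : nat) (omega p a : R)
    (hd : (1 <= d)%N) (homega : 0 < omega) (hp : 1 < p) (ha : 0 <= a < 1)
    (hsub : 1 / 2 - 1 / (p + 1) < (1 - a) / d%:R) :
  let solution (phi : 'rV[R]_d -> R) :=
    [/\ distributional_solution a omega p phi,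
        smooth_on [set x | x != 0] phi,
        in_H1a a phi &
        exp_decay a phi] in
  (exists phi, solution phi) /\
  (forall phi f, solution phi -> radial_profile phi f ->
    radial_asymptotics omega p a phi f).
Proof.
move=> solution; have /andP[a0 a1] := ha.
have a10 : 0 < 1 - a by rewrite subr_gt0.
have d0 : 0 < d%:R :> R by rewrite ltr0n.
split.
  have N1 : 1 <= d%:R / (1 - a).
    by rewrite ler_pdivlMr// mul1r; have : 1 <= d%:R :> R by [rewrite ler1n]; lra.
  have Np : d%:R / (1 - a) * (p - 1) < 2 * (p + 1).
    have pp : 0 < p + 1 by lra.
    have E : 1 / 2 - 1 / (p + 1) = (p - 1) / (2 * (p + 1)) by field; rewrite gt_eqF.
    rewrite mulrAC ltr_pdivrMr//; move: hsub; rewrite E.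
    by rewrite ltr_pdivrMr ?mulr_gt0// mulrAC ltr_pdivlMr// mulrC [2 * _ * _]mulrC.
  have [u [w [C [k gp]]]] := ground_profile_exists a1 homega N1 hp Np.
  exists (@sol R d a u); split.
  - exact: sol_solution gp ha hd.
  - exact: sol_smooth gp.
  - by exists (@sol_grad R d a w); exact: sol_H1a gp ha.
  - exact: sol_exp_decay gp.
move=> phi f; case: d hd {hsub d0} phi @solution => // n _ phi solution.
move=> [[G [HG weak]] smooth _ [delta [C [delta0 C0 decay]]]] rad.
have pos x : 0 < phi x by case/andP: (decay x).
have dec x : phi x <= C * expR (- delta * enorm x `^ (1 - a)) by case/andP: (decay x).
have bnd x : phi x <= C.
  apply: le_trans (dec x) _; rewrite ler_piMr ?(ltW C0)// -[leRHS]expR0 ler_expR.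
  by rewrite mulNr oppr_le0 mulr_ge0 ?powR_ge0// ltW.
have fpos (t : R) : 0 < t -> 0 < f t by move=> t0; rewrite -(gtr0_norm t0) -(enorm_line n) -rad.
have fle (t : R) : 0 < t -> f t <= C by move=> t0; rewrite -(gtr0_norm t0) -(enorm_line n) -rad.
have fd (t : R) : 0 < t -> isder t (1 : R) f (rad1 phi t) := rad_der smooth rad (r := t).
have f1d (t : R) : 0 < t -> isder t (1 : R) (rad1 phi) (rad2 phi t) := rad1_der smooth (r := t).
have ode (t : R) : 0 < t -> _ := rad2E ha homega hp HG weak smooth pos bnd rad (t := t).
have [K f1K] := rad1_bound ha homega hp HG weak smooth pos bnd rad.
have [phi0 fK] := radial_limit ha fd f1K.
have D1 : 1 <= n.+1%:R :> R by rewrite ler1n.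
have vanish (r e : R) : 0 < e -> exists2 s, r < s & f s < e.
  (* The radius [s] solves [s^(1-a) = X]. The first summand of [X] gives
     [C * expR (- delta * X) < e] through [expR y >= 1 + y], and the second gives [s > r]. *)
  move=> e0; pose X := C / (e * delta) + (`|r| + 1) `^ (1 - a).
  have X1 : C / (e * delta) < X by rewrite ltrDl powR_gt0// ltr_wpDl.
  have X2 : (`|r| + 1) `^ (1 - a) < X by rewrite ltrDr divr_gt0// mulr_gt0.
  have X0 : 0 < X by apply: lt_trans X1; rewrite divr_gt0// mulr_gt0.
  pose s := X `^ (1 - a)^-1; have s0 : 0 < s by exact: powR_gt0.
  have sX : s `^ (1 - a) = X by rewrite -powRrM mulVf ?gt_eqF// powRr1// ltW.
  exists s.
    rewrite ltNge; apply/negP => sr; move: X2; rewrite ltNge => /negP; apply.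
    rewrite -sX; apply: ge0_ler_powR; rewrite ?nnegrE ?(ltW a10) ?(ltW s0) ?addr_ge0//.
    by have := ler_norm r; lra.
  have := dec (s *: delta_mx ord0 ord0); rewrite rad enorm_line gtr0_norm// sX => h.
  apply: le_lt_trans h _; rewrite mulNr expRN ltr_pdivrMr ?expR_gt0//.
  have h2 : C / e < delta * X by move: X1; rewrite invfM mulrA ltr_pdivrMr// [X * _]mulrC.
  rewrite mulrC -ltr_pdivrMr//; apply: lt_le_trans h2 (le_trans _ (expR_ge1Dx _)).
  by rewrite lerDr.
have c0 := radial_c_gt0 D1 ha homega hp fd f1d fpos fle ode f1K fK vanish.
apply: (radial_asymptotics_of_bounds ha rad c0 fd f1d f1K fK).
- by move=> e e0; exact: (radial_asymp D1 ha hp fd f1d fpos ode f1K fK e0).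
- by move=> e e0; exact: (radial_der_asymp D1 ha hp f1d fpos ode f1K fK e0).
- by move=> e e0; exact: (radial_der2_asymp D1 ha hp f1d fpos ode f1K fK e0).
Qed.
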